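(* Let $(z,\theta)\in\bigwedge_\infty^\times$. The linear functional $\mathcal G_e(z,\theta)$ on $SD(1)$ defined by $$\mathcal G_e(z,\theta)F=\frac{d}{d\epsilon}F\Big(\big((z,\theta);\mathbf 0,(1,\mathbf 0),(1,\mathbf 0)\big)\;{}_1\infty_0\;\big(\mathbf 0,M(\epsilon,3/2)\big)\Big)\Big|_{\epsilon=0}$$ ($\epsilon$ an odd variable) is in $T_eSK(1)$, and $$\mathcal G_e(z,\theta)=\sum_{k=0}^1\sum_{j\ge1}z^{-(2k-1)j-2+k}\frac{\partial}{\partial M^{(k)}_{j-\frac12}}\Big|_e+2\theta\Big(\frac12z^{-2}\frac{\partial}{\partial a^{(1)}}\Big|_e+\sum_{k=0}^1\sum_{j\ge1}z^{-(2k-1)j-2}\frac{\partial}{\partial A^{(k)}_j}\Big|_e\Big).$$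
   Context: Grassmann algebra: $\bigwedge_\infty$ is the complex Grassmann algebra on anticommuting generators $\zeta_1,\zeta_2,\ldots$, with even/odd parts $\bigwedge_\infty^0,\bigwedge_\infty^1$, body/soul decomposition $a=a_B+a_S$, ${}^\times$ = invertible elements ($a_B\ne0$); points are written $(z,\theta)$ ($z$ even, $\theta$ odd). DeWitt open sets: $\{a:a_B\in V\}$, $V\subset\mathbb C$ open; $\mathcal B_0^r=\{a:|a_B|<r\}$, $\bar{\mathcal B}_0^r$ closed analogue. A function $H(w,\rho)=(f+\rho\xi,\psi+\rho g)$ ($f,g$ even, $\xi,\psi$ odd, analytic in $w$, Taylor extended from the body) is superconformal if $\xi=g\psi$, $g^2=f'+\psi\psi'$, $g+\rho\psi'\not\equiv0$. For $j\in\mathbb Z$: $L_j(x,\varphi)=-(x^{j+1}\partial_x+\frac{j+1}2\varphi x^j\partial_\varphi)$, $G_{j-1/2}(x,\varphi)=-x^j(\partial_\varphi-\varphi\partial_x)$; $b^{\mp2L_0}$ sends $c\varphi^mx^n$ to $c\,b^{\pm(2n+m)}\varphi^mx^n$. For sequences $(A,M)=\{(A_j,M_{j-1/2})\}_{j\ge1}$ (even, odd) and $a\in(\bigwedge_\infty^0)^\times$: $\tilde E(A,M)=\exp(-\sum_{j\ge1}(A_jL_j+M_{j-1/2}G_{j-1/2}))\cdot(x,\varphi)$, $\hat E(a,A,M)=\exp(-\sum_{j\ge1}(A_jL_j+M_{j-1/2}G_{j-1/2}))\cdot a^{-2L_0}\cdot(x,\varphi)$. $\mathcal H$ = set of $(A,M)$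 with $\tilde E(A,M)$ absolutely convergent near $0$; $\mathbf0$ = zero sequences. $I(w,\rho)=(1/w,i\rho/w)$, $s_{(z,\theta)}(w,\rho)=(w-z-\rho\theta,\rho-\theta)$. A supersphere is a super-Riemann surface over $\bigwedge_\infty$ (charts onto DeWitt open subsets of $\bigwedge_\infty$, superconformal transitions) whose body is a connected compact genus-zero Riemann surface; with $1+n$ tubes: one negatively oriented puncture $p_0$, $n$ positively oriented ordered punctures, distinct bodies, superconformal local coordinates vanishing at the punctures, considered up to superconformal isomorphisms matching punctures and coordinate germs. $S\hat{\mathbb C}$ is the super-Riemann sphere with charts $\Delta,\Upsilon$ onto $\bigwedge_\infty$, $\Delta\circ\Upsilon^{-1}=I$. For $n\ge1$, $SK(n)=SM^{n-1}\times\mathcal H\times((\bigwedge_\infty^0)^\times\times\mathcal H)^n$ ($SM^{n-1}$: $(n-1)$-tuples of points of $\bigwedge_\infty^\times$ with distinct bodies), $SK(0)=\{(A,M)\in\mathcal H:A_1=M_{1/2}=0\}$; $SK(n)$ is identified with the set of equivalence classes of superspheres with $1+n$ tubes: $((z_k,\theta_k)_{k<n};(A^{(0)},M^{(0)}),(a^{(k)},A^{(k)},M^{(k)})_{k\le n})$ is the class of $S\hat{\mathbb C}$ with punctures $\infty=\Upsilon^{-1}(0)$ (negative), $(z_k,\theta_k)$ and $(z_n,\theta_n)=0$, with coordinates $\tilde E(A^{(0)},-iM^{(0)})\circ I$ at $\infty$ and $\hat E(a^{(k)},A^{(k)},M^{(k)})\circ s_{(z_k,\theta_k)}$ at the $k$-th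 puncture (in the chart $\Delta$). Sewing: for $(S_1;p_0,\ldots,p_m;\Omega_k)$ and $(S_2;q_0,\ldots,q_n;\Xi_l)$ such that for some $r>0$ the images of $\Omega_i$, $\Xi_0$ contain $\bar{\mathcal B}_0^r$, $\bar{\mathcal B}_0^{1/r}$ and $p_i$, $q_0$ are the only punctures in their preimages, $S_1\,{}_i\infty_0\,S_2$ is obtained, for $r_2<r<r_1$ close to $r$, by gluing $S_1\smallsetminus\Omega_i^{-1}(\bar{\mathcal B}_0^{r_2})$ and $S_2\smallsetminus\Xi_0^{-1}(\bar{\mathcal B}_0^{1/r_1})$ via $p\sim\Xi_0^{-1}\circ I\circ\Omega_i(p)$ on $\Omega_i^{-1}(\mathcal B_0^{r_1}\smallsetminus\bar{\mathcal B}_0^{r_2})$, with punctures $p_0,\ldots,p_{i-1},q_1,\ldots,q_n,p_{i+1},\ldots,p_m$ and restricted coordinates. This induces a partial operation on the sets $SK(n)$. $e=(\mathbf0,(1,\mathbf0))\in SK(1)$. $(\mathbf0,M(\epsilon,3/2))\in SK(0)$ is the element with all $A_j=0$, $M_{3/2}=\epsilon$ and all other $M_{j-1/2}=0$. $SD(1)$: supermeromorphic superfunctions on $SK(1)$, i.e. functions $SK(1)\to\bigwedge_\infty$ that are polynomials in $a^{(1)},(a^{(1)})^{-1},A_j^{(k)},M_{j-1/2}^{(k)}$ ($k=0,1$); graded by the parity of values. $T_eSK(1)$ is the space of supermeromorphic tangent vectors at $e$: an even one is a linear map $\mathcal L:SD(1)\to\bigwedge_\infty$ with $\mathcal L(F_1F_2)=\mathcal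 LF_1\cdot F_2(e)+F_1(e)\cdot\mathcal LF_2$, an odd one satisfies $\mathcal L(F_1F_2)=\mathcal LF_1\cdot F_2(e)+(-1)^{|F_1|}F_1(e)\cdot\mathcal LF_2$ for $F_1$ homogeneous. Derivatives in odd variables are left derivatives. *)

(* Defs.v *)
From HB Require Import structures.
From Stdlib Require Import Relation_Operators.
From mathcomp Require Import all_boot all_order all_algebra.
From mathcomp Require Import finmap complex.
From mathcomp Require Import all_classical all_reals all_analysis.
Set Implicit Arguments. Unset Strict Implicit. Unset Printing Implicit Defensive.
Import Order.TTheory GRing.Theory Num.Theory numFieldNormedType.Exports.

(* An element is the finite sum of the x I * zeta_I, where zeta_I is the product
   in increasing order of the generators zeta_i, i \in I. *)
Definition grassmann (K : comNzRingType) := {fsfun {fset nat} -> K with 0%R}.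

HB.instance Definition _ (K : comNzRingType) := Choice.on (grassmann K).

Section GrassmannRing.
Local Open Scope fset_scope.
Local Open Scope ring_scope.
Variable K : comNzRingType.
Local Notation T := (grassmann K).
Implicit Types (x y z : T) (I J L : {fset nat}).

Definition gr_zero : T := [fsfun].
Definition gr_opp x : T := [fsfun I in finsupp x => - x I].
Definition gr_add x y : T := [fsfun I in finsupp x `|` finsupp y => x I + y I].
Definition gr_scale (a : K) x : T := [fsfun I in finsupp x => a * x I].
Definition gr_one : T := [fsfun I in [fset fset0] => 1].

(* zeta_J zeta_L = (-1)^(inversions J L) zeta_(J `|` L) for disjoint J, L. *)
Definition inversions J L : nat := (\sum_(i <- J) \sum_(j <- L) (j < i))%N.

Definition gr_mul x y : T :=
  [fsfun I in [fset J `|` L | J in finsupp x, L in finsupp y] =>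
     \sum_(J <- fpowerset I) (-1) ^+ inversions J (I `\` J) * (x J * y (I `\` J))].

Lemma gr_zeroE I : gr_zero I = 0. Proof. by rewrite fsfunE. Qed.
Lemma gr_oppE x I : gr_opp x I = - x I.
Proof. by rewrite fsfunE; case: finsuppP => //; rewrite oppr0. Qed.
Lemma gr_addE x y I : gr_add x y I = x I + y I.
Proof.
rewrite fsfunE in_fsetU.
by case: (finsuppP x); case: (finsuppP y) => //=; rewrite addr0.
Qed.
Lemma gr_scaleE a x I : gr_scale a x I = a * x I.
Proof. by rewrite fsfunE; case: finsuppP => //; rewrite mulr0. Qed.
Lemma gr_oneE I : gr_one I = (I == fset0)%:R.
Proof. by rewrite fsfunE in_fset1; case: eqP. Qed.

Lemma gr_mulE x y I : gr_mul x y I =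
  \sum_(J <- fpowerset I) (-1) ^+ inversions J (I `\` J) * (x J * y (I `\` J)).
Proof.
rewrite fsfunE; case: ifPn => // nI; rewrite big1_seq // => J /=.
rewrite fpowersetE => sJI; case: (finsuppP x) => [_|Jx]; first by rewrite mul0r mulr0.
case: (finsuppP y) => [_|Ly]; first by rewrite !mulr0.
case/negP: nI; have -> : I = J `|` (I `\` J); last exact: in_imfset2.
apply/fsetP => i; rewrite in_fsetU in_fsetD.
by case: (boolP (i \in J)) => [/(fsubsetP sJI)|].
Qed.

Let c J L I : K :=
  if fdisjoint J L && (J `|` L == I) then (-1) ^+ inversions J L else 0.

Let cE J L I : J `<=` I -> c J L I = if L == I `\` J then (-1) ^+ inversions J L else 0.
Proof.
move=> sJI; rewrite /c; congr (if _ then _ else _); apply/andP/eqP => [[dJL /eqP <-]|->].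
  by rewrite fsetDUl fsetDv fset0U; apply/esym/fsetDidPl; rewrite fdisjoint_sym.
split; first by apply/fdisjointP => i iJ; rewrite in_fsetD iJ.
apply/eqP/fsetP => i; rewrite in_fsetU in_fsetD.
by case: (boolP (i \in J)) => [/(fsubsetP sJI)|].
Qed.

Let c_out J L I : ~~ (J `<=` I) -> c J L I = 0.
Proof.
by move=> nJI; rewrite /c; case: ifP => // /andP[_ /eqP E]; rewrite -E fsubsetUl in nJI.
Qed.

Let mulE (S : {fset {fset nat}}) x y I : fpowerset I `<=` S ->
  gr_mul x y I = \sum_(J <- S) \sum_(L <- S) c J L I * (x J * y L).
Proof.
move=> sIS; rewrite gr_mulE.
rewrite -(big_fset_incl _ (A := fpowerset I) (B := S)) //=; last first.
  by move=> J _; rewrite fpowersetE => nJI; rewrite big1 // => L _; rewrite c_out // mul0r.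
apply: eq_big_seq => J; rewrite fpowersetE => sJI.
have LS : I `\` J \in S by apply: (fsubsetP sIS); rewrite fpowersetE fsubsetDl.
rewrite (big_fsetD1 _ LS) /= cE // eqxx big1_seq ?addr0 // => L /=.
by rewrite in_fsetD1 cE // => /andP[/negPf-> _]; rewrite mul0r.
Qed.

Let invUl J J' L : fdisjoint J J' ->
  inversions (J `|` J') L = (inversions J L + inversions J' L)%N.
Proof.
move=> d; rewrite /inversions -big_cat /=; apply: perm_big; apply: uniq_perm.
- exact: fset_uniq.
- by rewrite cat_uniq !fset_uniq andbT /=; apply/hasPn => i iJ'; apply: (fdisjointP_sym d).
- by move=> i; rewrite mem_cat in_fsetU.
Qed.

Let invUr J L L' : fdisjoint L L' ->
  inversions J (L `|` L') = (inversions J L + inversions J L')%N.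
Proof.
move=> d; rewrite /inversions -big_split /=; apply: eq_bigr => i _.
rewrite -big_cat /=; apply: perm_big; apply: uniq_perm.
- exact: fset_uniq.
- by rewrite cat_uniq !fset_uniq andbT /=; apply/hasPn => j jL'; apply: (fdisjointP_sym d).
- by move=> j; rewrite mem_cat in_fsetU.
Qed.

Let c_assoc P A B L I : P = fpowerset I ->
  \sum_(J <- P) c J L I * c A B J = \sum_(J <- P) c A J I * c B L J.
Proof.
move=> ->.
have sum1 (h : {fset nat} -> K) X Y :
    \sum_(J <- fpowerset I) h J * c X Y J =
    if (X `|` Y `<=` I) && fdisjoint X Y then h (X `|` Y) * (-1) ^+ inversions X Y else 0.
  have [sI|nsI] := boolP (X `|` Y `<=` I); last first.
    rewrite big1_seq // => J /=; rewrite fpowersetE /c => sJI.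
    by case: ifP => [/andP[_ /eqP E]|_]; [rewrite E sJI in nsI|rewrite mulr0].
  rewrite (big_fsetD1 (X `|` Y)) ?fpowersetE //= {1}/c eqxx andbT big1_seq ?addr0.
    by case: ifP; rewrite ?mulr0.
  move=> J /=; rewrite in_fsetD1 => /andP[nJ _]; rewrite /c.
  by rewrite eq_sym (negPf nJ) andbF mulr0.
rewrite (sum1 (fun J => c J L I)) (sum1 (fun J => c A J I)) /c.
rewrite fdisjointUX fdisjointXU -fsetUA.
have [E|_] := eqVneq (A `|` (B `|` L)) I; last first.
  by rewrite !andbF !mul0r !if_same.
rewrite !andbT -E fsetUA fsubsetUl /= -fsetUA fsubsetUr /=.
case: (boolP (fdisjoint A B)) => dAB; case: (boolP (fdisjoint B L)) => dBL;
  case: (boolP (fdisjoint A L)) => dAL //=; rewrite ?mul0r //.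
by rewrite -!exprD invUl // invUr //; congr (_ ^+ _); rewrite addnC addnA.
Qed.

Lemma gr_mulA : associative gr_mul.
Proof.
move=> x y z; apply/fsfunP => I; set P := fpowerset I.
have sP J : J \in P -> fpowerset J `<=` P.
  by rewrite /P fpowersetE => ?; rewrite fpowersetS.
have aux (a b d e f : K) : a * (b * (d * (e * f))) = a * d * (b * e * f).
  by rewrite [b * (d * _)]mulrCA !mulrA.
rewrite !(mulE _ _ (fsubset_refl P)).
transitivity (\sum_(A <- P) \sum_(B <- P) \sum_(L <- P)
    (\sum_(J <- P) c A J I * c B L J) * (x A * y B * z L)).
  apply: eq_bigr => A _.
  under eq_big_seq => J JP.
    rewrite (mulE _ _ (sP _ JP)) mulr_sumr mulr_sumr.
    under eq_bigr => B _ do (rewrite mulr_sumr mulr_sumr;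
      under eq_bigr => L _ do rewrite aux).
    over.
  rewrite exchange_big; apply: eq_bigr => B _; rewrite exchange_big.
  by apply: eq_bigr => L _; rewrite mulr_suml.
transitivity (\sum_(A <- P) \sum_(B <- P) \sum_(L <- P)
    (\sum_(J <- P) c J L I * c A B J) * (x A * y B * z L)).
  apply: eq_bigr => A _; apply: eq_bigr => B _; apply: eq_bigr => L _.
  by rewrite (c_assoc _ _ _ (erefl P)).
under eq_bigr => A _ do under eq_bigr => B _ do under eq_bigr => L _ do rewrite mulr_suml.
under eq_bigr => A _ do under eq_bigr => B _ do rewrite exchange_big.
under eq_bigr => A _ do rewrite exchange_big.
rewrite exchange_big; apply: eq_big_seq => J JP.
under eq_bigr => A _ do rewrite exchange_big.
rewrite exchange_big; apply: eq_bigr => L _.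
rewrite (mulE _ _ (sP _ JP)) mulr_suml mulr_sumr; apply: eq_bigr => A _.
rewrite mulr_suml mulr_sumr; apply: eq_bigr => B _.
by rewrite !mulrA.
Qed.

Lemma gr_mul1l : left_id gr_one gr_mul.
Proof.
move=> x; apply/fsfunP => I; rewrite gr_mulE (big_fsetD1 fset0) ?fpowersetE ?fsub0set //=.
rewrite fsetD0 gr_oneE eqxx mul1r /inversions big_seq_fset0 expr0 mul1r.
rewrite big1_seq ?addr0 // => J /=; rewrite in_fsetD1 gr_oneE => /andP[/negPf-> _].
by rewrite mul0r mulr0.
Qed.

Lemma gr_mul1r : right_id gr_one gr_mul.
Proof.
move=> x; apply/fsfunP => I; rewrite gr_mulE (big_fsetD1 I) ?fpowersetE ?fsubset_refl //=.
rewrite fsetDv gr_oneE eqxx mulr1 /inversions big1 ?expr0 ?mul1r; last first.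
  by move=> i _; rewrite big_seq_fset0.
rewrite big1_seq ?addr0 // => J /=; rewrite in_fsetD1 gr_oneE fpowersetE => /andP[nJI sJI].
have /negPf-> : I `\` J != fset0.
  by apply: contra nJI; rewrite fsetD_eq0 => sIJ; rewrite eqEfsubset sJI.
by rewrite !mulr0.
Qed.

Lemma gr_mulDl : left_distributive gr_mul gr_add.
Proof.
move=> x y z; apply/fsfunP => I; rewrite gr_addE !gr_mulE -big_split /=.
by apply: eq_bigr => J _; rewrite gr_addE mulrDl mulrDr.
Qed.

Lemma gr_mulDr : right_distributive gr_mul gr_add.
Proof.
move=> x y z; apply/fsfunP => I; rewrite gr_addE !gr_mulE -big_split /=.
by apply: eq_bigr => J _; rewrite gr_addE !mulrDr.
Qed.

Lemma gr_addA : associative gr_add.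
Proof. by move=> x y z; apply/fsfunP => I; rewrite !gr_addE addrA. Qed.
Lemma gr_addC : commutative gr_add.
Proof. by move=> x y; apply/fsfunP => I; rewrite !gr_addE addrC. Qed.
Lemma gr_add0 : left_id gr_zero gr_add.
Proof. by move=> x; apply/fsfunP => I; rewrite gr_addE gr_zeroE add0r. Qed.
Lemma gr_addN : left_inverse gr_zero gr_opp gr_add.
Proof. by move=> x; apply/fsfunP => I; rewrite gr_addE gr_oppE gr_zeroE addNr. Qed.

HB.instance Definition _ := GRing.isZmodule.Build T gr_addA gr_addC gr_add0 gr_addN.

Lemma gr_one_neq0 : gr_one != 0 :> T.
Proof.
apply/eqP => /fsfunP /(_ fset0); rewrite gr_oneE gr_zeroE eqxx.
by apply/eqP/oner_neq0.
Qed.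

HB.instance Definition _ := GRing.Zmodule_isNzRing.Build T
  gr_mulA gr_mul1l gr_mul1r gr_mulDl gr_mulDr gr_one_neq0.

Lemma gr_scaleA a b x : gr_scale a (gr_scale b x) = gr_scale (a * b) x.
Proof. by apply/fsfunP => I; rewrite !gr_scaleE mulrA. Qed.
Lemma gr_scale1 : left_id 1 gr_scale.
Proof. by move=> x; apply/fsfunP => I; rewrite gr_scaleE mul1r. Qed.
Lemma gr_scaleDr : right_distributive gr_scale +%R.
Proof.
by move=> a x y; apply/fsfunP => I; rewrite gr_scaleE !gr_addE !gr_scaleE mulrDr.
Qed.
Lemma gr_scaleDl x : {morph gr_scale^~ x : a b / a + b}.
Proof. by move=> a b; apply/fsfunP => I; rewrite gr_addE !gr_scaleE mulrDl. Qed.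

HB.instance Definition _ := GRing.Zmodule_isLmodule.Build K T
  gr_scaleA gr_scale1 gr_scaleDr gr_scaleDl.

Lemma gr_scaleAl (a : K) x y : a *: (x * y) = a *: x * y.
Proof.
apply/fsfunP => I; rewrite gr_scaleE !gr_mulE mulr_sumr; apply: eq_bigr => J _.
by rewrite gr_scaleE mulrCA !mulrA.
Qed.
Lemma gr_scaleAr (a : K) x y : a *: (x * y) = x * (a *: y).
Proof.
apply/fsfunP => I; rewrite gr_scaleE !gr_mulE mulr_sumr; apply: eq_bigr => J _.
by rewrite gr_scaleE mulrCA [x J * (a * _)]mulrCA.
Qed.

HB.instance Definition _ := GRing.Lmodule_isLalgebra.Build K T gr_scaleAl.
HB.instance Definition _ := GRing.Lalgebra_isAlgebra.Build K T gr_scaleAr.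

Definition gr_unit : pred T := fun x => `[< exists y, y * x = 1 /\ x * y = 1 >].

Definition gr_inv x : T :=
  if pselect (exists y, y * x = 1 /\ x * y = 1) is left h then projT1 (cid h) else x.

Lemma gr_mulVr : {in gr_unit, left_inverse 1 gr_inv *%R}.
Proof.
move=> x /asboolP ux; rewrite /gr_inv; case: pselect => [h|//].
by case: (cid h) => y [].
Qed.
Lemma gr_divrr : {in gr_unit, right_inverse 1 gr_inv *%R}.
Proof.
move=> x /asboolP ux; rewrite /gr_inv; case: pselect => [h|//].
by case: (cid h) => y [].
Qed.
Lemma gr_unitP x y : y * x = 1 /\ x * y = 1 -> gr_unit x.
Proof. by move=> h; apply/asboolP; exists y. Qed.
Lemma gr_inv_out : {in [predC gr_unit], gr_inv =1 id}.
Proof.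
move=> x /negP ux; rewrite /gr_inv; case: pselect => // h; case: ux.
exact/asboolP.
Qed.

HB.instance Definition _ := GRing.NzRing_hasMulInverse.Build T
  gr_mulVr gr_divrr gr_unitP gr_inv_out.

End GrassmannRing.

Local Open Scope classical_set_scope.
Local Open Scope ring_scope.

(* The complex numbers, with their topology. *)
Notation cplx R := ((complex R)^o).

Section Grading.
Variable R : realType.
Local Notation C := (cplx R).
Local Notation Lam := (grassmann C).
Implicit Types x p q : Lam.

Definition is_even x := forall I : {fset nat}, odd #|` I|%fset -> x I = 0.
Definition is_odd x := forall I : {fset nat}, ~~ odd #|` I|%fset -> x I = 0.

Definition body x : C := x fset0.
Definition soul x : Lam := x - (body x)%:A.

(* A point (w, rho) is encoded as the element w + rho, and a pair
   (even, odd) of values likewise as their sum. *)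
Definition evp p : Lam :=
  [fsfun I in finsupp p => if odd #|` I|%fset then 0 else p I].
Definition odp p : Lam := p - evp p.
Definition gconj p : Lam := evp p - odp p.

Definition dewitt (V : set C) : set Lam := [set p | V (body p)].
Definition in_ball (r : R) : set Lam := [set p | `|body p| < r%:C%C].
Definition in_cball (r : R) : set Lam := [set p | `|body p| <= r%:C%C].

(* Absolute convergence in the Grassmann algebra is componentwise, the sum s
   being itself required to be an element of the algebra. *)
Definition abs_sum (c : nat -> Lam) (s : Lam) : Prop :=
  forall I, cvgn [normed series (fun n => c n I : C)] /\
    series (fun n => c n I : C) @ \oo --> (s I : C).

(* An analytic function f of a complex variable is encoded by its Taylor
   coefficients: c z n = f^(n)(z) / n!, and in particular c z 0 = f z. *)
Definition jet := C -> nat -> Lam.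

Definition analytic_on (V : set C) (c : jet) : Prop :=
  forall z0, V z0 -> exists2 r : R, 0 < r & forall z : C, `|z - z0| < r%:C%C ->
    V z /\ abs_sum (fun n => (z - z0) ^+ n *: c z0 n) (c z 0%N).

Definition djet (c : jet) : jet := fun z n => c z n.+1 *+ n.+1.

(* For w even the Taylor expansion at the body of w is finite: a power of
   soul w beyond the number of monomials of w vanishes. *)
Definition taylor (c : jet) (w : Lam) : Lam :=
  \sum_(n < (#|` finsupp w|%fset).+1) c (body w) n * soul w ^+ n.

Definition superconformal (V : set C) (H : Lam -> Lam) : Prop :=
  exists f xi psi g : jet,
  [/\ [/\ analytic_on V f, analytic_on V xi, analytic_on V psi & analytic_on V g],
      forall z n, V z ->
        [/\ is_even (f z n), is_odd (xi z n), is_odd (psi z n) & is_even (g z n)],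
      forall p, V (body p) -> let w := evp p in let rho := odp p in
        H p = (taylor f w + rho * taylor xi w) + (taylor psi w + rho * taylor g w),
      forall w, is_even w -> V (body w) ->
        taylor xi w = taylor g w * taylor psi w /\
        taylor g w ^+ 2 = taylor (djet f) w + taylor psi w * taylor (djet psi) w
    & exists p, V (body p) /\
        taylor g (evp p) + odp p * taylor (djet psi) (evp p) != 0].

(* I(w, rho) = (1/w, i rho/w) and s_q(w, rho) = (w - z - rho theta, rho - theta)
   for q = (z, theta). *)
Definition inversionI p : Lam := (evp p)^-1 + 'i *: (odp p * (evp p)^-1).
Definition shift q p : Lam := p - q - odp p * odp q.

End Grading.

Section Surfaces.
Variable R : realType.
Local Notation C := (cplx R).
Local Notation Lam := (grassmann C).

(* Charts take values in the Grassmann algebra; cmap i is meaningful on cdom i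
   only.  The underlying set of points is the subset pts of the type pt. *)
Record surface := Surface {
  pt : Type;
  pts : set pt;
  cidx : Type;
  cdom : cidx -> set pt;
  cmap : cidx -> pt -> Lam }.
Arguments cdom : clear implicits.
Arguments cmap : clear implicits.

(* The topology is the one for which the charts are homeomorphisms for the
   DeWitt topology. *)
Definition sopen (X : surface) (U : set (pt X)) : Prop :=
  U `<=` pts (s := X) /\
  forall i, exists2 V : set C, open V & cmap X i @` (U `&` cdom X i) = dewitt V.

(* F, defined on U, is continuous and superconformal in the charts. *)
Definition superconformal_map (X Y : surface) (U : set (pt X)) (F : pt X -> pt Y) :=
  forall i j, let D := U `&` cdom X i `&` F @^-1` cdom Y j in
  exists V : set C, [/\ open V, cmap X i @` D = dewitt V &
    V !=set0 -> exists2 H, superconformal V H &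
      forall p, D p -> cmap Y j (F p) = H (cmap X i p)].

Definition super_riemann (X : surface) : Prop :=
  [/\ pts (s := X) = \bigcup_i cdom X i,
      forall i, set_inj (cdom X i) (cmap X i)
    & superconformal_map (pts (s := X)) (id : pt X -> pt X)].

Definition superconformal_iso (X Y : surface) (F : pt X -> pt Y) : Prop :=
  exists G : pt Y -> pt X,
  [/\ forall p, pts p -> pts (F p) /\ G (F p) = p,
      forall q, pts q -> pts (G q) /\ F (G q) = q,
      superconformal_map (pts (s := X)) F
    & superconformal_map (pts (s := Y)) G].

Definition flat : surface :=
  @Surface Lam setT unit (fun _ => setT) (fun _ => id).

Definition same_body (X : surface) (p q : pt X) : Prop :=
  exists i, [/\ cdom X i p, cdom X i q & body (cmap X i p) = body (cmap X i q)].

Definition local_coordinate (X : surface) (p : pt X) (U : set (pt X))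
    (phi : pt X -> Lam) : Prop :=
  [/\ sopen U /\ U p, set_inj U phi, phi p = 0,
      exists2 V : set C, open V & phi @` U = dewitt V
    & superconformal_map (Y := flat) U phi].

(* Index 0 is the negatively oriented puncture, the index k >= 1 the k-th
   positively oriented one; with 1 + n tubes only k <= n is meaningful. *)
Record tubed := Tubed {
  surf :> surface;
  punct : nat -> pt surf;
  udom : nat -> set (pt surf);
  ucrd : nat -> pt surf -> Lam }.
Arguments punct : clear implicits.
Arguments udom : clear implicits.
Arguments ucrd : clear implicits.

Definition with_tubes (n : nat) (X : tubed) : Prop :=
  [/\ super_riemann X,
      forall k, (k <= n)%N -> local_coordinate (punct X k) (udom X k) (ucrd X k)
    & forall k l, (k <= n)%N -> (l <= n)%N -> k <> l ->
        ~ same_body (punct X k) (punct X l)].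

Section Sewing.
Variables (m : nat) (X1 : tubed) (i : nat) (n : nat) (X2 : tubed) (r1 r2 : R).

(* For r2 < r < r1 with r the radius in the definition of sewing. *)
Definition sewable : Prop :=
  [/\ 0 < r2 /\ r2 < r1,
      in_cball r1 `<=` ucrd X1 i @` udom X1 i,
      in_cball r2^-1 `<=` ucrd X2 0%N @` udom X2 0%N,
      forall k, (k <= m)%N -> udom X1 i (punct X1 k) ->
        in_cball r1 (ucrd X1 i (punct X1 k)) -> k = i
    & forall l, (l <= n)%N -> udom X2 0%N (punct X2 l) ->
        in_cball r2^-1 (ucrd X2 0%N (punct X2 l)) -> l = 0%N].

Definition kept (u : pt X1 + pt X2) : Prop :=
  match u with
  | inl p => pts p /\ ~ (udom X1 i p /\ in_cball r2 (ucrd X1 i p))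
  | inr q => pts q /\ ~ (udom X2 0%N q /\ in_cball r1^-1 (ucrd X2 0%N q))
  end.

Definition glued (u v : pt X1 + pt X2) : Prop :=
  match u, v with
  | inl p, inr q =>
    [/\ udom X1 i p, in_ball r1 (ucrd X1 i p), ~ in_cball r2 (ucrd X1 i p),
        udom X2 0%N q & ucrd X2 0%N q = inversionI (ucrd X1 i p)]
  | _, _ => False
  end.

Definition glue_class (u : pt X1 + pt X2) : set (pt X1 + pt X2) :=
  clos_refl_sym_trans _ glued u.

(* The subset and the function induced on the classes by a subset and a
   function on one of the two pieces. *)
Definition push1 (U : set (pt X1)) : set (set (pt X1 + pt X2)) :=
  [set glue_class (inl p) | p in [set p | U p /\ kept (inl p)]].
Definition push2 (U : set (pt X2)) : set (set (pt X1 + pt X2)) :=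
  [set glue_class (inr q) | q in [set q | U q /\ kept (inr q)]].
Definition descend1 (f : pt X1 -> Lam) (K : set (pt X1 + pt X2)) : Lam :=
  xget 0 [set f p | p in [set p | K (inl p)]].
Definition descend2 (f : pt X2 -> Lam) (K : set (pt X1 + pt X2)) : Lam :=
  xget 0 [set f q | q in [set q | K (inr q)]].

Definition sewn_surface : surface :=
  @Surface (set (pt X1 + pt X2)) (glue_class @` kept) (cidx X1 + cidx X2)
    (fun a => match a with inl b => push1 (cdom X1 b) | inr b => push2 (cdom X2 b) end)
    (fun a => match a with
              | inl b => descend1 (cmap X1 b) | inr b => descend2 (cmap X2 b) end).

(* The punctures are p_0, .., p_(i-1), q_1, .., q_n, p_(i+1), .., p_m. *)
Definition sewn_tubed : tubed :=
  @Tubed sewn_surface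
    (fun k => if (k < i)%N then glue_class (inl (punct X1 k))
              else if (k < i + n)%N then glue_class (inr (punct X2 (k - i).+1))
              else glue_class (inl (punct X1 (k - n).+1)))
    (fun k => if (k < i)%N then push1 (udom X1 k)
              else if (k < i + n)%N then push2 (udom X2 (k - i).+1)
              else push1 (udom X1 (k - n).+1))
    (fun k => if (k < i)%N then descend1 (ucrd X1 k)
              else if (k < i + n)%N then descend2 (ucrd X2 (k - i).+1)
              else descend1 (ucrd X1 (k - n).+1)).

End Sewing.

(* The super-Riemann sphere: inl a is the point with Delta-coordinate a, and
   inr b, with body b = 0, the point over infinity with Upsilon-coordinate b.
   Since I (I (w, rho)) = (w, - rho), Upsilon = I^-1 \o Delta is gconj \o I. *)
Definition SC_Upsilon (P : Lam + Lam) : Lam :=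
  match P with inl a => gconj (inversionI a) | inr b => b end.

Definition SC : surface :=
  @Surface (Lam + Lam) [set P | if P is inr b then body b = 0 else True] bool
    (fun c => if c then [set P | if P is inl _ then True else False]
              else [set P | match P with inl a => body a != 0 | inr b => body b = 0 end])
    (fun c P => if c then match P with inl a => a | inr _ => 0 end
                else SC_Upsilon P).

(* I in the chart Delta, extended to the points over infinity by
   I \o Delta = I \o I \o Upsilon. *)
Definition SC_inversion (P : pt SC) : Lam :=
  match P with inl a => inversionI a | inr b => gconj b end.

End Surfaces.
Arguments cdom {R}.
Arguments cmap {R}.
Arguments punct {R}.
Arguments udom {R}.
Arguments ucrd {R}.

Section Exponentials.
Variable R : realType.
Local Notation C := (cplx R).
Local Notation Lam := (grassmann C).

(* The pair (u, v) is the series \sum_n x^n u_n + phi \sum_n x^n v_n, with the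
   coefficients on the right. *)
Definition sser := ((nat -> Lam) * (nat -> Lam))%type.
Implicit Type u : sser.

Definition xmul (k : nat) u : sser :=
  (fun n => if (k <= n)%N then u.1 (n - k)%N else 0,
   fun n => if (k <= n)%N then u.2 (n - k)%N else 0).
Definition phimul u : sser := (fun=> 0, u.1).
Definition dx u : sser := (fun n => u.1 n.+1 *+ n.+1, fun n => u.2 n.+1 *+ n.+1).
Definition dphi u : sser := (u.2, fun=> 0).
Definition coef_mul (c : Lam) u : sser :=
  (fun n => c * u.1 n, fun n => gconj c * u.2 n).

Definition opL (j : nat) u : sser :=
  - (xmul j.+1 (dx u) + (j.+1%:R / 2 : C) *: phimul (xmul j (dphi u))).
(* G_(j - 1/2) *)
Definition opG (j : nat) u : sser := - xmul j (dphi u - phimul (dx u)).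

(* b^(-2 L_0) *)
Definition pow_m2L0 (b : Lam) u : sser :=
  (fun n => b ^+ n.*2 * u.1 n, fun n => b ^+ n.*2.+1 * u.2 n).

(* In a sequence pair (A, M), A j stands for A_(j+1) and M j for M_(j+1/2). *)
Definition seqpair := ((nat -> Lam) * (nat -> Lam))%type.
Implicit Type AM : seqpair.

Definition seqpair0 : seqpair := (fun=> 0, fun=> 0).
Definition single (j : nat) (c : Lam) : nat -> Lam := fun l => if l == j then c else 0.

(* - \sum_(j >= 1) (A_j L_j + M_(j-1/2) G_(j-1/2)): the terms with j > n do not
   contribute to the coefficients of index n. *)
Definition genT AM u : sser :=
  let term j := coef_mul (AM.1 j) (opL j.+1 u) + coef_mul (AM.2 j) (opG j.+1 u) in
  (fun n => - \sum_(j < n) (term j).1 n, fun n => - \sum_(j < n) (term j).2 n).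

(* genT raises the weight by at least 1/2, for the weights 1 of x and 1/2 of
   phi; hence its l-th power does not contribute to x^n and phi x^n for
   l > 2 n + 1. *)
Definition expT AM u : sser :=
  (fun n => \sum_(l < n.*2.+2) (l`!%:R^-1 : C) *: (iter l (genT AM) u).1 n,
   fun n => \sum_(l < n.*2.+2) (l`!%:R^-1 : C) *: (iter l (genT AM) u).2 n).

Definition xphi : sser := (fun n => (n == 1%N)%:R, fun n => (n == 0%N)%:R).

Definition tildeE AM : sser := expT AM xphi.
Definition hatE (a : Lam) AM : sser := expT AM (pow_m2L0 a xphi).

(* s is the value of u at p, with absolute convergence. *)
Definition sser_at u (p s : Lam) : Prop :=
  abs_sum (fun n => evp p ^+ n * u.1 n + odp p * (evp p ^+ n * u.2 n)) s.

Definition setH : set seqpair := [set AM |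
  [/\ forall j, is_even (AM.1 j), forall j, is_odd (AM.2 j)
    & exists2 r : R, 0 < r & forall p, in_ball r p -> exists s, sser_at (tildeE AM) p s]].

End Exponentials.
Arguments seqpair0 {R}.

Section Moduli.
Variable R : realType.
Local Notation C := (cplx R).
Local Notation Lam := (grassmann C).

(* sk_pts lists the points (z_1, theta_1), .., (z_(n-1), theta_(n-1)); sk_a j
   and sk_tube j are a^(j+1) and (A^(j+1), M^(j+1)), and sk_inf is
   (A^(0), M^(0)). *)
Record skdata (n : nat) := SkData {
  sk_pts : n.-1.-tuple Lam;
  sk_inf : seqpair R;
  sk_a : 'I_n -> Lam;
  sk_tube : 'I_n -> seqpair R }.

Definition setSK (n : nat) : set (skdata n) := [set Q |
  [/\ forall p, p \in tval (sk_pts Q) -> body p != 0,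
      uniq [seq body p | p <- sk_pts Q],
      setH (sk_inf Q),
      forall j, [/\ is_even (sk_a Q j), body (sk_a Q j) != 0 & setH (sk_tube Q j)]
    & n = 0%N -> (sk_inf Q).1 0%N = 0 /\ (sk_inf Q).2 0%N = 0]].

Definition SK (n : nat) := {Q : skdata n | setSK Q}.

(* For j = n - 1 the default of nth is the last puncture, 0. *)
Definition sk_puncture n (Q : skdata n) (k : 'I_n.+1) : pt (SC R) :=
  if unlift ord0 k is Some j then inl (nth 0 (sk_pts Q) j) else inr 0.

(* s is the value at P of the k-th local coordinate of the supersphere Q. *)
Definition sk_coordinate n (Q : skdata n) (k : 'I_n.+1) (P : pt (SC R)) (s : Lam) : Prop :=
  if unlift ord0 k is Some j then
    exists2 p, P = inl p &
      sser_at (hatE (sk_a Q j) (sk_tube Q j)) (shift (nth 0 (sk_pts Q) j) p) s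
  else sser_at (tildeE ((sk_inf Q).1, fun j => - ('i *: (sk_inf Q).2 j)))
         (SC_inversion P) s.

(* X is in the class of superspheres with 1 + n tubes denoted by Q.  The body of
   X is then biholomorphic to the Riemann sphere. *)
Definition represents n (Q : skdata n) (X : tubed R) : Prop :=
  exists2 F : pt X -> pt (SC R), superconformal_iso F &
    forall k : 'I_n.+1, F (punct X k) = sk_puncture Q k /\
      exists2 W : set (pt X), sopen W /\ W (punct X k) &
        forall p, W p -> udom X k p /\ sk_coordinate Q k (F p) (ucrd X k p).

Definition is_sewing m n (Q1 : skdata m) (i : nat) (Q2 : skdata n)
    (Q : skdata (m + n).-1) : Prop :=
  [/\ setSK Q1, setSK Q2, setSK Q, (0 < i <= m)%N &
    exists (X1 X2 : tubed R) (r1 r2 : R),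
    [/\ with_tubes m X1 /\ represents Q1 X1, with_tubes n X2 /\ represents Q2 X2,
        sewable m X1 i n X2 r1 r2 & represents Q (sewn_tubed X1 i n X2 r1 r2)]].

(* Q1 _i oo_0 Q2, when defined; the class Q is unique. *)
Definition sew m n (Q1 : skdata m) (i : nat) (Q2 : skdata n) : option (SK (m + n).-1) :=
  if pselect (exists Q : SK (m + n).-1, is_sewing Q1 i Q2 (sval Q)) is left h
  then Some (projT1 (cid h)) else None.

(* (a^(1); (A^(k), M^(k)), k = 0, 1) in SK(1). *)
Definition sk1 (a : Lam) (AM : 'I_2 -> seqpair R) : skdata 1 :=
  @SkData 1 [tuple] (AM ord0) (fun=> a) (fun=> AM ord_max).

Definition sk_seq (Q : skdata 1) (k : 'I_2) : seqpair R :=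
  if k == ord0 then sk_inf Q else sk_tube Q ord0.

Definition superfun := SK 1 -> Lam.

(* Polynomials with coefficients in the Grassmann algebra. *)
Inductive SD1 : superfun -> Prop :=
| SD1_cst (c : Lam) : SD1 (fun=> c)
| SD1_a : SD1 (fun Q => sk_a (sval Q) ord0)
| SD1_aV : SD1 (fun Q => (sk_a (sval Q) ord0)^-1)
| SD1_A (k : 'I_2) (j : nat) : SD1 (fun Q => (sk_seq (sval Q) k).1 j)
| SD1_M (k : 'I_2) (j : nat) : SD1 (fun Q => (sk_seq (sval Q) k).2 j)
| SD1_add F1 F2 : SD1 F1 -> SD1 F2 -> SD1 (fun Q => F1 Q + F2 Q)
| SD1_mul F1 F2 : SD1 F1 -> SD1 F2 -> SD1 (fun Q => F1 Q * F2 Q).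

(* F at Q, extended by 0 outside of SK(1). *)
Definition value_at (F : superfun) (Q : skdata 1) : Lam :=
  if pselect (setSK Q) is left h then F (exist _ Q h) else 0.

Definition sk_e : skdata 1 := sk1 1 (fun=> seqpair0).

(* Linearity over the Grassmann algebra acting on the right, which includes
   complex linearity; it is the same condition for even and odd functionals. *)
Definition SD1_linear (L : superfun -> Lam) : Prop :=
  (forall F1 F2, SD1 F1 -> SD1 F2 -> L (fun Q => F1 Q + F2 Q) = L F1 + L F2) /\
  (forall F c, SD1 F -> L (fun Q => F Q * c) = L F * c).

Definition even_tangent (L : superfun -> Lam) : Prop :=
  SD1_linear L /\ forall F1 F2, SD1 F1 -> SD1 F2 ->
    L (fun Q => F1 Q * F2 Q) = L F1 * value_at F2 sk_e + value_at F1 sk_e * L F2.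

Definition odd_tangent (L : superfun -> Lam) : Prop :=
  SD1_linear L /\ forall (b : bool) F1 F2, SD1 F1 -> SD1 F2 ->
    (forall Q, if b then is_odd (F1 Q) else is_even (F1 Q)) ->
    L (fun Q => F1 Q * F2 Q) =
      L F1 * value_at F2 sk_e + (-1) ^+ b * (value_at F1 sk_e * L F2).

(* T_e SK(1) *)
Definition tangent_e (L : superfun -> Lam) : Prop :=
  exists L0 L1, [/\ even_tangent L0, odd_tangent L1 & forall F, SD1 F -> L F = L0 F + L1 F].

(* d is the left derivative with respect to an odd variable: a superfunction of
   one odd variable is affine. *)
Definition has_odd_deriv (h : Lam -> Lam) (d : Lam) : Prop :=
  forall eps, is_odd eps -> h eps = h 0 + eps * d.
Definition odd_deriv (h : Lam -> Lam) : Lam := xget 0 [set d | has_odd_deriv h d].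

(* The derivative at 0 with respect to an even variable. *)
Definition has_even_deriv (h : Lam -> Lam) (d : Lam) : Prop :=
  forall I, is_derive (0 : C) 1 (fun t : C => h t%:A I : C) (d I).
Definition even_deriv (h : Lam -> Lam) : Lam := xget 0 [set d | has_even_deriv h d].

Definition partial_a (F : superfun) : Lam :=
  even_deriv (fun t => value_at F (sk1 (1 + t) (fun=> seqpair0))).
Definition partial_A (k : 'I_2) (j : nat) (F : superfun) : Lam :=
  even_deriv (fun t => value_at F
    (sk1 1 (fun l => if l == k then (single j t, fun=> 0) else seqpair0))).
Definition partial_M (k : 'I_2) (j : nat) (F : superfun) : Lam :=
  odd_deriv (fun eps => value_at F
    (sk1 1 (fun l => if l == k then (fun=> 0, single j eps) else seqpair0))).

(* ((z, theta); 0, (1, 0), (1, 0)) in SK(2) *)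
Definition sk_pair (z theta : Lam) : skdata 2 :=
  @SkData 2 [tuple z + theta] seqpair0 (fun=> 1) (fun=> seqpair0).

(* (0, M(eps, 3/2)) in SK(0) *)
Definition sk_M32 (eps : Lam) : skdata 0 :=
  @SkData 0 [tuple] (fun=> 0, single 1 eps) (fun=> 1) (fun=> seqpair0).

Definition sewn_M32 (z theta eps : Lam) : option (SK 1) :=
  sew (sk_pair z theta) 1 (sk_M32 eps).

Definition Ge (z theta : Lam) (F : superfun) : Lam :=
  odd_deriv (fun eps => oapp F 0 (sewn_M32 z theta eps)).

End Moduli.

(* Main.v *)
(** A superconformal map is one that preserves the relation "the even part of the
    displacement s_p(q) vanishes", and for odd e the time-e flow of an odd
    superconformal vector field is affine in e.  The transition map of the sewing
    is such a flow in the coordinate s_(z, theta), and it factors as the flow of a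
    vector field regular away from (z, theta), infinity included, followed by a
    translation with odd parameter near (z, theta).  These two maps glue into an
    identification of the sewn surface with the super-Riemann sphere.  Expanding
    the first vector field at 0 and at infinity gives geometric series of
    generators L_j and G_(j-1/2); since e^2 = 0 their exponentials are explicit, so
    that the sewn supersphere has parameters affine in e.

    The class in SK(1) is unique: two representatives differ by a superconformal
    automorphism of the sphere fixing 0 and infinity; by Liouville's theorem applied
    to the components along lines it is t |-> t k on scalars, k = 1 by the
    normalization of the coordinate at infinity, it is then the identity near
    infinity, hence everywhere, and the parameters can be read off the local
    coordinates.  The formula for the derivative is the chain rule, by induction on
    superfunctions. *)

Require Import Defs.
From HB Require Import structures.
From Stdlib Require Import Relation_Operators.
From mathcomp Require Import all_boot all_order all_algebra.
From mathcomp Require Import finmap complex.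
From mathcomp Require Import all_classical all_reals all_analysis.
From mathcomp Require Import ring lra zify.
Set Implicit Arguments. Unset Strict Implicit. Unset Printing Implicit Defensive.
Import Order.TTheory GRing.Theory Num.Theory numFieldNormedType.Exports.
Local Open Scope classical_set_scope.
Local Open Scope ring_scope.

(** * Analytic functions of one complex variable *)

(** The element returned by [sew] rests on an arbitrary choice of superspheres, of which only germs
    at the punctures are prescribed, whereas the gluing uses the coordinates on whole discs. This
    gap shapes the uniqueness half: a coordinate must be continued from its germ to a disc on which
    it is only known to be a bijection. The fibre of the sphere over infinity contains many points
    besides the puncture, so fixing the puncture does not by itself keep finite points finite.
    Superanalytic maps are handled without a general composition theorem: through closure
    properties, through their action on analytic paths, and through polynomial identities in odd and
    even elements decided by normal forms. Identities that hold only after multiplication by an odd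
    parameter are divided by it, the parameter being a generator that occurs nowhere else. *)

Section ComplexSums.
Variable R : realType.
Local Notation C := (cplx R).
Implicit Types (x y : C) (u v : nat -> C).

(** The norm of [cplx R] is itself a complex number; a real modulus lets estimates be solved over
    [R]. *)
Definition cabs (x : C) : R := Normc.normc x.

Lemma normcE x : `|x| = (cabs x)%:C%C. Proof. by []. Qed.
Lemma cabs_lt x (r : R) : (`|x| < r%:C%C) = (cabs x < r).
Proof. by rewrite normcE ltcR. Qed.
Lemma cabs_le x (r : R) : (`|x| <= r%:C%C) = (cabs x <= r).
Proof. by rewrite normcE lecR. Qed.
Lemma cabs_ge0 x : 0 <= cabs x. Proof. by rewrite -lecR -normcE normr_ge0. Qed.
Lemma cabs0 : cabs 0 = 0. Proof. exact: Normc.normc0. Qed.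
Lemma cabs1 : cabs 1 = 1. Proof. exact: Normc.normc1. Qed.
Lemma cabsM x y : cabs (x * y) = cabs x * cabs y. Proof. exact: Normc.normcM. Qed.
Lemma cabsN x : cabs (- x) = cabs x. Proof. exact: normcN. Qed.
Lemma cabsD x y : cabs (x + y) <= cabs x + cabs y. Proof. exact: le_normcD. Qed.
Lemma cabsV x : cabs x^-1 = (cabs x)^-1. Proof. exact: Normc.normcV. Qed.
Lemma cabs_eq0 x : (cabs x == 0) = (x == 0).
Proof.
by apply/eqP/eqP => [|->]; [exact: Normc.eq0_normc | exact: cabs0].
Qed.
Lemma cabs_gt0 x : (0 < cabs x) = (x != 0).
Proof. by rewrite lt_def cabs_eq0 cabs_ge0 andbT. Qed.
Lemma cabsC x y : cabs (x - y) = cabs (y - x).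
Proof. by rewrite -cabsN opprB. Qed.
Lemma cabsB x y : cabs (x - y) <= cabs x + cabs y.
Proof. by rewrite -[cabs y]cabsN cabsD. Qed.
Lemma cabsDl x y : cabs x - cabs y <= cabs (x + y).
Proof. by rewrite lerBlDr (le_trans _ (cabsB _ _)) ?addrK. Qed.
Lemma cabsX x n : cabs (x ^+ n) = cabs x ^+ n.
Proof. by elim: n => [|n IH]; rewrite ?expr0 ?cabs1 // !exprS cabsM IH. Qed.
Lemma cabs_real (r : R) : cabs (r%:C%C) = `|r|.
Proof. by rewrite /cabs /= expr0n addr0 sqrtr_sqr. Qed.
Lemma cabs_nat n : cabs n%:R = n%:R.
Proof.
have -> : (n%:R : C) = (n%:R : R)%:C%C by rewrite rmorph_nat.
by rewrite cabs_real normr_nat.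
Qed.
Lemma cabs_sign n : cabs ((-1) ^+ n) = 1.
Proof. by rewrite cabsX cabsN cabs1 expr1n. Qed.
Lemma cabs_sum (I : Type) (r : seq I) (P : pred I) (F : I -> C) :
  cabs (\sum_(i <- r | P i) F i) <= \sum_(i <- r | P i) cabs (F i).
Proof.
elim/big_ind2: _ => [|x1 x2 y1 y2 h1 h2|//]; first by rewrite cabs0.
by rewrite (le_trans (cabsD _ _)) // lerD.
Qed.
Lemma Re_le_cabs x : `|complex.Re x| <= cabs x.
Proof. by rewrite -lecR; exact: (normc_ge_Re x). Qed.
Lemma Im_le_cabs x : `|complex.Im x| <= cabs x.
Proof.
case: x => a b; rewrite /cabs /= -(sqrtr_sqr b) ler_sqrt ?addr_ge0 ?sqr_ge0 //.
by rewrite lerDr sqr_ge0.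
Qed.
Lemma cabs_le_Re_Im x : cabs x <= `|complex.Re x| + `|complex.Im x|.
Proof.
case: x => a b; rewrite /cabs /= -(@ger0_norm _ (`|a| + `|b|)) ?addr_ge0 //.
rewrite -sqrtr_sqr ler_sqrt ?sqr_ge0 // sqrrD !real_normK ?num_real //.
by have := mulr_ge0 (normr_ge0 a) (normr_ge0 b); lra.
Qed.
Lemma small0 x : (forall e : R, 0 < e -> cabs x <= e) -> x = 0.
Proof.
move=> h; apply/eqP; rewrite -cabs_eq0 eq_le cabs_ge0 andbT leNgt.
apply/negP => x0; have := h (cabs x / 2); rewrite divr_gt0 // => /(_ isT).
by move: x0; lra.
Qed.

Definition ccvg u (l : C) :=
  forall e : R, 0 < e -> exists N, forall n, (N <= n)%N -> cabs (u n - l) < e.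

Lemma ccvgP u l : u @ \oo --> l <-> ccvg u l.
Proof.
split=> [/cvgrPdist_lt h e e0|h].
  have e0' : (0 : C) < e%:C%C by rewrite ltcR.
  have [N _ hN] := h _ e0'; exists N => n Nn.
  by have := hN n Nn; rewrite /= cabs_lt cabsC.
apply/cvgrPdist_lt => e e0.
have eR : e = (complex.Re e)%:C%C by rewrite RRe_real // gtr0_real.
have e0' : 0 < complex.Re e by rewrite -ltcR -eR.
have [N hN] := h _ e0'; exists N => // n Nn.
by rewrite /= eR cabs_lt cabsC; exact: hN.
Qed.

Lemma ccvg_uniq u l l' : ccvg u l -> ccvg u l' -> l = l'.
Proof.
move=> h h'; apply/eqP; rewrite -subr_eq0; apply/eqP/small0 => e e0.
have e2 : 0 < e / 2 by rewrite divr_gt0.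
have [N hN] := h _ e2; have [N' hN'] := h' _ e2.
have := hN (maxn N N') (leq_maxl _ _); have := hN' (maxn N N') (leq_maxr _ _).
set a := u _ => h1 h2; have -> : l - l' = (a - l') - (a - l) by ring.
by have := cabsB (a - l') (a - l); lra.
Qed.

Lemma ccvgD u v l m : ccvg u l -> ccvg v m -> ccvg (fun n => u n + v n) (l + m).
Proof.
move=> h h' e e0; have e2 : 0 < e / 2 by rewrite divr_gt0.
have [N hN] := h _ e2; have [N' hN'] := h' _ e2.
exists (maxn N N') => n; rewrite geq_max => /andP[/hN h1 /hN' h2].
have -> : u n + v n - (l + m) = (u n - l) + (v n - m) by ring.
by have := cabsD (u n - l) (v n - m); lra.
Qed.

Lemma ccvgZ c u l : ccvg u l -> ccvg (fun n => c * u n) (c * l).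
Proof.
move=> h e e0; have d0 : 0 < e / (cabs c + 1).
  by rewrite divr_gt0 // ltr_wpDl // cabs_ge0.
have [N hN] := h _ d0; exists N => n /hN hn; rewrite -mulrBr cabsM.
have c1 : 0 < cabs c + 1 by rewrite ltr_wpDl // cabs_ge0.
move: hn; rewrite ltr_pdivlMr //; apply: le_lt_trans.
by rewrite mulrC ler_wpM2l ?cabs_ge0 // lerDl.
Qed.

Lemma ccvg_const l : ccvg (fun=> l) l.
Proof. by move=> e e0; exists 0%N => n _; rewrite subrr cabs0. Qed.

Lemma ccvg_near u v l : (exists N, forall n, (N <= n)%N -> u n = v n) ->
  ccvg u l -> ccvg v l.
Proof.
move=> [N hN] h e e0; have [M hM] := h e e0; exists (maxn N M) => n.
by rewrite geq_max => /andP[/hN <- /hM].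
Qed.

Lemma ccvg_le u l (x : C) (M : R) N : ccvg u l ->
  (forall n, (N <= n)%N -> cabs (u n - x) <= M) -> cabs (l - x) <= M.
Proof.
move=> h hM; rewrite leNgt; apply/negP => lt.
have e0 : 0 < cabs (l - x) - M by rewrite subr_gt0.
have [N' hN'] := h _ e0.
have h1 := hN' (maxn N N') (leq_maxr _ _); have h2 := hM _ (leq_maxl N N').
have : cabs (l - x) <= cabs (u (maxn N N') - l) + cabs (u (maxn N N') - x).
  rewrite cabsC; set a := u _.
  have -> : x - l = (a - l) - (a - x) by ring.
  exact: cabsB.
by move: h1 h2; set a := cabs (u _ - l); set b := cabs (u _ - x); lra.
Qed.

(** Absolute convergence is kept as boundedness of the partial sums of moduli, the form that
    termwise domination gives directly. *)
Definition csum u (s : C) :=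
  (exists M : R, forall n, \sum_(i < n) cabs (u i) <= M) /\
  ccvg (fun n => \sum_(i < n) u i) s.

Lemma csum_uniq u s s' : csum u s -> csum u s' -> s = s'.
Proof. by move=> [_ h] [_ h']; apply: ccvg_uniq h h'. Qed.

Lemma eq_csum u v s : u =1 v -> csum u s -> csum v s.
Proof. by move=> /funext ->. Qed.

Lemma csumD u v s t : csum u s -> csum v t -> csum (fun n => u n + v n) (s + t).
Proof.
move=> [[M hM] h] [[M' hM'] h']; split.
  exists (M + M') => n; rewrite (le_trans _ (lerD (hM n) (hM' n))) //.
  by rewrite -big_split /= ler_sum // => i _; exact: cabsD.
by apply: ccvg_near (ccvgD h h'); exists 0%N => n _; rewrite big_split.
Qed.

Lemma csumZ c u s : csum u s -> csum (fun n => c * u n) (c * s).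
Proof.
move=> [[M hM] h]; split.
  exists (cabs c * M) => n; rewrite (le_trans _ (ler_wpM2l (cabs_ge0 c) (hM n))) //.
  by rewrite mulr_sumr ler_sum // => i _; rewrite cabsM.
by apply: ccvg_near (ccvgZ c h); exists 0%N => n _; rewrite mulr_sumr.
Qed.

Lemma csum_fin u N : (forall n, (N <= n)%N -> u n = 0) -> csum u (\sum_(i < N) u i).
Proof.
move=> u0.
have E (V : nmodType) (f : nat -> V) n : (forall n, (N <= n)%N -> f n = 0) ->
    (N <= n)%N -> \sum_(i < n) f i = \sum_(i < N) f i.
  move=> f0 Nn; rewrite -!(big_mkord xpredT f) (big_cat_nat (n := N)) //=.
  rewrite [X in _ + X]big1_seq ?addr0 // => i /=.
  by rewrite mem_index_iota => /andP[/f0].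
split.
  exists (\sum_(i < N) cabs (u i)) => n.
  have [nN|/ltnW Nn] := leqP n N; last first.
    by rewrite (E _ (fun i => cabs (u i))) // => k /u0 ->; rewrite cabs0.
  rewrite -!(big_mkord xpredT (fun i => cabs (u i))) [leRHS](big_cat_nat (n := n)) //=.
  by rewrite lerDl sumr_ge0 // => i _; exact: cabs_ge0.
apply: ccvg_near (ccvg_const _); exists N => n Nn.
by rewrite -(E _ u n).

Qed.

Lemma csum0 : csum (fun=> 0) 0.
Proof. by have := @csum_fin (fun=> 0) 0%N (fun _ _ => erefl); rewrite big_ord0. Qed.

Lemma csum_sum (I : Type) (r : seq I) (P : pred I) (F : I -> nat -> C) (S : I -> C) :
  (forall i, P i -> csum (F i) (S i)) ->
  csum (fun n => \sum_(i <- r | P i) F i n) (\sum_(i <- r | P i) S i).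
Proof.
move=> h; elim: r => [|i r IH].
  by rewrite big_nil; apply: eq_csum csum0 => n; rewrite big_nil.
rewrite big_cons; case: ifP => Pi; last by apply: eq_csum IH => n; rewrite big_cons Pi.
by apply: eq_csum (csumD (h i Pi) IH) => n; rewrite big_cons Pi.
Qed.

Lemma csum_le u s (M : R) : csum u s ->
  (forall n, \sum_(i < n) cabs (u i) <= M) -> cabs s <= M.
Proof.
move=> [_ h] hM; rewrite -[s]subr0; apply: (ccvg_le (N := 0%N) h) => n _.
by rewrite subr0 (le_trans (cabs_sum _ _ _)).
Qed.

Lemma csum_split u s k : csum u s ->
  csum (fun n => u (n + k)%N) (s - \sum_(i < k) u i).
Proof.
move=> [[M hM] h]; split.
  exists M => n; rewrite (le_trans _ (hM (k + n)%N)) // big_split_ord /=.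
  rewrite ler_wpDl ?sumr_ge0 // => [i _|]; first exact: cabs_ge0.
  by rewrite ler_sum // => i _; rewrite addnC.
move=> e e0; have [N hN] := h e e0; exists N => n Nn.
have := hN (k + n)%N (leq_trans Nn (leq_addl _ _)); rewrite big_split_ord /=.
have -> : \sum_(i < n) u (i + k)%N = \sum_(i < n) u (k + i)%N.
  by apply: eq_bigr => i _; rewrite addnC.
by rewrite opprB addrA (addrC (\sum_(i < k) _)).
Qed.

Lemma real_sum_cvg (a : nat -> R) (M : R) : (forall n, 0 <= a n) ->
  (forall n, \sum_(i < n) a i <= M) ->
  exists l, forall e, 0 < e -> exists N, forall n, (N <= n)%N ->
    `|\sum_(i < n) a i - l| < e.
Proof.
move=> a0 aM.
have nd : nondecreasing_seq (fun n => \sum_(i < n) a i).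
  by apply/nondecreasing_seqP => n; rewrite big_ord_recr lerDl.
have ub : has_ubound (range (fun n => \sum_(i < n) a i)).
  by exists M => _ [n _ <-].
exists (sup (range (fun n => \sum_(i < n) a i))) => e e0.
have /cvgrPdist_lt /(_ e e0) [N _ hN] := nondecreasing_cvgn nd ub.
by exists N => n Nn; rewrite distrC; exact: hN.
Qed.

(** The real part (and likewise the imaginary part) is the difference of the nonnegative series |f
    u| + f u and |f u|, both bounded, so monotone convergence over the reals is enough. *)
Lemma csum_ex u (M : R) : (forall n, \sum_(i < n) cabs (u i) <= M) ->
  exists s, csum u s.
Proof.
move=> hM.
have aux (f : C -> R) : (forall x, `|f x| <= cabs x) ->
    exists l, forall e, 0 < e -> exists N, forall n, (N <= n)%N ->
      `|\sum_(i < n) f (u i) - l| < e.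
  move=> fle.
  have [|n|l1 h1] := @real_sum_cvg (fun n => `|f (u n)| + f (u n)) (M + M).
  - by move=> n; have := ler_norm (- f (u n)); rewrite normrN; lra.
  - rewrite (le_trans _ (lerD (hM n) (hM n))) // -big_split /= ler_sum // => i _.
    by have := fle (u i); have := ler_norm (f (u i)); lra.
  have [|n|l2 h2] := @real_sum_cvg (fun n => `|f (u n)|) M.
  - by move=> n; exact: normr_ge0.
  - by rewrite (le_trans _ (hM n)) // ler_sum.
  exists (l1 - l2) => e e0; have e2 : 0 < e / 2 by rewrite divr_gt0.
  have [N1 hN1] := h1 _ e2; have [N2 hN2] := h2 _ e2.
  exists (maxn N1 N2) => n; rewrite geq_max => /andP[/hN1 g1 /hN2 g2].
  move: g1; rewrite big_split /=; move: g2.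
  set A := \sum_(i < n) `|_|; set B := \sum_(i < n) _ => g2 g1.
  have -> : B - (l1 - l2) = (A + B - l1) - (A - l2) by ring.
  by rewrite (le_lt_trans (ler_normB _ _)) //; lra.
have [a ha] := aux (@complex.Re R) (@Re_le_cabs).
have [b hb] := aux (@complex.Im R) (@Im_le_cabs).
exists (a +i* b)%C; split; first by exists M.
move=> e e0; have e2 : 0 < e / 2 by rewrite divr_gt0.
have [N1 hN1] := ha _ e2; have [N2 hN2] := hb _ e2.
exists (maxn N1 N2) => n; rewrite geq_max => /andP[/hN1 g1 /hN2 g2].
apply: le_lt_trans (cabs_le_Re_Im _) _.
have ReE (m : nat) : complex.Re (\sum_(i < m) u i) = \sum_(i < m) complex.Re (u i).
  elim: m => [|m IH]; rewrite ?big_ord0 // !big_ord_recr /= -IH.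
  by case: (\sum_(i < m) u i) => ? ?; case: (u m).
have ImE (m : nat) : complex.Im (\sum_(i < m) u i) = \sum_(i < m) complex.Im (u i).
  elim: m => [|m IH]; rewrite ?big_ord0 // !big_ord_recr /= -IH.
  by case: (\sum_(i < m) u i) => ? ?; case: (u m).
move: g1 g2; rewrite -ReE -ImE.
by case: (\sum_(i < n) u i) => x y /=; lra.
Qed.

Lemma csum_dom u (a : nat -> R) (M : R) : (forall n, cabs (u n) <= a n) ->
  (forall n, \sum_(i < n) a i <= M) -> exists s, csum u s.
Proof.
move=> h hM; apply: (csum_ex (M := M)) => n.
by rewrite (le_trans _ (hM n)) // ler_sum.
Qed.

End ComplexSums.

(** * Double series and Cauchy products *)

Section PowerSeries.
Variable R : realType.
Local Notation C := (cplx R).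
Implicit Types (x y z t : C) (u v a b : nat -> C) (r e : R) (h g : C -> C).

Lemma sum_ge_split (f : nat -> R) (L N : nat) : (forall n, 0 <= f n) -> (L <= N)%N ->
  \sum_(i < L) f i <= \sum_(i < N) f i.
Proof.
move=> f0 LN; rewrite -!(big_mkord xpredT f) [leRHS](big_cat_nat (n := L)) //=.
by rewrite lerDl sumr_ge0.
Qed.

Lemma cabs_sum_diff u (w : nat -> R) L N : (forall n, cabs (u n) <= w n) -> (L <= N)%N ->
  cabs (\sum_(i < N) u i - \sum_(i < L) u i) <= \sum_(i < N) w i - \sum_(i < L) w i.
Proof.
move=> uw LN; rewrite -!(big_mkord xpredT u) -!(big_mkord xpredT w).
rewrite [X in cabs (X - _)](big_cat_nat (n := L)) //= addrAC subrr add0r.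
rewrite [X in _ <= X - _](big_cat_nat (n := L)) //= addrAC subrr add0r.
by rewrite (le_trans (cabs_sum _ _ _)) // ler_sum.
Qed.

Lemma fin_approx (u : nat -> nat -> C) (c : nat -> C) K e :
  (forall k, ccvg (fun N => u N k) (c k)) -> 0 < e ->
  exists N0, forall N, (N0 <= N)%N ->
    \sum_(k < K) cabs (u N k - c k) < e.
Proof.
move=> h; elim: K e => [|K IH] e e0.
  by exists 0%N => N _; rewrite big_ord0.
have e2 : 0 < e / 2 by rewrite divr_gt0.
have [N1 h1] := IH _ e2; have [N2 h2] := h K _ e2.
exists (maxn N1 N2) => N; rewrite geq_max => /andP[/h1 g1 /h2 g2].
by rewrite big_ord_recr /=; move: g1 g2; lra.
Qed.

(** Rectangles containing the L-square are compared with that square: the signed sums differ by at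
    most what the sums of moduli differ. Taking L so that the square of moduli is within e / 3 of
    its supremum controls the row and the column summations at the same time. *)
Lemma csum_double (x : nat -> nat -> C) (M : R) (row col : nat -> C) S :
  (forall N K, \sum_(n < N) \sum_(k < K) cabs (x n k) <= M) ->
  (forall n, csum (x n) (row n)) -> (forall k, csum (x^~ k) (col k)) ->
  csum row S -> csum col S.
Proof.
move=> hM hrow hcol [_ hS].
pose X N K := \sum_(n < N) \sum_(k < K) x n k.
pose Y N K : R := \sum_(n < N) \sum_(k < K) cabs (x n k).
have Y0 : exists T : R, (forall N K, Y N K <= T) /\
    (forall e, 0 < e -> exists L, T - e < Y L L).
  pose A := range (fun NK : nat * nat => Y NK.1 NK.2).
  have sA : has_sup A.
    by split; [exists (Y 0 0)%N; exists (0, 0)%N | exists M => _ [[N K] _ <-]; exact: hM].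
  exists (sup A); split=> [N K|e e0].
    by apply: ub_le_sup; [exact: (proj2 sA) | exists (N, K)].
  have [_ [[N K] _ <-] /= lt] := sup_adherent e0 sA.
  exists (maxn N K); apply: (lt_le_trans lt); rewrite /Y /=.
  apply: (@le_trans _ _ (Y N (maxn N K))).
    by apply: ler_sum => n _; apply: (sum_ge_split (f := fun k => cabs (x n k)));
      [move=> k; exact: cabs_ge0 | exact: leq_maxr].
  apply: (sum_ge_split (f := fun n => \sum_(k < maxn N K) cabs (x n k))); last exact: leq_maxl.
  by move=> n; apply: sumr_ge0 => k _; exact: cabs_ge0.
have [T [hT hT']] := Y0.
have XY L N K : (L <= N)%N -> (L <= K)%N -> cabs (X N K - X L L) <= Y N K - Y L L.
  move=> LN LK; have -> : X N K - X L L = (X N K - X L K) + (X L K - X L L) by ring.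
  have -> : Y N K - Y L L = (Y N K - Y L K) + (Y L K - Y L L) by ring.
  rewrite (le_trans (cabsD _ _)) // lerD //.
    apply: (cabs_sum_diff (u := fun n => \sum_(k < K) x n k)
      (w := fun n => \sum_(k < K) cabs (x n k))) => // n.
    exact: cabs_sum.
  have -> : X L K - X L L = \sum_(k < K) \sum_(n < L) x n k - \sum_(k < L) \sum_(n < L) x n k.
    by rewrite /X; congr (_ - _); exact: exchange_big.
  have -> : Y L K - Y L L = \sum_(k < K) \sum_(n < L) cabs (x n k)
      - \sum_(k < L) \sum_(n < L) cabs (x n k).
    by rewrite /Y; congr (_ - _); exact: exchange_big.
  apply: (cabs_sum_diff (u := fun k => \sum_(n < L) x n k)
      (w := fun k => \sum_(n < L) cabs (x n k))) => // k.
  exact: cabs_sum.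
split.
  (* Finitely many columns are approximated simultaneously by sums over N0 rows, to which the bound
     M applies. *)
  exists M => K; apply/ler_addgt0Pr => e e0.
  have [N0 hN] := fin_approx K (fun k => proj2 (hcol k)) e0.
  have := hN N0 (leqnn _) => h1; apply: ltW.
  apply: le_lt_trans (_ : _ <= \sum_(k < K) cabs (\sum_(i < N0) x i k - col k)
     + \sum_(n < N0) \sum_(k < K) cabs (x n k)) _.
    rewrite exchange_big -big_split /=; apply: ler_sum => k _.
    rewrite (le_trans _ (lerD (lexx _) (cabs_sum _ _ _))) // cabsC.
    by have := cabsD (col k - \sum_(i < N0) x i k) (\sum_(i < N0) x i k); rewrite subrK.
  by have := hM N0 K; move: h1; set p := \sum_(_ < _) cabs _; set q := \sum_(_ < _) _; lra.
move=> e e0; have e3 : 0 < e / 3 by rewrite divr_gt0.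
have [L hL] := hT' _ e3.
have key N K : (L <= N)%N -> (L <= K)%N -> cabs (X N K - X L L) <= e / 3.
  by move=> LN LK; rewrite (le_trans (XY _ _ _ LN LK)) //; have := hT N K; move: hL; lra.
have colL K : (L <= K)%N -> cabs (\sum_(k < K) col k - X L L) <= e / 3.
  move=> LK; apply: (ccvg_le (u := fun N => X N K) (N := L)); last first.
    by move=> N LN; exact: key.
  move=> d d0; have [N0 hN] := fin_approx K (fun k => proj2 (hcol k)) d0.
  exists N0 => N /hN; apply: le_lt_trans; rewrite /X exchange_big -sumrB.
  exact: cabs_sum.
have rowL N : (L <= N)%N -> cabs (\sum_(n < N) row n - X L L) <= e / 3.
  move=> LN; apply: (ccvg_le (u := fun K => X N K) (N := L)); last first.
    by move=> K LK; exact: key.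
  move=> d d0.
  have [N0 hN] := fin_approx (u := fun K n => \sum_(k < K) x n k) N (fun n => proj2 (hrow n)) d0.
  exists N0 => K /hN; apply: le_lt_trans; rewrite /X -sumrB.
  exact: cabs_sum.
have SL : cabs (S - X L L) <= e / 3 by apply: (ccvg_le (N := L) hS).
exists L => K LK; have := colL K LK.
have -> : \sum_(i < K) col i - S = (\sum_(i < K) col i - X L L) - (S - X L L) by ring.
by move=> h1; rewrite (le_lt_trans (cabsB _ _)) //; lra.
Qed.

Lemma sum_shift (V : nmodType) (f : nat -> V) n K :
  \sum_(k < K) (if (n <= k)%N then f (k - n)%N else 0) = \sum_(k < K - n) f k.
Proof.
have [Kn|nK] := leqP K n.
  rewrite (eqP (_ : K - n == 0)%N) ?subn_eq0 // big_ord0 big1 // => k _.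
  by rewrite leqNgt (leq_trans (ltn_ord k) Kn).
rewrite -(big_mkord xpredT (fun k => if (n <= k)%N then f (k - n)%N else 0)).
rewrite (big_cat_nat (n := n)) ?(ltnW nK) //= big1_seq ?add0r => [|k /=].
  rewrite -{1}[n]add0n big_addn big_mkord; apply: eq_bigr => k _.
  by rewrite leq_addl addnK.
by rewrite mem_index_iota => /andP[_]; rewrite ltnNge => /negPf->.
Qed.

Lemma csum_shift u s n : csum u s ->
  csum (fun k => if (n <= k)%N then u (k - n)%N else 0) s.
Proof.
move=> [[M hM] h]; split.
  exists M => K; rewrite (eq_bigr (fun i : 'I_K =>
    if (n <= i)%N then cabs (u (i - n)%N) else 0)) => [|i _]; last by case: ifP; rewrite ?cabs0.
  by rewrite (sum_shift (fun k => cabs (u k))).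
move=> e e0; have [N hN] := h e e0; exists (N + n)%N => K NK.
by rewrite sum_shift; apply: hN; rewrite leq_subRL ?(leq_trans _ NK) ?leq_addl // addnC.
Qed.

Definition conv u v k := \sum_(i < k.+1) u i * v (k - i)%N.

(** A summation range independent of k makes the double sum rectangular, ready for an exchange of
    sums. *)
Lemma conv_if (V : pzRingType) (u v : nat -> V) k K : (k < K)%N ->
  \sum_(i < k.+1) u i * v (k - i)%N =
  \sum_(i < K) (if (i <= k)%N then u i * v (k - i)%N else 0).
Proof.
move=> kK; rewrite -(big_mkord xpredT (fun i => u i * v (k - i)%N)).
rewrite -(big_mkord xpredT (fun i => if (i <= k)%N then u i * v (k - i)%N else 0)).
rewrite [RHS](big_cat_nat (n := k.+1)) //= [X in _ = _ + X]big1_seq ?addr0 => [|i /=].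
  by apply: eq_big_nat => i /andP[_]; rewrite ltnS => ->.
by rewrite mem_index_iota => /andP[]; rewrite ltnNge => /negPf->.
Qed.

Lemma conv_bound (al be : nat -> R) K : (forall n, 0 <= al n) -> (forall n, 0 <= be n) ->
  \sum_(k < K) \sum_(i < k.+1) al i * be (k - i)%N <=
  (\sum_(i < K) al i) * (\sum_(i < K) be i).
Proof.
move=> a0 b0; under eq_bigr => k _ do rewrite (conv_if _ _ (ltn_ord k)).
rewrite exchange_big /= mulr_suml; apply: ler_sum => i _.
have -> : \sum_(k < K) (if (i <= k)%N then al i * be (k - i)%N else 0) =
    al i * \sum_(k < K - i) be k.
  rewrite -(sum_shift be) mulr_sumr; apply: eq_bigr => k _.
  by case: ifP; rewrite ?mulr0.
by rewrite ler_wpM2l // sum_ge_split // leq_subr.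
Qed.

Lemma cabs_conv u v k :
  cabs (conv u v k) <= \sum_(i < k.+1) cabs (u i) * cabs (v (k - i)%N).
Proof. by rewrite (le_trans (cabs_sum _ _ _)) // ler_sum // => i _; rewrite cabsM. Qed.

(** The array u_n v_(k-n), extended by 0 for k < n, has rows of sum u_n t and finite columns, which
    are the terms of [conv]; so [csum_double] applies. *)
Lemma csum_cauchy u v s t : csum u s -> csum v t -> csum (conv u v) (s * t).
Proof.
move=> hu hv; have [[Mu hMu] _] := hu; have [[Mv hMv] _] := hv.
pose x n k : C := if (n <= k)%N then u n * v (k - n)%N else 0.
have xE n k : x n k = u n * (if (n <= k)%N then v (k - n)%N else 0).
  by rewrite /x; case: ifP; rewrite ?mulr0.
apply: (csum_double (x := x) (M := Mu * Mv) (row := fun n => u n * t)).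
- move=> N K; rewrite (le_trans (_ : _ <= \sum_(n < N) cabs (u n) * Mv)) //.
    apply: ler_sum => n _; under eq_bigr do rewrite xE cabsM.
    rewrite -mulr_sumr ler_wpM2l ?cabs_ge0 //.
    rewrite (le_trans _ (hMv (K - n)%N)) // -(sum_shift (fun k => cabs (v k))).
    by apply: ler_sum => k _; case: ifP; rewrite ?cabs0.
  rewrite -mulr_suml ler_wpM2r //.
  by have := hMv 0%N; rewrite big_ord0.
- by move=> n; apply: eq_csum (csumZ (u n) (csum_shift n hv)) => k; rewrite xE.
- move=> k; have := @csum_fin _ (x^~ k) k.+1; rewrite (_ : \sum_(i < k.+1) _ = conv u v k).
    by apply=> n; rewrite /x ltnNge => /negPf->.
  by apply: eq_bigr => i _; rewrite /x -ltnS ltn_ord.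
- by rewrite mulrC; apply: eq_csum (csumZ t hu) => n; rewrite mulrC.
Qed.

End PowerSeries.

(** * Power series and analytic germs *)

Section Analytic.
Variable R : realType.
Local Notation C := (cplx R).
Implicit Types (x y z t : C) (u v a b : nat -> C) (r e : R) (h g : C -> C).

Definition pseries a r h z :=
  0 < r /\ forall t, cabs t < r -> csum (fun n => a n * t ^+ n) (h (z + t)).

Definition an h z := exists a r, pseries a r h z.

Lemma pseries_bound a r h z (rho : R) : pseries a r h z -> 0 <= rho -> rho < r ->
  exists2 M : R, 0 <= M & forall n, \sum_(i < n) cabs (a i) * rho ^+ i <= M.
Proof.
move=> [r0 hr] p0 pr; have := hr (rho%:C)%C; rewrite cabs_real ger0_norm //.
move=> /(_ pr) [[M hM] _]; exists M => [|n]; first by have := hM 0%N; rewrite big_ord0.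
by apply: le_trans (hM n); apply: ler_sum => i _; rewrite cabsM cabsX cabs_real ger0_norm.
Qed.

Lemma pseries0 a r h z : pseries a r h z -> h z = a 0%N.
Proof.
move=> [r0 hr]; have := hr 0; rewrite cabs0 addr0 => /(_ r0) h0.
apply: csum_uniq h0 _; have := @csum_fin _ (fun n => a n * 0 ^+ n) 1%N.
by rewrite big_ord1 expr0 mulr1; apply=> -[|n] // _; rewrite expr0n mulr0.
Qed.

(** Half the radius leaves room: the sums of |a i| (r / 2)^i are bounded, and this bound divided by
    (r / 2)^k is the constant. *)
Lemma pseries_rem a r h z k : pseries a r h z ->
  exists2 M : R, 0 <= M & forall t, cabs t <= r / 2 ->
    cabs (h (z + t) - \sum_(i < k) a i * t ^+ i) <= M * cabs t ^+ k.
Proof.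
move=> hr; have r0 := proj1 hr; have r2 : 0 < r / 2 by rewrite divr_gt0.
have [M M0 hM] := pseries_bound hr (ltW r2) (ltac:(lra) : r / 2 < r).
exists (M / (r / 2) ^+ k) => [|t tr]; first by rewrite divr_ge0 // exprn_ge0 // ltW.
have tr' : cabs t < r by lra.
apply: (csum_le (csum_split k (proj2 hr t tr'))) => n.
rewrite mulrAC ler_pdivlMr ?exprn_gt0 // mulr_suml.
apply: (@le_trans _ _ (\sum_(i < n) (cabs (a (i + k)%N) * (r / 2) ^+ (i + k)) * cabs t ^+ k)).
  apply: ler_sum => i _; rewrite cabsM cabsX !exprD.
  have -> : cabs (a (i + k)%N) * (cabs t ^+ i * cabs t ^+ k) * (r / 2) ^+ k =
    cabs t ^+ i * (cabs (a (i + k)%N) * cabs t ^+ k * (r / 2) ^+ k) by ring.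
  have -> : cabs (a (i + k)%N) * ((r / 2) ^+ i * (r / 2) ^+ k) * cabs t ^+ k =
    (r / 2) ^+ i * (cabs (a (i + k)%N) * cabs t ^+ k * (r / 2) ^+ k) by ring.
  rewrite ler_wpM2r ?mulr_ge0 ?exprn_ge0 ?cabs_ge0 ?(ltW r2) //.
  by rewrite lerXn2r ?nnegrE ?cabs_ge0 // ltW.
rewrite -mulr_suml ler_wpM2r ?exprn_ge0 ?cabs_ge0 // (le_trans _ (hM (k + n)%N)) //.
rewrite big_split_ord /= ler_wpDl ?sumr_ge0 // => [i _|].
  by rewrite mulr_ge0 ?cabs_ge0 // exprn_ge0 // ltW.
by apply: ler_sum => i _; rewrite addnC.
Qed.

Lemma ex_small (B e : R) : 0 <= B -> 0 < e -> exists2 d : R, 0 < d & d * B < e.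
Proof.
move=> B0 e0; exists (e / (B + 1)); first by rewrite divr_gt0 // ltr_wpDl.
by rewrite mulrAC ltr_pdivrMr ?ltr_wpDl // ltr_pM2l // ltrDl.
Qed.

(** Isolation of zeros: once the lower coefficients vanish, the remainder estimate at a zero t reads
    |a n| <= M |t|, and t can be taken arbitrarily small. *)
Lemma pseries_zero a r h z : pseries a r h z ->
  (forall e, 0 < e -> exists t, [/\ t != 0, cabs t < e & h (z + t) = 0]) ->
  forall n, a n = 0.
Proof.
move=> hr hz; elim/ltn_ind => n IH; have r0 := proj1 hr.
have [M M0 hM] := pseries_rem n.+1 hr.
apply: small0 => e e0; have [d d0 dM] := ex_small M0 e0.
have m0 : 0 < Num.min d (r / 2) by rewrite lt_min d0 divr_gt0.
have [t [t0]] := hz _ m0; rewrite lt_min => /andP[td /ltW tr] ht.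
have := hM t tr; rewrite ht sub0r cabsN big_ord_recr /= big1 => [|i _]; last first.
  by rewrite IH ?mul0r.
rewrite add0r cabsM cabsX exprSr mulrA [leRHS]mulrAC ler_pM2r ?exprn_gt0 ?cabs_gt0 //.
move=> /le_trans; apply; rewrite mulrC (le_trans _ (ltW dM)) //.
by rewrite ler_wpM2r // ltW.
Qed.

Lemma pseries_uniq a b r h z r' : pseries a r h z -> pseries b r' h z -> a =1 b.
Proof.
move=> [r0 ha] [r'0 hb] n; apply/eqP; rewrite -subr_eq0; apply/eqP.
have m0 : 0 < Num.min r r' by rewrite lt_min r0.
have hc : pseries (fun n => a n - b n) (Num.min r r') (fun=> 0) z.
  split=> // t; rewrite lt_min => /andP[/ha h1 /hb h2].
  rewrite -(subrr (h (z + t))) -[X in _ - X]mul1r -mulNr.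
  by apply: eq_csum (csumD h1 (csumZ (-1) h2)) => k; ring.
apply: (pseries_zero hc) => e e0; exists ((e / 2)%:C)%C; split=> //.
  by rewrite -cabs_gt0 cabs_real gtr0_norm ?divr_gt0.
by rewrite cabs_real gtr0_norm ?divr_gt0 //; lra.
Qed.

Lemma an_near h g z r : 0 < r -> (forall t, cabs t < r -> h (z + t) = g (z + t)) ->
  an h z -> an g z.
Proof.
move=> r0 hg [a [r' ha]]; exists a, (Num.min r r'); split.
  by rewrite lt_min r0 (proj1 ha).
by move=> t; rewrite lt_min => /andP[tr tr']; rewrite -hg //; apply: (proj2 ha).
Qed.

Lemma an_cst c z : an (fun=> c) z.
Proof.
exists (fun n => if n is 0%N then c else 0), 1; split=> // t _.
have := @csum_fin _ (fun n => (if n is 0%N then c else 0) * t ^+ n) 1%N.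
by rewrite big_ord1 expr0 mulr1; apply=> -[|n] // _; rewrite mul0r.
Qed.

Lemma an_id z : an id z.
Proof.
exists (fun n => if n is 0%N then z else if n is 1%N then 1 else 0), 1; split=> // t _.
have := @csum_fin _ (fun n => (if n is 0%N then z else if n is 1%N then 1 else 0) * t ^+ n) 2%N.
rewrite !big_ord_recl big_ord0 /= expr0 mulr1 addr0 expr1 mul1r; apply.
by move=> [|[|n]] // _; rewrite mul0r.
Qed.

Lemma anD h g z : an h z -> an g z -> an (fun t => h t + g t) z.
Proof.
move=> [a [r ha]] [b [r' hb]]; exists (fun n => a n + b n), (Num.min r r'); split.
  by rewrite lt_min (proj1 ha) (proj1 hb).
move=> t; rewrite lt_min => /andP[/(proj2 ha) h1 /(proj2 hb) h2].
by apply: eq_csum (csumD h1 h2) => n; ring.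
Qed.

Lemma anM h g z : an h z -> an g z -> an (fun t => h t * g t) z.
Proof.
move=> [a [r ha]] [b [r' hb]]; exists (conv a b), (Num.min r r'); split.
  by rewrite lt_min (proj1 ha) (proj1 hb).
move=> t; rewrite lt_min => /andP[/(proj2 ha) h1 /(proj2 hb) h2].
apply: eq_csum (csum_cauchy h1 h2) => n; rewrite /conv mulr_suml.
apply: eq_bigr => i _; rewrite mulrACA -exprD subnKC //.
by rewrite -ltnS ltn_ord.
Qed.

Lemma an_sum (I : Type) (s : seq I) (P : pred I) (F : I -> C -> C) z :
  (forall i, P i -> an (F i) z) -> an (fun t => \sum_(i <- s | P i) F i t) z.
Proof.
move=> hF; elim: s => [|i s IH].
  by under eq_fun do rewrite big_nil; exact: an_cst.
under eq_fun do rewrite big_cons.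
by case Pi: (P i); [exact: anD (hF i Pi) IH | exact: IH].
Qed.

Lemma an_cont h z : an h z -> forall e, 0 < e ->
  exists2 d, 0 < d & forall t, cabs t < d -> cabs (h (z + t) - h z) < e.
Proof.
move=> [a [r ha]] e e0; have r0 := proj1 ha; have [M M0 hM] := pseries_rem 1 ha.
have [d d0 dM] := ex_small M0 e0.
exists (Num.min d (r / 2)) => [|t]; first by rewrite lt_min d0 divr_gt0.
rewrite lt_min => /andP[td /ltW tr]; have := hM t tr.
rewrite big_ord1 expr0 mulr1 -(pseries0 ha) expr1 => /le_lt_trans; apply.
by rewrite (le_lt_trans _ dM) // mulrC ler_wpM2r // ltW.
Qed.

Fixpoint conv_pow b n : nat -> C :=
  if n is n'.+1 then conv b (conv_pow b n') else fun k => (k == 0%N)%:R.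

Lemma conv_pow_csum b t s : csum (fun n => b n * t ^+ n) s ->
  forall n, csum (fun k => conv_pow b n k * t ^+ k) (s ^+ n).
Proof.
move=> hb; elim=> [|n IH] /=.
  rewrite expr0; have := @csum_fin _ (fun k => (k == 0%N)%:R * t ^+ k) 1%N.
  by rewrite big_ord1 eqxx expr0 mulr1; apply=> -[|k] // _; rewrite mul0r.
rewrite exprS; apply: eq_csum (csum_cauchy hb IH) => k.
rewrite /conv mulr_suml; apply: eq_bigr => i _; rewrite mulrACA -exprD subnKC //.
by rewrite -ltnS ltn_ord.
Qed.

Lemma conv_pow_bound b (rho B : R) : 0 <= rho ->
  (forall K, \sum_(k < K) cabs (b k) * rho ^+ k <= B) ->
  forall n K, \sum_(k < K) cabs (conv_pow b n k) * rho ^+ k <= B ^+ n.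
Proof.
move=> p0 hB; have B0 : 0 <= B by have := hB 0%N; rewrite big_ord0.
elim=> [|n IH] K /=.
  rewrite expr0; case: K => [|K]; first by rewrite big_ord0.
  under eq_bigr do rewrite cabs_nat.
  by rewrite big_ord_recl big1 => [|i _]; [rewrite addr0 expr0 mulr1 | rewrite mul0r].
apply: le_trans (_ : _ <= \sum_(k < K) \sum_(i < k.+1) (cabs (b i) * rho ^+ i) *
   (cabs (conv_pow b n (k - i)%N) * rho ^+ (k - i))) _.
  apply: ler_sum => k _; rewrite (le_trans (ler_wpM2r _ (cabs_conv _ _ _))) ?exprn_ge0 //.
  rewrite mulr_suml; apply: ler_sum => i _; rewrite mulrACA -exprD subnKC //.
  by rewrite -ltnS ltn_ord.
rewrite (le_trans (conv_bound (al := fun i => cabs (b i) * rho ^+ i)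
  (be := fun i => cabs (conv_pow b n i) * rho ^+ i) _ _ _)) => //.
- by move=> k; rewrite mulr_ge0 ?cabs_ge0 ?exprn_ge0.
- by move=> k; rewrite mulr_ge0 ?cabs_ge0 ?exprn_ge0.
rewrite exprS ler_pM // ?sumr_ge0 // => k _;
  by rewrite mulr_ge0 ?cabs_ge0 ?exprn_ge0.
Qed.

Lemma conv_pow_lt b : b 0%N = 0 -> forall n k, (k < n)%N -> conv_pow b n k = 0.
Proof.
move=> b0; elim=> // n IH k; rewrite ltnS => kn /=; rewrite /conv big_ord_recl b0 mul0r add0r.
apply: big1 => i _; rewrite IH ?mulr0 //= /bump /=.
by have := ltn_ord i; lia.
Qed.

(** Substitution is a double series in the powers of the inner series. Removing the constant term of
    the latter ([b']) makes [conv_pow b' n k] vanish for k < n, so every column is finite. *)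
Lemma an_comp h g z : an g z -> an h (g z) -> an (h \o g) z.
Proof.
move=> [b [r hb]] [a [r' ha]]; have r0 := proj1 hb; have r'0 := proj1 ha.
pose b' k := if k is 0%N then 0 else b k.
have hb' t : cabs t < r -> csum (fun n => b' n * t ^+ n) (g (z + t) - g z).
  move=> /(proj2 hb) h1; rewrite (pseries0 hb) -[X in _ - X]mul1r -mulNr.
  have h2 := @csum_fin _ (fun n => if n is 0%N then b 0%N else 0) 1%N.
  rewrite big_ord1 in h2.
  apply: eq_csum (csumD h1 (csumZ (-1) (h2 _))) => [[|n]|[|n]] //=.
    by rewrite mul0r expr0; ring.
  by rewrite mulr0 addr0.
have r2 : 0 < r / 2 by rewrite divr_gt0.
have [M M0 hM] := pseries_bound hb (ltW r2) (ltac:(lra) : r / 2 < r).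
(* Since [b'] has no constant term, shrinking the radius from r / 2 to [rho] scales its sum of
   moduli by at most rho / (r / 2); d makes the result smaller than r' / 2, inside the disc of the
   outer series. *)
have [d d0 dM] := @ex_small (M / (r / 2)) (r' / 2) (divr_ge0 M0 (ltW r2)) (ltac:(lra)).
pose rho := Num.min d (r / 2); have p0 : 0 < rho by rewrite lt_min d0.
have hB K : \sum_(k < K) cabs (b' k) * rho ^+ k <= r' / 2.
  case: K => [|K]; first by rewrite big_ord0; lra.
  have b'S i : b' i.+1 = b i.+1 by [].
  have b'0 : cabs (b' 0%N) = 0 by exact: cabs0.
  rewrite big_ord_recl b'0 mul0r add0r.
  apply: le_trans (_ : _ <= rho / (r / 2) * \sum_(i < K.+1) cabs (b i) * (r / 2) ^+ i) _.
    rewrite big_ord_recl mulrDr ler_wpDl //.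
      by rewrite mulr_ge0 ?mulr_ge0 ?invr_ge0 ?cabs_ge0 // ltW.
    rewrite mulr_sumr ler_sum // => i _; rewrite lift0 b'S mulrCA.
    rewrite ler_wpM2l ?cabs_ge0 // !exprS mulrA divfK ?gt_eqF // ler_wpM2l ?(ltW p0) //.
    by rewrite lerXn2r ?nnegrE ?(ltW p0) ?(ltW r2) // /rho ge_min lexx orbT.
  apply: le_trans (_ : _ <= rho / (r / 2) * M) _.
    by rewrite ler_wpM2l // divr_ge0 // ltW.
  rewrite mulrAC -mulrA (le_trans _ (ltW dM)) // ler_wpM2r ?divr_ge0 ?(ltW r0) //.
  by rewrite /rho ge_min lexx.
have [M' M'0 hM'] := pseries_bound ha (ltac:(lra) : 0 <= r' / 2) (ltac:(lra) : r' / 2 < r').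
exists (fun k => \sum_(n < k.+1) a n * conv_pow b' n k), rho; split=> // t tr.
have trho : cabs t < r by rewrite (lt_le_trans tr) // /rho ge_min; lra.
have hbt := hb' t trho.
have bt K : \sum_(k < K) cabs (b' k) * cabs t ^+ k <= r' / 2.
  rewrite (le_trans _ (hB K)) // ler_sum // => k _; rewrite ler_wpM2l ?cabs_ge0 //.
  by rewrite lerXn2r ?nnegrE ?cabs_ge0 ?(ltW p0) // ltW.
apply: (csum_double (x := fun n k => a n * (conv_pow b' n k * t ^+ k)) (M := M')
  (row := fun n => a n * (g (z + t) - g z) ^+ n)).
- move=> N K; rewrite (le_trans _ (hM' N)) // ler_sum // => n _.
  under eq_bigr do rewrite !cabsM cabsX.
  by rewrite -mulr_sumr ler_wpM2l ?cabs_ge0 // conv_pow_bound ?cabs_ge0.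
- by move=> n; apply: csumZ; apply: conv_pow_csum.
- move=> k; rewrite mulr_suml.
  have := @csum_fin _ (fun n => a n * (conv_pow b' n k * t ^+ k)) k.+1.
  rewrite (_ : \sum_(i < k.+1) _ = \sum_(i < k.+1) a i * conv_pow b' i k * t ^+ k).
    by apply=> n kn; rewrite conv_pow_lt // mul0r mulr0.
  by apply: eq_bigr => i _; rewrite mulrA.
- rewrite /= -[X in h X](subrK (g z)) [X in h X]addrC; apply: (proj2 ha).
  apply: le_lt_trans (_ : r' / 2 < r'); last by lra.
  apply: csum_le hbt _ => K; under eq_bigr do rewrite cabsM cabsX.
  exact: bt.
Qed.

(* The value of the k-th jet near z is obtained by re-expanding at z + t the
   expansion at z. *)
Lemma jet_an (V : C -> Prop) (c : C -> nat -> C) :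
  (forall z, V z -> exists2 r, 0 < r & forall t, cabs t < r ->
     V (z + t) /\ csum (fun n => c z n * t ^+ n) (c (z + t) 0%N)) ->
  forall z, V z -> forall k, an (c^~ k) z.
Proof.
move=> hV z Vz k; have [r r0 hr] := hV z Vz.
have hz : pseries (c z) r (c^~ 0%N) z by split=> // t /hr [].
exists (fun m => 'C(m + k, k)%:R * c z (m + k)%N), r; split=> // t tr.
have [Vzt _] := hr t tr; have [r1 r10 hr1] := hV _ Vzt.
have hzt : pseries (c (z + t)) r1 (c^~ 0%N) (z + t) by split=> // s /hr1 [].
pose x s n k := c z n * ('C(n, k)%:R * t ^+ (n - k) * s ^+ k).
have x0 s n i : (n < i)%N -> x s n i = 0.
  by move=> ni; rewrite /x bin_small // !mul0r mulr0.
(* Half of the room left around t, so that |t| + s0 stays below r. *)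
pose s0 : R := (r - cabs t) / 2; have s00 : 0 < s0 by rewrite /s0; lra.
have [M M0 hM] := pseries_bound hz (ltac:(rewrite /s0; have := cabs_ge0 t; lra) :
  0 <= cabs t + s0) (ltac:(rewrite /s0; lra) : cabs t + s0 < r).
have rowb s n K : cabs s <= s0 -> \sum_(i < K) cabs (x s n i) <= cabs (c z n) * (cabs t + s0) ^+ n.
  move=> ss; under eq_bigr do rewrite cabsM 2!cabsM !cabsX cabs_nat.
  rewrite -mulr_sumr ler_wpM2l ?cabs_ge0 // exprDn.
  pose F i : R := 'C(n, i)%:R * cabs t ^+ (n - i) * cabs s ^+ i.
  have F0 i : 0 <= F i by rewrite !mulr_ge0 ?exprn_ge0 ?cabs_ge0.
  apply: (@le_trans _ _ (\sum_(i < n.+1) F i)).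
    have [Kn|nK] := leqP K n.+1; first exact: (sum_ge_split F0 Kn).
    rewrite -(big_mkord xpredT F) (big_cat_nat (n := n.+1)) ?(ltnW nK) //=.
    rewrite [X in _ + X]big1_seq ?addr0 ?big_mkord // => i /=.
    by rewrite mem_index_iota => /andP[ni _]; rewrite /F bin_small // !mul0r.
  apply: ler_sum => i _; rewrite /F -mulrA mulr_natl ler_wMn2r //.
  by rewrite ler_wpM2l ?exprn_ge0 ?cabs_ge0 // lerXn2r ?nnegrE ?cabs_ge0 ?(ltW s00).
have rectb s N K : cabs s <= s0 -> \sum_(n < N) \sum_(i < K) cabs (x s n i) <= M.
  by move=> ss; rewrite (le_trans _ (hM N)) // ler_sum // => n _; exact: rowb.
have colex s i : cabs s <= s0 -> exists d, csum (fun n => x s n i) d.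
  move=> ss; apply: (csum_ex (M := M)) => N; rewrite (le_trans _ (rectb s N i.+1 ss)) //.
  apply: ler_sum => n _; rewrite big_ord_recr /= ler_wpDl // sumr_ge0 // => j _.
  exact: cabs_ge0.
pose y i m := 'C(m + i, i)%:R * c z (m + i)%N * t ^+ m.
have yE s m i : x s (m + i)%N i = s ^+ i * y i m by rewrite /x /y addnK; ring.
have yex i : exists d, csum (y i) d.
  have ss : cabs (s0%:C)%C <= s0 by rewrite cabs_real gtr0_norm.
  have [d /(csum_split i)] := colex _ i ss; rewrite big1 => [|j _]; last by rewrite x0.
  rewrite subr0 => /(csumZ (((s0%:C)%C ^+ i)^-1)) hd.
  exists (((s0%:C)%C ^+ i)^-1 * d); apply: eq_csum hd => m.
  rewrite yE mulrA mulVf ?mul1r // expf_neq0 // -cabs_gt0 cabs_real gtr0_norm //.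
pose dd i := projT1 (cid (yex i)); have hdd i : csum (y i) (dd i).
  by rewrite /dd; case: cid.
have hcol s i : csum (fun n => x s n i) (dd i * s ^+ i).
  have := csum_shift i (csumZ (s ^+ i) (hdd i)); rewrite mulrC; apply: eq_csum => n.
  by case: leqP => [ni|/x0->//]; rewrite -yE subnK.
have hd : pseries dd s0 (c^~ 0%N) (z + t).
  split=> // s ss; apply: (csum_double (x := x s) (M := M) (row := fun n => c z n * (t + s) ^+ n)).
  - by move=> N K; apply: rectb; rewrite ltW.
  - move=> n; have := @csum_fin _ (x s n) n.+1; rewrite (_ : \sum_(i < n.+1) _ = c z n * (t + s) ^+ n).
      by apply=> i; exact: x0.
    rewrite exprDn mulr_sumr; apply: eq_bigr => i _; rewrite /x -mulr_natl; ring.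
  - by move=> i; exact: hcol.
  - rewrite -addrA; apply: (proj2 hz).
    by rewrite (le_lt_trans (cabsD _ _)) //; move: ss; rewrite /s0; lra.
(* Uniqueness of expansions identifies the jet given at z + t with the re-expanded one, whose k-th
   coefficient is a power series in t. *)
by rewrite (pseries_uniq hzt hd) ; apply: eq_csum (hdd k).
Qed.

End Analytic.

(** * Identity theorem, maximum modulus and Liouville's theorem *)

Section Liouville.
Variable R : realType.
Local Notation C := (cplx R).
Implicit Types (x y z t : C) (r e : R) (h g : C -> C).

Lemma an_zero_near h z : an h z ->
  (forall e, 0 < e -> exists t, [/\ t != 0, cabs t < e & h (z + t) = 0]) ->
  exists2 r, 0 < r & forall t, cabs t < r -> h (z + t) = 0.
Proof.
move=> [a [r ha]] hz; exists r => [|t tr]; first exact: proj1 ha.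
have a0 := pseries_zero ha hz.
apply: csum_uniq (proj2 ha t tr) _.
by apply: eq_csum (@csum0 R) => n; rewrite a0 mul0r.
Qed.

Definition zero_near h z := exists2 r, 0 < r & forall t, cabs t < r -> h (z + t) = 0.

(** At the supremum b of the times up to which h vanishes locally, zeros accumulate; hence h
    vanishes near b, and b can only be 1. *)
Lemma an_segment h : (forall t : R, 0 <= t <= 1 -> an h (t%:C)%C) -> zero_near h 0 ->
  forall t : R, 0 <= t <= 1 -> zero_near h (t%:C)%C.
Proof.
move=> han h0.
pose A := [set t : R | 0 <= t <= 1 /\ forall s, 0 <= s <= t -> zero_near h (s%:C)%C].
have A0 : A 0.
  split=> [|s]; first by rewrite lexx ler01.
  by move=> s0; have -> : s = 0 by apply/eqP; rewrite eq_le andbC.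
have sA : has_sup A by split; [exists 0 | exists 1 => t [/andP[_]]].
pose b := sup A; have b0 : 0 <= b by apply: ub_le_sup => //; exact: (proj2 sA).
have b1 : b <= 1 by apply: ge_sup => [|t [/andP[_]]] //; exists 0.
have zb : zero_near h (b%:C)%C.
  apply: an_zero_near => [|e e0]; first by apply: han; rewrite b0.
  have [t At tb] := sup_adherent e0 sA; have tb' : t <= b by apply: ub_le_sup; [exact: (proj2 sA)|].
  have [[t0 hA]] := At; have := hA t; rewrite lexx andbT; case/andP: t0 => -> _ /(_ isT) [r r0 hr].
  (* Accumulation requires a zero different from b; if the supremum is attained, a neighbouring
     point of the disc around it serves. *)
  have [teb|tnb] := eqVneq t b.
    exists ((Num.min e r / 2)%:C)%C; have m0 : 0 < Num.min e r by rewrite lt_min e0.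
    split; first by rewrite -cabs_gt0 cabs_real gtr0_norm ?divr_gt0.
      by rewrite cabs_real gtr0_norm ?divr_gt0 // ltr_pdivrMr // gt_min; lra.
    by rewrite -teb hr // cabs_real gtr0_norm ?divr_gt0 // ltr_pdivrMr // gt_min; lra.
  exists ((t - b)%:C)%C; split.
  - by rewrite -cabs_gt0 cabs_real normr_gt0 subr_eq0.
  - by rewrite cabs_real distrC ger0_norm ?subr_ge0 //; move: tb; rewrite -/b; lra.
  - by have := hr 0; rewrite cabs0 addr0 -rmorphD /= addrCA subrr addr0 => /(_ r0).
have [r r0 hr] := zb.
have near s : `|s - b| < r -> zero_near h (s%:C)%C.
  move=> sb; exists (r - `|s - b|) => [|t tr]; first by rewrite subr_gt0.
  have := hr ((s - b)%:C%C + t); rewrite addrA -rmorphD /= addrCA subrr addr0; apply.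
  by rewrite (le_lt_trans (cabsD _ _)) // cabs_real; lra.
have Ab s : 0 <= s -> s < b -> zero_near h (s%:C)%C.
  move=> s0 sb; have d0 : 0 < b - s by rewrite subr_gt0.
  have [t [[t0 hA]] tb] := sup_adherent d0 sA.
  by apply: hA; rewrite s0 /=; move: tb; rewrite -/b; lra.
have b1' : b = 1.
  apply/eqP; rewrite eq_le b1 /= leNgt; apply/negP => blt.
  have m0 : 0 < Num.min (r / 2) (1 - b) by rewrite lt_min divr_gt0 //= subr_gt0.
  have : b + Num.min (r / 2) (1 - b) <= b; last by lra.
  apply: ub_le_sup; first exact: (proj2 sA).
  have mr : Num.min (r / 2) (1 - b) <= r / 2 by rewrite ge_min lexx.
  have m1 : Num.min (r / 2) (1 - b) <= 1 - b by rewrite ge_min lexx orbT.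
  split=> [|s /andP[s0 sb]]; first by apply/andP; split; lra.
  have [sb'|bs] := ltP s b; first exact: Ab.
  by apply: near; rewrite ger0_norm ?subr_ge0 //; lra.
move=> t /andP[t0 t1]; have [tb|bt] := ltP t b; first exact: Ab.
by have -> : t = b by apply/eqP; rewrite eq_le bt b1' t1.
Qed.

(** If a (k + 1) is the first nonzero coefficient after the constant one, there is a direction in
    which the two terms add up in modulus, and the gain of order s^(k+1) beats the remainder of
    order s^(k+2). *)
Lemma max_modulus h z e : an h z -> 0 < e ->
  (forall t, cabs t < e -> cabs (h (z + t)) <= cabs (h z)) ->
  exists2 r, 0 < r & forall t, cabs t < r -> h (z + t) = h z.
Proof.
move=> [a [r ha]] e0 hmax; have r0 := proj1 ha; have hz := pseries0 ha.
have [hz0|hz0] := eqVneq (h z) 0.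
  exists e => // t /hmax; rewrite hz0 cabs0 => le0; apply/eqP.
  by rewrite -cabs_eq0 eq_le le0 cabs_ge0.
have [aS|] := pselect (forall n, a n.+1 = 0).
  exists r => // t tr; apply: csum_uniq (proj2 ha t tr) _.
  rewrite hz; have := @csum_fin _ (fun n => a n * t ^+ n) 1%N.
  by rewrite big_ord1 expr0 mulr1; apply=> -[|n] // _; rewrite aS mul0r.
move=> /existsNP [n0 /eqP an0].
have exk : exists k, a k.+1 != 0 by exists n0.
pose k := ex_minn exk.
have [ak kmin] : a k.+1 != 0 /\ forall i, (i < k)%N -> a i.+1 = 0.
  rewrite /k; case: ex_minnP => m am mmin; split=> // i im; apply/eqP/negPn/negP => ai.
  by have := mmin i ai; rewrite leqNgt im.
exfalso.
(* The direction w is chosen so that a (k + 1) w^(k+1) equals the constant term a 0. *)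
pose w : complex R := k.+1.-root (a 0%N / a k.+1 : complex R).
have wk : a k.+1 * w ^+ k.+1 = a 0%N by rewrite rootCK // mulrC divfK.
have [M M0 hM] := pseries_rem k.+2 ha.
have w0 : 0 < cabs w.
  rewrite cabs_gt0; apply/eqP => w0; move: wk; rewrite w0 expr0n mulr0 => /esym a0.
  by rewrite hz a0 eqxx in hz0.
have hz1 : 0 < cabs (h z) by rewrite cabs_gt0.
have [d d0 dM] := @ex_small _ (M * cabs w ^+ k.+2) (cabs (h z))
  (mulr_ge0 M0 (exprn_ge0 _ (ltW w0))) hz1.
(* The bound by d puts the remainder below s^(k+1) |h z|; the other bound keeps s w in the two discs
   where the hypotheses hold. *)
pose s := Num.min d (Num.min (e / 2) (r / 2) / cabs w).
have s0 : 0 < s by rewrite lt_min d0 divr_gt0 // lt_min !divr_gt0.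
pose t : C := (s%:C)%C * w.
have tE : cabs t = s * cabs w by rewrite cabsM cabs_real gtr0_norm.
have tm : cabs t <= Num.min (e / 2) (r / 2).
  by rewrite tE -ler_pdivlMr // /s ge_min lexx orbT.
move: tm; rewrite le_min => /andP[te tr].
have := hM t tr; rewrite big_ord_recr /= big_ord_recl /= big1 => [|i _]; last first.
  by rewrite /bump /= add1n kmin ?mul0r.
rewrite expr0 mulr1 addr0 /t exprMn mulrCA wk -/t.
have -> : a 0%N + (s%:C)%C ^+ k.+1 * a 0%N = (1 + (s%:C)%C ^+ k.+1) * a 0%N by ring.
set q := 1 + _; have q1 : cabs q = 1 + s ^+ k.+1.
  have -> : q = ((1 + s ^+ k.+1)%:C)%C by rewrite /q rmorphD rmorph1 rmorphXn.
  by rewrite cabs_real ger0_norm // addr_ge0 ?exprn_ge0 // ltW.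
move=> hrem; have hm : cabs (h (z + t)) <= cabs (h z) by apply: hmax; lra.
have : cabs (q * a 0%N) <= cabs (h (z + t)) + M * cabs t ^+ k.+2.
  have -> : q * a 0%N = h (z + t) - (h (z + t) - q * a 0%N) by ring.
  by rewrite (le_trans (cabsB _ _)) // lerD2l.
rewrite cabsM q1 -hz tE exprMn mulrCA => hle.
have : s ^+ k.+2 * (M * cabs w ^+ k.+2) < s ^+ k.+1 * cabs (h z).
  rewrite exprSr -mulrA ltr_pM2l ?exprn_gt0 // (le_lt_trans _ dM) // ler_wpM2r //.
    by rewrite mulr_ge0 // exprn_ge0 // ltW.
  by rewrite /s ge_min lexx.
by move: hle hm; rewrite mulrDl mul1r; lra.
Qed.

(** Away from the square of half-side B the modulus is at most half its value at z0, so a maximum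
    over this compact square is global. *)
Lemma max_attained h (B : R) z0 : (forall z, an h z) -> 0 < cabs (h z0) ->
  (forall z, B < cabs z -> cabs (h z) <= cabs (h z0) / 2) ->
  exists c, forall z, cabs (h z) <= cabs (h c).
Proof.
move=> han hz0 hB.
have B0 : 0 <= B.
  rewrite leNgt; apply/negP => Bn; have := hB z0 (lt_le_trans Bn (cabs_ge0 _)); lra.
pose I := [set` (`[- B, B] : interval R)].
pose F (p : R * R) := cabs (h (p.1 +i* p.2)%C).
have [|||c cA hc] := @compact_EVT_max (R * R)%type R F (I `*` I).
- by exists (0, 0); split; rewrite /I /= in_itv /= lerNl oppr0 B0.
- by apply: compact_setX; exact: segment_compact.
- apply: continuous_subspaceT => p; apply/cvgrPdist_lt => e e0.
  have [d d0 hd] := an_cont (han (p.1 +i* p.2)%C) e0.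
  have d2 : 0 < d / 2 by rewrite divr_gt0.
  exists (ball p.1 (d / 2), ball p.2 (d / 2)); first by split; exact: nbhsx_ballx.
  move=> q [/= q1 q2]; rewrite -ball_normE /ball_ /= in q1 q2.
  pose t : C := ((q.1 - p.1) +i* (q.2 - p.2))%C.
  have qE : (q.1 +i* q.2)%C = ((p.1 +i* p.2)%C : C) + t.
    by apply/eqP; rewrite eq_complex /= !(addrC p.1, addrC p.2) !subrK !eqxx.
  rewrite /F qE; have td : cabs t < d.
    rewrite (le_lt_trans (cabs_le_Re_Im _)) //=.
    move: q1 q2; rewrite !(distrC q.1, distrC q.2); lra.
  have := hd t td; set u := h _; set v := h _ => uv.
  have h1 : cabs u <= cabs (u - v) + cabs v by rewrite -[X in cabs X <= _](subrK v) cabsD.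
  have h2 : cabs v <= cabs (u - v) + cabs u.
    by rewrite cabsC -[X in cabs X <= _](subrK u) cabsD.
  by rewrite ltr_norml; apply/andP; split; lra.
- exists (c.1 +i* c.2)%C => z.
  have inA z' : cabs z' <= B -> cabs (h z') <= F c.
    case: z' => x y xy; apply: (hc (x, y)); rewrite inE; split=> /=.
      rewrite /I /= in_itv /= -ler_norml (le_trans _ xy) //; exact: (Re_le_cabs (x +i* y)%C).
    rewrite /I /= in_itv /= -ler_norml (le_trans _ xy) //; exact: (Im_le_cabs (x +i* y)%C).
  have [zB|Bz] := leP (cabs z) B; first exact: inA.
  have [zB0|Bz0] := leP (cabs z0) B.
    by rewrite (le_trans (hB z Bz)) // (le_trans _ (inA _ zB0)) //; lra.
  by have := hB z0 Bz0; lra.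
Qed.

(** Stated for functions tending to 0 at infinity, the form in which slopes and differences are
    submitted to it. The maximum of the modulus is attained at some c, h is constant near c by
    [max_modulus], and [an_segment] carries the constancy along segments from c. *)
Lemma liouville h : (forall z, an h z) ->
  (forall e, 0 < e -> exists B, forall z, B < cabs z -> cabs (h z) <= e) ->
  forall z, h z = 0.
Proof.
move=> han hlim z0; apply/eqP; rewrite -cabs_eq0 eq_le cabs_ge0 andbT leNgt.
apply/negP => hz0; have e0 : 0 < cabs (h z0) / 2 by rewrite divr_gt0.
have [B hB] := hlim _ e0.
have [c hc] := max_attained han hz0 hB.
have [r r0 hr] := max_modulus (han c) ltr01 (fun t _ => hc (c + t)).
have cz0 : 0 < cabs (h c) by rewrite (lt_le_trans hz0).
have allc z : h z = h c.
  pose g t := h (c + t * (z - c)) - h c.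
  have gan t : an g t.
    apply: anD; last exact: an_cst.
    apply: (an_comp (h := h) (g := fun t => c + t * (z - c))); last exact: han.
    by apply: anD; [exact: an_cst | apply: anM; [exact: an_id | exact: an_cst]].
  have g0 : zero_near g 0.
    have [d d0 dz] := ex_small (cabs_ge0 (z - c)) r0.
    exists d => // t td; rewrite /g add0r hr ?subrr // cabsM (le_lt_trans _ dz) //.
    by rewrite ler_wpM2r ?cabs_ge0 // ltW.
  have [|d d0] := @an_segment g (fun (t : R) _ => gan _) g0 1; first by rewrite ler01 lexx.
  move=> /(_ 0); rewrite cabs0 addr0 /g rmorph1 mul1r addrCA subrr addr0 => /(_ d0) /eqP.
  by rewrite subr_eq0 => /eqP.
pose b : C := ((`|B| + 1)%:C)%C.
have := hB b; rewrite cabs_real ger0_norm ?addr_ge0 // (allc b) (allc z0).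
by rewrite (le_lt_trans (ler_norm B)) ?ltrDl // => /(_ isT); lra.
Qed.

End Liouville.

(** * The Grassmann algebra *)

Section GrassmannAlgebra.
Local Open Scope fset_scope.
Local Open Scope ring_scope.
Variable R : realType.
Local Notation C := (cplx R).
Local Notation Lam := (grassmann C).
Implicit Types (x y p q w : Lam) (I J L : {fset nat}) (a : C).

Lemma gr0E I : (0 : Lam) I = 0. Proof. exact: gr_zeroE. Qed.
Lemma grDE x y I : (x + y) I = x I + y I. Proof. exact: gr_addE. Qed.
Lemma grNE x I : (- x) I = - x I. Proof. exact: gr_oppE. Qed.
Lemma grBE x y I : (x - y) I = x I - y I. Proof. by rewrite grDE grNE. Qed.
Lemma grZE a x I : (a *: x) I = a * x I. Proof. exact: gr_scaleE. Qed.
Lemma gr1E I : (1 : Lam) I = (I == fset0)%:R. Proof. exact: gr_oneE. Qed.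
Lemma grME x y I : (x * y) I =
  \sum_(J <- fpowerset I) (-1) ^+ inversions J (I `\` J) * (x J * y (I `\` J)).
Proof. exact: gr_mulE. Qed.
Lemma grAE a I : (a%:A : Lam) I = if I == fset0 then a else 0.
Proof. by rewrite grZE gr1E; case: eqP; rewrite ?mulr1 ?mulr0. Qed.
Lemma gr_sumE (T : Type) (s : seq T) (P : pred T) (F : T -> Lam) I :
  (\sum_(i <- s | P i) F i) I = \sum_(i <- s | P i) F i I.
Proof. by elim/big_rec2: _ => [|i y z _ <-]; rewrite ?gr0E ?grDE. Qed.
Lemma grP x y : (forall I, x I = y I) -> x = y. Proof. by move=> h; apply/fsfunP. Qed.

Lemma odd_fsetD I J : J `<=` I -> odd #|` I| = odd #|` J| (+) odd #|` I `\` J|.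
Proof. by move=> sJI; rewrite -oddD cardfsD (fsetIidPr sJI) subnKC // fsubset_leq_card. Qed.

Lemma evpE p I : evp p I = if odd #|` I| then 0 else p I.
Proof. by rewrite fsfunE; case: finsuppP => //; rewrite if_same. Qed.
Lemma odpE p I : odp p I = if odd #|` I| then p I else 0.
Proof. by rewrite grBE evpE; case: ifP; rewrite ?subr0 ?subrr. Qed.
Lemma gconjE p I : gconj p I = (-1) ^+ odd #|` I| * p I.
Proof.
by rewrite grBE evpE odpE; case: odd; rewrite ?subr0 ?sub0r ?expr1 ?mulN1r ?expr0 ?mul1r.
Qed.
Lemma evp_odp p : evp p + odp p = p. Proof. by rewrite addrC subrK. Qed.
Lemma evp_even p : is_even (evp p). Proof. by move=> I oI; rewrite evpE oI. Qed.
Lemma odp_odd p : is_odd (odp p). Proof. by move=> I /negPf oI; rewrite odpE oI. Qed.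
Lemma evpD p q : evp (p + q) = evp p + evp q.
Proof. by apply: grP => I; rewrite grDE !evpE grDE; case: ifP; rewrite ?addr0. Qed.
Lemma odpD p q : odp (p + q) = odp p + odp q.
Proof. by rewrite /odp evpD; apply: grP => I; rewrite !(grDE, grNE); ring. Qed.
Lemma even_evp x : is_even x -> evp x = x.
Proof. by move=> ex; apply: grP => I; rewrite evpE; case: ifP => // /ex. Qed.
Lemma even_odp x : is_even x -> odp x = 0.
Proof. by move=> ex; rewrite /odp even_evp // subrr. Qed.
Lemma odd_evp x : is_odd x -> evp x = 0.
Proof. by move=> ox; apply: grP => I; rewrite evpE gr0E; case: ifPn => // /ox. Qed.
Lemma odd_odp x : is_odd x -> odp x = x.
Proof. by move=> ox; rewrite /odp odd_evp // subr0. Qed.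

Lemma ev0 : is_even (0 : Lam). Proof. by move=> I _; rewrite gr0E. Qed.
Lemma od0 : is_odd (0 : Lam). Proof. by move=> I _; rewrite gr0E. Qed.
Lemma ev1 : is_even (1 : Lam).
Proof. by move=> I; rewrite gr1E; case: eqP => // ->; rewrite cardfs0. Qed.
Lemma evD x y : is_even x -> is_even y -> is_even (x + y).
Proof. by move=> ex ey I oI; rewrite grDE ex // ey // addr0. Qed.
Lemma odD x y : is_odd x -> is_odd y -> is_odd (x + y).
Proof. by move=> ex ey I oI; rewrite grDE ex // ey // addr0. Qed.
Lemma evZ a x : is_even x -> is_even (a *: x).
Proof. by move=> ex I oI; rewrite grZE ex // mulr0. Qed.
Lemma odZ a x : is_odd x -> is_odd (a *: x).
Proof. by move=> ex I oI; rewrite grZE ex // mulr0. Qed.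
Lemma evN x : is_even x -> is_even (- x).
Proof. by rewrite -scaleN1r; exact: evZ. Qed.
Lemma odN x : is_odd x -> is_odd (- x).
Proof. by rewrite -scaleN1r; exact: odZ. Qed.
Lemma evB x y : is_even x -> is_even y -> is_even (x - y).
Proof. by move=> ex ey; apply/evD/evN. Qed.
Lemma odB x y : is_odd x -> is_odd y -> is_odd (x - y).
Proof. by move=> ex ey; apply/odD/odN. Qed.
Lemma evA a : is_even (a%:A : Lam). Proof. exact/evZ/ev1. Qed.

Lemma grM_parity x y (b c : bool) :
  (forall I, odd #|` I| != b -> x I = 0) -> (forall I, odd #|` I| != c -> y I = 0) ->
  forall I, odd #|` I| != b (+) c -> (x * y) I = 0.
Proof.
move=> hx hy I hI; rewrite grME big1_seq // => J /=; rewrite fpowersetE => sJI.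
have [hJ|/hx ->] := eqVneq (odd #|` J|) b; last by rewrite mul0r mulr0.
rewrite (hy (I `\` J)) ?mulr0 //; apply: contra hI => /eqP <-.
by rewrite -hJ (odd_fsetD sJI).
Qed.
Lemma evM x y : is_even x -> is_even y -> is_even (x * y).
Proof.
by move=> ex ey I oI; apply: (grM_parity (b := false) (c := false)) => [J|J|];
  rewrite ?oI // eqbF_neg negbK; [exact: ex|exact: ey].
Qed.
Lemma odM x y : is_odd x -> is_odd y -> is_even (x * y).
Proof.
by move=> ex ey I oI; apply: (grM_parity (b := true) (c := true)) => [J|J|];
  rewrite ?oI // eqb_id; [exact: ex|exact: ey].
Qed.
Lemma ev_odM x y : is_even x -> is_odd y -> is_odd (x * y).
Proof.
move=> ex ey I oI; apply: (grM_parity (b := false) (c := true)) => [J|J|].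
- by rewrite eqbF_neg negbK; exact: ex.
- by rewrite eqb_id; exact: ey.
- by rewrite addFb eqb_id.
Qed.
Lemma od_evM x y : is_odd x -> is_even y -> is_odd (x * y).
Proof.
move=> ex ey I oI; apply: (grM_parity (b := true) (c := false)) => [J|J|].
- by rewrite eqb_id; exact: ex.
- by rewrite eqbF_neg negbK; exact: ey.
- by rewrite addTb /= eqb_id.
Qed.
Lemma evX x n : is_even x -> is_even (x ^+ n).
Proof.
by move=> ex; elim: n => [|n IH]; rewrite ?expr0 ?exprS; [exact: ev1|exact: evM].
Qed.
Lemma ev_sum (T : Type) (s : seq T) (P : pred T) (F : T -> Lam) :
  (forall i, P i -> is_even (F i)) -> is_even (\sum_(i <- s | P i) F i).
Proof. by move=> h; elim/big_ind: _ => // [|x y]; [exact: ev0|exact: evD]. Qed.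
Lemma od_sum (T : Type) (s : seq T) (P : pred T) (F : T -> Lam) :
  (forall i, P i -> is_odd (F i)) -> is_odd (\sum_(i <- s | P i) F i).
Proof. by move=> h; elim/big_ind: _ => // [|x y]; [exact: od0|exact: odD]. Qed.
Lemma evMn x n : is_even x -> is_even (x *+ n).
Proof. by rewrite -scaler_nat; exact: evZ. Qed.
Lemma odMn x n : is_odd x -> is_odd (x *+ n).
Proof. by rewrite -scaler_nat; exact: odZ. Qed.

Lemma evp_add x y : is_even x -> is_odd y -> evp (x + y) = x.
Proof. by move=> ex oy; rewrite evpD even_evp // odd_evp // addr0. Qed.
Lemma odp_add x y : is_even x -> is_odd y -> odp (x + y) = y.
Proof. by move=> ex oy; rewrite odpD even_odp // odd_odp // add0r. Qed.
Lemma parity_uniq x x' y y' : is_even x -> is_even x' -> is_odd y -> is_odd y' ->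
  x + y = x' + y' -> x = x' /\ y = y'.
Proof.
move=> ex ex' oy oy' E; split; first by rewrite -(evp_add ex oy) E evp_add.
by rewrite -(odp_add ex oy) E odp_add.
Qed.

(** By disjointness each pair (i, j) is an inversion on exactly one of the two sides. *)
Lemma inversionsC J L : [disjoint J & L]%fset ->
  (inversions J L + inversions L J = #|` J| * #|` L|)%N.
Proof.
move=> dJL; rewrite /inversions [X in (_ + X)%N]exchange_big -big_split /=.
transitivity (\sum_(i <- J) #|` L|)%N; last first.
  by rewrite big_const_seq count_predT iter_addn_0 mulnC.
apply: eq_big_seq => i iJ; rewrite -big_split /=.
have -> : #|` L| = (\sum_(j <- L) 1)%N by rewrite sum1_size.
apply: eq_big_seq => j jL; case: ltngtP => // ij; move/fdisjointP: dJL => /(_ _ iJ).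
by rewrite -ij jL.
Qed.

Lemma perm_fpowersetD I : perm_eq (fpowerset I) [seq I `\` J | J <- fpowerset I].
Proof.
have DK J : J `<=` I -> I `\` (I `\` J) = J.
  by move=> sJI; apply: fsetDK.
apply: uniq_perm; first exact: fset_uniq.
  rewrite map_inj_in_uniq ?fset_uniq // => J J'.
  by rewrite !fpowersetE => sJ sJ' /(congr1 (fun K => I `\` K)); rewrite !DK.
move=> J; rewrite fpowersetE; apply/idP/mapP => [sJ|[J' _ ->]]; last exact: fsubsetDl.
by exists (I `\` J); rewrite ?DK // fpowersetE fsubsetDl.
Qed.

(** Taking complements inside I permutes the terms of the product, and [inversionsC] gives the sign
    of each term with factors of the right parities. *)
Lemma supercomm x y (b c : bool) :
  (forall I, odd #|` I| != b -> x I = 0) -> (forall I, odd #|` I| != c -> y I = 0) ->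
  x * y = (-1) ^+ (b && c) *: (y * x).
Proof.
move=> hx hy; apply: grP => I; rewrite grZE !grME mulr_sumr.
rewrite (perm_big _ (perm_fpowersetD I)) big_map; apply: eq_big_seq => J.
rewrite fpowersetE => sJI; have -> : I `\` (I `\` J) = J by exact: fsetDK.
have [hJ|/hy ->] := eqVneq (odd #|` J|) c; last by rewrite !(mul0r, mulr0).
have [hL|/hx ->] := eqVneq (odd #|` I `\` J|) b; last by rewrite !(mul0r, mulr0).
rewrite [RHS]mulrA [y J * _]mulrC; congr (_ * _); rewrite -exprD.
rewrite -[LHS]signr_odd -[RHS]signr_odd oddD oddb.
have d : [disjoint (I `\` J) & J]%fset.
  by apply/fdisjointP => i; rewrite in_fsetD => /andP[].
have := congr1 odd (inversionsC d); rewrite oddD oddM hJ hL => /esym ->.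
by rewrite addbK.
Qed.

Lemma evenC x y : is_even x -> x * y = y * x.
Proof.
move=> ex; rewrite -(evp_odp y) mulrDl mulrDr.
rewrite (@supercomm x (evp y) false false) ?expr0 ?scale1r; last 2 first.
- by move=> I; rewrite eqbF_neg negbK; exact: ex.
- by move=> I; rewrite eqbF_neg negbK; exact: evp_even.
rewrite (@supercomm x (odp y) false true) ?expr0 ?scale1r //.
- by move=> I; rewrite eqbF_neg negbK; exact: ex.
- by move=> I; rewrite eqb_id; exact: odp_odd.
Qed.
Lemma oddC x y : is_odd x -> is_odd y -> x * y = - (y * x).
Proof.
move=> ox oy; rewrite (@supercomm x y true true) ?expr1 ?scaleN1r //.
- by move=> I; rewrite eqb_id; exact: ox.
- by move=> I; rewrite eqb_id; exact: oy.
Qed.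
Lemma odd_sq x : is_odd x -> x * x = 0.
Proof.
move=> ox; have /eqP := oddC ox ox; rewrite -subr_eq0 opprK -mulr2n => /eqP h.
apply: grP => I; have := congr1 (fun z : Lam => z I) h; rewrite mulr2n grDE gr0E.
by move=> /eqP; rewrite -mulr2n mulrn_eq0 /= => /eqP.
Qed.

Lemma gconjM x y : gconj (x * y) = gconj x * gconj y.
Proof.
apply: grP => I; rewrite gconjE !grME mulr_sumr; apply: eq_big_seq => J.
rewrite fpowersetE => /odd_fsetD ->; rewrite !gconjE signr_addb; ring.
Qed.
Lemma gconjK : involutive (@gconj R).
Proof. by move=> x; apply: grP => I; rewrite !gconjE mulrA -expr2 sqrr_sign mul1r. Qed.
Lemma gconj_even x : is_even x -> gconj x = x.
Proof. by move=> ex; rewrite /gconj even_evp // even_odp // subr0. Qed.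
Lemma gconj_odd x : is_odd x -> gconj x = - x.
Proof. by move=> ex; rewrite /gconj odd_evp // odd_odp // sub0r. Qed.
Lemma evp_gconj x : evp (gconj x) = evp x.
Proof. by rewrite /gconj evp_add //; [exact: evp_even|exact/odN/odp_odd]. Qed.
Lemma odp_gconj x : odp (gconj x) = - odp x.
Proof. by rewrite /gconj odp_add //; [exact: evp_even|exact/odN/odp_odd]. Qed.
Lemma odd_swap x y : is_odd x -> y * x = x * gconj y.
Proof.
move=> ox; rewrite -{1}(evp_odp y) mulrDl /gconj mulrBr.
by rewrite (evenC _ (@evp_even y)) (oddC (@odp_odd y) ox).
Qed.

Lemma bodyD x y : body (x + y) = body x + body y. Proof. exact: grDE. Qed.
Lemma bodyN x : body (- x) = - body x. Proof. exact: grNE. Qed.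
Lemma bodyZ a x : body (a *: x) = a * body x. Proof. exact: grZE. Qed.
Lemma bodyA a : body (a%:A) = a. Proof. by rewrite /body grAE eqxx. Qed.
Lemma body0 : body (0 : Lam) = 0. Proof. exact: gr0E. Qed.
Lemma body1 : body (1 : Lam) = 1. Proof. by rewrite /body gr1E eqxx. Qed.
Lemma bodyM x y : body (x * y) = body x * body y.
Proof.
rewrite /body grME fpowerset0 big_seq_fset1 fsetD0 /inversions.
by rewrite big_seq_fset0 expr0 mul1r.
Qed.
Lemma bodyX x n : body (x ^+ n) = body x ^+ n.
Proof. by elim: n => [|n IH]; rewrite ?expr0 ?body1 // !exprS bodyM IH. Qed.
Lemma body_odd x : is_odd x -> body x = 0. Proof. by move=> ox; apply: ox; rewrite cardfs0. Qed.
Lemma body_evp p : body (evp p) = body p. Proof. by rewrite /body evpE cardfs0. Qed.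
Lemma body_odp p : body (odp p) = 0. Proof. exact/body_odd/odp_odd. Qed.
Lemma body_soul x : body (soul x) = 0. Proof. by rewrite bodyD bodyN bodyA subrr. Qed.
Lemma body_gconj x : body (gconj x) = body x.
Proof. by rewrite /body gconjE cardfs0 expr0 mul1r. Qed.
Lemma soulE x I : soul x I = if I == fset0 then 0 else x I.
Proof. by rewrite grBE grAE; case: eqP => [->|_]; rewrite ?subrr ?subr0. Qed.
Lemma even_soul x : is_even x -> is_even (soul x).
Proof. by move=> ex; apply: evB => //; exact: evA. Qed.
Lemma soul_body x : (body x)%:A + soul x = x. Proof. by rewrite addrC subrK. Qed.

End GrassmannAlgebra.

(** * Invertibility, fresh generators and weighted seminorms *)

Section GrassmannUnits.
Local Open Scope fset_scope.
Local Open Scope ring_scope.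
Variable R : realType.
Local Notation C := (cplx R).
Local Notation Lam := (grassmann C).
Implicit Types (x y p q w : Lam) (I J L : {fset nat}) (a : C).

Definition mono I : Lam := [fsfun J in [fset I] => 1].
Lemma monoE I J : mono I J = (J == I)%:R.
Proof. by rewrite fsfunE in_fset1; case: eqP. Qed.

Lemma mono_sum x : x = \sum_(I <- finsupp x) x I *: mono I.
Proof.
apply: grP => K; rewrite gr_sumE; case: finsuppP => [nK|Kx].
  rewrite big1_seq // => I /= Ix; rewrite grZE monoE; case: eqP => [E|_]; last by rewrite mulr0.
  by rewrite E Ix in nK.
rewrite (big_fsetD1 K) //= grZE monoE eqxx mulr1 big1_seq ?addr0 // => I /=.
by rewrite in_fsetD1 grZE monoE eq_sym => /andP[/negPf->]; rewrite mulr0.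
Qed.

Lemma mono_sq I : I != fset0 -> mono I * mono I = 0.
Proof.
move=> I0; apply: grP => K; rewrite grME gr0E big1_seq // => J /=.
rewrite !monoE; case: eqP => [->|_]; last by rewrite mul0r mulr0.
case: eqP => [E|_]; last by rewrite mulr0 mulr0.
case/fset0Pn: I0 => i iI; exfalso; move: (iI); rewrite -{1}E in_fsetD iI.
by rewrite andFb.
Qed.

Lemma mono_even I : ~~ odd #|` I| -> is_even (mono I).
Proof. by move=> eI J oJ; rewrite monoE; case: eqP => // E; rewrite E (negPf eI) in oJ. Qed.

(** The summands commute and have square zero, so no nonzero product has more than [size s]
    factors. *)
Lemma sum_sq0_nilp (T : eqType) (s : seq T) (F : T -> Lam) :
  (forall i, i \in s -> is_even (F i)) -> (forall i, i \in s -> F i * F i = 0) ->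
  (\sum_(i <- s) F i) ^+ (size s).+1 = 0.
Proof.
elim: s => [|i s IH] hF hs; first by rewrite big_nil expr1.
rewrite big_cons /=; set S := \sum_(_ <- _) _ in IH *.
have S0 : S ^+ (size s).+1 = 0.
  by apply: IH => j js; [apply: hF|apply: hs]; rewrite inE js orbT.
have Fi2 : F i ^+ 2 = 0 by rewrite expr2 hs // inE eqxx.
rewrite exprDn_comm; last by apply: evenC; apply: hF; rewrite inE eqxx.
rewrite big1 // => -[k hk] _ /=; have [mk|km] := leqP (size s).+1 k.
  by rewrite -(subnK mk) exprD S0 !mulr0 mul0rn.
have h2 : (2 <= (size s).+2 - k)%N by move: km; lia.
by rewrite -(subnK h2) exprD Fi2 mulr0 mul0r mul0rn.
Qed.

(** The soul is a sum over the nonempty monomials of w, all even and of square zero. *)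
Lemma soul_nilp w n : is_even w -> (#|` finsupp w| < n)%N -> soul w ^+ n = 0.
Proof.
move=> ew wn; pose F I := if I == fset0 then 0 else w I *: mono I.
have -> : soul w = \sum_(I <- finsupp w) F I.
  rewrite {1}[w]mono_sum /soul big_mkcond /= ; apply: grP => K; rewrite grBE grAE !gr_sumE.
  have [->|K0] := eqVneq K fset0.
    rewrite [X in _ - X](_ : _ = (\sum_(i <- finsupp w) w i *: mono i) fset0).
      by rewrite gr_sumE subrr big1 // => I _; rewrite /F; case: eqP => [_|I0];
        rewrite ?gr0E // grZE monoE; case: eqP => [E|_]; rewrite ?mulr0 //; case: I0.
    by rewrite -mono_sum.
  rewrite subr0; apply: eq_bigr => I _; rewrite /F; case: eqP => // ->.
  by rewrite gr0E grZE monoE (negPf K0) mulr0.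
rewrite -(subnK wn) exprD sum_sq0_nilp ?mulr0 // => I Iw; rewrite /F.
  case: eqP => [_|I0]; first exact: ev0.
  apply/evZ/mono_even; apply/negP => oI; move: Iw; rewrite mem_finsupp ew //.
  by rewrite eqxx.
case: eqP => [_|/eqP I0]; first by rewrite mul0r.
by rewrite -scalerAl -scalerAr mono_sq // !scaler0.
Qed.

(** The inverse is a finite geometric sum in the nilpotent soul, divided by a power of the body. *)
Lemma ev_unit w : is_even w -> body w != 0 -> w \is a GRing.unit.
Proof.
move=> ew b0; set N := (#|` finsupp w|).+1.
have sN : (- soul w) ^+ N = 0 by rewrite exprNn soul_nilp // mulr0.
have wE : w = (body w)%:A - (- soul w) by rewrite opprK soul_body.
have bsC : GRing.comm ((body w)%:A) (- soul w) by apply: evenC; exact: evA.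
have := subrXX_comm N bsC; rewrite sN subr0 -wE; set S := \sum_(_ < _) _ => hS.
have eS : is_even S.
  apply: ev_sum => i _; apply: evM; apply: evX; [exact: evA|exact/evN/even_soul].
have bN : (body w)%:A ^+ N = (body w ^+ N)%:A :> Lam by rewrite exprZn expr1n.
have wS : w * ((body w ^+ N)^-1 *: S) = 1.
  by rewrite -scalerAr -hS bN scalerA mulVf ?expf_neq0 // scale1r.
by apply/unitrP; exists ((body w ^+ N)^-1 *: S); split=> //; rewrite -evenC.
Qed.

Lemma ev_inv w : is_even w -> is_even w^-1.
Proof.
move=> ew; have [uw|nuw] := boolP (w \is a GRing.unit); last by rewrite invr_out.
have := mulrV uw; rewrite -{1}(evp_odp w^-1) mulrDr => h.
have [] := @parity_uniq _ (w * evp w^-1) 1 (w * odp w^-1) 0.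
- by apply: evM => //; exact: evp_even.
- exact: ev1.
- by apply: ev_odM => //; exact: odp_odd.
- exact: od0.
- by rewrite h addr0.
move=> h1 _; have -> : w^-1 = evp w^-1 by rewrite -[RHS](mulKr uw) h1 mulr1.
exact: evp_even.
Qed.

Lemma evVr w : is_even w -> body w != 0 -> w^-1 * w = 1.
Proof. by move=> ew b0; rewrite mulVr // ev_unit. Qed.
Lemma evrV w : is_even w -> body w != 0 -> w * w^-1 = 1.
Proof. by move=> ew b0; rewrite mulrV // ev_unit. Qed.

Lemma bodyV w : is_even w -> body w != 0 -> body w^-1 = (body w)^-1.
Proof.
move=> ew b0; apply: (mulfI b0); rewrite -bodyM evrV // body1.
by rewrite mulfV.
Qed.

Lemma evV_unique w y : is_even w -> w * y = 1 -> w^-1 = y.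
Proof.
move=> ew h; have b0 : body w != 0.
  by apply/eqP => b0; have /eqP := congr1 (@body R) h; rewrite bodyM b0 mul0r body1 eq_sym oner_eq0.
by rewrite -[w^-1]mulr1 -h mulrA evVr // mul1r.
Qed.

Definition zeta i : Lam := mono [fset i].
Lemma zeta_odd i : is_odd (zeta i).
Proof. by move=> J; rewrite /zeta monoE; case: eqP => // ->; rewrite cardfs1. Qed.

Definition gens x : {fset nat} := \bigcup_(I <- finsupp x) I.
Lemma gensP x I : x I != 0 -> I `<=` gens x.
Proof.
by move=> xI; apply: (@bigfcup_sup _ _ _ I xpredT id); rewrite ?mem_finsupp.
Qed.

Lemma zetaM i x I : i \notin gens x -> i \notin I ->
  (zeta i * x) (i |` I) = (-1) ^+ inversions [fset i] I * x I.
Proof.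
move=> ix iI; have iS : [fset i] \in fpowerset (i |` I) by rewrite fpowersetE fsub1set fset1U1.
have DI : (i |` I) `\` [fset i] = I by rewrite fsetDUl fsetDv fset0U; apply: mem_fsetD1.
rewrite grME (big_fsetD1 _ iS) /= monoE eqxx DI mul1r big1_seq ?addr0 // => J /=.
by rewrite in_fsetD1 monoE => /andP[/negPf-> _]; rewrite mul0r mulr0.
Qed.

(** This is the cancellation of an odd parameter: a generator that does not occur in x sends
    distinct monomials of x to distinct monomials, up to sign. *)
Lemma zeta_inj i x : i \notin gens x -> zeta i * x = 0 -> x = 0.
Proof.
move=> ix h; apply: grP => I; rewrite gr0E.
have [iI|iI] := boolP (i \in I).
  apply/eqP/negPn/negP => /gensP /fsubsetP /(_ _ iI); exact/negP.
have /eqP := congr1 (fun y : Lam => y (i |` I)) h; rewrite /= zetaM // gr0E.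
by rewrite mulf_eq0 signr_eq0 => /eqP.
Qed.

Lemma fresh (s : seq {fset nat}) : exists i, forall I, I \in s -> i \notin I.
Proof.
exists (\max_(j <- \bigcup_(I <- s) I) j).+1 => I Is; apply/negP => iI.
have : (\max_(j <- \bigcup_(I <- s) I) j).+1 \in \bigcup_(I <- s) I.
  by apply/bigfcupP; exists I; rewrite ?Is.
set m := \max_(j <- _) j => mI.
by have := @leq_bigmax_seq _ _ xpredT id _ mI isT; rewrite /= -/m ltnn.
Qed.

(** A weighted l^1 seminorm on the components inside I. It is submultiplicative, and it tends to the
    modulus of the body as lam tends to 0, so that an element with body in the open unit disc has
    seminorm less than 1 for some lam. *)
Definition gnorm (lam : R) I x : R := \sum_(J <- fpowerset I) cabs (x J) * lam ^+ #|` J|.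

Section Seminorm.
Variables (lam : R) (I : {fset nat}).
Hypothesis lam0 : 0 < lam.
Local Notation N := (gnorm lam I).

Lemma gnorm_ge0 x : 0 <= N x.
Proof. by apply: sumr_ge0 => J _; rewrite mulr_ge0 ?cabs_ge0 // exprn_ge0 // ltW. Qed.
Lemma gnorm_comp x J : J `<=` I -> cabs (x J) * lam ^+ #|` J| <= N x.
Proof.
move=> JI; rewrite /gnorm (big_fsetD1 J) ?fpowersetE //= lerDl sumr_ge0 // => L _.
by rewrite mulr_ge0 ?cabs_ge0 // exprn_ge0 // ltW.
Qed.
Lemma gnormD x y : N (x + y) <= N x + N y.
Proof.
rewrite -big_split /=; apply: ler_sum => J _; rewrite grDE -mulrDl ler_wpM2r ?cabsD //.
by rewrite exprn_ge0 // ltW.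
Qed.
Lemma gnormZ a x : N (a *: x) = cabs a * N x.
Proof. by rewrite /gnorm mulr_sumr; apply: eq_bigr => J _; rewrite grZE cabsM mulrA. Qed.
Lemma gnormN x : N (- x) = N x.
Proof. by rewrite -scaleN1r gnormZ cabsN cabs1 mul1r. Qed.
Lemma gnorm1 : N 1 = 1.
Proof.
rewrite /gnorm (big_fsetD1 fset0) ?fpowersetE ?fsub0set // gr1E eqxx cabs_nat.
rewrite cardfs0 /= mulr1.
rewrite big1_seq ?addr0 // => J /=; rewrite in_fsetD1 gr1E => /andP[/negPf-> _].
by rewrite cabs0 mul0r.
Qed.
Lemma gnormA a : N (a%:A) = cabs a.
Proof. by rewrite gnormZ gnorm1 mulr1. Qed.

(** The weight of K is the product of the weights of J and of its complement in K, and for fixed J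
    distinct K have distinct complements. *)
Lemma gnormM x y : N (x * y) <= N x * N y.
Proof.
pose F J L := (cabs (x J) * lam ^+ #|` J|) * (cabs (y L) * lam ^+ #|` L|).
have F0 J L : 0 <= F J L by rewrite !mulr_ge0 ?cabs_ge0 ?exprn_ge0 ?(ltW lam0).
set P := fpowerset I.
apply: (@le_trans _ _ (\sum_(K <- P) \sum_(J <- P | J `<=` K) F J (K `\` J))).
  rewrite /gnorm [leLHS]big_seq_cond [leRHS]big_seq_cond; apply: ler_sum => K.
  rewrite andbT fpowersetE => KI; rewrite grME.
  have -> : \sum_(J <- P | J `<=` K) F J (K `\` J) = \sum_(J <- fpowerset K) F J (K `\` J).
    rewrite -big_filter; apply: perm_big; apply: uniq_perm.
    - by rewrite filter_uniq // fset_uniq.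
    - exact: fset_uniq.
    - move=> J; rewrite mem_filter !fpowersetE andb_idr // => JK.
      exact: fsubset_trans JK KI.
  rewrite (le_trans (ler_wpM2r _ (cabs_sum _ _ _))) ?exprn_ge0 ?(ltW lam0) // mulr_suml.
  rewrite [leLHS]big_seq_cond [leRHS]big_seq_cond; apply: ler_sum => J.
  rewrite andbT fpowersetE => JK; rewrite !cabsM cabs_sign mul1r /F mulrACA -exprD.
  by rewrite cardfsDS // subnKC // fsubset_leq_card.
under eq_bigr do rewrite big_mkcond /=.
rewrite exchange_big /= /gnorm mulr_suml; apply: ler_sum => J _.
rewrite mulr_sumr -/(F J _) -big_mkcond /=.
rewrite -big_filter -(big_map (fun K => K `\` J) xpredT (F J)).
set s := map _ _.
have us : uniq s.
  rewrite map_inj_in_uniq ?filter_uniq ?fset_uniq // => K K'.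
  rewrite !mem_filter => /andP[JK _] /andP[JK' _] E.
  apply/fsetP => i; have [iJ|iJ] := boolP (i \in J).
    by rewrite (fsubsetP JK) // (fsubsetP JK').
  by have := congr1 (fun L : {fset nat} => i \in L) E; rewrite !in_fsetD iJ.
have sP L : L \in s -> L \in P.
  move=> /mapP[K]; rewrite mem_filter => /andP[_]; rewrite !fpowersetE => KI ->.
  by rewrite (fsubset_trans _ KI) // fsubsetDl.
have -> : \sum_(L <- s) F J L = \sum_(L <- P | L \in s) F J L.
  rewrite -[RHS]big_filter; apply: perm_big; apply: uniq_perm => //.
    by rewrite filter_uniq // fset_uniq.
  by move=> L; rewrite mem_filter andb_idr //; exact: sP.
rewrite [leRHS](bigID (fun L => L \in s)) /= lerDl sumr_ge0 // => L _.
exact: F0.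
Qed.

Lemma gnormX x n : N (x ^+ n) <= N x ^+ n.
Proof.
elim: n => [|n IH]; first by rewrite !expr0 gnorm1.
by rewrite !exprS (le_trans (gnormM _ _)) // ler_wpM2l // gnorm_ge0.
Qed.
End Seminorm.

End GrassmannUnits.

(** * Absolutely convergent series and reciprocal series in the Grassmann algebra *)

Section AbsSums.
Local Open Scope fset_scope.
Local Open Scope ring_scope.
Variable R : realType.
Local Notation C := (cplx R).
Local Notation Lam := (grassmann C).
Implicit Types (x y p q w s t : Lam) (I J L : {fset nat}) (a : C) (c d u v : nat -> Lam).

Lemma abs_sumP c s : abs_sum c s <-> forall I, csum (fun n => c n I : C) (s I).
Proof.
have E (f : nat -> C) : (series f : nat -> C) = (fun n => \sum_(i < n) f i).
  by apply/funext => n; rewrite /series /= big_mkord.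
have ns I n : [normed series (fun n => c n I : C)] n = ((\sum_(i < n) cabs (c i I))%:C)%C.
  by rewrite /normed_series_of /series /= big_mkord rmorph_sum.
split=> h I; have := h I.
  case=> /cvg_ex [/= l /ccvgP hl]; rewrite E => /ccvgP hs; split=> //.
  have [N hN] := hl 1 ltr01; exists (cabs l + 1) => n.
  apply: (@le_trans _ _ (\sum_(i < maxn n N) cabs (c i I))).
    by apply: (sum_ge_split (f := fun i => cabs (c i I))) => [k|]; rewrite ?cabs_ge0 ?leq_maxl.
  have := hN _ (leq_maxr n N); rewrite ns; set S := \sum_(_ < _) _.
  have S0 : 0 <= S by apply: sumr_ge0 => i _; exact: cabs_ge0.
  have := cabsD ((S%:C)%C - l) l; rewrite subrK cabs_real ger0_norm //; lra.
move=> [[M hM] hs]; split; last by rewrite E; apply/ccvgP.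
have [l hl] := real_sum_cvg (fun n => cabs_ge0 (c n I)) hM.
apply/cvg_ex; exists (l%:C)%C; apply/ccvgP => e e0; have [N hN] := hl e e0.
by exists N => n Nn; rewrite ns -rmorphB cabs_real; exact: hN.
Qed.

Lemma abs_sum_uniq c s t : abs_sum c s -> abs_sum c t -> s = t.
Proof.
by move=> /abs_sumP h /abs_sumP h'; apply: grP => I; apply: csum_uniq (h I) (h' I).
Qed.
Lemma eq_abs_sum c d s : c =1 d -> abs_sum c s -> abs_sum d s.
Proof. by move=> /funext ->. Qed.
Lemma abs_sumD c d s t : abs_sum c s -> abs_sum d t -> abs_sum (fun n => c n + d n) (s + t).
Proof.
move=> /abs_sumP h /abs_sumP h'; apply/abs_sumP => I; rewrite grDE.
by apply: eq_csum (csumD (h I) (h' I)) => n; rewrite grDE.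
Qed.
Lemma abs_sum_fin c N : (forall n, (N <= n)%N -> c n = 0) -> abs_sum c (\sum_(i < N) c i).
Proof.
move=> h; apply/abs_sumP => I; rewrite gr_sumE; apply: csum_fin => n /h ->.
exact: gr0E.
Qed.

Lemma abs_sumMl x c s : abs_sum c s -> abs_sum (fun n => x * c n) (x * s).
Proof.
move=> /abs_sumP h; apply/abs_sumP => I; rewrite grME.
have := @csum_sum R _ (fpowerset I) xpredT
  (fun J n => (-1) ^+ inversions J (I `\` J) * (x J * c n (I `\` J)))
  (fun J => (-1) ^+ inversions J (I `\` J) * (x J * s (I `\` J))).
move=> /(_ (fun J _ => csumZ _ (csumZ _ (h _)))).
by apply: eq_csum => n; rewrite grME.
Qed.
Lemma abs_sumZ a c s : abs_sum c s -> abs_sum (fun n => a *: c n) (a *: s).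
Proof.
move=> h; rewrite -[a *: s]mulr_algl; apply: eq_abs_sum (abs_sumMl _ h) => n.
by rewrite mulr_algl.
Qed.
Lemma abs_sum_lin (f : Lam -> Lam) (k : {fset nat} -> C) c s :
  (forall x I, f x I = k I * x I) -> abs_sum c s -> abs_sum (fun n => f (c n)) (f s).
Proof.
move=> fk /abs_sumP h; apply/abs_sumP => I; rewrite fk.
by apply: eq_csum (csumZ (k I) (h I)) => n; rewrite fk.
Qed.

Definition gconv (V : pzRingType) (u v : nat -> V) k : V := \sum_(i < k.+1) u i * v (k - i)%N.

Lemma gconv_comp u v n I : gconv u v n I =
  \sum_(J <- fpowerset I) (-1) ^+ inversions J (I `\` J) *
     conv (fun n => u n J) (fun n => v n (I `\` J)) n.
Proof.
rewrite gr_sumE; under eq_bigr do rewrite grME.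
by rewrite exchange_big; apply: eq_bigr => J _; rewrite -mulr_sumr.
Qed.

Lemma abs_sum_cauchy u v s t : abs_sum u s -> abs_sum v t -> abs_sum (gconv u v) (s * t).
Proof.
move=> /abs_sumP hu /abs_sumP hv; apply/abs_sumP => I; rewrite grME.
have := @csum_sum R _ (fpowerset I) xpredT
  (fun J n => (-1) ^+ inversions J (I `\` J) * conv (fun n => u n J) (fun n => v n (I `\` J)) n)
  (fun J => (-1) ^+ inversions J (I `\` J) * (s J * t (I `\` J))).
move=> /(_ (fun J _ => csumZ _ (csum_cauchy (hu J) (hv (I `\` J))))).
by apply: eq_csum => n; rewrite gconv_comp.
Qed.

Lemma gconv_poly (V : nzRingType) (u v : nat -> V) N n : (n < N)%N ->
  gconv u v n = ((\poly_(i < N) u i) * (\poly_(i < N) v i))`_n.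
Proof.
move=> nN; rewrite coefM; apply: eq_bigr => i _; rewrite !coef_poly.
by rewrite (leq_ltn_trans _ nN) ?(leq_ltn_trans (leq_subr _ _) nN) // -ltnS ltn_ord.
Qed.
(** Associativity is inherited from polynomials, after truncation above degree n. *)
Lemma gconvA (V : nzRingType) (u v w : nat -> V) n :
  gconv u (gconv v w) n = gconv (gconv u v) w n.
Proof.
pose P (u : nat -> V) : {poly V} := \poly_(i < n.+1) u i.
have PE (u' : nat -> V) i : (i <= n)%N -> (P u')`_i = u' i by move=> h; rewrite coef_poly ltnS h.
transitivity ((P u * (P v * P w))`_n).
  rewrite coefM; apply: eq_bigr => i _; rewrite PE ?(gconv_poly _ _ (N := n.+1)) //.
    by rewrite ltnS leq_subr.
  by rewrite -ltnS ltn_ord.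
rewrite mulrA coefM; apply: eq_bigr => i _; rewrite PE ?leq_subr //.
by rewrite (gconv_poly _ _ (ltn_ord i)).
Qed.

Lemma geom_small (A B : R) : 0 <= A -> 0 <= B ->
  exists2 r : R, 0 < r & forall t : R, 0 <= t -> t < r ->
    forall n, \sum_(i < n) A * B ^+ i * t ^+ i <= 2 * A.
Proof.
move=> A0 B0; exists (2 * (B + 1))^-1.
  by rewrite invr_gt0 mulr_gt0 // ltr_wpDl.
move=> t t0 tr n; under eq_bigr do rewrite -mulrA -exprMn.
rewrite -mulr_sumr mulrC ler_wpM2r //.
have Bt : B * t <= 2^-1.
  have : t * (2 * (B + 1)) < 1 by rewrite -ltr_pdivlMr ?div1r // mulr_gt0 // ltr_wpDl.
  nra.
have Bt0 : 0 <= B * t by rewrite mulr_ge0.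
apply: (@le_trans _ _ (\sum_(i < n) (2^-1 : R) ^+ i)).
  by apply: ler_sum => i _; rewrite lerXn2r ?nnegrE // invr_ge0.
have -> : \sum_(i < n) (2^-1 : R) ^+ i = 2 - 2 * 2^-1 ^+ n.
  elim: n => [|n IH]; first by rewrite big_ord0 expr0; ring.
  by rewrite big_ord_recr /= IH exprS; field.
by rewrite gerBl mulr_ge0 // exprn_ge0 // invr_ge0.
Qed.

(** The coefficients of the reciprocal power series; the recurrence refers to all the earlier ones,
    hence the list. *)
Fixpoint inv_list (V : unitRingType) (u : nat -> V) n : seq V :=
  if n is m.+1 then
    let l := inv_list u m in
    rcons l (- ((u 0%N)^-1 * \sum_(k < m.+1) u k.+1 * nth 0 l (m - k)))
  else [:: (u 0%N)^-1].
Definition inv_seq (V : unitRingType) (u : nat -> V) n := nth 0 (inv_list u n) n.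

Lemma size_inv_list (V : unitRingType) (u : nat -> V) n : size (inv_list u n) = n.+1.
Proof. by elim: n => //= n IH; rewrite size_rcons IH. Qed.
Lemma nth_inv_list (V : unitRingType) (u : nat -> V) m n : (n <= m)%N ->
  nth 0 (inv_list u m) n = inv_seq u n.
Proof.
elim: m => [|m IH]; first by rewrite leqn0 => /eqP->.
rewrite leq_eqVlt => /orP[/eqP->//|]; rewrite ltnS => nm.
by rewrite /= nth_rcons size_inv_list ltnS nm IH.
Qed.
Lemma inv_seqS (V : unitRingType) (u : nat -> V) m : inv_seq u m.+1 =
  - ((u 0%N)^-1 * \sum_(k < m.+1) u k.+1 * inv_seq u (m - k)).
Proof.
rewrite {1}/inv_seq /= nth_rcons size_inv_list ltnn eqxx; congr (- (_ * _)).
by apply: eq_bigr => k _; rewrite nth_inv_list // leq_subr.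
Qed.
Lemma gconv_inv (V : unitRingType) (u : nat -> V) n : u 0%N \is a GRing.unit ->
  gconv u (inv_seq u) n = (n == 0%N)%:R.
Proof.
move=> u0; case: n => [|n]; first by rewrite /gconv big_ord1 mulrV.
rewrite /gconv big_ord_recl subn0 inv_seqS mulrN mulrA mulrV // mul1r.
by rewrite addrC; apply/eqP; rewrite subr_eq0; apply/eqP/eq_bigr => k _; rewrite lift0.
Qed.

(** The ratio (M + 1) B closes the induction: the sum of M B^(n+1) (M + 1)^(n-i) over i <= n is
    geometric, equal to B^(n+1) ((M + 1)^(n+1) - 1). *)
Lemma inv_bound (b be : nat -> C) (M B : R) : b 0%N != 0 -> 0 <= M -> 0 <= B ->
  (forall n, conv b be n = (n == 0%N)%:R) ->
  (forall n, cabs (b n) <= cabs (b 0%N) * M * B ^+ n) ->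
  forall n, cabs (be n) <= (cabs (b 0%N))^-1 * ((M + 1) * B) ^+ n.
Proof.
move=> b0 M0 B0 hc hb; have cb0 : 0 < cabs (b 0%N) by rewrite cabs_gt0.
elim/ltn_ind => -[|n] IH.
  have := hc 0%N; rewrite /conv big_ord1 => h.
  by rewrite expr0 mulr1 -[be 0%N]mul1r -(mulVf b0) -mulrA h mulr1 cabsV.
have := hc n.+1; rewrite /conv big_ord_recl subn0 => h.
have -> : be n.+1 = - ((b 0%N)^-1 * \sum_(i < n.+1) b i.+1 * be (n - i)%N).
  apply: (mulfI b0); rewrite mulrN mulVKf //; apply/eqP; rewrite -addr_eq0 -[X in _ == X]h.
  by apply/eqP; congr (_ + _); apply: eq_bigr => i _; rewrite lift0.
rewrite cabsN cabsM cabsV ler_pM2l ?invr_gt0 //.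
apply: (@le_trans _ _ (\sum_(i < n.+1) M * B ^+ n.+1 * (M + 1) ^+ (n - i))).
  rewrite (le_trans (cabs_sum _ _ _)) // ler_sum // => i _; rewrite cabsM.
  have i_n : (i <= n)%N by rewrite -ltnS.
  apply: le_trans (ler_pM (cabs_ge0 _) (cabs_ge0 _) (hb _) (IH (n - i)%N _)) _.
    by rewrite ltnS leq_subr.
  have -> : B ^+ n.+1 = B ^+ i.+1 * B ^+ (n - i) by rewrite -exprD addSn subnKC.
  rewrite exprMn (_ : cabs (b 0%N) * M * _ * _ = M * (B ^+ i.+1 * B ^+ (n - i)) * (M + 1) ^+ (n - i)) //.
  by field; rewrite gt_eqF.
have -> : \sum_(i < n.+1) M * B ^+ n.+1 * (M + 1) ^+ (n - i) =
    B ^+ n.+1 * ((M + 1) ^+ n.+1 - 1).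
  rewrite -mulr_sumr subrX1 addrK mulrA [B ^+ _ * M]mulrC; congr (_ * _).
  rewrite (reindex_inj rev_ord_inj) /=; apply: eq_bigr => i _.
  by rewrite subSS subKn // -ltnS.
rewrite exprMn [leRHS]mulrC ler_wpM2l ?exprn_ge0 //; lra.
Qed.

End AbsSums.

(** * Superanalytic and superconformal functions *)

Section SuperAnalytic.
Local Open Scope fset_scope.
Local Open Scope ring_scope.
Variable R : realType.
Local Notation C := (cplx R).
Local Notation Lam := (grassmann C).
Implicit Types (x y p q w s : Lam) (I J L : {fset nat}) (a t z : C) (c d : jet R) (V : set C).

Lemma openP V : open V <->
  forall z, V z -> exists2 r : R, 0 < r & forall t, cabs t < r -> V (z + t).
Proof.
rewrite openE; split=> h z Vz.
  have /nbhs_ballP [e e0 he] := h z Vz.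
  have eR : e = (complex.Re e)%:C%C by rewrite RRe_real // gtr0_real.
  exists (complex.Re e) => [|t te]; first by rewrite -ltcR -eR.
  by apply: he; rewrite -ball_normE /ball_ /= opprD addrA subrr sub0r normrN eR cabs_lt.
have [r r0 hr] := h z Vz; apply/nbhs_ballP; exists (r%:C)%C; first by rewrite /= ltcR.
move=> t; rewrite -ball_normE /ball_ /= distrC cabs_lt => tr.
by rewrite -(subrK z t) addrC; exact: hr.
Qed.

Lemma analyticP V c : analytic_on V c <->
  forall z, V z -> exists2 r : R, 0 < r & forall t, cabs t < r ->
    V (z + t) /\ abs_sum (fun n => t ^+ n *: c z n) (c (z + t) 0%N).
Proof.
split=> h z Vz; have [r r0 hr] := h z Vz; exists r => // t tr.
  by have := hr (z + t); rewrite addrAC subrr add0r cabs_lt => /(_ tr).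
by rewrite cabs_lt in tr; have := hr _ tr; rewrite addrCA subrr addr0.
Qed.

Lemma analytic_open V c : analytic_on V c -> open V.
Proof.
move=> /analyticP h; apply/openP => z /h [r r0 hr]; exists r => // t /hr.
by case.
Qed.

Lemma analytic_sub V V' c : open V' -> (V' `<=` V)%classic -> analytic_on V c -> analytic_on V' c.
Proof.
move=> /openP oV' sV /analyticP h; apply/analyticP => z Vz.
have [r r0 hr] := oV' z Vz; have [r' r'0 hr'] := h z (sV z Vz).
exists (Num.min r r') => [|t]; first by rewrite lt_min r0.
by rewrite lt_min => /andP[/hr h1 /hr' [_ h2]].
Qed.

Definition jcst x : jet R := fun z n => if n is 0%N then x else 0.
Definition jid : jet R := fun z n => if n is 0%N then z%:A else if n is 1%N then 1 else 0.
Definition jlin (f : Lam -> Lam) c : jet R := fun z n => f (c z n).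
Definition jadd c d : jet R := fun z n => c z n + d z n.
Definition jmul c d : jet R := fun z n => gconv (c z) (d z) n.
Definition jinv c : jet R := fun z n => inv_seq (c z) n.

Lemma analytic_cst V x : open V -> analytic_on V (jcst x).
Proof.
move=> /openP oV; apply/analyticP => z /oV [r r0 hr]; exists r; first exact: r0.
move=> t /hr Vt; split; first exact: Vt.
have := @abs_sum_fin _ (fun n => t ^+ n *: jcst x z n) 1%N.
by rewrite big_ord1 expr0 scale1r; apply=> -[|n] //= _; rewrite scaler0.
Qed.

Lemma analytic_id V : open V -> analytic_on V jid.
Proof.
move=> /openP oV; apply/analyticP => z /oV [r r0 hr]; exists r; first exact: r0.
move=> t /hr Vt; split; first exact: Vt.
have := @abs_sum_fin _ (fun n => t ^+ n *: jid z n) 2%N.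
rewrite !big_ord_recl big_ord0 /= expr0 scale1r addr0 expr1 -scalerDl; apply.
by move=> [|[|n]] //= _; rewrite scaler0.
Qed.

Lemma analytic_lin V (f : Lam -> Lam) (k : {fset nat} -> C) c :
  (forall x I, f x I = k I * x I) -> analytic_on V c -> analytic_on V (jlin f c).
Proof.
move=> fk /analyticP h; apply/analyticP => z /h [r r0 hr]; exists r; first exact: r0.
move=> t /hr [Vt hs]; split; first exact: Vt.
apply: eq_abs_sum (abs_sum_lin fk hs) => n.
by apply: grP => I; rewrite fk !grZE fk mulrCA.
Qed.

Lemma analytic_add V c d : analytic_on V c -> analytic_on V d -> analytic_on V (jadd c d).
Proof.
move=> /analyticP h /analyticP h'; apply/analyticP => z Vz.
have [r r0 hr] := h z Vz; have [r' r'0 hr'] := h' z Vz.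
exists (Num.min r r') => [|t]; first by rewrite lt_min r0.
rewrite lt_min => /andP[/hr [Vt h1] /hr' [_ h2]]; split; first exact: Vt.
by apply: eq_abs_sum (abs_sumD h1 h2) => n; rewrite scalerDr.
Qed.

Lemma gconvZ t (u v : nat -> Lam) n :
  gconv (fun n => t ^+ n *: u n) (fun n => t ^+ n *: v n) n = t ^+ n *: gconv u v n.
Proof.
rewrite /gconv scaler_sumr; apply: eq_bigr => i _.
by rewrite -scalerAl -scalerAr scalerA -exprD subnKC // -ltnS.
Qed.

Lemma analytic_mul V c d : analytic_on V c -> analytic_on V d -> analytic_on V (jmul c d).
Proof.
move=> /analyticP h /analyticP h'; apply/analyticP => z Vz.
have [r r0 hr] := h z Vz; have [r' r'0 hr'] := h' z Vz.
exists (Num.min r r') => [|t]; first by rewrite lt_min r0.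
rewrite lt_min => /andP[/hr [Vt h1] /hr' [_ h2]]; split; first exact: Vt.
rewrite /jmul {2}/gconv big_ord1.
by apply: eq_abs_sum (abs_sum_cauchy h1 h2) => n; rewrite gconvZ.
Qed.

(** On bodies this is the reciprocal of a scalar series, whose convergence comes from [inv_bound].
    The other components are then forced by c * c^-1 = 1, and converge as Cauchy products of series
    already known to converge. *)
Lemma analytic_inv V c : (forall z, V z -> is_even (c z 0%N) /\ body (c z 0%N) != 0) ->
  analytic_on V c -> analytic_on V (jinv c).
Proof.
move=> hc /analyticP h; apply/analyticP => z Vz.
have [r r0 hr] := h z Vz; have [ec bc] := hc z Vz.
pose b n : C := c z n fset0; pose be n : C := inv_seq (c z) n fset0.
have hconv n : gconv (c z) (inv_seq (c z)) n = (n == 0%N)%:R.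
  by apply: gconv_inv; apply: ev_unit.
have hbe n : conv b be n = (n == 0%N)%:R.
  have := congr1 (fun x : Lam => x fset0) (hconv n).
  rewrite gconv_comp fpowerset0 big_seq_fset1 fsetD0 /inversions big_seq_fset0 expr0 mul1r.
  by move=> ->; case: n => [|n]; rewrite ?gr1E ?eqxx ?gr0E.
have hb : pseries b r (fun z => c z 0%N fset0) z.
  split=> // t /hr [_ /abs_sumP /(_ fset0)]; apply: eq_csum => n.
  by rewrite grZE mulrC.
have r2 : 0 < r / 2 by rewrite divr_gt0.
have [M M0 hM] := pseries_bound hb (ltW r2) (ltac:(lra) : r / 2 < r).
have b0 : 0 < cabs (b 0%N) by rewrite cabs_gt0.
have bbound n : cabs (b n) <= cabs (b 0%N) * (M / cabs (b 0%N)) * (r / 2)^-1 ^+ n.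
  rewrite mulrCA mulfV ?gt_eqF // mulr1 exprVn ler_pdivlMr ?exprn_gt0 //.
  rewrite (le_trans _ (hM n.+1)) // big_ord_recr /= lerDr sumr_ge0 // => i _.
  by rewrite mulr_ge0 ?cabs_ge0 // exprn_ge0 // ltW.
have r2V : 0 <= (r / 2)^-1 by rewrite invr_ge0 ltW.
have bebound := inv_bound bc (divr_ge0 M0 (ltW b0)) r2V hbe bbound.
set B := (_ * (r / 2)^-1) in bebound.
have B0 : 0 <= B by rewrite mulr_ge0 ?invr_ge0 ?(ltW r2) // addr_ge0 // divr_ge0 // ltW.
have bV : 0 <= (cabs (b 0%N))^-1 by rewrite invr_ge0 ltW.
have [r' r'0 hr'] := geom_small bV B0.
exists (Num.min r r') => [|t]; first by rewrite lt_min r0.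
rewrite lt_min => /andP[tr tr']; have [Vt hs] := hr t tr; split; first exact: Vt.
have [ect bct] := hc _ Vt; set ct := c (z + t) 0%N in ect bct hs *.
have -> : jinv c (z + t) 0%N = ct^-1 by [].
have [s hbes] : exists s : C, csum (fun n => be n * t ^+ n) s.
  apply: (csum_dom (a := fun n => (cabs (b 0%N))^-1 * B ^+ n * cabs t ^+ n)
    (M := 2 * (cabs (b 0%N))^-1)) => [n|].
    by rewrite cabsM cabsX ler_wpM2r ?exprn_ge0 ?cabs_ge0.
  by apply: hr' => //; exact: cabs_ge0.
have hbt := proj2 hb t tr.
have convt (u v : nat -> C) n :
    conv (fun n => u n * t ^+ n) (fun n => v n * t ^+ n) n = conv u v n * t ^+ n.
  rewrite /conv mulr_suml; apply: eq_bigr => i _; rewrite mulrACA -exprD subnKC //.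
  by rewrite -ltnS.
have bs : ct fset0 * s = 1.
  apply: csum_uniq (csum_cauchy hbt hbes) _.
  have := @csum_fin _ (fun n => conv b be n * t ^+ n) 1%N.
  rewrite big_ord1 hbe expr0 mulr1 => h1; apply: eq_csum (h1 _) => n; first by rewrite convt.
  by rewrite hbe; case: n => // n _; rewrite mul0r.
have ctV : ct * ct^-1 = 1 by apply: evrV.
have hsc I := proj1 (abs_sumP _ _) hs I.
(* Induction on the number of generators: in component I of the product, every nonempty J leaves a
   strictly smaller complement. *)
apply/abs_sumP => I; move: {2}(#|` I|).+1 (ltnSn #|` I|) => N.
elim: N I => // N IH I; rewrite ltnS => IN.
(* The right-hand side of the component equation once the terms with J nonempty have been moved
   there; component I of the inverse is its convolution with the scalar reciprocal [be]. *)
pose ee n : C := (1 *+ (n == 0%N) : Lam) I -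
  \sum_(J <- fpowerset I `\ fset0) (-1) ^+ inversions J (I `\` J) *
     conv (fun n => c z n J) (fun n => inv_seq (c z) n (I `\` J)) n.
have hee n : conv b (fun n => inv_seq (c z) n I) n = ee n.
  rewrite /ee -[1 *+ _]/((n == 0%N)%:R) -hconv gconv_comp (big_fsetD1 fset0) ?fpowersetE ?fsub0set //=.
  by rewrite fsetD0 addrK /inversions big_seq_fset0 expr0 mul1r.
have hcI n : inv_seq (c z) n I = conv be ee n.
  rewrite -[RHS]/(gconv (V := C) be ee n).
  have -> : gconv (V := C) be ee n = gconv (V := C) be (gconv (V := C) b (fun n => inv_seq (c z) n I)) n.
    by apply: eq_bigr => i _; rewrite -hee.
  rewrite gconvA /gconv (eq_bigr (fun i : 'I_n.+1 => (i == 0%N :> nat)%:R * inv_seq (c z) (n - i)%N I)).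
    by rewrite big_ord_recl mul1r subn0 big1 ?addr0 // => i _; rewrite mul0r.
  move=> i _; congr (_ * _); rewrite -[LHS]/(conv be b i) -hbe /conv.
  rewrite (reindex_inj rev_ord_inj) /=; apply: eq_bigr => j _.
  by rewrite subSS mulrC subKn // -ltnS.
have hcomp J : J \in fpowerset I `\ fset0 ->
    csum (fun n => inv_seq (c z) n (I `\` J) * t ^+ n) (ct^-1 (I `\` J)).
  rewrite in_fsetD1 fpowersetE => /andP[J0 JI].
  have lt : (#|` I `\` J| < N)%N.
    rewrite (leq_trans _ IN) // cardfsDS // ltn_subrL cardfs_gt0 J0 /=.
    by rewrite (leq_trans _ (fsubset_leq_card JI)) // cardfs_gt0.
  by apply: eq_csum (IH _ lt) => n; rewrite grZE mulrC.
pose E : C := (1 : Lam) I - \sum_(J <- fpowerset I `\ fset0) (-1) ^+ inversions J (I `\` J) *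
     (ct J * ct^-1 (I `\` J)).
have heet : csum (fun n => ee n * t ^+ n) E.
  have h1 : csum (fun n => (1 *+ (n == 0%N) : Lam) I * t ^+ n) ((1 : Lam) I).
    have := @csum_fin _ (fun n => (1 *+ (n == 0%N) : Lam) I * t ^+ n) 1%N.
    by rewrite big_ord1 expr0 mulr1; apply=> -[|n] // _; rewrite gr0E mul0r.
  have h2 : csum (fun n => \sum_(J <- fpowerset I `\ fset0) (-1) ^+ inversions J (I `\` J) *
     (conv (fun n => c z n J) (fun n => inv_seq (c z) n (I `\` J)) n * t ^+ n))
     (\sum_(J <- fpowerset I `\ fset0) (-1) ^+ inversions J (I `\` J) *
     (ct J * ct^-1 (I `\` J))).
    rewrite big_seq; under [X in csum X]funext => n do rewrite big_seq.
    apply: csum_sum => J JI; apply: csumZ.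
    have hJ : csum (fun n => c z n J * t ^+ n) (ct J).
      by apply: eq_csum (hsc J) => n; rewrite grZE mulrC.
    by apply: eq_csum (csum_cauchy hJ (hcomp J JI)) => n; rewrite convt.
  rewrite /E -mulN1r; apply: eq_csum (csumD h1 (csumZ (-1) h2)) => n.
  by rewrite mulN1r /ee mulrBl mulr_suml; congr (_ - _); apply: eq_bigr => J _; rewrite mulrA.
have -> : ct^-1 I = s * E.
  have := congr1 (fun x : Lam => x I) ctV; rewrite grME (big_fsetD1 fset0) ?fpowersetE ?fsub0set //=.
  rewrite fsetD0 /inversions big_seq_fset0 expr0 mul1r -/(inversions _ _) => /eqP.
  rewrite eq_sym -subr_eq => /eqP hE; rewrite /E hE mulrA [s * _]mulrC bs mul1r //.
by apply: eq_csum (csum_cauchy hbes heet) => n; rewrite convt -hcI grZE mulrC.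
Qed.

End SuperAnalytic.

(** * Normal forms of polynomials in even and odd elements *)

Section SuperNormal.
Variable R : realType.
Local Notation C := (cplx R).
Local Notation Lam := (grassmann C).
Implicit Types (x y z : Lam).

Inductive sexp :=
| Sev of nat | Sod of nat | S0 | S1 | Sadd of sexp & sexp | Smul of sexp & sexp | Sopp of sexp.

(* A monomial is a sign coefficient, a sorted list of even variables and a sorted
   list of odd variables. *)
Definition smono := (int * (seq nat * seq nat))%type.

Fixpoint ins (i : nat) (s : seq nat) :=
  if s is j :: s' then if (i <= j)%N then i :: s else j :: ins i s' else [:: i].
(** [None] means that an odd variable is repeated, hence that the product is zero; the boolean is
    the sign of the reordering. *)
Fixpoint oins (i : nat) (s : seq nat) : option (bool * seq nat) :=
  if s is j :: s' then
    if (i < j)%N then Some (false, i :: s)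
    else if i == j then None
    else if oins i s' is Some (b, s'') then Some (~~ b, j :: s'') else None
  else Some (false, [:: i]).
Fixpoint omul (s t : seq nat) : option (bool * seq nat) :=
  if s is i :: s' then
    if omul s' t is Some (b, u) then
      if oins i u is Some (b', v) then Some (b (+) b', v) else None
    else None
  else Some (false, t).
Definition mmul (m n : smono) : seq smono :=
  if omul m.2.2 n.2.2 is Some (b, os) then
    [:: ((if b then - (m.1 * n.1) else m.1 * n.1)%R, (foldr ins n.2.1 m.2.1, os))]
  else [::].
Fixpoint madd (m : smono) (p : seq smono) : seq smono :=
  if p is n :: p' then if m.2 == n.2 then ((m.1 + n.1)%R, n.2) :: p' else n :: madd m p'
  else [:: m].
Definition padd (p q : seq smono) := foldr madd q p.
Definition pmul (p q : seq smono) :=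
  foldr (fun m acc => foldr (fun n acc' => padd (mmul m n) acc') acc q) [::] p.
Fixpoint snorm (e : sexp) : seq smono :=
  match e with
  | Sev i => [:: (1, ([:: i], [::]))]
  | Sod i => [:: (1, ([::], [:: i]))]
  | S0 => [::]
  | S1 => [:: (1, ([::], [::]))]
  | Sadd a b => padd (snorm a) (snorm b)
  | Smul a b => pmul (snorm a) (snorm b)
  | Sopp a => map (fun m => (- m.1, m.2)) (snorm a)
  end.
(** Cancelled monomials remain in the normal form with coefficient 0, so equality is tested on
    coefficients and not by emptiness. *)
Definition scheck a b := all (fun m => m.1 == 0) (snorm (Sadd a (Sopp b))).

Variables ev od : seq Lam.
Fixpoint seval e : Lam :=
  match e with
  | Sev i => nth 0 ev i
  | Sod i => nth 0 od i
  | S0 => 0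
  | S1 => 1
  | Sadd a b => seval a + seval b
  | Smul a b => seval a * seval b
  | Sopp a => - seval a
  end.
Definition meval (m : smono) : Lam :=
  m.1%:~R * ((\prod_(i <- m.2.1) nth 0 ev i) * \prod_(i <- m.2.2) nth 0 od i).
Definition peval p : Lam := \sum_(m <- p) meval m.

Definition all_even := foldr (fun x P => is_even x /\ P) True.
Definition all_odd := foldr (fun x P => is_odd x /\ P) True.
Hypotheses (hev : all_even ev) (hod : all_odd od).

Lemma nth_ev i : is_even (nth 0 ev i).
Proof.
move: hev; elim: ev i => [|x s IH] i /=; first by rewrite nth_nil => _; exact: ev0.
by case: i => [|i] [hx hs]; [exact: hx | exact: IH].
Qed.
Lemma nth_od i : is_odd (nth 0 od i).
Proof.
move: hod; elim: od i => [|x s IH] i /=; first by rewrite nth_nil => _; exact: od0.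
by case: i => [|i] [hx hs]; [exact: hx | exact: IH].
Qed.
Lemma prod_ev s : is_even (\prod_(i <- s) nth 0 ev i).
Proof.
elim: s => [|i s IH]; first by rewrite big_nil; exact: ev1.
by rewrite big_cons; apply: evM => //; exact: nth_ev.
Qed.

Lemma insE i s : \prod_(j <- ins i s) nth 0 ev j = nth 0 ev i * \prod_(j <- s) nth 0 ev j.
Proof.
elim: s => [|j s IH] /=; first by rewrite !big_cons !big_nil.
case: ifP => _; first by rewrite big_cons.
by rewrite !big_cons IH !mulrA (evenC _ (nth_ev j)).
Qed.
Lemma oinsE i s : nth 0 od i * \prod_(j <- s) nth 0 od j =
  if oins i s is Some (b, u) then (-1) ^+ b * \prod_(j <- u) nth 0 od j else 0.
Proof.
elim: s => [|j s IH] /=; first by rewrite !big_cons !big_nil expr0 mul1r.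
case: ifP => _; first by rewrite expr0 mul1r !big_cons.
case: eqP => [->|_]; first by rewrite big_cons mulrA odd_sq ?mul0r //; exact: nth_od.
rewrite big_cons mulrA (oddC (nth_od i) (nth_od j)) mulNr -mulrA IH.
case: oins => [[b u]|]; last by rewrite mulr0 oppr0.
by rewrite big_cons signrN mulNr mulrA mulrA; congr (- (_ * _)); rewrite commr_sign.
Qed.
Lemma omulE s t : (\prod_(j <- s) nth 0 od j) * (\prod_(j <- t) nth 0 od j) =
  if omul s t is Some (b, u) then (-1) ^+ b * \prod_(j <- u) nth 0 od j else 0.
Proof.
elim: s => [|i s IH] /=; first by rewrite big_nil expr0 !mul1r.
rewrite big_cons -mulrA IH; case: omul => [[b u]|]; last by rewrite mulr0.
rewrite mulrA commr_sign -mulrA oinsE; case: oins => [[b' v]|]; last by rewrite mulr0.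
by rewrite mulrA signr_addb.
Qed.
Lemma mmulE m n : meval m * meval n = peval (mmul m n).
Proof.
case: m => c [es os]; case: n => c' [es' os']; rewrite /meval /mmul /=.
have intC (z : int) y : y * z%:~R = z%:~R * y by rewrite -[RHS]mulrzl mulrzr mulrzl mulrzl || rewrite mulrzr mulrzl.
set E := \prod_(i <- es) _; set E' := \prod_(i <- es') _.
set P := \prod_(i <- os) _; set P' := \prod_(i <- os') _.
have EE : E * E' = \prod_(i <- foldr ins es' es) nth 0 ev i.
  rewrite /E; elim: (es) => [|i s IH] /=; first by rewrite big_nil mul1r.
  by rewrite big_cons insE -mulrA IH.
have -> : c%:~R * (E * P) * (c'%:~R * (E' * P')) = (c * c')%:~R * (E * E' * (P * P')).
  rewrite -mulrA (mulrA (E * P)) intC intrM -!mulrA; congr (_ * (_ * _)).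
  by rewrite !mulrA; congr (_ * _); rewrite -!mulrA; congr (_ * _); rewrite (evenC _ (prod_ev es')).
rewrite EE omulE; case: omul => [[[] os'']|]; rewrite /peval ?big_nil ?mulr0 //;
  rewrite big_cons big_nil addr0 /meval /=.
  by rewrite expr1 mulN1r !mulrN mulrNz mulNr.
by rewrite expr0 mul1r.
Qed.
Lemma maddE m p : peval (madd m p) = meval m + peval p.
Proof.
rewrite /peval; elim: p => [|n p IH] /=; first by rewrite !big_cons big_nil.
case: eqP => [E|_]; last by rewrite !big_cons IH addrCA.
by rewrite !big_cons addrA; congr (_ + _); rewrite /meval /= E intrD mulrDl.
Qed.
Lemma paddE p q : peval (padd p q) = peval p + peval q.
Proof.
elim: p => [|m p IH] /=; first by rewrite {2}/peval big_nil add0r.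
by rewrite maddE IH /peval big_cons addrA.
Qed.
Lemma pmulE p q : peval (pmul p q) = peval p * peval q.
Proof.
elim: p => [|m p IH] /=; first by rewrite /peval !big_nil mul0r.
rewrite [peval (m :: p)]/peval big_cons -/(peval p) mulrDl -IH.
move: (pmul p q) => acc {IH}; elim: q => [|n q IHq] /=; first by rewrite /peval big_nil mulr0 add0r.
by rewrite paddE IHq -mmulE addrA -mulrDr /peval big_cons.
Qed.
Lemma snormE e : seval e = peval (snorm e).
Proof.
elim: e => [i|i|||a IHa b IHb|a IHa b IHb|a IHa] /=.
- by rewrite /peval big_cons big_nil addr0 /meval /= big_cons !big_nil mul1r !mulr1.
- by rewrite /peval big_cons big_nil addr0 /meval /= big_cons !big_nil !mul1r mulr1.
- by rewrite /peval big_nil.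
- by rewrite /peval big_cons big_nil addr0 /meval /= !big_nil !mul1r.
- by rewrite paddE IHa IHb.
- by rewrite pmulE IHa IHb.
- by rewrite IHa /peval big_map -sumrN; apply: eq_bigr => m _; rewrite /meval /= mulrNz mulNr.
Qed.
Lemma scheckP a b : scheck a b -> seval a = seval b.
Proof.
move=> /allP h; apply/eqP; rewrite -subr_eq0; apply/eqP.
rewrite -[LHS]/(seval (Sadd a (Sopp b))) snormE /peval big1_seq // => m /= /h /eqP E.
by rewrite /meval E mul0r.
Qed.

End SuperNormal.

Ltac sparity := repeat first [assumption | exact I | apply: odp_odd | apply: evp_even | split].
Ltac sindex x l :=
  lazymatch l with
  | x :: _ => constr:(0%N)
  | _ :: ?l' => let n := sindex x l' in constr:(S n)
  end.
Ltac sreify ods evs t :=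
  lazymatch t with
  | (?a + ?b)%R => let a' := sreify ods evs a in let b' := sreify ods evs b in constr:(Sadd a' b')
  | (?a * ?b)%R => let a' := sreify ods evs a in let b' := sreify ods evs b in constr:(Smul a' b')
  | (- ?a)%R => let a' := sreify ods evs a in constr:(Sopp a')
  | (?a *+ 2)%R => let a' := sreify ods evs a in constr:(Sadd a' a')
  | (?a ^+ 2)%R => let a' := sreify ods evs a in constr:(Smul a' a')
  | 0%R => constr:(S0)
  | 1%R => constr:(S1)
  | _ => match constr:(tt) with
         | _ => let i := sindex t ods in constr:(Sod i)
         | _ => let j := sindex t evs in constr:(Sev j)
         end
  end.
(* Decides identities between polynomials in odd and even elements of the
   Grassmann algebra. *)
Ltac super ods evs :=
  lazymatch goal with
  | |- ?a = ?b =>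
    let a' := sreify ods evs a in let b' := sreify ods evs b in
    refine (@scheckP _ evs ods _ _ a' b' _); [sparity | sparity | vm_compute; reflexivity]
  end.
Ltac gr_lin := apply: grP => ?; rewrite ?(grDE, grNE, grZE, gr0E); ring.

(** * Taylor expansions, superanalytic functions and the superconformal condition *)

Section SuperFunctions.
Variable R : realType.
Local Notation C := (cplx R).
Local Notation Lam := (grassmann C).
Implicit Types (x y p q w s : Lam) (I J L : {fset nat}) (a t z : C) (c d : jet R) (V : set C).

Lemma taylorE c w N : is_even w -> (#|` finsupp w|%fset < N)%N ->
  taylor c w = \sum_(n < N) c (body w) n * soul w ^+ n.
Proof.
move=> ew wN; rewrite /taylor; set F := fun n => c (body w) n * soul w ^+ n.
rewrite -(big_mkord xpredT F) -[RHS](big_mkord xpredT F).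
rewrite [RHS](big_cat_nat (n := (#|` finsupp w|%fset).+1)) //=.
rewrite [X in _ + X]big1_seq ?addr0 // => i /=; rewrite mem_index_iota => /andP[wi _].
by rewrite /F soul_nilp // mulr0.
Qed.

Lemma taylor_cst x w : is_even w -> taylor (jcst x) w = x.
Proof.
move=> ew; rewrite (taylorE _ ew (ltnSn _)) big_ord_recl /= mulr1 big1 ?addr0 // => i _.
by rewrite mul0r.
Qed.
Lemma taylor_id w : is_even w -> taylor (@jid R) w = w.
Proof.
move=> ew; rewrite (taylorE _ ew (leqnSn _)) !big_ord_recl /= mulr1 mul1r expr1.
by rewrite big1 ?addr0 ?soul_body // => i _; rewrite mul0r.
Qed.
Lemma taylor_add c d w : is_even w -> taylor (jadd c d) w = taylor c w + taylor d w.
Proof.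
move=> ew; rewrite !(taylorE _ ew (ltnSn _)) -big_split; apply: eq_bigr => i _.
by rewrite /jadd mulrDl.
Qed.
Lemma taylor_evp c w : is_even w -> taylor (jlin (@evp R) c) w = evp (taylor c w).
Proof.
move=> ew; rewrite !(taylorE _ ew (ltnSn _)).
elim: (_.+1) => [|n IH]; first by rewrite !big_ord0 even_evp //; exact: ev0.
rewrite !big_ord_recr /= evpD IH; congr (_ + _); rewrite /jlin.
set s := soul w ^+ n; have es : is_even s by apply/evX/even_soul.
rewrite -{2}[c (body w) n]evp_odp mulrDl evp_add //.
  by apply: evM => //; exact: evp_even.
by apply: od_evM => //; exact: odp_odd.
Qed.
Lemma taylor_odp c w : is_even w -> taylor (jlin (@odp R) c) w = odp (taylor c w).
Proof.
move=> ew; rewrite /odp -taylor_evp // !(taylorE _ ew (ltnSn _)) -sumrB.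
by apply: eq_bigr => i _; rewrite -mulrBl.
Qed.
Lemma taylor_mul c d w : is_even w -> taylor (jmul c d) w = taylor c w * taylor d w.
Proof.
move=> ew; set N := (#|` finsupp w|%fset).+1; set s := soul w.
pose P (u : nat -> Lam) : {poly Lam} := \poly_(i < N) u i.
have PE u : (P u).[s] = \sum_(n < N) u n * s ^+ n by rewrite horner_poly.
have cs x : GRing.comm x s by apply/esym/evenC/even_soul.
rewrite !(taylorE _ ew (ltnSn _)) -/N -/s -!PE -hornerM_comm; last exact/esym/cs.
rewrite (horner_coef_wide s (n := N + N)); last first.
  by rewrite (leq_trans (size_polyMleq _ _)) // (leq_trans (leq_pred _)) // leq_add ?size_poly.
rewrite big_split_ord /= [X in _ + X]big1 ?addr0 => [|i _].
  rewrite PE; apply: eq_bigr => i _; congr (_ * _); exact: gconv_poly.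
by rewrite soul_nilp ?mulr0 // /N; lia.
Qed.
Lemma taylor_inv c w : is_even w -> (is_even (c (body w) 0%N)) -> body (c (body w) 0%N) != 0 ->
  is_even (taylor c w) -> taylor (jinv c) w = (taylor c w)^-1.
Proof.
move=> ew ec bc et; apply/esym/evV_unique => //.
rewrite -taylor_mul // -[RHS](taylor_cst 1 ew) !(taylorE _ ew (ltnSn _)).
apply: eq_bigr => i _; rewrite /jmul gconv_inv ?ev_unit //.
by case: (i : nat).
Qed.

Lemma body_taylor c w : is_even w -> body (taylor c w) = body (c (body w) 0%N).
Proof.
move=> ew; rewrite (taylorE _ ew (ltnSn _)) big_ord_recl expr0 mulr1 bodyD -[RHS]addr0.
congr (_ + _); elim/big_ind: _ => [|x y hx hy|i _]; first exact: body0.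
  by rewrite bodyD hx hy addr0.
by rewrite lift0 bodyM bodyX body_soul expr0n mulr0.
Qed.

Lemma exprD_sq0 x y n : is_even x -> is_even y -> y * y = 0 ->
  (x + y) ^+ n.+1 = x ^+ n.+1 + x ^+ n * y *+ n.+1.
Proof.
move=> ex ey yy; have C1 : x * y = y * x by exact: evenC.
elim: n => [|n IH]; first by rewrite !expr1 expr0 mul1r mulr1n.
rewrite exprSr IH mulrDl !mulrDr -exprSr -addrA; congr (_ + _).
rewrite mulrnAl -mulrA -C1 mulrA -exprSr mulrnAl -mulrA yy mulr0 mul0rn addr0.
by rewrite -mulrS.
Qed.

(** The expansion is exact at first order because y has square zero, as for a product of two odd
    parameters. *)
Lemma taylor_shift c w y : is_even w -> is_even y -> body y = 0 -> y * y = 0 ->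
  taylor c (w + y) = taylor c w + taylor (djet c) w * y.
Proof.
move=> ew ey by0 yy.
pose wy : Lam := w + y; have ewy : is_even wy by exact: evD.
set M := (maxn (#|` finsupp w|%fset) (#|` finsupp wy|%fset)).+1.
have wM : (#|` finsupp w|%fset < M)%N by rewrite ltnS leq_maxl.
have wM' : (#|` finsupp w|%fset < M.+1)%N by rewrite ltnW.
have wyM : (#|` finsupp wy|%fset < M.+1)%N by rewrite !ltnS leqW // leq_maxr.
rewrite -/wy; have bE : body wy = body w by rewrite bodyD by0 addr0.
have sE : soul wy = soul w + y by rewrite /soul bE addrAC.
rewrite (taylorE _ ewy wyM) (taylorE _ ew wM') (taylorE _ ew wM) bE sE; move: M {wM wM' wyM} => M.
rewrite big_ord_recl [X in _ = X + _]big_ord_recl !expr0 -[RHS]addrA; congr (_ + _).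
rewrite mulr_suml -big_split; apply: eq_bigr => i _.
rewrite !lift0 exprD_sq0 //; last exact: even_soul.
by rewrite mulrDr /djet; congr (_ + _); rewrite mulrnAr !mulrnAl mulrA.
Qed.

Opaque analytic_on.
(** Superanalytic functions. No parity is imposed on the jets, so that the class is closed under
    sums, products and parity parts; [SA_parity] recovers the four functions of the superconformal
    normal form. *)
Definition SA V (phi : Lam -> Lam) := exists f g : jet R,
  [/\ analytic_on V f, analytic_on V g
    & forall p, V (body p) -> phi p = taylor f (evp p) + odp p * taylor g (evp p)].

Lemma SA_open V phi : SA V phi -> open V.
Proof. by move=> [f [g [/analytic_open]]]. Qed.
Lemma SA_ext V phi psi : (forall p, V (body p) -> phi p = psi p) -> SA V phi -> SA V psi.
Proof. by move=> h [f [g [hf hg H]]]; exists f, g; split=> // p Vp; rewrite -h // H. Qed.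
Lemma SA_sub V V' phi : open V' -> V' `<=` V -> SA V phi -> SA V' phi.
Proof.
move=> oV sV [f [g [hf hg H]]]; exists f, g; split.
- exact: analytic_sub hf.
- exact: analytic_sub hg.
- by move=> p /sV /H.
Qed.
Lemma SA_cst V x : open V -> SA V (fun=> x).
Proof.
move=> oV; exists (jcst x), (jcst 0); split; [exact: analytic_cst|exact: analytic_cst|].
by move=> p _; rewrite !taylor_cst ?mulr0 ?addr0 //; exact: evp_even.
Qed.
Lemma SA_evp_id V : open V -> SA V (@evp R).
Proof.
move=> oV; exists (@jid R), (jcst 0); split; [exact: analytic_id|exact: analytic_cst|].
by move=> p _; rewrite taylor_id ?taylor_cst ?mulr0 ?addr0 //; exact: evp_even.
Qed.
Lemma SA_odp_id V : open V -> SA V (@odp R).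
Proof.
move=> oV; exists (jcst 0), (jcst 1); split; [exact: analytic_cst|exact: analytic_cst|].
by move=> p _; rewrite !taylor_cst ?mulr1 ?add0r //; exact: evp_even.
Qed.
Lemma SA_add V phi psi : SA V phi -> SA V psi -> SA V (fun p => phi p + psi p).
Proof.
move=> [f [g [hf hg H]]] [f' [g' [hf' hg' H']]]; exists (jadd f f'), (jadd g g').
split; [exact: analytic_add|exact: analytic_add|] => p Vp.
by rewrite !taylor_add ?H ?H' // ?mulrDr; [rewrite addrACA|exact: evp_even|exact: evp_even].
Qed.
Lemma SA_id V : open V -> SA V id.
Proof.
move=> oV; apply: SA_ext (SA_add (SA_evp_id oV) (SA_odp_id oV)) => p _.
exact: evp_odp.
Qed.

Lemma gconj_lin x I : gconj x I = (fun I => (-1) ^+ odd #|` I|%fset) I * x I.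
Proof. exact: gconjE. Qed.
Lemma evp_lin x I : evp x I = (fun I => (~~ odd #|` I|%fset)%:R : C) I * x I.
Proof. by rewrite evpE; case: odd; rewrite ?mul0r ?mul1r. Qed.
Lemma odp_lin x I : odp x I = (fun I => (odd #|` I|%fset)%:R : C) I * x I.
Proof. by rewrite odpE; case: odd; rewrite ?mul0r ?mul1r. Qed.

Lemma taylor_gconj c w : is_even w -> taylor (jlin (@gconj R) c) w = gconj (taylor c w).
Proof.
move=> ew; rewrite {2}/gconj -taylor_evp // -taylor_odp // !(taylorE _ ew (ltnSn _)) -sumrB.
by apply: eq_bigr => i _; rewrite -mulrBl.
Qed.

Lemma SA_mul V phi psi : SA V phi -> SA V psi -> SA V (fun p => phi p * psi p).
Proof.
move=> [f [g [hf hg H]]] [f' [g' [hf' hg' H']]].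
exists (jmul f f'), (jadd (jmul (jlin (@gconj R) f) g') (jmul g f')); split.
- exact: analytic_mul hf hf'.
- exact: analytic_add (analytic_mul (analytic_lin gconj_lin hf) hg') (analytic_mul hg hf').
move=> p Vp; have ew := @evp_even R p; have orho := @odp_odd R p.
rewrite taylor_add // !taylor_mul // taylor_gconj // H // H' //.
set F := taylor f _; set G := taylor g _; set F' := taylor f' _; set G' := taylor g' _.
set r := odp p in orho *.
have gF : F * r = r * gconj F by apply: odd_swap.
have gG : G * r = r * gconj G by apply: odd_swap.
rewrite mulrDl !mulrDr -addrA; congr (_ + _); rewrite !mulrA gF; congr (_ + _).
by rewrite -(mulrA r G r) gG !mulrA odd_sq // !mul0r addr0.
Qed.
Lemma SA_scale V a phi : SA V phi -> SA V (fun p => a *: phi p).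
Proof.
move=> h; apply: SA_ext (SA_mul (SA_cst (a%:A) (SA_open h)) h) => p _.
by rewrite mulr_algl.
Qed.
Lemma SA_opp V phi : SA V phi -> SA V (fun p => - phi p).
Proof. by move=> h; apply: SA_ext (SA_scale (-1) h) => p _; rewrite scaleN1r. Qed.
Lemma SA_sub2 V phi psi : SA V phi -> SA V psi -> SA V (fun p => phi p - psi p).
Proof. by move=> h h'; apply: SA_add => //; exact: SA_opp. Qed.

Lemma SA_evp V phi : SA V phi -> SA V (fun p => evp (phi p)).
Proof.
move=> [f [g [hf hg H]]]; exists (jlin (@evp R) f), (jlin (@odp R) g); split.
- exact: analytic_lin evp_lin hf.
- exact: analytic_lin odp_lin hg.
move=> p Vp; have ew := @evp_even R p; rewrite taylor_evp // taylor_odp // H // evpD.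
set G := taylor g _; have o1 : is_odd (odp p * evp G) by apply: od_evM; [exact: odp_odd|exact: evp_even].
have e1 : is_even (odp p * odp G) by apply: odM; exact: odp_odd.
by rewrite -{1}(evp_odp G) mulrDr evpD (odd_evp o1) add0r (even_evp e1).
Qed.
Lemma SA_odp V phi : SA V phi -> SA V (fun p => odp (phi p)).
Proof. by move=> h; apply: SA_sub2 => //; exact: SA_evp. Qed.
Lemma SA_gconj V phi : SA V phi -> SA V (fun p => gconj (phi p)).
Proof. by move=> h; apply: SA_sub2; [exact: SA_evp|exact: SA_odp]. Qed.

Lemma SA_parity V phi : SA V phi -> exists f xi psi g : jet R,
  [/\ [/\ analytic_on V f, analytic_on V xi, analytic_on V psi & analytic_on V g],
      forall z n, [/\ is_even (f z n), is_odd (xi z n), is_odd (psi z n) & is_even (g z n)]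
    & forall p, V (body p) -> let w := evp p in
      evp (phi p) = taylor f w + odp p * taylor xi w /\
      odp (phi p) = taylor psi w + odp p * taylor g w].
Proof.
move=> [f [g [hf hg H]]].
exists (jlin (@evp R) f), (jlin (@odp R) g), (jlin (@odp R) f), (jlin (@evp R) g); split.
- by split; [exact: analytic_lin evp_lin hf|exact: analytic_lin odp_lin hg|
    exact: analytic_lin odp_lin hf|exact: analytic_lin evp_lin hg].
- by move=> z n; split; [exact: evp_even|exact: odp_odd|exact: odp_odd|exact: evp_even].
move=> p Vp w; have ew := @evp_even R p; have orho := @odp_odd R p.
rewrite !taylor_evp // !taylor_odp // H // -/w.
set F := taylor f w; set G := taylor g w.
rewrite -{1 3}(evp_odp F) -{1 3}(evp_odp G) mulrDr.
have -> : evp F + odp F + (odp p * evp G + odp p * odp G) =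
  (evp F + odp p * odp G) + (odp F + odp p * evp G).
  by gr_lin.
have e1 : is_even (evp F + odp p * odp G).
  by apply: evD; [exact: evp_even|apply: odM => //; exact: odp_odd].
have o1 : is_odd (odp F + odp p * evp G).
  by apply: odD; [exact: odp_odd|apply: od_evM => //; exact: evp_even].
by rewrite evp_add // odp_add.
Qed.

Lemma taylor_parity c w (b : bool) :
  (forall n, if b then is_odd (c (body w) n) else is_even (c (body w) n)) ->
  is_even w -> if b then is_odd (taylor c w) else is_even (taylor c w).
Proof.
case: b => h ew; rewrite (taylorE _ ew (ltnSn _)).
  by apply: od_sum => i _; apply: od_evM => //; apply/evX/even_soul.
by apply: ev_sum => i _; apply: evM => //; apply/evX/even_soul.
Qed.

(** With r the odd variable, the reciprocal of F + r X is F^-1 - r X F^-2, since r has square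
    zero. *)
Lemma SA_inv V phi : SA V phi ->
  (forall p, V (body p) -> is_even (phi p) /\ body (phi p) != 0) ->
  SA V (fun p => (phi p)^-1).
Proof.
move=> h hphi; have [f [xi [psi [g [[hf hxi _ _] hpar H]]]]] := SA_parity h.
have bf z : V z -> body (f z 0%N) != 0.
  move=> Vz; have Vz' : V (body (z%:A : Lam)) by rewrite bodyA.
  have [ep] := hphi _ Vz'; have [] := H _ Vz'; rewrite even_evp // => -> _.
  have eA : is_even (evp (z%:A : Lam)) by exact: evp_even.
  by rewrite bodyD bodyM body_odp mul0r addr0 body_taylor // body_evp bodyA.
have anf : analytic_on V (jinv f).
  by apply: analytic_inv => // z /bf bz; split=> //; case: (hpar z 0%N).
exists (jinv f), (jlin (fun x => (-1 : C) *: x) (jmul xi (jmul (jinv f) (jinv f)))).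
split; first exact: anf.
  apply: (@analytic_lin _ _ _ (fun=> -1)) => [x I|]; first exact: grZE.
  exact: analytic_mul hxi (analytic_mul anf anf).
move=> p Vp; have ew := @evp_even R p; have orho := @odp_odd R p.
have [ep bp] := hphi p Vp; have [] := H p Vp; rewrite even_evp // => pE _.
set w := evp p in ew pE *; have bw : body w = body p by exact: body_evp.
have fev : is_even (taylor f w) by apply: (taylor_parity (b := false)) => // n; case: (hpar (body w) n).
have xod : is_odd (taylor xi w) by apply: (taylor_parity (b := true)) => // n; case: (hpar (body w) n).
have b0 : body (f (body w) 0%N) != 0 by rewrite bw; exact: bf.
have e0 : is_even (f (body w) 0%N) by case: (hpar (body w) 0%N).
have bF : body (taylor f w) != 0 by rewrite body_taylor.
have -> : taylor (jlin (fun x => (-1 : C) *: x) (jmul xi (jmul (jinv f) (jinv f)))) w =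
    - (taylor xi w * ((taylor f w)^-1 * (taylor f w)^-1)).
  rewrite -!(taylor_inv ew e0 b0 fev) -!taylor_mul // !(taylorE _ ew (ltnSn _)) -sumrN.
  by apply: eq_bigr => i _; rewrite /jlin scaleN1r mulNr.
rewrite taylor_inv //; apply: evV_unique => //; rewrite pE.
have Fg := evrV fev bF; have eg := ev_inv fev.
move: (taylor f w) (taylor f w)^-1 (taylor xi w) (odp p) fev xod orho Fg eg {pE bF} => F G X r.
move=> fev xod orho Fg eg.
transitivity (F * G - (F * G - 1) * G * r * X); last by rewrite Fg subrr !mul0r subr0.
super [:: r; X] [:: F; G].
Qed.

(* Superconformal maps are those that preserve the relation that the even part
   of the displacement s_p(q) vanishes. *)
Definition sc_rel p q := evp q - evp p = odp q * odp p.
Definition sc_preserving V (H : Lam -> Lam) :=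
  forall p q, V (body p) -> V (body q) -> sc_rel p q -> sc_rel (H p) (H q).

Lemma gens_fresh (s : seq Lam) : exists i, forall x, x \in s -> i \notin gens x.
Proof.
have [i hi] := fresh [seq gens x | x <- s]; exists i => x xs.
by apply: hi; apply/mapP; exists x.
Qed.

(** Preservation of [sc_rel], tested on pairs of points depending on two odd parameters, yields both
    differential equations. Injectivity serves for the nondegeneracy of g + rho psi' only. *)
Lemma SA_superconformal V H : V !=set0 -> SA V H -> sc_preserving V H ->
  (forall p q, V (body p) -> V (body q) -> H p = H q -> p = q) -> superconformal V H.
Proof.
move=> [z0 Vz0] hSA hsc hinj.
have [f [xi [psi [g [[hf hxi hpsi hg] hpar HE]]]]] := SA_parity hSA.
have rel w : is_even w -> V (body w) -> 
    taylor xi w = taylor g w * taylor psi w /\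
    taylor (djet f) w = taylor g w ^+ 2 + taylor (djet psi) w * taylor psi w.
  move=> ew Vw.
  have Fev : is_even (taylor f w) by apply: (taylor_parity (b := false)) => // n; case: (hpar (body w) n).
  have Xod : is_odd (taylor xi w) by apply: (taylor_parity (b := true)) => // n; case: (hpar (body w) n).
  have Pod : is_odd (taylor psi w) by apply: (taylor_parity (b := true)) => // n; case: (hpar (body w) n).
  have Gev : is_even (taylor g w) by apply: (taylor_parity (b := false)) => // n; case: (hpar (body w) n).
  have F'ev : is_even (taylor (djet f) w).
    by apply: (taylor_parity (b := false)) => // n; apply: evMn; case: (hpar (body w) n.+1).
  have P'od : is_odd (taylor (djet psi) w).
    by apply: (taylor_parity (b := true)) => // n; apply: odMn; case: (hpar (body w) n.+1).
  set F := taylor f w in Fev *; set X := taylor xi w in Xod *; set P := taylor psi w in Pod *.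
  set G := taylor g w in Gev *; set F' := taylor (djet f) w in F'ev *.
  set P' := taylor (djet psi) w in P'od *.
  have main r e : is_odd r -> is_odd e ->
      e * (r * F' + X) = e * (G * P + r * (P' * P + G * G)).
    (* These points are related: their even parts differ by e r, which is (r + e) r as r has square
       zero. *)
    move=> orr oe; pose p := w + r; pose q := (w + e * r) + (r + e).
    have eer : is_even (e * r) by exact: odM.
    have ber : body (e * r) = 0 by rewrite bodyM body_odd // mul0r.
    have pe : evp p = w by rewrite evp_add.
    have po : odp p = r by rewrite odp_add.
    have qe : evp q = w + e * r by rewrite evp_add //; [exact: evD|exact: odD].
    have qo : odp q = r + e by rewrite odp_add //; [exact: evD|exact: odD].
    have Vp : V (body p) by rewrite bodyD (body_odd orr) addr0.
    have Vq : V (body q) by rewrite !bodyD ber (body_odd orr) (body_odd oe) !addr0.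
    have rr : r * r = 0 by exact: odd_sq.
    have ee : e * e = 0 by exact: odd_sq.
    have re : r * e = - (e * r) by exact: oddC.
    have erer : (e * r) * (e * r) = 0 by rewrite mulrA -(mulrA e r e) re mulrN mulrA ee mul0r oppr0 mul0r.
    have ts c : taylor c (w + e * r) = taylor c w + e * r * taylor (djet c) w.
      by rewrite taylor_shift // -(evenC _ eer).
    have /= := hsc p q Vp Vq; rewrite /sc_rel.
    have [-> ->] := HE p Vp; have [-> ->] := HE q Vq.
    rewrite pe po qe qo !ts -/F -/X -/P -/G -/F' -/P'.
    have k1 y : (r + e) * (e * r * y) = 0.
      by rewrite mulrDl !mulrA re ee !mul0r addr0 mulNr -mulrA rr mulr0 oppr0 mul0r.
    rewrite !mulrDr !k1 !addr0 => h.
    have {h} := h (ltac:(by rewrite addrAC subrr add0r mulrDl rr add0r)).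
    move=> h; transitivity (F + e * r * F' + ((r + e) * X) - (F + r * X)).
      by super [:: e; r; X; P; P'] [:: G; F; F'].
    by rewrite h; super [:: e; r; X; P; P'] [:: G; F; F'].
  have XE : X = G * P.
    (* At r = 0 the identity [main] becomes e X = e G P, and a fresh generator for e is cancelled.
       With both parameters fresh, the terms in e r then give the equation for F'. *)
    have [i /(_ (X - G * P))] := gens_fresh [:: X - G * P].
    rewrite mem_head => /(_ isT) hi; apply/eqP; rewrite -subr_eq0; apply/eqP.
    apply: (zeta_inj hi); have := main 0 (zeta R i) (@od0 R) (@zeta_odd R i).
    by rewrite !mul0r add0r addr0 mulrBr => ->; rewrite subrr.
  split=> //; have [i /(_ (F' - (G * G + P' * P)))] := gens_fresh [:: F' - (G * G + P' * P)].
  rewrite mem_head => /(_ isT) hi; apply/eqP; rewrite -subr_eq0 expr2; apply/eqP.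
  apply: (zeta_inj hi); set y := zeta R i * _; have [j /(_ y)] := gens_fresh [:: y].
  rewrite mem_head => /(_ isT) hj; apply: (zeta_inj hj).
  have := main (zeta R i) (zeta R j) (@zeta_odd R i) (@zeta_odd R j).
  rewrite XE mulrDr [in RHS]mulrDr addrC => /addrI; rewrite /y => h.
  by rewrite mulrBr [in X in _ - X]addrC mulrBr h subrr.
exists f, xi, psi, g; split=> //.
- move=> p Vp /=; have [pe po] := HE p Vp; rewrite -[LHS]evp_odp pe po.
  by [].
- move=> w ew Vw; have [h1 h2] := rel w ew Vw; split=> //.
  have Pod : is_odd (taylor psi w) by apply: (taylor_parity (b := true)) => // n; case: (hpar (body w) n).
  have P'od : is_odd (taylor (djet psi) w).
    by apply: (taylor_parity (b := true)) => // n; apply: odMn; case: (hpar (body w) n.+1).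
  by rewrite h2 -addrA (oddC P'od Pod) addNr addr0.
- have eA := @evA R z0; exists (z0%:A); split; first by rewrite bodyA.
  rewrite (even_evp eA) (even_odp eA) mul0r addr0; apply/eqP => g0.
  have Vz : V (body (z0%:A : Lam)) by rewrite bodyA.
  have [xi0 _] := rel _ eA Vz; rewrite g0 mul0r in xi0.
  (* If g vanished at z0 so would xi = g psi, and the points z0 and z0 + zeta_0 would have the same
     image. *)
  have oz := @zeta_odd R 0; pose q : Lam := z0%:A + zeta R 0.
  have Vq : V (body q) by rewrite bodyD bodyA (body_odd oz) addr0.
  have : (z0%:A : Lam) = q.
    apply: hinj => //; rewrite -[LHS]evp_odp -[RHS]evp_odp.
    have [-> ->] := HE _ Vz; have [-> ->] := HE _ Vq.
    by rewrite (even_evp eA) (even_odp eA) (evp_add eA oz) (odp_add eA oz) xi0 g0 !mul0r !mulr0.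
  move=> /eqP; rewrite -[X in X == _]addr0 /q (inj_eq (addrI _)) => /eqP h0.
  have : (zeta R 0 : Lam) [fset 0%N]%fset = 0 by rewrite -h0 gr0E.
  by rewrite /zeta monoE eqxx => /eqP; rewrite oner_eq0.
Qed.

End SuperFunctions.

(** * Analytic paths *)

Section Paths.
Variable R : realType.
Local Notation C := (cplx R).
Local Notation Lam := (grassmann C).
Implicit Types (x y p q w s : Lam) (I J L : {fset nat}) (a t z : C) (c d : jet R) (V : set C).
Implicit Types (ga de : C -> Lam).

(** A germ at t = 0, analytic in each component. Continuity and identity-theorem arguments for
    functions on the algebra are made along such paths, where they are statements about one complex
    variable. *)
Definition anpath ga := forall I, an (fun t => ga t I) 0.

Lemma anpath_near ga de (r : R) : 0 < r -> (forall t, cabs t < r -> ga t = de t) ->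
  anpath ga -> anpath de.
Proof.
move=> r0 h hg I; apply: an_near r0 _ (hg I) => t tr.
by rewrite !add0r h.
Qed.
Lemma anpath_cst x : anpath (fun=> x). Proof. by move=> I; exact: an_cst. Qed.
Lemma anpathD ga de : anpath ga -> anpath de -> anpath (fun t => ga t + de t).
Proof.
move=> h h' I; apply: (an_near ltr01 _ (anD (h I) (h' I))) => t _.
by rewrite grDE.
Qed.
Lemma anpath_lin (f : Lam -> Lam) (k : {fset nat} -> C) ga :
  (forall x I, f x I = k I * x I) -> anpath ga -> anpath (fun t => f (ga t)).
Proof.
move=> fk h I; apply: (an_near ltr01 _ (anM (an_cst (k I) 0) (h I))) => t _.
by rewrite fk.
Qed.
Lemma anpath_evp ga : anpath ga -> anpath (fun t => evp (ga t)).
Proof. exact: (anpath_lin (@evp_lin R)). Qed.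
Lemma anpath_odp ga : anpath ga -> anpath (fun t => odp (ga t)).
Proof. exact: (anpath_lin (@odp_lin R)). Qed.
Lemma anpathN ga : anpath ga -> anpath (fun t => - ga t).
Proof. by apply: (anpath_lin (k := fun=> -1)) => x I; rewrite grNE mulN1r. Qed.
Lemma anpathB ga de : anpath ga -> anpath de -> anpath (fun t => ga t - de t).
Proof. by move=> h h'; apply: anpathD => //; exact: anpathN. Qed.
Lemma anpathM ga de : anpath ga -> anpath de -> anpath (fun t => ga t * de t).
Proof.
move=> h h' I.
have := @an_sum R _ (fpowerset I) xpredT
  (fun J t => (-1) ^+ inversions J (I `\` J)%fset * (ga t J * de t (I `\` J)%fset)) 0.
move=> /(_ (fun J _ => anM (an_cst _ _) (anM (h J) (h' _)))) h1.
by apply: (an_near ltr01 _ h1) => t _; rewrite grME.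
Qed.
Lemma anpathX ga n : anpath ga -> anpath (fun t => ga t ^+ n).
Proof.
move=> h; elim: n => [|n IH].
  by under eq_fun do rewrite expr0; exact: anpath_cst.
by under eq_fun do rewrite exprS; exact: anpathM.
Qed.
Lemma anpath_scalar (h : C -> C) : an h 0 -> anpath (fun t => (h t)%:A).
Proof.
move=> hh I; apply: (an_near ltr01 _ (anM hh (an_cst ((1 : Lam) I) 0))) => t _.
by rewrite grZE.
Qed.
Lemma anpath_id : anpath (fun t => t%:A). Proof. exact: anpath_scalar (an_id 0). Qed.

Lemma anpath_body ga : anpath ga -> an (fun t => body (ga t)) 0.
Proof. by move=> h; exact: h. Qed.

Lemma anpath_in V ga : open V -> anpath ga -> V (body (ga 0)) ->
  exists2 r : R, 0 < r & forall t, cabs t < r -> V (body (ga t)).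
Proof.
move=> /openP oV h /oV [e e0 he]; have [d d0 hd] := an_cont (anpath_body h) e0.
exists d => // t /hd; rewrite add0r => /he.
by rewrite addrCA subrr addr0.
Qed.

Lemma nilp_comp s n J : body s = 0 -> (#|` J|%fset < n)%N -> (s ^+ n) J = 0.
Proof.
move=> bs; elim: n J => // n IH J; rewrite ltnS => Jn.
rewrite exprS grME big1_seq // => L /=; rewrite fpowersetE => LJ.
have [->|L0] := eqVneq L fset0; first by rewrite -/(body s) bs mul0r mulr0.
rewrite IH ?mulr0 // (leq_trans _ Jn) // cardfsDS // ltn_subrL cardfs_gt0 L0 /=.
by rewrite (leq_trans _ (fsubset_leq_card LJ)) // cardfs_gt0.
Qed.

(** The number of terms depends on I only, whereas the one in [taylor] depends on the support of w,
    which varies along a path. *)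
Lemma taylor_comp c w I : is_even w ->
  taylor c w I = \sum_(n < #|` I|%fset.+1) (c (body w) n * soul w ^+ n) I.
Proof.
move=> ew; set N := maxn (#|` finsupp w|%fset).+1 (#|` I|%fset).+1.
rewrite (taylorE c ew (N := N)) ?leq_maxl // gr_sumE.
pose F n := (c (body w) n * soul w ^+ n) I.
rewrite -(big_mkord xpredT F) -[RHS](big_mkord xpredT F).
rewrite (big_cat_nat (n := #|` I|%fset.+1)) ?leq_maxr //= [X in _ + X]big1_seq ?addr0 // => n /=.
rewrite mem_index_iota => /andP[In _]; rewrite /F grME big1_seq // => J /=.
rewrite fpowersetE => JI; rewrite nilp_comp ?mulr0 ?body_soul //.
by rewrite (leq_ltn_trans _ In) // fsubset_leq_card // fsubsetDl.
Qed.

Lemma anpath_taylor V c ga : analytic_on V c -> anpath ga -> (forall t, is_even (ga t)) ->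
  V (body (ga 0)) -> anpath (fun t => taylor c (ga t)).
Proof.
move=> hc hg eg V0 I.
have hjet n : anpath (fun t => c (body (ga t)) n).
  move=> J; apply: (an_comp (h := fun z => c z n J) (g := fun t => body (ga t))).
    exact: anpath_body.
  apply: (jet_an (V := V) (c := fun z n => c z n J)) => // z /(proj1 (analyticP V c) hc).
  move=> [r r0 hr]; exists r => // t /hr [Vt /abs_sumP /(_ J) hs]; split=> //.
  by apply: eq_csum hs => k; rewrite grZE mulrC.
have hsoul : anpath (fun t => soul (ga t)).
  by apply: anpathB => //; apply: anpath_scalar; exact: anpath_body.
have := @an_sum R _ (index_enum 'I_(#|` I|%fset.+1)) xpredT
  (fun n t => (c (body (ga t)) n * soul (ga t) ^+ n) I) 0.
move=> /(_ (fun n _ => anpathM (hjet n) (anpathX n hsoul) I)) h1.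
by apply: (an_near ltr01 _ h1) => t _; rewrite taylor_comp.
Qed.

Lemma SA_anpath V (phi : Lam -> Lam) ga : SA V phi -> anpath ga -> V (body (ga 0)) ->
  anpath (fun t => phi (ga t)).
Proof.
move=> h hg V0; have oV := SA_open h; have [f [g [hf hgg H]]] := h.
have [r r0 hr] := anpath_in oV hg V0.
apply: (anpath_near (ga := fun t => taylor f (evp (ga t)) + odp (ga t) * taylor g (evp (ga t))) r0).
  by move=> t /hr /H.
have V0' : V (body (evp (ga 0))) by rewrite body_evp.
have e t : is_even (evp (ga t)) by exact: evp_even.
apply: anpathD; first exact: anpath_taylor hf (anpath_evp hg) e V0'.
apply: anpathM; first exact: anpath_odp.
exact: anpath_taylor hgg (anpath_evp hg) e V0'.
Qed.

Lemma superconformal_SA V H : superconformal V H -> SA V H.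
Proof.
move=> [f [xi [psi [g [[hf hxi hpsi hg] _ HE _ _]]]]].
exists (jadd f psi), (jadd xi g); split; [exact: analytic_add|exact: analytic_add|].
move=> p /HE /= ->; have ew := @evp_even R p.
by rewrite !taylor_add // mulrDr addrACA.
Qed.

Lemma anpath_small ga lam I : anpath ga -> ga 0 = 0 ->
  exists2 K : R, 0 <= K & exists2 r : R, 0 < r & forall t, cabs t < r ->
    gnorm lam I (ga t) <= K * cabs t.
Proof.
move=> hg g0.
suff h (s : seq {fset nat}) : exists2 K : R, 0 <= K & exists2 r : R, 0 < r & forall t, cabs t < r ->
    \sum_(J <- s) cabs (ga t J) * lam ^+ #|` J|%fset <= K * cabs t.
  exact: h.
elim: s => [|J s [K K0 [r r0 hr]]].
  by exists 0 => //; exists 1 => // t _; rewrite big_nil mul0r.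
have [a [r' ha]] := hg J; have [M M0 hM] := pseries_rem 1 ha.
have r'0 : 0 < r' by case: ha.
exists (M * `|lam| ^+ #|` J|%fset + K); first by rewrite addr_ge0 ?mulr_ge0 ?exprn_ge0.
exists (Num.min r (r' / 2)) => [|t]; first by rewrite lt_min r0 divr_gt0.
rewrite lt_min => /andP[tr tr']; rewrite big_cons mulrDl lerD ?hr //.
have := hM t (ltW tr'); rewrite big_ord1 expr0 mulr1 -(pseries0 ha) /= add0r g0 gr0E subr0 expr1.
rewrite mulrAC => h1; apply: (@le_trans _ _ (cabs (ga t J) * `|lam| ^+ #|` J|%fset)).
  by rewrite ler_wpM2l ?cabs_ge0 // -normrX ler_norm.
by rewrite ler_wpM2r // exprn_ge0.
Qed.

End Paths.

(** * Flows with odd time *)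

Section Flow.
Variable R : realType.
Local Notation C := (cplx R).
Local Notation Lam := (grassmann C).
Implicit Types (x y p q w e th : Lam) (V : set C) (k l m : Lam -> Lam).

(* The time e flow of the odd superconformal vector field with even part of the
   displacement - phi k + 2 th l and odd part k + th phi m, where m = l'. *)
Definition flow e th k l m p : Lam :=
  let x := evp p in let phi := odp p in
  (x - e * phi * k x + (e * th * l x) *+ 2) + (phi + e * k x + e * th * phi * m x).

(** An algebraic substitute for the differentiability of k, l, m with l' = m: expansions with even
    cofactors. They are applied to nilpotent increments y - x, and they reduce all identities on
    flows to polynomial ones, decided by [super]. *)
Definition flow_data V k l m := forall x y, is_even x -> is_even y -> V (body x) ->
  body y = body x ->
  [/\ is_even (k x), is_even (l x), is_even (m x)
   & [/\ exists2 a, is_even a & k y = k x + (y - x) * a,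
         exists2 a, is_even a & l y = l x + (y - x) * m x + (y - x) * (y - x) * a
       & exists2 a, is_even a & m y = m x + (y - x) * a]].

Variables (e th : Lam).
Hypotheses (oe : is_odd e) (oth : is_odd th).

Lemma odd_mid x : e * x * e = 0.
Proof. by rewrite -mulrA (odd_swap x oe) mulrA odd_sq // mul0r. Qed.

Lemma flow_parts V k l m p : flow_data V k l m -> V (body p) ->
  evp (flow e th k l m p) = evp p - e * odp p * k (evp p) + (e * th * l (evp p)) *+ 2 /\
  odp (flow e th k l m p) = odp p + e * k (evp p) + e * th * odp p * m (evp p).
Proof.
move=> hf Vp; have ew := @evp_even R p; have op := @odp_odd R p.
have Vw : V (body (evp p)) by rewrite body_evp.
have [ek el em _] := hf _ _ ew ew Vw erefl.
have h1 : is_even (evp p - e * odp p * k (evp p) + (e * th * l (evp p)) *+ 2).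
  apply: evD; last by apply/evMn/evM => //; exact: odM.
  by apply: evB => //; apply: evM => //; exact: odM.
have h2 : is_odd (odp p + e * k (evp p) + e * th * odp p * m (evp p)).
  apply: odD; first by apply: odD => //; exact: od_evM.
  by apply: od_evM => //; apply: ev_odM => //; exact: odM.
by rewrite /flow evp_add // odp_add.
Qed.

Lemma flow_body V k l m p : flow_data V k l m -> V (body p) ->
  body (flow e th k l m p) = body p.
Proof.
move=> hf Vp; have [h _] := flow_parts hf Vp; rewrite -body_evp h mulr2n.
by rewrite !(bodyD, bodyN, bodyM) (body_odd oe) !mul0r subr0 !addr0 body_evp.
Qed.

Lemma flow_sc V k l m : flow_data V k l m -> sc_preserving V (flow e th k l m).
Proof.
move=> hf p q Vp Vq; rewrite /sc_rel.
have [-> ->] := flow_parts hf Vp; have [-> ->] := flow_parts hf Vq.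
have ex := @evp_even R p; have ey := @evp_even R q.
have of1 := @odp_odd R p; have of2 := @odp_odd R q.
move: (evp p) (evp q) (odp p) (odp q) (body_evp p) (body_evp q) ex ey of1 of2.
move=> x y f1 f2 bx byy ex ey of1 of2 rel.
have yE : y = x + f2 * f1 by rewrite -rel addrC subrK.
have Vx : V (body x) by rewrite bx.
have bxy : body y = body x by rewrite yE bodyD bodyM (body_odd of1) mulr0 addr0.
have [ek el em [[a ea ka] [b eb lb] [c ec mc]]] := hf x y ex ey Vx bxy.
have nn : f2 * f1 * (f2 * f1) = 0.
  by rewrite mulrA -(mulrA f2 f1 f2) (oddC of1 of2) mulrN mulrA odd_sq // mul0r oppr0 mul0r.
rewrite ka lb mc rel nn mul0r addr0.
set kx := k x in ek *; set lx := l x in el *; set mx := m x in em *.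
rewrite yE; super [:: e; th; f2; f1] [:: a; c; mx; lx; kx; x].
Qed.

Lemma flow_inv V k l m p : flow_data V k l m -> V (body p) ->
  flow (- e) th k l m (flow e th k l m p) = p.
Proof.
move=> hf Vp; have [pe po] := flow_parts hf Vp.
have ex := @evp_even R p; have op := @odp_odd R p.
have Vx : V (body (evp p)) by rewrite body_evp.
have ey := @evp_even R (flow e th k l m p).
have bxy : body (evp (flow e th k l m p)) = body (evp p).
  by rewrite !body_evp (flow_body hf Vp).
have [ek el em [[a ea ka] [b eb lb] [c ec mc]]] := hf _ _ ex ey Vx bxy.
rewrite {1}/flow ka lb mc pe po -[RHS]evp_odp.
move: (evp p) (odp p) ex op (k (evp p)) ek (l (evp p)) el (m (evp p)) em {hf Vp pe po Vx ey bxy ka lb mc}.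
move=> x f ex of' kx ek lx el mx em.
super [:: e; th; f] [:: a; b; c; kx; lx; mx; x].
Qed.

End Flow.

(** * The vector fields of the sewing at finite points and at infinity *)

Section FlowFunctions.
Variable R : realType.
Local Notation C := (cplx R).
Local Notation Lam := (grassmann C).
Implicit Types (x y z : Lam) (V : set C).

(** Reasoning modulo a relation p = q: c is the cofactor that certifies that a - b is a multiple of
    p - q, and what remains is a polynomial identity. *)
Lemma mod_eq (a b p q c : Lam) : p = q -> a = b + (p - q) * c -> a = b.
Proof. by move=> -> ->; rewrite subrr mul0r addr0. Qed.

(** The pole 1 / (x - z) is the generator of the transition map, and the constant 1 / z is added so
    that the field vanishes at 0, which keeps the puncture there. *)
Definition hfin z x : Lam := z^-1 + (x - z)^-1.
Definition hfin' z x : Lam := - ((x - z)^-1 * (x - z)^-1).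

(** The resolvent identity, from which the cofactors demanded by [flow_data] are derived. *)
Lemma invB z x y : is_even z -> is_even x -> is_even y -> body x != body z -> body y != body z ->
  (y - z)^-1 = (x - z)^-1 - (y - x) * ((x - z)^-1 * (y - z)^-1).
Proof.
move=> ez ex ey bx byz.
have exz : is_even (x - z) by exact: evB.
have eyz : is_even (y - z) by exact: evB.
have b1 : body (x - z) != 0 by rewrite bodyD bodyN subr_eq0.
have b2 : body (y - z) != 0 by rewrite bodyD bodyN subr_eq0.
have := evrV exz b1; have := evrV eyz b2; have := ev_inv exz; have := ev_inv eyz.
set g := (y - z)^-1; set f := (x - z)^-1 => eg ef hg hf.
transitivity (g * ((x - z) * f) + f * (1 - (y - z) * g)).
  by rewrite hf hg subrr mulr0 addr0 mulr1.
by super (@nil Lam) [:: x; y; z; f; g].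
Qed.

Lemma hfin_data z V : is_even z -> (forall b, V b -> b != body z) ->
  flow_data V (hfin z) (hfin z) (hfin' z).
Proof.
move=> ez hV x y ex ey /hV Vx bxy; have Vy : body y != body z by rewrite bxy.
have exz : is_even (x - z) by exact: evB.
have eyz : is_even (y - z) by exact: evB.
have ezi := ev_inv ez; have := invB ez ex ey Vx Vy.
have := ev_inv exz; have := ev_inv eyz; rewrite /hfin /hfin'.
set g := (y - z)^-1; set f := (x - z)^-1; set zi := z^-1 => eg ef E.
have e1 : is_even (zi + f) by exact: evD.
have eff : is_even (f * f) by exact: evM.
have efg : is_even (f * g) by exact: evM.
have E' : f - g = (y - x) * (f * g).
  by rewrite {1}E; super (@nil Lam) [:: x; y; f; g].
split=> //; first exact: evN.
split.
- exists (- (f * g)); first exact: evN.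
  apply: (mod_eq (c := -1) E'); super (@nil Lam) [:: x; y; f; g; zi].
- exists (f * f * g); first exact: evM.
  apply: (mod_eq (c := (y - x) * f - 1) E'); super (@nil Lam) [:: x; y; f; g; zi].
- exists (f * f * g + f * g * g); first by apply: evD; exact: evM.
  apply: (mod_eq (c := f + g) E'); super (@nil Lam) [:: x; y; f; g; zi].
Qed.

(* The same vector field in the coordinate y = 1/x; the factor i comes from the
   odd coordinate i phi / x. *)
Definition uinf z y : Lam := (1 - z * y)^-1.
Definition kinf s z y : Lam := s * z^-1 * z^-1 * (uinf z y - 1).
Definition linf z y : Lam := z^-1 * z^-1 * y - z^-1 * z^-1 * z^-1 * (uinf z y - 1).
Definition minf z y : Lam := z^-1 * z^-1 * (1 - uinf z y * uinf z y).

Lemma minf_data s z V : is_even s -> is_even z -> body z != 0 ->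
  (forall b, V b -> 1 - body z * b != 0) -> flow_data V (kinf s z) (linf z) (minf z).
Proof.
move=> es ez bz hV x y ex ey Vx bxy; have e1 := @ev1 R.
have exz : is_even (1 - z * x) by apply: evB => //; exact: evM.
have eyz : is_even (1 - z * y) by apply: evB => //; exact: evM.
have b1 : body (1 - z * x) != 0 by rewrite bodyD body1 bodyN bodyM; exact: hV.
have b2 : body (1 - z * y) != 0 by rewrite bodyD body1 bodyN bodyM bxy; exact: hV.
have := evrV exz b1; have := evrV eyz b2; have := ev_inv exz; have := ev_inv eyz.
have := evrV ez bz; have := ev_inv ez; rewrite /kinf /linf /minf /uinf.
set g := (1 - z * y)^-1; set f := (1 - z * x)^-1; set zi := z^-1 => ezi hz eg ef hg hf.
have E : g - f = (y - x) * (z * f * g).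
  apply: (mod_eq (c := f) hg); apply: (mod_eq (c := - g) hf).
  by super (@nil Lam) [:: x; y; z; f; g].
have [ezz eff eyx] : [/\ is_even (zi * zi), is_even (f * f) & is_even (y - x)].
  by split; [exact: evM|exact: evM|exact: evB].
split.
- by apply: evM; [apply: evM => //; exact: evM|exact: evB].
- by apply: evB; [exact: evM|apply: evM; [exact: evM|exact: evB]].
- by apply: evM => //; exact: evB.
split.
- exists (s * zi * zi * z * f * g); first by do 5 apply: evM => //.
  by apply: (mod_eq (c := s * zi * zi) E); super (@nil Lam) [:: s; x; y; z; f; g; zi].
- exists (- (zi * zi * z * f * f * g)); first by apply: evN; do 4 apply: evM => //.
  apply: (mod_eq (c := - (zi * zi * zi) - zi * zi * (y - x) * f) E).
  apply: (mod_eq (c := - (zi * zi * (y - x) * f * g)) hz).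
  by super (@nil Lam) [:: x; y; z; f; g; zi].
- exists (- (zi * zi * z * f * g * (g + f))).
    by apply: evN; apply: evM; [do 4 apply: evM => //|exact: evD].
  by apply: (mod_eq (c := - (zi * zi * (g + f))) E); super (@nil Lam) [:: x; y; z; f; g; zi].
Qed.

End FlowFunctions.

(** * Inversion, shifts and the transition map *)

Section Inversion.
Variable R : realType.
Local Notation C := (cplx R).
Local Notation Lam := (grassmann C).
Implicit Types (x y z p q e th : Lam) (V : set C).

Local Notation shift := (@Defs.shift R).
Definition ii : Lam := ('i : C)%:A.
Lemma ii_even : is_even ii. Proof. exact: evA. Qed.
Lemma ii2 : ii * ii = -1.
Proof. by rewrite /ii mulr_algl scalerA -expr2 sqrCi scaleN1r. Qed.
Lemma ii_scale x : ('i : C) *: x = ii * x. Proof. by rewrite /ii mulr_algl. Qed.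

Lemma inversionI_parts p : evp (inversionI p) = (evp p)^-1 /\
  odp (inversionI p) = ii * odp p * (evp p)^-1.
Proof.
have ev := ev_inv (@evp_even R p).
have o1 : is_odd ('i *: (odp p * (evp p)^-1)) by apply/odZ/od_evM => //; exact: odp_odd.
by rewrite /inversionI evp_add // odp_add // ii_scale mulrA.
Qed.

Lemma inversionI_body p : body p != 0 -> body (inversionI p) = (body p)^-1.
Proof.
move=> b0; rewrite -body_evp; have [-> _] := inversionI_parts p.
by rewrite bodyV ?body_evp //; exact: evp_even.
Qed.

Lemma gconj_parts p : evp (gconj p) = evp p /\ odp (gconj p) = - odp p.
Proof. by rewrite evp_gconj odp_gconj. Qed.

Lemma inversionI_gconj p : inversionI (gconj p) = gconj (inversionI p).
Proof.
rewrite -[LHS]evp_odp -[RHS]evp_odp; have [-> ->] := gconj_parts (inversionI p).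
have [-> ->] := inversionI_parts (gconj p); have [-> ->] := gconj_parts p.
by have [-> ->] := inversionI_parts p; rewrite mulrN mulNr.
Qed.

Lemma inversionI2 p : body p != 0 -> inversionI (inversionI p) = gconj p.
Proof.
move=> b0; rewrite -[LHS]evp_odp -[RHS]evp_odp; have [-> ->] := gconj_parts p.
have [-> ->] := inversionI_parts (inversionI p); have [-> ->] := inversionI_parts p.
have ev := @evp_even R p; have bv : body (evp p) != 0 by rewrite body_evp.
have -> : ((evp p)^-1)^-1 = evp p by apply: evV_unique; [exact: ev_inv|exact: evVr].
congr (_ + _); have := evrV ev bv; have ov := @odp_odd R p; have e1 := ev_inv ev.
have ie := ii_even; have := ii2.
move: (evp p) (evp p)^-1 (odp p) ev ov e1 => x g f ex of' eg hi hx.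
apply: (mod_eq (c := - f) hx); apply: (mod_eq (c := f * x * g) hi).
by super [:: f] [:: x; g; ii].
Qed.

Lemma inversionI_inj p q : body p != 0 -> body q != 0 -> inversionI p = inversionI q -> p = q.
Proof.
move=> bp bq h; have := congr1 (@inversionI R) h; rewrite !inversionI2 //.
by move/(congr1 (@gconj R)); rewrite !gconjK.
Qed.

Lemma inversionI_sc : sc_preserving [set b : C | b != 0] (@inversionI R).
Proof.
move=> p q /= bp bq; rewrite /sc_rel.
have [-> ->] := inversionI_parts p; have [-> ->] := inversionI_parts q.
have := @evp_even R p; have := @odp_odd R p; have := @evp_even R q; have := @odp_odd R q.
have : body (evp p) != 0 by rewrite body_evp. 
have : body (evp q) != 0 by rewrite body_evp.
move: (evp p) (evp q) (odp p) (odp q) => x y f h by' bx oh ey of' ex rel.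
have := ii2; have := ii_even; have := evrV ex bx; have := evrV ey by'.
have := ev_inv ex; have := ev_inv ey.
move: x^-1 y^-1 => xi yi eyi exi hy hx ie i2.
apply: (mod_eq (c := - xi * yi) rel); apply: (mod_eq (c := - (h * f * yi * xi)) i2).
apply: (mod_eq (c := xi) hy); apply: (mod_eq (c := - yi) hx).
by super [:: h; f] [:: x; y; xi; yi; ii].
Qed.

Lemma gconj_sc V : sc_preserving V (@gconj R).
Proof.
move=> p q _ _; rewrite /sc_rel; have [-> ->] := gconj_parts p.
by have [-> ->] := gconj_parts q; rewrite mulrNN.
Qed.

Lemma SA_inversionI V (phi : Lam -> Lam) : SA V phi ->
  (forall p, V (body p) -> body (phi p) != 0) -> SA V (fun p => inversionI (phi p)).
Proof.
move=> h hb; have hi : SA V (fun p => (evp (phi p))^-1).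
  apply: SA_inv => [|p /hb bp]; first exact: SA_evp.
  by split; [exact: evp_even|rewrite body_evp].
by apply: SA_add => //; apply/SA_scale/SA_mul => //; exact: SA_odp.
Qed.

Definition unshift q p : Lam := p + q + odp p * odp q.
Lemma shift_parts q p : evp (shift q p) = evp p - evp q - odp p * odp q /\
  odp (shift q p) = odp p - odp q.
Proof.
have := @odM _ _ _ (@odp_odd R p) (@odp_odd R q) => e1.
have -> : shift q p = (evp p - evp q - odp p * odp q) + (odp p - odp q).
  by rewrite /Defs.shift; set PQ := odp p * odp q; rewrite /odp; gr_lin.
have h1 : is_even (evp p - evp q - odp p * odp q) by do 2 apply: evB => //; exact: evp_even.
have h2 : is_odd (odp p - odp q) by apply: odB; exact: odp_odd.
by rewrite evp_add // odp_add.
Qed.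
Lemma unshift_parts q p : evp (unshift q p) = evp p + evp q + odp p * odp q /\
  odp (unshift q p) = odp p + odp q.
Proof.
have := @odM _ _ _ (@odp_odd R p) (@odp_odd R q) => e1.
have -> : unshift q p = (evp p + evp q + odp p * odp q) + (odp p + odp q).
  by rewrite /unshift; set PQ := odp p * odp q; rewrite /odp; gr_lin.
have h1 : is_even (evp p + evp q + odp p * odp q) by do 2 apply: evD => //; exact: evp_even.
have h2 : is_odd (odp p + odp q) by apply: odD; exact: odp_odd.
by rewrite evp_add // odp_add.
Qed.
Lemma shiftK q p : unshift q (shift q p) = p.
Proof.
rewrite -[LHS]evp_odp -[RHS]evp_odp.
have [-> ->] := unshift_parts q (shift q p); have [-> ->] := shift_parts q p.
have := @evp_even R p; have := @odp_odd R p; have := @evp_even R q; have := @odp_odd R q.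
move: (evp p) (evp q) (odp p) (odp q) => x y f h oh ey of' ex.
by super [:: h; f] [:: x; y].
Qed.
Lemma unshiftK q p : shift q (unshift q p) = p.
Proof.
rewrite -[LHS]evp_odp -[RHS]evp_odp.
have [-> ->] := shift_parts q (unshift q p); have [-> ->] := unshift_parts q p.
have := @evp_even R p; have := @odp_odd R p; have := @evp_even R q; have := @odp_odd R q.
move: (evp p) (evp q) (odp p) (odp q) => x y f h oh ey of' ex.
by super [:: h; f] [:: x; y].
Qed.
Lemma shift_sc q V : sc_preserving V (shift q).
Proof.
move=> p p' _ _; rewrite /sc_rel.
have [-> ->] := shift_parts q p; have [-> ->] := shift_parts q p'.
have := @evp_even R p; have := @odp_odd R p; have := @evp_even R q; have := @odp_odd R q.
have := @evp_even R p'; have := @odp_odd R p'.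
move: (evp p) (evp q) (odp p) (odp q) (evp p') (odp p') => x y f h x' f' oh' ex' oh ey of' ex rel.
apply: (mod_eq (c := 1) rel); by super [:: h; f; f'] [:: x; y; x'].
Qed.
Lemma unshift_sc q V : sc_preserving V (unshift q).
Proof.
move=> p p' _ _; rewrite /sc_rel.
have [-> ->] := unshift_parts q p; have [-> ->] := unshift_parts q p'.
have := @evp_even R p; have := @odp_odd R p; have := @evp_even R q; have := @odp_odd R q.
have := @evp_even R p'; have := @odp_odd R p'.
move: (evp p) (evp q) (odp p) (odp q) (evp p') (odp p') => x y f h x' f' oh' ex' oh ey of' ex rel.
apply: (mod_eq (c := 1) rel); by super [:: h; f; f'] [:: x; y; x'].
Qed.
Lemma body_shift q p : body (shift q p) = body p - body q.
Proof.
by rewrite /Defs.shift [LHS]bodyD [body (- (_ * _))]bodyN bodyM body_odp mul0r subr0 bodyD bodyN.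
Qed.
Lemma body_unshift q p : body (unshift q p) = body p + body q.
Proof. by rewrite /unshift [LHS]bodyD bodyM body_odp mul0r addr0 bodyD. Qed.
Lemma SA_shift q V phi : SA V phi -> SA V (fun p => shift q (phi p)).
Proof.
move=> h; have oV := SA_open h; have cst x := SA_cst x oV.
by apply: SA_sub2; [exact: SA_sub2|apply: SA_mul => //; exact: SA_odp].
Qed.
Lemma SA_unshift q V phi : SA V phi -> SA V (fun p => unshift q (phi p)).
Proof.
move=> h; have oV := SA_open h; have cst x := SA_cst x oV.
by apply: SA_add; [exact: SA_add|apply: SA_mul => //; exact: SA_odp].
Qed.

(* [glue_map e] is the transition map of the sewing, and [cap_coord e] the local
   coordinate at infinity of (0, M(e, 3/2)), up to the inversion. *)
Definition glue_map e := flow e (0 : Lam) (fun x => x^-1) (fun=> 0) (fun=> 0).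
Definition cap_coord e := flow e (0 : Lam) (fun x => - ii * x * x) (fun=> 0) (fun=> 0).
Definition translation e th z := flow e th (fun=> z^-1) (fun=> z^-1) (fun=> 0 : Lam).
Definition kappa e th z := flow e th (hfin z) (hfin z) (hfin' z).
Definition kappa_inf e th z := flow e th (kinf (- ii) z) (linf z) (minf z).

Lemma glue_data : flow_data [set b : C | b != 0] (fun x => x^-1) (fun=> 0) (fun=> 0).
Proof.
move=> x y ex ey /= bx bxy; have by' : body y != 0 by rewrite bxy.
have := evrV ex bx; have := evrV ey by'; have := ev_inv ex; have := ev_inv ey.
have e0 := @ev0 R; set xi := x^-1; set yi := y^-1 => exi eyi hy hx.
split=> //; split; last 2 first.
- by exists 0; rewrite // !mulr0 !addr0.
- by exists 0; rewrite // !mulr0 !addr0.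
exists (- (xi * yi)); first by apply/evN/evM.
apply: (mod_eq (c := - yi) hx); apply: (mod_eq (c := xi) hy).
by super (@nil Lam) [:: x; y; xi; yi].
Qed.

Lemma cap_data V : flow_data V (fun x => - ii * x * x) (fun=> 0) (fun=> 0).
Proof.
move=> x y ex ey _ _; have e0 := @ev0 R; have ie := ii_even.
split=> //; first by do 2 apply: evM => //; exact: evN.
split; last 2 first.
- by exists 0; rewrite // !mulr0 !addr0.
- by exists 0; rewrite // !mulr0 !addr0.
exists (- ii * (x + y)); first by apply: evM; [exact: evN|exact: evD].
by super (@nil Lam) [:: x; y; ii].
Qed.

Lemma translation_data z V : is_even z -> flow_data V (fun=> z^-1) (fun=> z^-1) (fun=> 0 : Lam).
Proof.
move=> ez x y ex ey _ _; have e0 := @ev0 R; have ei := ev_inv ez.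
by split=> //; split; exists 0; rewrite // !mulr0 !addr0.
Qed.

(** Gluing equates the tube coordinate of the second sphere with I of the tube coordinate p of the
    first. The identity exhibits [glue_map e p] as the point of the second sphere, in the chart
    Delta, that satisfies this. *)
Lemma cap_glue e p : is_odd e -> body p != 0 ->
  cap_coord e (inversionI (glue_map e p)) = inversionI p.
Proof.
move=> oe b0; have o0 := @od0 R.
have [te to] := flow_parts oe o0 glue_data (b0 : [set b : C | b != 0] (body p)).
have bt := flow_body oe o0 glue_data (b0 : [set b : C | b != 0] (body p)).
rewrite -[RHS]evp_odp /cap_coord {1}/flow; have [-> ->] := inversionI_parts p.
have [-> ->] := inversionI_parts (glue_map e p); rewrite te to.
have := @evp_even R p; have := @odp_odd R p; have : body (evp p) != 0 by rewrite body_evp.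
move: (evp p) (odp p) => x f bx of' ex; have := evrV ex bx; have := ev_inv ex.
have ie := ii_even; have i2 := ii2.
set xi := x^-1 => exi hx.
(* The correction to x is a multiple of e, so its reciprocal stops at first order. *)
have -> : (x - e * f * xi + (e * 0 * 0) *+ 2)^-1 = xi + e * f * xi * xi * xi.
  apply: evV_unique.
    rewrite mulr0 mul0rn addr0; apply: evB => //; apply: evM => //; exact: odM.
  apply: (mod_eq (c := 1 + e * f * xi * xi) hx).
  by super [:: e; f] [:: x; xi].
apply: (mod_eq (c := e * f * xi * xi * xi) i2).
by super [:: e; f] [:: x; xi; ii].
Qed.

Lemma hfin_dataT z : is_even z -> flow_data [set b : C | b != body z] (hfin z) (hfin z) (hfin' z).
Proof. by move=> ez; apply: hfin_data. Qed.
Lemma minf_dataT s z : is_even s -> is_even z -> body z != 0 ->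
  flow_data [set b : C | 1 - body z * b != 0] (kinf s z) (linf z) (minf z).
Proof. by move=> es ez bz; apply: minf_data. Qed.

(** The shift turns the generator 1 / x into 1 / (x - z), up to a correction in theta, and the
    translation adds 1 / z: the sum is the field [hfin], regular away from body z. *)
Lemma kappa_glue e th z p : is_odd e -> is_odd th -> is_even z -> body p != body z ->
  translation e th z (unshift (z + th) (glue_map e (shift (z + th) p))) = kappa e th z p.
Proof.
move=> oe oth ez bp; have o0 := @od0 R.
have bs : [set b : C | b != 0] (body (shift (z + th) p)).
  by rewrite /= body_shift bodyD (body_odd oth) addr0 subr_eq0.
have [ge go] := flow_parts oe o0 glue_data bs.
have [ue uo] := unshift_parts (z + th) (glue_map e (shift (z + th) p)).
have [se so] := shift_parts (z + th) p.
rewrite /translation {1}/flow ue uo ge go se so evp_add // odp_add // /kappa /flow /hfin /hfin'.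
have := @evp_even R p; have := @odp_odd R p; have : body (evp p) != body z by rewrite body_evp.
move: (evp p) (odp p) {ge go ue uo se so bs bp} => x f bp of' ex.
have exz : is_even (x - z) by exact: evB.
have bxz : body (x - z) != 0 by rewrite bodyD bodyN subr_eq0.
have := evrV exz bxz; have := ev_inv exz; have := ev_inv ez.
set g := (x - z)^-1; set zi := z^-1 => ezi eg hg.
have -> : (x - z - f * th)^-1 = g + g * g * (f * th).
  apply: evV_unique; first by apply: evB => //; exact: odM.
  apply: (mod_eq (c := 1 + g * f * th) hg).
  by super [:: f; th] [:: x; z; g].
by super [:: e; th; f] [:: x; z; g; zi].
Qed.

(** This makes [kappa] extend over infinity: [kappa_inf], its expression in the coordinate Upsilon,
    is regular at the origin. *)
Lemma kappa_kappa_inf e th z p : is_odd e -> is_odd th -> is_even z -> body z != 0 ->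
  body p != 0 -> body p != body z ->
  gconj (inversionI (kappa e th z p)) = kappa_inf e th z (gconj (inversionI p)).
Proof.
move=> oe oth ez bz0 bp0 bpz.
have [ke ko] := flow_parts oe oth (hfin_dataT ez) (bpz : [set b : C | b != body z] (body p)).
rewrite -[LHS]evp_odp; have [-> ->] := gconj_parts (inversionI (kappa e th z p)).
have [-> ->] := inversionI_parts (kappa e th z p); rewrite ke ko /kappa_inf /flow.
have [-> ->] := gconj_parts (inversionI p); have [-> ->] := inversionI_parts p.
have := @evp_even R p; have := @odp_odd R p; have : body (evp p) != body z by rewrite body_evp.
have : body (evp p) != 0 by rewrite body_evp.
move: (evp p) (odp p) {ke ko bp0 bpz} => x f bx bxz of' ex.
have exz : is_even (x - z) by exact: evB.
have bxz' : body (x - z) != 0 by rewrite bodyD bodyN subr_eq0.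
have := evrV exz bxz'; have := ev_inv exz; have := ev_inv ez; have := evrV ez bz0.
have := evrV ex bx; have := ev_inv ex; have ie := ii_even; have i2 := ii2.
rewrite /hfin /hfin' /kinf /linf /minf.
set g := (x - z)^-1; set zi := z^-1; set xi := x^-1 => exi hx hz ezi eg hg.
have -> : uinf z xi = 1 + z * g.
  apply: evV_unique; first by apply: evB; [exact: ev1|exact: evM].
  apply: (mod_eq (c := - z * g) hx); apply: (mod_eq (c := z * xi) hg).
  by super (@nil Lam) [:: x; z; g; xi].
have -> : (x - e * f * (zi + g) + (e * th * (zi + g)) *+ 2)^-1 =
    xi + xi * xi * (e * f * (zi + g) - (e * th * (zi + g)) *+ 2).
  apply: evV_unique.
    have ezg : is_even (zi + g) by exact: evD.
    apply: evD; last by apply/evMn/evM => //; exact: odM.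
    by apply: evB => //; apply: evM => //; exact: odM.
  apply: (mod_eq (c := 1 + xi * (e * f * (zi + g) - (e * th * (zi + g)) *+ 2)) hx).
  by super [:: e; th; f] [:: x; g; zi; xi].
(* Partial fractions: 1 / (x z) + 1 / (x (x - z)) = 1 / (z (x - z)). *)
have R1 : xi * zi + xi * g = zi * g.
  apply: (mod_eq (c := - xi * zi) hg); apply: (mod_eq (c := - xi * g) hz).
  apply: (mod_eq (c := zi * g) hx).
  by super (@nil Lam) [:: x; z; g; zi; xi].
have kE : - ii * zi * zi * (1 + z * g - 1) = - ii * zi * g.
  by apply: (mod_eq (c := - ii * zi * g) hz); super (@nil Lam) [:: ii; z; g; zi].
have lE : zi * zi * xi - zi * zi * zi * (1 + z * g - 1) = zi * zi * xi - zi * zi * g.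
  by apply: (mod_eq (c := - zi * zi * g) hz); super (@nil Lam) [:: xi; z; g; zi].
have mE : zi * zi * (1 - (1 + z * g) * (1 + z * g)) = - (zi * g) *+ 2 - g * g.
  apply: (mod_eq (c := - (zi * g) *+ 2 - g * g * (z * zi + 1)) hz).
  by super (@nil Lam) [:: z; g; zi].
rewrite kE lE mE.
apply: (mod_eq (c := e * f * xi * zi * g) i2).
apply: (mod_eq (c := e * f * xi - (e * th * (xi + zi)) *+ 2 - ii * e + (ii * e * th * f * xi) *+ 2) R1).
by super [:: e; th; f] [:: ii; g; zi; xi].
Qed.

End Inversion.

(** * Exponentials of the generators *)

Section Series.
Variable R : realType.
Local Notation C := (cplx R).
Local Notation Lam := (grassmann C).
Implicit Types (x y z p q e c : Lam) (u v : sser R) (AM : seqpair R).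

Lemma genT1 AM u n : (genT AM u).1 n =
  \sum_(j < n) (AM.1 j * (u.1 (n - j.+1)%N *+ (n - j.+1)) + AM.2 j * u.2 (n - j.+1)%N).
Proof.
rewrite /genT /= -sumrN; apply: eq_bigr => -[j jn] _ /=.
rewrite [LHS](_ : _ = - (AM.1 j * (opL j.+1 u).1 n + AM.2 j * (opG j.+1 u).1 n)) //.
have -> : (opG j.+1 u).1 n = - u.2 (n - j.+1)%N.
  by rewrite [LHS](_ : _ = - (if (j.+1 <= n)%N then u.2 (n - j.+1)%N - 0 else 0)) // jn subr0.
have -> : (opL j.+1 u).1 n = - (u.1 (n - j.+1)%N *+ (n - j.+1)).
  rewrite [LHS](_ : _ = - ((if (j.+2 <= n)%N then u.1 (n - j.+2).+1 *+ (n - j.+2).+1 else 0)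
    + (j.+2%:R / 2 : C) *: (0 : Lam))) // scaler0 addr0.
  case: ifP => h; first by rewrite -subSn.
  have -> : (n - j.+1 = 0)%N by lia.
  by rewrite mulr0n.
by rewrite !mulrN opprD !opprK.
Qed.

Lemma genT2 AM u n : (genT AM u).2 n =
  \sum_(j < n) (gconj (AM.1 j) * (u.2 (n - j.+1)%N *+ (n - j.+1) +
     (j.+2%:R / 2 : C) *: u.2 (n - j.+1)%N) - gconj (AM.2 j) * (u.1 (n - j)%N *+ (n - j))).
Proof.
rewrite /genT /= -sumrN; apply: eq_bigr => -[j jn] _ /=.
rewrite [LHS](_ : _ = - (gconj (AM.1 j) * (opL j.+1 u).2 n + gconj (AM.2 j) * (opG j.+1 u).2 n)) //.
have -> : (opG j.+1 u).2 n = u.1 (n - j)%N *+ (n - j).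
  rewrite [LHS](_ : _ = - (if (j.+1 <= n)%N then
    0 - u.1 (n - j.+1).+1 *+ (n - j.+1).+1 else 0)) // jn sub0r opprK.
  by rewrite subnSK.
have -> : (opL j.+1 u).2 n = - (u.2 (n - j.+1)%N *+ (n - j.+1) + (j.+2%:R / 2 : C) *: u.2 (n - j.+1)%N).
  rewrite [LHS](_ : _ = - ((if (j.+2 <= n)%N then u.2 (n - j.+2).+1 *+ (n - j.+2).+1 else 0)
    + (j.+2%:R / 2 : C) *: (if (j.+1 <= n)%N then u.2 (n - j.+1)%N else 0))) // jn.
  case: ifP => h; first by rewrite -subSn.
  have -> : (n - j.+1 = 0)%N by lia.
  by rewrite mulr0n.
by rewrite mulrN opprD opprK.
Qed.

Definition sser_eq u v := forall n, u.1 n = v.1 n /\ u.2 n = v.2 n.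
Lemma sser_ext u v : sser_eq u v -> u = v.
Proof.
case: u v => [u1 u2] [v1 v2] h; congr pair; apply/funext => n; by case: (h n).
Qed.

Lemma sserD1 u v n : (u + v).1 n = u.1 n + v.1 n. Proof. by []. Qed.
Lemma sserD2 u v n : (u + v).2 n = u.2 n + v.2 n. Proof. by []. Qed.
Opaque genT.

Lemma genTD AM u v : genT AM (u + v) = genT AM u + genT AM v.
Proof.
apply: sser_ext => n; split; apply/esym.
  apply: etrans (congr2 +%R (genT1 AM u n) (genT1 AM v n)) (esym (etrans (genT1 AM (u + v) n) _)).
  apply/esym; rewrite -big_split; apply: eq_bigr => j _ /=.
  by rewrite addrACA -!mulrDr -mulrnDl.
apply: etrans (congr2 +%R (genT2 AM u n) (genT2 AM v n)) (esym (etrans (genT2 AM (u + v) n) _)).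
apply/esym; rewrite -big_split; apply: eq_bigr => j _ /=.
rewrite addrACA -opprD -!mulrDr -!mulrnDl; congr (_ * _ - _ * _).
by rewrite addrACA -mulrnDl -scalerDr.
Qed.

Lemma genT0 AM : genT AM 0 = 0.
Proof. by have /eqP := genTD AM 0 0; rewrite addr0 -subr_eq0 opprD addrA subrr sub0r oppr_eq0 => /eqP. Qed.

(** The truncation order [n.*2.+2] is at least 2, so both surviving terms of the exponential are
    present for every n. *)
Lemma expT_nilp2 AM u : genT AM (genT AM u) = 0 -> expT AM u = u + genT AM u.
Proof.
move=> h; have it l : iter l.+2 (genT AM) u = 0.
  by elim: l => [|l IH]; [exact: h | rewrite iterS IH; exact: genT0].
have E (f : sser R -> nat -> Lam) n : (forall n, f 0 n = 0) ->
    \sum_(l < n.*2.+2) (l`!%:R^-1 : C) *: f (iter l (genT AM) u) n = f u n + f (genT AM u) n.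
  move=> f0; rewrite !big_ord_recl big1 => [|l _]; last first.
    by rewrite !lift0 it f0 scaler0.
  by rewrite addr0 lift0 /= fact0 factS fact0 mul1n !invr1 !scale1r.
by apply: sser_ext => n; split; [exact: (E (fun v => v.1))|exact: (E (fun v => v.2))].
Qed.

Definition linear_sser (b d : Lam) : sser R :=
  (fun n => (n == 1%N)%:R * b, fun n => (n == 0%N)%:R * d).
Lemma xphiE : xphi R = linear_sser 1 1.
Proof. by apply: sser_ext => n; rewrite /= !mulr1. Qed.
Lemma pow_xphiE a : pow_m2L0 a (xphi R) = linear_sser (a * a) a.
Proof.
apply: sser_ext => n; rewrite /=; split.
  by case: n => [|[|n]] /=; rewrite ?mulr0 ?mul0r // mulr1 mul1r expr2.
by case: n => [|n] /=; rewrite ?mulr0 ?mul0r // mulr1 mul1r expr1.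
Qed.

Section Geometric.
Variables (e al mu c b d : Lam).
Hypotheses (oe : is_odd e) (ec : is_even c) (eal : is_even al) (omu : is_odd mu).
Hypotheses (al_e : exists y, al = e * y) (mu_e : exists y, mu = e * y).
Hypotheses (albd : al * b = al /\ al * d = al) (mubd : mu * b = mu /\ mu * d = mu).

(** Expanding a simple pole produces geometric sequences. All their entries are multiples of the
    same odd e, so products of two entries vanish. *)
Definition geoAM : seqpair R := (fun j => al * c ^+ j.+1, fun j => mu * c ^+ j.+1).

Lemma geo_parity j : is_even (geoAM.1 j) /\ is_odd (geoAM.2 j).
Proof.
have h : is_even (c ^+ j.+1) by exact: evX.
by split; [exact: evM|exact: od_evM].
Qed.

(** The ideal generated by e: two-sided because e is odd, and of square zero. *)
Definition emult x := exists y, x = e * y.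
Lemma emultD x y : emult x -> emult y -> emult (x + y).
Proof. by move=> [x' ->] [y' ->]; exists (x' + y'); rewrite mulrDr. Qed.
Lemma emultN x : emult x -> emult (- x).
Proof. by move=> [x' ->]; exists (- x'); rewrite mulrN. Qed.
Lemma emultMr x y : emult x -> emult (x * y).
Proof. by move=> [x' ->]; exists (x' * y); rewrite mulrA. Qed.
Lemma emultMl x y : emult x -> emult (y * x).
Proof. by move=> [x' ->]; exists (gconj y * x'); rewrite [RHS]mulrA -(odd_swap y oe) mulrA. Qed.
Lemma emultZ (a : C) x : emult x -> emult (a *: x).
Proof. by move=> h; rewrite -mulr_algl; exact: emultMl. Qed.
Lemma emultMn n x : emult x -> emult (x *+ n).
Proof. by rewrite -scaler_nat; exact: emultZ. Qed.
Lemma emult0 : emult 0. Proof. by exists 0; rewrite mulr0. Qed.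
Lemma emult_gconj x : emult x -> emult (gconj x).
Proof. by move=> [x' ->]; exists (- gconj x'); rewrite gconjM gconj_odd // mulrN mulNr. Qed.
Lemma emult_mul x y : emult x -> emult y -> x * y = 0.
Proof. by move=> [x' ->] [y' ->]; rewrite mulrA odd_mid // mul0r. Qed.
Lemma emult_sum n (F : 'I_n -> Lam) : (forall i, emult (F i)) -> emult (\sum_(i < n) F i).
Proof. by move=> h; elim/big_ind: _ => //; [exact: emult0|exact: emultD]. Qed.

Lemma emult_genT2 AM u : (forall j, emult (AM.1 j)) -> (forall j, emult (AM.2 j)) ->
  genT AM (genT AM u) = 0.
Proof.
move=> eA eM.
have g1 v n : emult ((genT AM v).1 n).
  by rewrite genT1; apply: emult_sum => j; apply: emultD; exact: emultMr.
have g2 v n : emult ((genT AM v).2 n).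
  rewrite genT2; apply: emult_sum => j; apply: emultD; first by apply/emultMr/emult_gconj.
  by apply/emultN/emultMr/emult_gconj.
apply: sser_ext => n; split.
  rewrite genT1 big1 // => j _; rewrite !emult_mul ?addr0 //; exact: emultMn.
rewrite genT2 big1 // => j _; rewrite !emult_mul ?subr0 //; try exact: emult_gconj.
  exact: emultMn.
by apply: emultD; [exact: emultMn|exact: emultZ].
Qed.

Lemma geo_genT2 u : genT geoAM (genT geoAM u) = 0.
Proof. by apply: emult_genT2 => j; exact: emultMr. Qed.

(** The even generators start at j = 1, so the geometric sequence has no entry for x^1; subtracting
    [(m == 0)] removes it. The hypotheses on b and d say that they act as 1 on multiples of the
    generators' parameters. *)
Lemma geo_exp1 n : (expT geoAM (linear_sser b d)).1 n =
  (n == 1%N)%:R * b + (if n is m.+1 then al * (c ^+ m - (m == 0%N)%:R) + mu * c ^+ n else 0).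
Proof.
rewrite expT_nilp2 ?geo_genT2 // [LHS]sserD1.
congr (_ + _); rewrite genT1; case: n => [|n]; first by rewrite big_ord0.
rewrite big_split /=; congr (_ + _); last first.
  rewrite big_ord_recr /= subnn mul1r big1 ?add0r => [|j _]; last first.
    by rewrite subSS subn_eq0 leqNgt ltn_ord mul0r mulr0.
  by rewrite -mulrA (evenC d (evX _ ec)) mulrA (proj2 mubd).
case: n => [|n]; first by rewrite big_ord1 mulr0n mulr0 expr0 subrr mulr0.
rewrite big_ord_recr big_ord_recr /= subr0 subnn mulr0n mulr0 addr0.
rewrite big1 ?add0r => [|j _].
  by rewrite subSnn mulr1n mul1r -mulrA (evenC b (evX _ ec)) mulrA (proj1 albd).
have jn := ltn_ord j; have -> : (n.+2 - j.+1 == 1)%N = false by lia.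
by rewrite mul0r mul0rn mulr0.
Qed.

Lemma geo_exp2 n : (expT geoAM (linear_sser b d)).2 n =
  (n == 0%N)%:R * d + (if n is m.+1 then (n.+1%:R / 2 : C) *: (al * c ^+ n) + mu * c ^+ n else 0).
Proof.
rewrite expT_nilp2 ?geo_genT2 // [LHS]sserD2.
congr (_ + _); rewrite genT2; case: n => [|n]; first by rewrite big_ord0.
have [eA oM] := (fun j => proj1 (geo_parity j), fun j => proj2 (geo_parity j)).
rewrite big_ord_recr big1 ?add0r /= => [|j _].
  rewrite subnn mulr0n [0 + _ *: _]add0r mul1r subSnn mulr1n mul1r gconj_even ?gconj_odd ?mulNr ?opprK //.
    rewrite -scalerAr -!mulrA !(evenC _ (evX _ ec)) !mulrA (proj2 albd) (proj1 mubd).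
    by rewrite add0r.
  - exact: (oM n).
  - exact: (eA n).
have jn := ltn_ord j; have -> : (n.+1 - j.+1 == 0)%N = false by lia.
have -> : (n.+1 - j == 1)%N = false by lia.
by rewrite !mul0r !mul0rn scaler0 addr0 !mulr0 subr0.
Qed.
End Geometric.

Lemma gnorm_lt q I (rho : R) : cabs (body q) < rho ->
  exists2 lam : R, 0 < lam & gnorm lam I q < rho.
Proof.
move=> qr; pose K := \sum_(J <- (fpowerset I `\ fset0)%fset) cabs (q J).
have K0 : 0 <= K by apply: sumr_ge0 => J _; exact: cabs_ge0.
have [dd d0 dK] := ex_small K0 (ltac:(by rewrite subr_gt0) : 0 < rho - cabs (body q)).
exists (Num.min dd 1); first by rewrite lt_min d0 ltr01.
set lam := Num.min dd 1; have l0 : 0 < lam by rewrite lt_min d0 ltr01.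
have l1 : lam <= 1 by rewrite ge_min lexx orbT.
rewrite /gnorm (big_fsetD1 fset0) ?fpowersetE ?fsub0set // cardfs0 /= mulr1 -ltrBrDl.
apply: (le_lt_trans _ dK); rewrite mulr_sumr !big_seq; apply: ler_sum => J.
rewrite in_fsetD1 => /andP[J0 _]; rewrite mulrC ler_wpM2r ?cabs_ge0 //.
have [k ->] : exists k, #|` J|%fset = k.+1.
  by exists (#|` J|%fset).-1; rewrite prednK // cardfs_gt0.
rewrite exprS (le_trans (ler_piMr _ _)) ?(ltW l0) ?exprn_ile1 ?(ltW l0) //.
by rewrite ge_min lexx.
Qed.

Lemma geom_sum (rho : R) n : 0 <= rho -> rho < 1 -> \sum_(i < n) rho ^+ i <= (1 - rho)^-1.
Proof.
move=> p0 p1; have h : 0 < 1 - rho by rewrite subr_gt0.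
rewrite -[leRHS]mul1r ler_pdivlMr // mulrC -opprB mulNr -subrX1 opprB gerBl.
by rewrite exprn_ge0.
Qed.

(** For each I a weight lam is chosen that makes the seminorm of q less than 1; component I is then
    dominated by a scalar geometric series. *)
Lemma abs_sum_geom q : is_even q -> cabs (body q) < 1 ->
  abs_sum (fun n => q ^+ n) (1 - q)^-1.
Proof.
move=> eq1 bq; apply/abs_sumP => I; pose rho := (cabs (body q) + 1) / 2.
have qr : cabs (body q) < rho by rewrite /rho; lra.
have r1 : rho < 1 by rewrite /rho; lra.
have r0 : 0 <= rho by rewrite ltW // (le_lt_trans (cabs_ge0 _) qr).
have [lam l0 hl] := gnorm_lt I qr.
have lI : 0 < lam ^+ #|` I|%fset by rewrite exprn_gt0.
have comp x : cabs (x I) <= gnorm lam I x / lam ^+ #|` I|%fset.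
  by rewrite ler_pdivlMr //; apply: gnorm_comp.
have qn n : gnorm lam I (q ^+ n) <= rho ^+ n.
  rewrite (le_trans (gnormX _ l0 _ _)) // lerXn2r ?nnegrE ?gnorm_ge0 //; exact: ltW.
split.
  exists ((1 - rho)^-1 / lam ^+ #|` I|%fset) => n.
  apply: (@le_trans _ _ (\sum_(i < n) rho ^+ i / lam ^+ #|` I|%fset)).
    apply: ler_sum => i _; rewrite (le_trans (comp _)) // ler_wpM2r ?invr_ge0 ?(ltW lI) //.
  by rewrite -mulr_suml ler_wpM2r ?invr_ge0 ?(ltW lI) // geom_sum.
have e1q : is_even (1 - q) by apply: evB => //; exact: ev1.
have b1q : body (1 - q) != 0.
  rewrite bodyD body1 bodyN subr_eq0; apply/eqP => h; move: bq; rewrite -h cabs1 ltxx //.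
have Sn n : \sum_(i < n) q ^+ i = (1 - q)^-1 - (1 - q)^-1 * q ^+ n.
  have h : (1 - q) * \sum_(i < n) q ^+ i = 1 - q ^+ n by rewrite -opprB mulNr -subrX1 opprB.
  by rewrite -[LHS](mulKr (ev_unit e1q b1q)) h mulrBr mulr1.
move=> ep ep0; set U := (1 - q)^-1; pose K := gnorm lam I U / lam ^+ #|` I|%fset.
have K0 : 0 <= K by rewrite divr_ge0 ?gnorm_ge0 // ltW.
have K1 : 0 < K + 1 by rewrite ltr_wpDl.
have /cvgrPdist_lt hexp : (fun n => rho ^+ n) @ \oo --> (0 : R).
  by apply: cvg_expr; rewrite ger0_norm.
have [N _ hN] := hexp (ep / (K + 1)) (divr_gt0 ep0 K1).
exists N => n Nn; have := hN n Nn; rewrite sub0r normrN ger0_norm ?exprn_ge0 // => hn.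
have := congr1 (fun x : Lam => x I) (Sn n); rewrite gr_sumE => ->.
rewrite grBE addrAC subrr sub0r cabsN (le_lt_trans (comp _)) //.
apply: (@le_lt_trans _ _ (K * rho ^+ n)).
  rewrite /K mulrAC ler_wpM2r ?invr_ge0 ?(ltW lI) // (le_trans (gnormM _ l0 _ _)) //.
  by rewrite ler_wpM2l ?gnorm_ge0.
move: hn; rewrite ltr_pdivlMr //; apply: le_lt_trans; rewrite mulrC ler_wpM2l ?exprn_ge0 //.
by rewrite lerDl.
Qed.

End Series.

(** * Values of the exponentials *)

Section SeriesValues.
Variable R : realType.
Local Notation C := (cplx R).
Local Notation Lam := (grassmann C).
Implicit Types (x y z p q e c th : Lam) (u v : sser R) (AM : seqpair R).

Lemma abs_sum_geom2 q : is_even q -> cabs (body q) < 1 ->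
  abs_sum (fun n => q ^+ n *+ n.+1) ((1 - q)^-1 * (1 - q)^-1).
Proof.
move=> eq1 bq; have h := abs_sum_geom eq1 bq.
apply: eq_abs_sum (abs_sum_cauchy h h) => n; rewrite /gconv.
rewrite (eq_bigr (fun=> q ^+ n)) ?sumr_const ?card_ord // => i _.
by rewrite -exprD subnKC // -ltnS ltn_ord.
Qed.

Lemma abs_sum_cons (f : nat -> Lam) s : abs_sum f s ->
  abs_sum (fun n => if n is m.+1 then f m else 0) s.
Proof.
move=> /abs_sumP h; apply/abs_sumP => I.
apply: eq_csum (csum_shift 1 (h I)) => -[|n] /=; first by rewrite gr0E.
by rewrite subn1.
Qed.

Lemma abs_sum_delta (k : nat) x : abs_sum (fun n => (n == k)%:R * x) x.
Proof.
have := @abs_sum_fin R (fun n => (n == k)%:R * x) k.+1.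
rewrite big_ord_recr big1 /= => [|i _]; last first.
  by rewrite (ltn_eqF (ltn_ord i)) mul0r.
rewrite eqxx mul1r add0r; apply=> n; rewrite ltnNge => /negPf.
by case: eqP => [->|]; rewrite ?leqnn // mul0r.
Qed.

(** The even part sums a geometric series with value U, and the generators L_j contribute (j + 1) /
    2 to the coefficient of phi, which produces U^2 and the factor 1 / 2. *)
Lemma geo_value e al mu c b d p : is_odd e -> is_even c -> is_even al -> is_odd mu ->
  (exists y, al = e * y) -> (exists y, mu = e * y) ->
  (al * b = al /\ al * d = al) -> (mu * b = mu /\ mu * d = mu) ->
  cabs (body c * body p) < 1 ->
  let x := evp p in let U := (1 - c * x)^-1 in
  sser_at (expT (geoAM al mu c) (linear_sser b d)) p
    (x * b + (al * (x * (U - 1)) + mu * (U - 1)) +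
     odp p * (d + ((2^-1 : C) *: (al * (U * U - 1)) + mu * (U - 1)))).
Proof.
move=> oe ec eal omu ale mue albd mubd bp x U.
have ex : is_even x := evp_even p.
have eq1 : is_even (c * x) by exact: evM.
have bq : cabs (body (c * x)) < 1 by rewrite bodyM body_evp.
have g := abs_sum_geom eq1 bq; have g2 := abs_sum_geom2 eq1 bq.
have d0 := abs_sum_delta 0 1; have d1 := abs_sum_delta 1 (x * b).
(* The generators start at j = 1, hence the term of index 0 is subtracted from both series. *)
have gm := abs_sumD g (abs_sumZ (-1) d0); have g2m := abs_sumD g2 (abs_sumZ (-1) d0).
rewrite !scaleN1r in gm g2m.
have h1 := abs_sumMl al (abs_sumMl x (abs_sum_cons gm)).
have h2 := abs_sumMl mu gm.
have h3 := abs_sumD (abs_sum_delta 0 d) (abs_sumD (abs_sumZ (2^-1 : C) (abs_sumMl al g2m)) h2).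
have h4 := abs_sumD (abs_sumD d1 (abs_sumD h1 h2)) (abs_sumMl (odp p) h3).
apply: eq_abs_sum h4 => n.
rewrite (geo_exp1 oe ec ale mue albd mubd) (geo_exp2 oe ec eal omu ale mue albd mubd).
have exn k : is_even (x ^+ k) := evX k ex.
have ecn k : is_even (c ^+ k) := evX k ec.
have cx k : (c * x) ^+ k = c ^+ k * x ^+ k by rewrite exprMn_comm //; exact: evenC.
pose simpz := (mulr0n, mulr1n, mul0r, mulr0, mul1r, mulr1, addr0, add0r, scaler0, scaleN1r,
  expr0, expr1, subrr, subr0).
have mid k y w : is_even y -> x ^+ k * (w * y) = w * (y * x ^+ k).
  by move=> ey; rewrite [LHS]evenC // mulrA.
congr (_ + odp p * _).
- case: n => [|[|n]]; rewrite -/x; cbn [eqn eq_op Nat.eqb]; rewrite /= ?simpz //.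
  + by rewrite mulrDr; congr (_ + _); have := mid 1%N c mu ec; rewrite !expr1 => ->.
  rewrite mulrDr !cx; congr (_ + _); last by rewrite (mid _ _ _ (ecn _)).
  rewrite (mid _ _ _ (ecn _)); congr (_ * _).
  by rewrite (exprS x n.+1) !mulrA (evenC x (ecn n.+1)) -!mulrA.
case: n => [|n]; rewrite -/x /= ?simpz //.
rewrite [RHS]mulrDr cx; congr (_ + _); last by rewrite (mid _ _ _ (ecn _)).
by rewrite -scalerAr (mid _ _ _ (ecn _)) mulrnAr mulr_natl -scalerMnl scalerMnr.
Qed.

Lemma half_double x y : (2^-1 : C) *: ((x *+ 2) * y) = x * y.
Proof. by rewrite mulrnAl -scalerMnr scalerMnl -mulr_natr mulVf ?scale1r // pnatr_eq0. Qed.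

Lemma sser_at_eq u p s s' : s = s' -> sser_at u p s -> sser_at u p s'.
Proof. by move=> ->. Qed.

(* The local coordinates of the sewn supersphere at its two punctures. *)
Lemma hatE_value e th z p : is_odd e -> is_odd th -> is_even z -> body z != 0 ->
  cabs (body p) < cabs (body z) ->
  sser_at (hatE (1 + e * th * z^-1 * z^-1) (geoAM ((e * th * z^-1 * z^-1) *+ 2) (e * z^-1) z^-1)) p
    (flow (- e) th (hfin z) (hfin z) (hfin' z) p).
Proof.
move=> oe oth ez bz pz; have ei := ev_inv ez; have hz := evrV ez bz.
have eeth : is_even (e * th) by exact: odM.
have emid x : e * x * e = 0 := odd_mid oe x.
(* The square of a has to be the coefficient of x in the flow, 1 + 2 e theta z^-2; a itself has no
   factor 2 because e has square zero. *)
set zi := z^-1 in ei hz *; set a := 1 + _.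
have e2 : e * e = 0 by exact: odd_sq.
have bzi : body zi = (body z)^-1 by rewrite bodyV.
have small : cabs (body zi * body p) < 1.
  by rewrite cabsM bzi cabsV mulrC ltr_pdivrMr ?mul1r // cabs_gt0.
have al_e : exists y, (e * th * zi * zi) *+ 2 = e * y.
  by exists ((th * zi * zi) *+ 2); rewrite mulrnAr !mulrA.
have eal : is_even ((e * th * zi * zi) *+ 2) by apply/evMn; do 2 apply: evM => //.
have V := geo_value oe ei eal (od_evM oe ei) al_e (ex_intro _ zi erefl)
  (b := a * a) (d := a) _ _ small.
rewrite /hatE pow_xphiE.
have o0 := @od0 R; have e0 := @ev0 R.
have {}V := V ltac:(split; rewrite /a; super [:: e; th] [:: zi]) ltac:(split; rewrite /a; super [:: e; th] [:: zi]).
move: V => /=; rewrite /flow /hfin /hfin'.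
have ex := @evp_even R p; have of' := @odp_odd R p.
have bx : body (evp p) = body p := body_evp p.
move: (evp p) (odp p) ex of' bx => x f ex of' bx.
have exz : is_even (x - z) by exact: evB.
have bxz : body (x - z) != 0.
  by rewrite bodyD bodyN bx subr_eq0; apply/eqP => h; rewrite h ltxx in pz.
have := evrV exz bxz; have := ev_inv exz; set g := (x - z)^-1 => eg hg.
have -> : (1 - zi * x)^-1 = - (z * g).
  apply: evV_unique; first by apply: evB; [exact: ev1|exact: evM].
  apply: (mod_eq (c := 1) hg); apply: (mod_eq (c := x * g) hz).
  by super (@nil Lam) [:: x; z; zi; g].
rewrite half_double -/zi; apply: sser_at_eq.
apply: (mod_eq (c := - ((e * th * (zi * x * g + g)) *+ 2) - e * g - f * e * g + f * e * th * g * g * (z * zi + 1)) hz).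
apply: (mod_eq (c := - (e * th * zi) *+ 2) hg).
by rewrite /a; super [:: e; th; f] [:: x; z; zi; g].
Qed.

Lemma tildeE_value e th z p : is_odd e -> is_odd th -> is_even z -> body z != 0 ->
  cabs (body z * body p) < 1 ->
  sser_at (tildeE (geoAM ((e * th * z^-1 * z^-1) *+ 2) (- ii R * e * z^-1 * z^-1) z)) p
    (flow (- e) th (kinf (ii R) z) (linf z) (minf z) p).
Proof.
move=> oe oth ez bz pz; have ei := ev_inv ez; have hz := evrV ez bz.
have eeth : is_even (e * th) by exact: odM.
have ie := ii_even R.
set zi := z^-1 in ei hz *.
have al_e : exists y, (e * th * zi * zi) *+ 2 = e * y.
  by exists ((th * zi * zi) *+ 2); rewrite mulrnAr !mulrA.
have mu_e : exists y, - ii R * e * zi * zi = e * y.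
  by exists (- ii R * zi * zi); super [:: e] [:: ii R; zi].
have eal : is_even ((e * th * zi * zi) *+ 2) by apply/evMn; do 2 apply: evM => //.
have omu : is_odd (- ii R * e * zi * zi).
  by do 2 apply: od_evM => //; apply: ev_odM => //; exact: evN.
have m1 (w : Lam) : w * 1 = w /\ w * 1 = w by rewrite mulr1.
have := geo_value oe ez eal omu al_e mu_e (m1 _) (m1 _) pz.
rewrite /tildeE xphiE /= /flow /kinf /linf /minf /uinf.
have ex := @evp_even R p; have of' := @odp_odd R p.
have bx : body (evp p) = body p := body_evp p.
move: (evp p) (odp p) ex of' bx => x f ex of' bx.
have ezx : is_even (1 - z * x) by apply: evB; [exact: ev1|exact: evM].
have bzx : body (1 - z * x) != 0.
  by rewrite bodyD body1 bodyN bodyM bx subr_eq0; apply/eqP => h; rewrite -h cabs1 ltxx in pz.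
have := evrV ezx bzx; have := ev_inv ezx; set U := (1 - z * x)^-1 => eU hU.
rewrite half_double -/zi; apply: sser_at_eq.
apply: (mod_eq (c := - ((e * th * zi * zi * x * U) *+ 2)) hz).
apply: (mod_eq (c := - (e * th * zi * zi * zi) *+ 2) hU).
by super [:: e; th; f] [:: x; z; zi; U; ii R].
Qed.

Lemma setH_geo e al mu c : is_odd e -> is_even c -> is_even al -> is_odd mu ->
  (exists y, al = e * y) -> (exists y, mu = e * y) -> setH (geoAM al mu c).
Proof.
move=> oe ec eal omu ale mue.
have h (w : Lam) : w * 1 = w /\ w * 1 = w by rewrite mulr1.
split=> [j|j|]; [exact: (geo_parity ec eal omu j).1|exact: (geo_parity ec eal omu j).2|].
have K1 : 0 < cabs (body c) + 1 by rewrite ltr_wpDl // cabs_ge0.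
exists (cabs (body c) + 1)^-1; first by rewrite invr_gt0.
move=> p; rewrite /in_ball /= cabs_lt => pr; rewrite /tildeE xphiE; eexists.
apply: (geo_value oe ec eal omu ale mue (h _) (h _)).
rewrite cabsM mulrC; apply: le_lt_trans (_ : cabs (body p) * (cabs (body c) + 1) < 1).
  by rewrite ler_wpM2l ?cabs_ge0 // lerDl.
by rewrite -ltr_pdivlMr // div1r.
Qed.

Lemma single_odd_value j e p : is_odd e ->
  sser_at (tildeE (fun=> 0, single j e)) p
    (evp p + evp p ^+ j.+1 * e + odp p * (1 + evp p ^+ j.+1 * e)).
Proof.
move=> oe; have ex := @evp_even R p.
have eM i : emult e (single j e i).
  by rewrite /single; case: eqP => _; [exists 1; rewrite mulr1|exact: emult0].
have h : genT (fun=> 0, single j e) (genT (fun=> 0, single j e) (xphi R)) = 0.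
  by apply: (emult_genT2 oe) => // i; exact: emult0.
have sE i : single j e i = (i == j)%:R * e by rewrite /single; case: eqP; rewrite ?mul1r ?mul0r.
have d x i : abs_sum (fun n => (n == i)%:R * x) x := abs_sum_delta i x.
have := abs_sumD (abs_sumD (d (evp p) 1%N) (d (evp p ^+ j.+1 * e) j.+1))
  (abs_sumMl (odp p) (abs_sumD (d 1 0%N) (d (evp p ^+ j.+1 * e) j.+1))).
apply: eq_abs_sum => n; rewrite /tildeE expT_nilp2 // sserD1 sserD2.
have E (k : nat) : (n == k)%:R * (evp p ^+ k * e) = evp p ^+ n * ((n == k)%:R * e).
  by case: eqP => [->|_]; rewrite ?mul1r // !mul0r mulr0.
rewrite !mulrDr E; congr (_ + _ + (_ + _)).
- rewrite /xphi /=; case: eqP => [->|_]; first by rewrite mulr1n mul1r expr1 mulr1.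
  by rewrite mul0r mulr0.
- congr (_ * _); rewrite genT1; case: n {E} => [|n]; first by rewrite big_ord0 mul0r.
  rewrite big_ord_recr big1 /= => [|i _].
    by rewrite subnn mul0r !add0r mulr1 sE eqSS.
  by rewrite subSS subn_eq0 leqNgt ltn_ord mul0r mulr0 addr0.
- congr (_ * _); rewrite /xphi /=; case: eqP => [->|_]; first by rewrite expr0.
  by rewrite mul0r mulr0.
have g0 : gconj (0 : Lam) = 0 by rewrite gconj_even //; exact: ev0.
have os i : is_odd (single j e i) by rewrite /single; case: eqP => _ //; exact: od0.
congr (_ * (_ * _)); rewrite genT2; case: n {E} => [|n]; first by rewrite big_ord0 mul0r.
rewrite big_ord_recr big1 /= => [|i _].
  by rewrite add0r g0 mul0r sub0r subSnn mulr1n mulr1 (gconj_odd (os _)) opprK sE eqSS.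
rewrite g0 mul0r sub0r /=.
have -> : (n.+1 - i == 1)%N = false by move: (ltn_ord i); clear; lia.
by rewrite mul0rn mulr0 oppr0.
Qed.

Lemma setH_single_odd j e : is_odd e -> setH (fun=> 0, single j e).
Proof.
move=> oe; split=> [i|i|]; [exact: ev0|by rewrite /= /single; case: eqP => _ //; exact: od0|].
by exists 1 => // p _; eexists; exact: single_odd_value.
Qed.

Lemma seqpair0E : seqpair0 = (fun=> 0, single 0 0) :> seqpair R.
Proof. by congr pair; apply/funext => i; rewrite /single; case: eqP. Qed.
Lemma setH0 : setH (@seqpair0 R).
Proof. by rewrite seqpair0E; apply: setH_single_odd; exact: od0. Qed.
Lemma tildeE0 p : sser_at (tildeE (@seqpair0 R)) p p.
Proof.
rewrite seqpair0E; apply: sser_at_eq (single_odd_value 0 p (@od0 R)).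
by rewrite !mulr0 !addr0 mulr1 evp_odp.
Qed.
Lemma hatE0 p : sser_at (hatE 1 (@seqpair0 R)) p p.
Proof.
by rewrite /hatE pow_xphiE mul1r -xphiE; exact: tildeE0.
Qed.
Lemma tildeE_cap e p : is_odd e ->
  sser_at (tildeE (fun=> 0, fun j => - ('i *: single 1 e j))) p (cap_coord e p).
Proof.
move=> oe; have -> : (fun j => - ('i *: single 1 e j)) = single 1 (- ii R * e).
  apply/funext => j; rewrite /single ii_scale; case: eqP; rewrite ?mulr0 ?oppr0 ?mulNr //.
have oie : is_odd (- ii R * e) by apply: ev_odM => //; apply/evN/ii_even.
apply: sser_at_eq (single_odd_value 1 p oie); rewrite /cap_coord /flow.
have ex := @evp_even R p; have of' := @odp_odd R p; have ie := ii_even R; have o0 := @od0 R.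
move: (evp p) (odp p) ex of' => x f ex of'.
by super [:: e; f] [:: x; ii R].
Qed.
End SeriesValues.

(** * Convergence of the tubes with one even scalar parameter *)

Section ScalarTube.
Variable R : realType.
Local Notation C := (cplx R).
Local Notation Lam := (grassmann C).
Implicit Types (x y z p q e c th : Lam) (u v w : sser R) (AM : seqpair R) (G I : {fset nat}).

Definition supported G x := forall I, ~~ (I `<=` G)%fset -> x I = 0.
Lemma supportedM G x y : supported G x -> supported G y -> supported G (x * y).
Proof.
move=> hx hy I nI; rewrite grME big1_seq // => J /=; rewrite fpowersetE => JI.
have [JG|nJG] := boolP (J `<=` G)%fset; last by rewrite hx // mul0r mulr0.
rewrite hy ?mulr0 //; apply: contra nI => IJG; rewrite -(fsetID J I) fsubUset IJG andbT.
exact: fsubset_trans (fsubsetIr _ _) JG.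
Qed.
Lemma supported1 G : supported G 1.
Proof. by move=> I nI; rewrite gr1E; case: eqP nI => // ->; rewrite fsub0set. Qed.
Lemma supportedX G x n : supported G x -> supported G (x ^+ n).
Proof.
by move=> h; elim: n => [|n IH]; rewrite ?expr0 ?exprS; [exact: supported1|exact: supportedM].
Qed.

(** Componentwise sums define an element of the algebra only if its support is finite; a common
    finite set G of generators guarantees this. *)
Lemma abs_sum_ex G (f : nat -> Lam) : (forall n, supported G (f n)) ->
  (forall I, exists s, csum (fun n => f n I : C) s) -> exists s, abs_sum f s.
Proof.
move=> fG h; have [s hs] := choice h.
exists [fsfun I in fpowerset G => s I]; apply/abs_sumP => I; rewrite fsfunE fpowersetE.
case: ifPn => // nI; apply: eq_csum (@csum0 R) => n; exact/esym/fG.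
Qed.

Lemma scalar_series_sum x (a : nat -> C) (B : R) : is_even x -> 0 <= B ->
  (forall n, cabs (a n) <= 2 * B ^+ n) -> cabs (body x) * B < 1 ->
  exists s, abs_sum (fun n => x ^+ n * (a n)%:A) s.
Proof.
move=> ex B0 ha xB.
have E n : x ^+ n * (a n)%:A = a n *: x ^+ n by rewrite mulr_algr.
suff [s hs] : exists s, abs_sum (fun n => a n *: x ^+ n) s.
  by exists s; apply: eq_abs_sum hs => n; rewrite E.
apply: (@abs_sum_ex (gens x)) => [n I nI|I].
  rewrite grZE (supportedX n _ nI) ?mulr0 // => J; apply: contraNeq; exact: gensP.
have [eps eps0 hB] := ex_small B0 (ltac:(by rewrite subr_gt0) : 0 < 1 - cabs (body x) * B).
have [lam l0 hl] := gnorm_lt I (ltac:(by rewrite ltrDl) : cabs (body x) < cabs (body x) + eps).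
have lI : 0 < lam ^+ #|` I|%fset by rewrite exprn_gt0.
set rho := gnorm lam I x in hl; have r0 : 0 <= rho by rewrite gnorm_ge0.
have q1 : rho * B < 1.
  apply: le_lt_trans (_ : (cabs (body x) + eps) * B < 1); first by rewrite ler_wpM2r // ltW.
  by rewrite mulrDl -ltrBrDl.
apply: (@csum_dom R _ (fun n => 2 / lam ^+ #|` I|%fset * (rho * B) ^+ n)
  (2 / lam ^+ #|` I|%fset * (1 - rho * B)^-1)) => [n|n].
  rewrite grZE cabsM exprMn.
  apply: le_trans (_ : 2 * B ^+ n * (rho ^+ n / lam ^+ #|` I|%fset) <= _).
    rewrite ler_pM ?cabs_ge0 // ler_pdivlMr //.
    apply: le_trans (gnormX I l0 x n); apply: gnorm_comp => //.
  by rewrite le_eqVlt; apply/orP; left; apply/eqP; ring.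
rewrite -mulr_sumr ler_wpM2l ?divr_ge0 ?(ltW lI) // geom_sum //.
by rewrite mulr_ge0.
Qed.

Section SingleScalar.
Variables (j : nat) (t : C).
Let AM : seqpair R := (single j t%:A, fun=> 0).

(** Here the parameter is not nilpotent, but a single generator L_(j+1) sends a monomial to a scalar
    multiple of one monomial, so all the powers are explicit. *)
Lemma single_scalar_iter l n :
  (iter l (genT AM) (xphi R)).1 n =
    (n == (l * j.+1).+1)%:R * (t ^+ l * \prod_(i < l) (i * j.+1).+1%:R)%:A /\
  (iter l (genT AM) (xphi R)).2 n =
    (n == l * j.+1)%N%:R * (t ^+ l * \prod_(i < l) ((i * j.+1)%:R + j.+2%:R / 2))%:A.
Proof.
have g0 : gconj (0 : Lam) = 0 by rewrite gconj_even //; exact: ev0.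
have gt : gconj (t%:A : Lam) = t%:A by rewrite gconj_even //; exact: evA.
elim: l n => [|l IH] n; first by rewrite !big_ord0 /= mul0n expr0 mulr1 scale1r !mulr1.
have sumE (F : nat -> Lam) : (forall i, i != j -> F i = 0) ->
    \sum_(i < n) F i = if (j < n)%N then F j else 0.
  move=> F0; case: ifP => jn.
    by rewrite (bigD1 (Ordinal jn)) //= big1 ?addr0 // => i ij; apply: F0.
  rewrite big1 // => i _; apply: F0; apply/eqP => ij; move: (ltn_ord i).
  by rewrite ij jn.
have sj : single j (t%:A : Lam) j = t%:A by rewrite /single eqxx.
have s0 i : i != j -> single j (t%:A : Lam) i = 0 by rewrite /single => /negPf->.
split; rewrite iterS; move: (iter l (genT AM) (xphi R)) IH => u IH.
  apply: (etrans (genT1 AM u n)).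
  rewrite (sumE (fun i => AM.1 i * (u.1 (n - i.+1)%N *+ (n - i.+1)) + AM.2 i * u.2 (n - i.+1)%N)).
    rewrite /= sj mul0r addr0; case: ifP => jn; last first.
      have -> : (n == (l.+1 * j.+1).+1) = false by (move: jn; clear; lia). by rewrite mul0r.
    rewrite (IH _).1 big_ord_recr /= exprS.
    have -> : (n - j.+1 == (l * j.+1).+1)%N = (n == (l.+1 * j.+1).+1) by move: jn; clear; lia.
    case: eqP => [->|_]; last by rewrite !mul0r mul0rn mulr0.
    have -> : ((l.+1 * j.+1).+1 - j.+1 = (l * j.+1).+1)%N by clear; lia.
    rewrite !mul1r mulr_algl scalerMnl scalerA; congr (_ *: _).
    by rewrite -mulr_natr; ring.
  by move=> i ij; rewrite /= s0 // !mul0r addr0.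
apply: (etrans (genT2 AM u n)).
rewrite (sumE (fun i => gconj (AM.1 i) * (u.2 (n - i.+1)%N *+ (n - i.+1) + (i.+2%:R / 2 : C) *: u.2 (n - i.+1)%N)
  - gconj (AM.2 i) * (u.1 (n - i)%N *+ (n - i)))).
  rewrite /= sj gt g0 mul0r subr0; case: ifP => jn; last first.
    have -> : (n == (l.+1 * j.+1))%N = false by (move: jn; clear; lia). by rewrite mul0r.
  rewrite (IH _).2 big_ord_recr /= exprS.
  have -> : (n - j.+1 == l * j.+1)%N = (n == l.+1 * j.+1)%N by move: jn; clear; lia.
  case: eqP => [->|_]; last by rewrite !mul0r mul0rn scaler0 addr0 mulr0.
  have -> : (l.+1 * j.+1 - j.+1 = l * j.+1)%N by clear; lia.
  rewrite !mul1r mulr_algl scalerMnl scalerA -scalerDl scalerA; congr (_ *: _).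
  by rewrite -mulr_natr; ring.
by move=> i ij; rewrite /= s0 // g0 !mul0r subr0.
Qed.

Lemma prod_fact_bound (f : nat -> C) l : (forall i, cabs (f i) <= i.+1%:R * j.+1%:R) ->
  cabs (l`!%:R^-1 * \prod_(i < l) f i) <= j.+1%:R ^+ l.
Proof.
move=> hf; rewrite cabsM cabsV cabs_nat mulrC ler_pdivrMr ?ltr0n ?fact_gt0 //.
elim: l => [|l IH]; first by rewrite big_ord0 cabs1 expr0 mul1r.
rewrite big_ord_recr cabsM exprSr factS natrM.
apply: le_trans (ler_pM (cabs_ge0 _) (cabs_ge0 _) IH (hf l)) _.
by rewrite le_eqVlt; apply/orP; left; apply/eqP; ring.
Qed.

Let B := 1 + cabs t * j.+1%:R.
(** A nonzero term has l <= P l = n, hence modulus at most B^n since B >= 1; there are 2 (n + 1) <=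
    2 * 2^n terms. *)
Lemma coef_bound (f : nat -> C) (P : nat -> nat) n : (forall i, cabs (f i) <= i.+1%:R * j.+1%:R) ->
  (forall l, l <= P l)%N ->
  cabs (\sum_(l < n.*2.+2) (n == P l)%:R * (l`!%:R^-1 * (t ^+ l * \prod_(i < l) f i))) <= 2 * (2 * B) ^+ n.
Proof.
move=> hf hP; have B0 : 0 <= cabs t * j.+1%:R by rewrite mulr_ge0 ?cabs_ge0.
have B1 : 1 <= B by rewrite lerDl.
have BB : cabs t * j.+1%:R <= B by rewrite /B lerDr.
have n2 : (n.+1 <= 2 ^ n)%N by exact: ltn_expl.
apply: (le_trans (cabs_sum _ _ _)); apply: (@le_trans _ _ (\sum_(l < n.*2.+2) B ^+ n)).
  apply: ler_sum => l _; case: eqP => [/esym nl|_]; last first.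
    by rewrite mul0r cabs0 exprn_ge0 // (le_trans _ B1).
  have ln := hP l; rewrite nl in ln.
  rewrite mul1r mulrCA cabsM cabsX.
  apply: (le_trans (ler_wpM2l (exprn_ge0 _ (cabs_ge0 t)) (prod_fact_bound _ hf))).
  rewrite -exprMn; apply: (@le_trans _ _ (B ^+ l)); last by rewrite ler_weXn2l.
  by rewrite lerXn2r ?nnegrE // (le_trans _ B1).
rewrite sumr_const card_ord -[leLHS]mulr_natl exprMn mulrA ler_wpM2r ?exprn_ge0 ?(le_trans _ B1) //.
by rewrite -natrX -natrM ler_nat; lia.
Qed.

Lemma setH_single_scalar : setH AM.
Proof.
split=> [i|i|]; [|exact: od0|].
  by rewrite /= /single; case: eqP => _; [exact: evA|exact: ev0].
have B1 : 0 < 2 * B.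
  by rewrite mulr_gt0 // ltr_pwDl // mulr_ge0 ?cabs_ge0.
exists (2 * B)^-1 => [|p]; rewrite ?invr_gt0 // /in_ball /= cabs_lt => pr.
have ex := @evp_even R p.
have small : cabs (body (evp p)) * (2 * B) < 1 by rewrite body_evp -ltr_pdivlMr // div1r.
pose a n : C := \sum_(l < n.*2.+2) (n == (l * j.+1).+1)%:R * (l`!%:R^-1 * (t ^+ l * \prod_(i < l) (i * j.+1).+1%:R)).
pose b n : C := \sum_(l < n.*2.+2) (n == l * j.+1)%N%:R * (l`!%:R^-1 * (t ^+ l * \prod_(i < l) ((i * j.+1)%:R + j.+2%:R / 2))).
have ha n : cabs (a n) <= 2 * (2 * B) ^+ n.
  apply: (coef_bound (f := fun i => (i * j.+1).+1%:R) (P := fun l => (l * j.+1).+1)) => [i|l].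
    by rewrite cabs_nat -natrM ler_nat; lia.
  lia.
have hb n : cabs (b n) <= 2 * (2 * B) ^+ n.
  apply: (coef_bound (f := fun i => (i * j.+1)%:R + j.+2%:R / 2) (P := fun l => (l * j.+1)%N)) => [i|l].
    apply: (le_trans (cabsD _ _)); rewrite cabsM cabsV !cabs_nat -natrM.
    rewrite -lerBrDl -natrB; last lia.
    by rewrite ler_pdivrMr // -natrM ler_nat; lia.
  lia.
have [s1 h1] := scalar_series_sum ex (ltW B1) ha small.
have [s2 h2] := scalar_series_sum ex (ltW B1) hb small.
exists (s1 + odp p * s2); apply: eq_abs_sum (abs_sumD h1 (abs_sumMl (odp p) h2)) => n.
congr (_ ^+ _ * _ + _ * (_ ^+ _ * _)); rewrite /tildeE /expT /= scaler_suml; apply: eq_bigr => l _.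
  rewrite (single_scalar_iter l n).1; case: eqP => _; last by rewrite !mul0r scaler0 scale0r.
  by rewrite !mul1r scalerA.
rewrite (single_scalar_iter l n).2; case: eqP => _; last by rewrite !mul0r scaler0 scale0r.
by rewrite !mul1r scalerA.
Qed.

End SingleScalar.
End ScalarTube.

(** * An exponential determines its parameters *)

Section Injectivity.
Variable R : realType.
Local Notation C := (cplx R).
Local Notation Lam := (grassmann C).
Implicit Types (x y z p q e c th : Lam) (u v w : sser R) (AM : seqpair R).

Lemma sser_scalar_coef u u' (r : R) : 0 < r ->
  (forall t : C, cabs t < r -> exists2 s, sser_at u t%:A s & sser_at u' t%:A s) ->
  u.1 =1 u'.1.
Proof.
move=> r0 h n; apply/grP => I.
have parts (t : C) : evp (t%:A : Lam) = t%:A /\ odp (t%:A : Lam) = 0.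
  by rewrite even_evp ?even_odp //; exact: evA.
have term (v : sser R) (t : C) m : (evp (t%:A : Lam) ^+ m * v.1 m + odp (t%:A : Lam) * (evp (t%:A : Lam) ^+ m * v.2 m)) I =
    v.1 m I * t ^+ m.
  by rewrite (parts t).1 (parts t).2 mul0r addr0 exprZn expr1n mulr_algl grZE mulrC.
have hs : forall t : C, exists s : Lam, cabs t < r -> sser_at u t%:A s /\ sser_at u' t%:A s.
  move=> t; case: (pselect (cabs t < r)) => [/h[s hu hu']|nr]; first by exists s.
  by exists 0.
have [s {}hs] := choice hs.
have ps (v : sser R) : (forall t : C, cabs t < r -> sser_at v t%:A (s t)) ->
    pseries (fun m => v.1 m I) r (fun t => s t I) 0.
  move=> hv; split=> // t tr; rewrite add0r.
  by have /abs_sumP/(_ I) := hv t tr; apply: eq_csum => m; rewrite term.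
apply: (pseries_uniq (ps u _) (ps u' _)) => t tr; [exact: (hs t tr).1|exact: (hs t tr).2].
Qed.

(** At an odd generator the even part is 0, so the series reduces to u.1 0 + zeta_i u.2 0, and
    freshness of the generator cancels it. *)
Lemma sser_zeta_coef u u' i s : i \notin gens (u.2 0%N - u'.2 0%N) -> u.1 0%N = u'.1 0%N ->
  sser_at u (zeta R i) s -> sser_at u' (zeta R i) s -> u.2 0%N = u'.2 0%N.
Proof.
move=> fi e1 h h'; have oz := zeta_odd R i.
have term (v : sser R) : abs_sum (fun n => evp (zeta R i) ^+ n * v.1 n +
    odp (zeta R i) * (evp (zeta R i) ^+ n * v.2 n)) (v.1 0%N + zeta R i * v.2 0%N).
  rewrite (odd_evp oz) (odd_odp oz).
  have := @abs_sum_fin R (fun n => 0 ^+ n * v.1 n + zeta R i * (0 ^+ n * v.2 n)) 1%N.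
  rewrite big_ord1 expr0 !mul1r; apply=> -[|n] // _.
  by rewrite exprS !mul0r mulr0 addr0.
have := abs_sum_uniq (term u) h; rewrite -(abs_sum_uniq (term u') h') e1 => /addrI E.
apply/eqP; rewrite -subr_eq0; apply/eqP; apply: zeta_inj fi _.
by rewrite mulrBr E subrr.
Qed.

Lemma expT_1 AM u n : (expT AM u).1 n =
  \sum_(l < n.*2.+2) (l`!%:R^-1 : C) *: (iter l (genT AM) u).1 n.
Proof. by []. Qed.
Lemma expT_linear AM b d : (expT AM (linear_sser b d)).2 0%N = d /\
  (expT AM (linear_sser b d)).1 0%N = 0.
Proof.
have E (f : sser R -> nat -> Lam) : f (genT AM (linear_sser b d)) 0%N = 0 ->
    \sum_(l < 0.*2.+2) (l`!%:R^-1 : C) *: f (iter l (genT AM) (linear_sser b d)) 0%N =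
    f (linear_sser b d) 0%N.
  move=> f0; rewrite big_ord_recr big_ord_recr big_ord0 /= f0 scaler0 addr0 add0r.
  by rewrite fact0 invr1 scale1r.
split.
  apply: etrans (E (fun v n => v.2 n) _) _; first by rewrite genT2 big_ord0.
  by rewrite /= mul1r.
apply: etrans (E (fun v n => v.1 n) _) _; first by rewrite genT1 big_ord0.
by rewrite /= mul0r.
Qed.

Section Agreement.
Variables (AM AM' : seqpair R) (b d : Lam).
Hypotheses (eA : forall j, is_even (AM.1 j)) (eA' : forall j, is_even (AM'.1 j)).
Hypotheses (oM : forall j, is_odd (AM.2 j)) (oM' : forall j, is_odd (AM'.2 j)).
Hypotheses (eb : is_even b) (ed : is_even d) (bb : body b != 0) (bd : body d != 0).
Let w := linear_sser b d.
Let u l := iter l (genT AM) w.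
Let u' l := iter l (genT AM') w.

Lemma genT_low_agree j v v' : (forall i, (i < j)%N -> AM.1 i = AM'.1 i /\ AM.2 i = AM'.2 i) ->
  (forall n, (n <= j)%N -> v.1 n = v'.1 n /\ v.2 n = v'.2 n) ->
  forall n, (n <= j)%N -> (genT AM v).1 n = (genT AM' v').1 n /\ (genT AM v).2 n = (genT AM' v').2 n.
Proof.
move=> hA hv n nj; have ind (i : 'I_n) : (i < j)%N by exact: leq_trans (ltn_ord i) nj.
have hs k : (n - k <= j)%N by exact: leq_trans (leq_subr _ _) nj.
split.
  apply: etrans (genT1 AM v n) (etrans _ (esym (genT1 AM' v' n))); apply: eq_bigr => i _.
  by rewrite (hA i (ind i)).1 (hA i (ind i)).2 (hv _ (hs i.+1)).1 (hv _ (hs i.+1)).2.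
apply: etrans (genT2 AM v n) (etrans _ (esym (genT2 AM' v' n))); apply: eq_bigr => i _.
by rewrite (hA i (ind i)).1 (hA i (ind i)).2 (hv _ (hs i.+1)).2 (hv _ (hs i)).1.
Qed.

Lemma iter_low_agree j l : (forall i, (i < j)%N -> AM.1 i = AM'.1 i /\ AM.2 i = AM'.2 i) ->
  forall n, (n <= j)%N -> (u l).1 n = (u' l).1 n /\ (u l).2 n = (u' l).2 n.
Proof.
move=> hA; elim: l => [|l IH] n nj; first by split; reflexivity.
exact: (genT_low_agree hA IH nj).
Qed.

Lemma genT_two_0 v (AN : seqpair R) : (genT AN v).2 0%N = 0.
Proof. by apply: etrans (genT2 AN v 0) _; rewrite big_ord0. Qed.

Lemma genT_top1 j v v' : (forall i, (i < j)%N -> AM.1 i = AM'.1 i /\ AM.2 i = AM'.2 i) ->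
  (forall n, (n <= j)%N -> v.1 n = v'.1 n /\ v.2 n = v'.2 n) ->
  (genT AM v).1 j.+1 - (genT AM' v').1 j.+1 = (AM.2 j - AM'.2 j) * v.2 0%N.
Proof.
move=> hA hv; have := genT1 AM v j.+1; have := genT1 AM' v' j.+1.
rewrite !big_ord_recr /= !subnn !mulr0n !mulr0 !add0r => -> ->.
rewrite (hv 0%N (leq0n _)).2 opprD addrACA mulrBl.
rewrite -[RHS]add0r; congr (_ + _); apply/eqP; rewrite subr_eq0; apply/eqP.
apply: eq_bigr => i _ /=; have ij := ltn_ord i.
have hs : (j.+1 - i.+1 <= j)%N by rewrite subSS leq_subr.
by rewrite (hA i ij).1 (hA i ij).2 (hv _ hs).1 (hv _ hs).2.
Qed.

Lemma expT_diff n : (expT AM w).1 n - (expT AM' w).1 n =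
  \sum_(l < n.*2.+2) (l`!%:R^-1 : C) *: ((u l).1 n - (u' l).1 n).
Proof. by rewrite !expT_1 -sumrB; apply: eq_bigr => l _; rewrite -scalerBr. Qed.

Lemma sum_trunc3 (D : nat -> Lam) m : D 0%N = 0 -> (forall l, D l.+3 = 0) ->
  \sum_(l < m.+3) (l`!%:R^-1 : C) *: D l = D 1%N + (2^-1 : C) *: D 2%N.
Proof.
move=> D0 D3; do 3 rewrite big_ord_recl; rewrite big1 => [|l _].
  by rewrite /= D0 scaler0 add0r addr0 invr1 scale1r.
by rewrite !lift0 D3 scaler0.
Qed.

(** With the lower parameters equal, the coefficients of x^(j+1) differ by (M j - M' j) d, through
    the first power of the generator, and d is invertible. *)
Lemma M_agree j : (forall i, (i < j)%N -> AM.1 i = AM'.1 i /\ AM.2 i = AM'.2 i) ->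
  (expT AM w).1 j.+1 = (expT AM' w).1 j.+1 -> AM.2 j = AM'.2 j.
Proof.
move=> hA /eqP; rewrite -subr_eq0 expT_diff.
have D l : (u l.+1).1 j.+1 - (u' l.+1).1 j.+1 = (AM.2 j - AM'.2 j) * (u l).2 0%N.
  exact: (genT_top1 hA (fun n => @iter_low_agree j l hA n)).
have z0 l : (u l.+1).2 0%N = 0 by exact: genT_two_0.
have u02 : (u 0).2 0%N = d by rewrite /= mul1r.
rewrite (sum_trunc3 (D := fun l => (u l).1 j.+1 - (u' l).1 j.+1)) => [||l].
- rewrite !D z0 mulr0 scaler0 addr0 u02 => /eqP h.
  by apply/eqP; rewrite -subr_eq0 -[X in X == 0](mulrK (ev_unit ed bd)) h mul0r.
- exact: subrr.
by rewrite D z0 mulr0.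
Qed.

(** The coefficient of x^(j+2) also involves M (j + 1), which is not known to agree yet. Parity
    separates the two: the contribution (A j - A' j) b is even and all the others are odd. *)
Lemma A_agree j : (forall i, (i < j)%N -> AM.1 i = AM'.1 i /\ AM.2 i = AM'.2 i) ->
  AM.2 j = AM'.2 j -> (expT AM w).1 j.+2 = (expT AM' w).1 j.+2 -> AM.1 j = AM'.1 j.
Proof.
move=> hA hM.
have hv l := iter_low_agree l hA.
have hv1 l : (u l).1 j.+1 = (u' l).1 j.+1.
  case: l => [|l]; first by reflexivity.
  apply/eqP; rewrite -subr_eq0; apply/eqP; apply: etrans (genT_top1 hA (hv l)) _.
  by rewrite hM subrr mul0r.
have hM' i : (i <= j)%N -> AM.2 i = AM'.2 i.
  by rewrite leq_eqVlt => /orP[/eqP->//|/hA[]].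
have hv1' l : (u l).1 1%N = (u' l).1 1%N.
  by case: (posnP j) => [j0|j0]; [rewrite -[1%N](congr1 S j0); exact: hv1|exact: (hv l 1%N j0).1].
have hu l k : (u l).1 (j.+1 - k)%N = (u' l).1 (j.+1 - k)%N.
  by case: k => [|k]; [exact: hv1|apply: (hv l _ _).1; rewrite subSS leq_subr].
pose dA := AM.1 j - AM'.1 j; pose dM := AM.2 j.+1 - AM'.2 j.+1.
have top2 l : (u l.+1).2 j.+1 - (u' l.+1).2 j.+1 =
    dA * ((j.+2%:R / 2 : C) *: (u l).2 0%N).
  apply: etrans (congr2 (fun a b => a - b) (genT2 AM (u l) j.+1) (genT2 AM' (u' l) j.+1)) _.
  rewrite !big_ord_recr /= !subnn !mulr0n !add0r.
  rewrite opprD addrACA hM subSnn (hv1' l) (hv l 0%N (leq0n _)).2.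
  rewrite !(gconj_even (eA _)) !(gconj_even (eA' _)) [X in _ + X](_ : _ = dA * ((j.+2%:R / 2 : C) *: (u' l).2 0%N)).
    rewrite -[RHS]add0r; congr (_ + _); apply/eqP; rewrite subr_eq0; apply/eqP.
    apply: eq_bigr => i _ /=; have ij := ltn_ord i.
    have hs : (j.+1 - i.+1 <= j)%N by rewrite subSS leq_subr.
    by rewrite (hA i ij).1 (hA i ij).2 (hv l _ hs).2 (hu l i); reflexivity.
  by rewrite opprB addrA subrK -mulrBl.
have split1 v AN : (genT AN v).1 j.+2 =
    (\sum_(i < j) AN.1 i * (v.1 (j.+1 - i)%N *+ (j.+1 - i)) + AN.1 j * v.1 1%N) +
    (AN.2 0%N * v.2 j.+1 + \sum_(i < j) AN.2 i.+1 * v.2 (j - i)%N + AN.2 j.+1 * v.2 0%N).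
  apply: (etrans (genT1 AN v j.+2)); rewrite big_split /=; congr (_ + _).
    by rewrite !big_ord_recr /= subnn mulr0n mulr0 addr0 subSnn mulr1n.
  by rewrite big_ord_recr big_ord_recl /= subnn.
have top1 l : (u l.+1).1 j.+2 - (u' l.+1).1 j.+2 =
    dA * (u l).1 1%N + dM * (u l).2 0%N + AM.2 0%N * ((u l).2 j.+1 - (u' l).2 j.+1).
  apply: etrans (congr2 (fun a b => a - b) (split1 (u l) AM) (split1 (u' l) AM')) _.
  have E1 : \sum_(i < j) AM.1 i * ((u l).1 (j.+1 - i)%N *+ (j.+1 - i)) =
            \sum_(i < j) AM'.1 i * ((u' l).1 (j.+1 - i)%N *+ (j.+1 - i)).
    by apply: eq_bigr => i _; rewrite (hA i (ltn_ord i)).1 (hu l i); reflexivity.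
  have E2 : \sum_(i < j) AM.2 i.+1 * (u l).2 (j - i)%N = \sum_(i < j) AM'.2 i.+1 * (u' l).2 (j - i)%N.
    apply: eq_bigr => i _; have ij := ltn_ord i; rewrite (hv l _ (leq_subr _ _)).2.
    by rewrite (hM' i.+1 ij).
  rewrite E1 E2 (hM' 0%N (leq0n _)) (hv1' l) (hv l 0%N (leq0n _)).2 /dA /dM mulrBr !mulrBl.
  set a1 := \sum_(i < j) _; set a2 := \sum_(i < j) _.
  by set x1 := AM'.2 0%N * _; set x2 := AM'.2 0%N * _; clear; gr_lin.
have z0 l : (u l.+1).2 0%N = 0 by exact: genT_two_0.
have one1 l : (u l.+1).1 1%N = AM.2 0%N * (u l).2 0%N.
  apply: etrans (genT1 AM (u l) 1) _.
  by rewrite big_ord1 subnn mulr0n mulr0 add0r.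
move=> /eqP; rewrite -subr_eq0 expT_diff.
rewrite (sum_trunc3 (D := fun l => (u l).1 j.+2 - (u' l).1 j.+2)) => [||l]; last 2 first.
- exact: subrr.
- by rewrite top1 top2 one1 !z0 !(mulr0, scaler0, addr0).
rewrite !top1 top2 one1 !z0.
have [-> -> ->] : [/\ (u 0).1 1%N = b, (u 0).2 0%N = d & (u 0).2 j.+1 - (u' 0).2 j.+1 = 0].
  by split; [rewrite /= mul1r|rewrite /= mul1r|exact: subrr].
rewrite !(mulr0, addr0) -addrA => /eqP h.
have edA : is_even dA by exact: evB.
have e1 : is_even (dA * b) by exact: evM.
have o1 : is_odd (dM * d) by apply: od_evM => //; exact: odB.
have o2 : is_odd (dA * (AM.2 0%N * d)) by apply: ev_odM => //; exact: od_evM.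
have o3 : is_odd (AM.2 0%N * (dA * ((j.+2%:R / 2 : C) *: d))).
  by apply: od_evM => //; apply: evM => //; exact: evZ.
have h0 : dA * b = 0.
  rewrite -(@evp_add R _ _ e1 (odD o1 (odZ (2^-1 : C) (odD o2 o3)))) h even_evp //; exact: ev0.
by apply/eqP; rewrite -subr_eq0 -/dA -[X in X == 0](mulrK (ev_unit eb bb)) h0 mul0r.
Qed.

(** The components [.1] suffice: the coefficient of x^(j+1) yields M j, and then that of x^(j+2)
    yields A j. *)
Lemma expT_inj : (forall n, (expT AM w).1 n = (expT AM' w).1 n) -> AM = AM'.
Proof.
move=> h; have A j : forall i, (i < j)%N -> AM.1 i = AM'.1 i /\ AM.2 i = AM'.2 i.
  elim: j => [|j IH] i //; rewrite ltnS leq_eqVlt => /orP[/eqP->|/IH//].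
  have hM := M_agree IH (h j.+1); split=> //; exact: A_agree IH hM (h j.+2).
move: A {h}; case: AM AM' => [a m] [a' m'] A.
by congr pair; apply/funext => j; have [] := A j.+1 j (ltnSn j).
Qed.
End Agreement.
End Injectivity.

(** * Surfaces modelled on the super-Riemann sphere *)

Section Charts.
Variable R : realType.
Local Notation C := (cplx R).
Local Notation Lam := (grassmann C).
Local Notation shift := (@Defs.shift R).
Implicit Types (x y z p q e th a : Lam) (V W : set C) (m n H : Lam -> Lam).

Lemma SA_flow_comp e th V phi k l m : SA V phi -> SA V (fun p => k (evp (phi p))) ->
  SA V (fun p => l (evp (phi p))) -> SA V (fun p => m (evp (phi p))) ->
  SA V (fun p => flow e th k l m (phi p)).
Proof.
move=> h hk hl hm; have oV := SA_open h; have hx := SA_evp h; have hp := SA_odp h.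
have cst x := SA_cst x oV.
apply: SA_add; apply: SA_add.
- by apply: SA_sub2 => //; apply: SA_mul => //; exact: SA_mul.
- apply: SA_ext (SA_scale 2 (SA_mul (cst (e * th)) hl)) => p _.
  by rewrite scaler_nat.
- by apply: SA_add => //; exact: SA_mul.
- by apply: SA_mul => //; exact: SA_mul.
Qed.

(* Closure under precomposition replaces a composition theorem for SA. *)
Definition SAc W H := forall V phi, SA V phi -> (forall p, V (body p) -> W (body (phi p))) ->
  SA V (fun p => H (phi p)).

Lemma SAc_SA W H : open W -> SAc W H -> SA W H.
Proof. by move=> oW h; apply: h => //; exact: SA_id. Qed.
Lemma SAc_comp W W' H H' : SAc W H -> SAc W' H' -> (forall p, W (body p) -> W' (body (H p))) ->
  SAc W (fun p => H' (H p)).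
Proof. by move=> h h' hb V phi hphi hV; apply: h' => [|p /hV/hb//]; exact: h. Qed.
Lemma SAc_sub W W' H : W' `<=` W -> SAc W H -> SAc W' H.
Proof. by move=> s h V phi hphi hV; apply: h => // p /hV/s. Qed.
Lemma SAc_gconj W : SAc W (@gconj R). Proof. by move=> V phi hphi _; exact: SA_gconj. Qed.
Lemma SAc_inversionI : SAc [set b : C | b != 0] (@inversionI R).
Proof. by move=> V phi hphi hV; exact: SA_inversionI. Qed.
Lemma SAc_shift q W : SAc W (shift q). Proof. by move=> V phi hphi _; exact: SA_shift. Qed.
Lemma SAc_unshift q W : SAc W (unshift q). Proof. by move=> V phi hphi _; exact: SA_unshift. Qed.

Lemma SAc_translation e th z W : SAc W (translation e th z).
Proof.
move=> V phi h _; have oV := SA_open h; have cst x := SA_cst x oV.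
by apply: SA_flow_comp.
Qed.
Lemma SAc_cap e W : SAc W (cap_coord e).
Proof.
move=> V phi h _; have oV := SA_open h; have cst x := SA_cst x oV.
apply: SA_flow_comp => //; apply: SA_mul; [apply: SA_mul => //|]; exact: SA_evp.
Qed.
Lemma SAc_kappa e th z : is_even z -> SAc [set b : C | b != body z] (kappa e th z).
Proof.
move=> ez V phi h hV; have oV := SA_open h; have cst x := SA_cst x oV.
have hi : SA V (fun p => (evp (phi p) - z)^-1).
  apply: SA_inv => [|p /hV /= bp]; first by apply: SA_sub2 => //; exact: SA_evp.
  by split; [apply: evB => //; exact: evp_even|rewrite bodyD bodyN body_evp subr_eq0].
apply: SA_flow_comp => //; rewrite /hfin /hfin'; try exact: SA_add.
by apply/SA_opp/SA_mul.
Qed.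
Lemma SAc_kappa_inf e th z : is_even z -> SAc [set b : C | 1 - body z * b != 0] (kappa_inf e th z).
Proof.
move=> ez V phi h hV; have oV := SA_open h; have cst x := SA_cst x oV; have hx := SA_evp h.
have hi : SA V (fun p => uinf z (evp (phi p))).
  apply: SA_inv => [|p /hV /= bp]; first by apply: SA_sub2 => //; exact: SA_mul.
  split; last by rewrite bodyD body1 bodyN bodyM body_evp.
  by apply: evB; [exact: ev1|apply: evM => //; exact: evp_even].
apply: SA_flow_comp => //.
- by apply: SA_mul => //; exact: SA_sub2.
- by apply: SA_sub2; [exact: SA_mul|apply: SA_mul => //; exact: SA_sub2].
- by apply: SA_mul => //; apply: SA_sub2 => //; exact: SA_mul.
Qed.

Lemma SA_body V H p q : SA V H -> V (body p) -> body q = body p -> body (H q) = body (H p).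
Proof.
move=> [f [g [_ _ h]]] Vp qp; rewrite !h ?qp // !bodyD !bodyM !body_odp !mul0r !addr0.
by rewrite !body_taylor ?body_evp ?qp //; exact: evp_even.
Qed.

Lemma bodyA1 (t : C) : body (t%:A : Lam) = t.
Proof. by rewrite bodyZ body1 mulr1. Qed.

Lemma SA_open_pre V W H : SA V H -> open W -> open [set b | V b /\ W (body (H b%:A))].
Proof.
move=> h oW; have oV := SA_open h; apply/openP => b [Vb Wb].
have pid : anpath (fun t => (b + t)%:A : Lam).
  by apply: anpath_scalar; apply: anD; [exact: an_cst|exact: an_id].
have b0 : body ((b + 0)%:A : Lam) = b by rewrite addr0 bodyA1.
have V0 : V (body ((b + 0)%:A : Lam)) by rewrite b0.
have [r r0 hr] := anpath_in oV pid V0.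
have W0 : W (body (H (b + 0)%:A)) by rewrite addr0.
have [r' r'0 hr'] := anpath_in oW (SA_anpath h pid V0) W0.
exists (Num.min r r'); first by rewrite lt_min r0.
move=> t; rewrite lt_min => /andP[tr tr']; split; last exact: hr'.
by have := hr t tr; rewrite bodyA1.
Qed.

(** Isomorphisms of DeWitt open sets in a form that composes directly; [SA_superconformal] converts
    them into superconformal maps when needed. *)
Record gpair W V m n : Prop := Gpair {
  gp_oW : open W; gp_oV : open V; gp_SA : SAc W m; gp_SAi : SAc V n;
  gp_sc : sc_preserving W m; gp_sci : sc_preserving V n;
  gp_K : forall a, W (body a) -> V (body (m a)) /\ n (m a) = a;
  gp_Ki : forall a, V (body a) -> W (body (n a)) /\ m (n a) = a }.

Lemma gpair_id W : open W -> gpair W W id id.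
Proof. by move=> oW; split=> //; move=> p q. Qed.

Lemma gpair_comp W V U m n m' n' : gpair W V m n -> gpair V U m' n' ->
  gpair W U (fun a => m' (m a)) (fun a => n (n' a)).
Proof.
move=> [oW oV s1 s2 c1 c2 k1 k2] [_ oU s1' s2' c1' c2' k1' k2']; split=> //.
- by apply: (SAc_comp s1 s1') => p /k1[].
- by apply: (SAc_comp s2' s2) => p /k2'[].
- by move=> p q Wp Wq r; apply: c1'; [exact: (k1 _ Wp).1|exact: (k1 _ Wq).1|exact: c1].
- by move=> p q Wp Wq r; apply: c2; [exact: (k2' _ Wp).1|exact: (k2' _ Wq).1|exact: c2'].
- by move=> a /k1[/k1'[h ->] ->].
by move=> a /k2'[/k2[h ->] ->].
Qed.

Lemma gpair_sub W V m n W' V' : gpair W V m n -> open W' -> open V' -> W' `<=` W -> V' `<=` V ->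
  (forall a, W' (body a) -> V' (body (m a))) -> (forall a, V' (body a) -> W' (body (n a))) ->
  gpair W' V' m n.
Proof.
move=> [oW oV s1 s2 c1 c2 k1 k2] oW' oV' sW sV h1 h2; split=> //.
- exact: SAc_sub s1.
- exact: SAc_sub s2.
- by move=> p q /sW Wp /sW Wq; exact: c1.
- by move=> p q /sV Wp /sV Wq; exact: c2.
- by move=> a Wa; split; [exact: h1|exact: (k1 _ (sW _ Wa)).2].
by move=> a Wa; split; [exact: h2|exact: (k2 _ (sV _ Wa)).2].
Qed.

Lemma gpair_sym W V m n : gpair W V m n -> gpair V W n m.
Proof. by case. Qed.

Definition SCinv (c : bool) a : pt (SC R) :=
  if c then inl a else if body a == 0 then inr a else inl (inversionI a).

Lemma body_inv0 (b : C) : b != 0 -> b^-1 != 0. Proof. by rewrite invr_eq0. Qed.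

Lemma SCinvP c a : cdom (SC R) c (SCinv c a) /\ cmap (SC R) c (SCinv c a) = a.
Proof.
case: c => //=; case: eqP => [b0|/eqP b0] //=; split; last first.
  by rewrite inversionI2 // gconjK.
by rewrite inversionI_body // body_inv0.
Qed.

Lemma SCinvK c P : cdom (SC R) c P -> SCinv c (cmap (SC R) c P) = P.
Proof.
case: c P => -[a|b] //= h; last by rewrite h eqxx.
rewrite body_gconj inversionI_body // invr_eq0 (negPf h) inversionI_gconj inversionI2 //.
by rewrite gconjK.
Qed.

Lemma SC_pts c P : cdom (SC R) c P -> pts P.
Proof. by case: c P => -[]. Qed.

(* The change of charts of the super-Riemann sphere; I is involutive up to gconj. *)
Definition SCtrans (c c' : bool) : Lam -> Lam :=
  match c, c' with true, false => fun a => gconj (inversionI a) | false, true => @inversionI R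
  | _, _ => id end.
Definition SCtrans_dom (c c' : bool) : set C := if c == c' then setT else [set b | b != 0].

Lemma SCtrans_gpair c c' :
  gpair (SCtrans_dom c c') (SCtrans_dom c c') (SCtrans c c') (SCtrans c' c).
Proof.
have o0 : open [set b : C | b != 0].
  apply/openP => b /= b0; exists (cabs b); first by rewrite cabs_gt0.
  move=> t tb; apply/eqP => /eqP; rewrite addr_eq0 => /eqP E.
  by move: tb; rewrite E cabsN ltxx.
have nz a : body a != 0 -> body (inversionI a) != 0.
  by move=> a0; rewrite inversionI_body // body_inv0.
have g : gpair [set b : C | b != 0] [set b : C | b != 0] (fun a => gconj (inversionI a)) (@inversionI R).
  split=> //.
  - by move=> V phi h hV; apply: SA_gconj; exact: SA_inversionI.
  - exact: SAc_inversionI.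
  - by move=> p q Wp Wq r; apply: (@gconj_sc _ setT) => //; exact: inversionI_sc.
  - exact: inversionI_sc.
  - by move=> a /= a0; rewrite body_gconj; split; [exact: nz|rewrite inversionI_gconj inversionI2 ?gconjK].
  by move=> a /= a0; split; [exact: nz|rewrite inversionI2 // gconjK].
by case: c; case: c' => /=; [exact: gpair_id openT|exact: g|exact: gpair_sym g|exact: gpair_id openT].
Qed.

Lemma SCtransE c c' P : cdom (SC R) c P -> cdom (SC R) c' P ->
  SCtrans_dom c c' (body (cmap (SC R) c P)) /\ SCtrans c c' (cmap (SC R) c P) = cmap (SC R) c' P.
Proof.
case: c P => -[a|b]; case: c' => //= h h'; split=> //.
  by rewrite /SCtrans_dom /= body_gconj inversionI_body // body_inv0.
by rewrite inversionI_gconj inversionI2 // gconjK.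
Qed.

Lemma SCtrans_cdom c c' a : SCtrans_dom c c' (body a) -> cdom (SC R) c' (SCinv c a).
Proof.
case: c; case: c' => //= h; last by have [] := SCinvP false a.
by move: h; rewrite /SCtrans_dom /= => /negPf->.
Qed.

(** The charts compatible with the sphere: a standard chart, restricted by a condition on bodies and
    followed by a [gpair]. *)
Definition is_chart (D : set (pt (SC R))) (f : pt (SC R) -> Lam) :=
  exists c W V m n, [/\ gpair W V m n,
    forall P, D P <-> cdom (SC R) c P /\ W (body (cmap (SC R) c P))
    & forall P, D P -> f P = m (cmap (SC R) c P)].

Lemma chart_trans D f D' f' : is_chart D f -> is_chart D' f' ->
  exists2 V : set C, open V & f @` (D `&` D') = dewitt V /\
    (V !=set0 -> exists2 H, superconformal V H & forall P, D P -> D' P -> f' P = H (f P)).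
Proof.
move=> [c [W [V [m [n [g hD hf]]]]]] [c' [W' [V' [m' [n' [g' hD' hf']]]]]].
have t := SCtrans_gpair c c'; set T := SCtrans_dom c c' in t; set tau := SCtrans c c' in t.
have SAn := SAc_SA (gp_oV g) (gp_SAi g).
(* The domain is cut twice: to points coming from the overlap of the two standard charts, then to
   those that land in the second domain. Testing scalars is enough, since the body of a value
   depends on the body of the argument only. *)
have oV1 : open [set b | V b /\ T (body (n b%:A))] := SA_open_pre SAn (gp_oW t).
set V1 := [set b | _] in oV1.
have nT a : V1 (body a) -> V (body a) /\ T (body (n a)).
  move=> [Va Ta]; split=> //.
  by rewrite (SA_body (p := (body a)%:A) SAn) ?bodyA1.
have SAtn : SA V1 (fun b => tau (n b)).
  apply: (gp_SA t) => [|p /nT[]//]; apply: (gp_SAi g) => [|p []//].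
  exact: SA_id.
have oV2 : open [set b | V1 b /\ W' (body (tau (n b%:A)))] := SA_open_pre SAtn (gp_oW g').
set V2 := [set b | _] in oV2.
have tW a : V2 (body a) -> [/\ V (body a), T (body (n a)) & W' (body (tau (n a)))].
  move=> [Va Ta]; have [h1 h2] := nT a Va; split=> //.
  by rewrite (SA_body (p := (body a)%:A) SAtn) ?bodyA1.
have tWi a : V (body a) -> T (body (n a)) -> W' (body (tau (n a))) -> V2 (body a).
  move=> Va Ta Wa; have V1a : V1 (body a).
    by split=> //; rewrite (SA_body (p := a) SAn) ?bodyA1.
  by split=> //; rewrite (SA_body (p := a) SAtn) ?bodyA1.
exists V2 => //; split.
  apply/seteqP; split=> [_ [P [DP DP'] <-]|a /tW[Va Ta Wa]] /=.
    have [cP WP] := (hD P).1 DP; have [cP' WP'] := (hD' P).1 DP'.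
    have [TP tE] := SCtransE cP cP'; have [VP nm] := gp_K g WP.
    by rewrite /dewitt /= (hf P DP); apply: tWi; rewrite ?nm // /tau tE.
  have [Wa' ma] := gp_Ki g Va; have [cP cE] := SCinvP c (n a).
  have cP' := SCtrans_cdom Ta; have [_ tE] := SCtransE cP cP'; rewrite cE in tE.
  have DP : D (SCinv c (n a)) by apply/hD; rewrite cE.
  exists (SCinv c (n a)); last by rewrite hf // cE.
  by split=> //; apply/hD'; rewrite -tE.
move=> V0; exists (fun a => m' (tau (n a))); last first.
  move=> P DP DP'; have [cP WP] := (hD P).1 DP; have [cP' WP'] := (hD' P).1 DP'.
  by rewrite hf // hf' // (gp_K g WP).2 /tau (SCtransE cP cP').2.
apply: (SA_superconformal V0).
- apply: (gp_SA g') => [|p /tW[]//]; apply: SA_sub oV2 _ SAtn; first by move=> b [].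
- move=> p q /tW[Vp Tp Wp] /tW[Vq Tq Wq] r.
  by apply: (gp_sc g') => //; apply: (gp_sc t) => //; exact: (gp_sci g).
move=> p q /tW[Vp Tp Wp] /tW[Vq Tq Wq] /(congr1 n'); rewrite (gp_K g' Wp).2 (gp_K g' Wq).2.
move=> /(congr1 (SCtrans c' c)); rewrite (gp_K t Tp).2 (gp_K t Tq).2 => /(congr1 m).
by rewrite (gp_Ki g Vp).2 (gp_Ki g Vq).2.
Qed.

Lemma chart_inj D f : is_chart D f -> set_inj D f.
Proof.
move=> [c [W [V [m [n [g hD hf]]]]]] P Q /set_mem DP /set_mem DQ; rewrite !hf //.
have [cP WP] := (hD P).1 DP; have [cQ WQ] := (hD Q).1 DQ.
move=> /(congr1 n); rewrite (gp_K g WP).2 (gp_K g WQ).2 => E.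
by rewrite -(SCinvK cP) E SCinvK.
Qed.

Lemma chart_image D f : is_chart D f -> exists2 V : set C, open V & f @` D = dewitt V.
Proof.
by move=> h; have [V oV [E _]] := chart_trans h h; exists V; rewrite // -E setIid.
Qed.

Lemma chart_pts D f P : is_chart D f -> D P -> pts P.
Proof. by move=> [c [W [V [m [n [g hD hf]]]]]] /hD[/SC_pts]. Qed.

Lemma is_chart_intro c W V m n : gpair W V m n ->
  is_chart [set P | cdom (SC R) c P /\ W (body (cmap (SC R) c P))] (fun P => m (cmap (SC R) c P)).
Proof. by move=> g; exists c, W, V, m, n. Qed.

Lemma is_chart_ext D f D' f' : (forall P, D' P <-> D P) -> (forall P, D P -> f' P = f P) ->
  is_chart D f -> is_chart D' f'.
Proof.
move=> hD hf [c [W [V [m [n [g hD' hf']]]]]]; exists c, W, V, m, n; split=> // P.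
- by split=> [/hD/hD'|/hD'/hD].
- by move=> /hD DP; rewrite hf // hf'.
Qed.

Lemma is_chart_SC c : is_chart (cdom (SC R) c) (cmap (SC R) c).
Proof.
apply: is_chart_ext (is_chart_intro c (gpair_id openT)) => // P.
by split=> [|[]].
Qed.

End Charts.

Section ModelledSurfaces.
Variable R : realType.
Local Notation C := (cplx R).
Local Notation Lam := (grassmann C).

(* The charts of X are charts of the super-Riemann sphere read through K. *)
Definition modelled (X : surface R) (K : pt X -> pt (SC R)) :=
  [/\ forall p : pt X, pts p -> pts (K p),
      forall P : pt (SC R), pts P -> exists2 p : pt X, pts p & K p = P,
      forall p q : pt X, pts p -> pts q -> K p = K q -> p = q,
      pts (s := X) = \bigcup_i cdom X i
    & forall i, exists D f, [/\ is_chart D f, forall p, cdom X i p <-> pts p /\ D (K p)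
        & forall p, cdom X i p -> cmap X i p = f (K p)]].

Lemma modelled_SC : modelled (X := SC R) id.
Proof.
split=> //; first by move=> P; exists P.
  apply/seteqP; split=> [[a|b] h|P [c _ /SC_pts//]]; first by exists true.
  by exists false.
move=> c; exists (cdom (SC R) c), (cmap (SC R) c); split=> //; first exact: is_chart_SC.
by move=> P; split=> [h|[]//]; split=> //; exact: SC_pts h.
Qed.

Section Modelled.
Variables (X : surface R) (K : pt X -> pt (SC R)).
Hypothesis hX : modelled K.

Lemma modelled_image D : (forall P, D P -> pts P) -> K @` [set p | pts p /\ D (K p)] = D.
Proof.
case: hX => h1 h2 _ _ _ hD; apply/seteqP; split=> [_ [p [_ Dp] <-]//|P DP].
have [p pp E] := h2 P (hD P DP); exists p => //=; split=> //; by rewrite E.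
Qed.

Lemma modelled_chart_image i D f D' f' : is_chart D f -> is_chart D' f' ->
  (forall p, cdom X i p <-> pts p /\ D (K p)) -> (forall p, cdom X i p -> cmap X i p = f (K p)) ->
  cmap X i @` [set p | pts p /\ D (K p) /\ D' (K p)] = f @` (D `&` D').
Proof.
move=> c c' hD hf; have h : forall P, (D `&` D') P -> pts P by move=> P [/(chart_pts c)].
rewrite -(modelled_image h) image_comp; apply/seteqP; split=> [_ [p [pp [Dp Dp']] <-]|_ [p [pp [Dp Dp']] <-]].
  by exists p => //=; rewrite hf //; apply/hD.
by exists p => //=; rewrite hf //; apply/hD.
Qed.

Lemma modelled_sopen D f : is_chart D f -> sopen [set p | pts p /\ D (K p)].
Proof.
move=> c; split=> [p []//|i]; case: hX => _ _ _ _ /(_ i)[Di [fi [ci hD hf]]].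
have [V oV [E _]] := chart_trans ci c; exists V => //; rewrite -E -(modelled_chart_image ci c hD hf).
congr image; apply/seteqP; split=> p /=; first by move=> [[pp Dp] /hD[_ Dip]].
by move=> [pp [Dip Dp]]; split=> //; apply/hD.
Qed.

(** Read on the sphere, F is the identity, so its superconformality is that of the transition maps
    between charts of the sphere. *)
Lemma modelled_super_map (Y : surface R) (K' : pt Y -> pt (SC R)) (F : pt X -> pt Y) :
  modelled K' -> (forall p, pts p -> pts (F p) /\ K' (F p) = K p) ->
  superconformal_map (pts (s := X)) F.
Proof.
move=> hY hF i j; case: hX => _ _ _ _ /(_ i)[Di [fi [ci hD hf]]].
case: hY => _ _ _ _ /(_ j)[Dj [fj [cj hD' hf']]].
have [V oV [E h]] := chart_trans ci cj; exists V; split=> //.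
  rewrite -E -(modelled_chart_image ci cj hD hf); congr image; apply/seteqP; split=> p /=.
    by move=> [[pp /hD[_ Dp]] /hD'[_]]; rewrite (hF p pp).2.
  move=> [pp [Dip Djp]]; split; first by split=> //; apply/hD.
  by apply/hD'; have [pF ->] := hF p pp.
move=> /h[H sH hH]; exists H => // p [[pp dp] dp'].
have [_ Djp] := (hD' _).1 dp'; have [_ Dip] := (hD _).1 dp.
by rewrite hf // hf' // (hF p pp).2 in Djp *; exact: hH.
Qed.

Lemma modelled_flat_map D f phi : is_chart D f ->
  (forall p, pts p -> D (K p) -> phi p = f (K p)) ->
  superconformal_map (Y := flat R) [set p | pts p /\ D (K p)] phi.
Proof.
move=> c hphi i j; case: hX => _ _ _ _ /(_ i)[Di [fi [ci hD hf]]].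
have [V oV [E h]] := chart_trans ci c; exists V; split=> //.
  rewrite -E -(modelled_chart_image ci c hD hf); congr image; apply/seteqP; split=> p /=.
    by move=> [[[pp Dp] /hD[_ Dip]] _].
  by move=> [pp [Dip Dp]]; split=> //; split=> //; apply/hD.
move=> /h[H sH hH]; exists H => // p [[[pp Dp] dp] _] /=.
by have [_ Dip] := (hD _).1 dp; rewrite hf // hphi //; exact: hH.
Qed.

Lemma modelled_super_riemann : super_riemann X.
Proof.
case: (hX) => h1 h2 h3 h4 h5; split=> //.
  move=> i; have [D [f [c hD hf]]] := h5 i; move=> p q /set_mem dp /set_mem dq; rewrite !hf //.
  have [pp Dp] := (hD p).1 dp; have [pq Dq] := (hD q).1 dq => E; apply: h3 => //.
  by apply: (chart_inj c) => //; exact: mem_set.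
by apply: modelled_super_map hX _.
Qed.

End Modelled.

Lemma modelled_iso (X : surface R) (K : pt X -> pt (SC R)) : modelled K ->
  superconformal_iso (X := X) (Y := SC R) K.
Proof.
move=> hX; case: (hX) => h1 h2 h3 h4 h5.
have [G hG] : exists G : pt (SC R) -> pt X, forall P, pts P -> pts (G P) /\ K (G P) = P.
  have [p0 _ _] := h2 (inl 0) I.
  have : forall P, exists p, pts P -> pts p /\ K p = P.
    move=> P; have [h|h] := pselect (pts P); last by exists p0.
    by have [p pp E] := h2 P h; exists p.
  by move=> /choice[G hG]; exists G.
exists G; split.
- by move=> p pp; have [q1 q2] := hG _ (h1 p pp); split; [exact: h1|exact: h3].
- by move=> P PP; have [q1 q2] := hG P PP.
- by apply: (modelled_super_map hX modelled_SC) => p pp; split=> //; exact: h1.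
by apply: (modelled_super_map modelled_SC hX) => P /hG.
Qed.
End ModelledSurfaces.

Section GoodPairs.
Variable R : realType.
Local Notation C := (cplx R).
Local Notation Lam := (grassmann C).
Local Notation shift := (@Defs.shift R).
Implicit Types (x y z p q e th a : Lam) (V W : set C) (m n H : Lam -> Lam).

Lemma gpair_flow e th V k l m : is_odd e -> is_odd th -> open V -> flow_data V k l m ->
  (forall e', SAc V (flow e' th k l m)) -> gpair V V (flow e th k l m) (flow (- e) th k l m).
Proof.
move=> oe oth oV hf hS; have one := odN oe; split=> //.
- exact: flow_sc.
- exact: flow_sc.
- by move=> a Va; rewrite (flow_body oe oth hf Va) (flow_inv oe oth hf Va).
move=> a Va; rewrite (flow_body one oth hf Va); split=> //.
by have := flow_inv one oth hf Va; rewrite opprK.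
Qed.

Lemma open_ball_gt (c : C) (r : R) (f : C -> C) : (forall b, exists2 K : R, 0 <= K & forall t, cabs (f (b + t) - f b) <= K * cabs t) ->
  open [set b : C | r < cabs (f b)].
Proof.
move=> hf; apply/openP => b /= rb; have [K K0 hK] := hf b.
have [d d0 hd] := ex_small K0 (ltac:(by rewrite subr_gt0) : 0 < cabs (f b) - r).
exists d => // t td; have h1 := cabsDl (f b) (f (b + t) - f b).
rewrite subrKC in h1; apply: lt_le_trans h1; rewrite ltrBrDl -ltrBrDr.
by apply: le_lt_trans (hK t) _; apply: le_lt_trans hd; rewrite mulrC ler_wpM2r // ltW.
Qed.

Lemma open_gt (c : C) (r : R) : open [set b : C | r < cabs (b - c)].
Proof.
apply: (open_ball_gt 0) => b; exists 1 => // t; rewrite mul1r.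
by rewrite [X in cabs X](_ : _ = t) //; ring.
Qed.
Lemma open_lt (c : C) (r : R) : open [set b : C | cabs (b - c) < r].
Proof.
apply/openP => b /= br; exists (r - cabs (b - c)); first by rewrite subr_gt0.
move=> t tr; rewrite addrAC (le_lt_trans (cabsD _ _)) // -ltrBrDl //.
Qed.
Lemma open_ne (c : C) : open [set b : C | b != c].
Proof.
rewrite (_ : [set b | _] = [set b : C | 0 < cabs (b - c)]); first exact: open_gt.
by apply/funext => b /=; rewrite cabs_gt0 subr_eq0.
Qed.
Lemma open_and V W : open V -> open W -> open [set b | V b /\ W b].
Proof. exact: openI. Qed.

(** * The sewn supersphere *)

Section Pairs.
Variables (e th z : Lam).
Hypotheses (oe : is_odd e) (oth : is_odd th) (ez : is_even z) (bz : body z != 0).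

Lemma gpair_kappa : gpair [set b | b != body z] [set b | b != body z] (kappa e th z) (kappa (- e) th z).
Proof.
by apply: gpair_flow => //; [exact: open_ne|exact: hfin_dataT|move=> e'; exact: SAc_kappa].
Qed.
Lemma gpair_kappa_inf : gpair [set b | 1 - body z * b != 0] [set b | 1 - body z * b != 0]
  (kappa_inf e th z) (kappa_inf (- e) th z).
Proof.
apply: gpair_flow => //; last by move=> e'; exact: SAc_kappa_inf.
  rewrite (_ : [set b | _] = [set b | b != (body z)^-1]); first exact: open_ne.
  apply/funext => b /=; rewrite subr_eq0 eq_sym -(inj_eq (mulfI bz) b) divff //.
by apply: minf_dataT => //; apply/evN/ii_even.
Qed.
Lemma gpair_translation V : open V -> gpair V V (translation e th z) (translation (- e) th z).
Proof.
by move=> oV; apply: gpair_flow => //; [exact: translation_data|move=> e'; exact: SAc_translation].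
Qed.
End Pairs.
Lemma gpair_cap e V : is_odd e -> open V -> gpair V V (cap_coord e) (cap_coord (- e)).
Proof.
move=> oe oV; apply: gpair_flow => //; [exact: od0|exact: cap_data|move=> e'; exact: SAc_cap].
Qed.
Lemma gpair_gconj V : open V -> gpair V V (@gconj R) (@gconj R).
Proof.
by move=> oV; split=> //; (try exact: SAc_gconj); (try exact: gconj_sc) => a Va; rewrite body_gconj gconjK.
Qed.
Lemma gpair_shift q W V : open W -> open V -> (forall b, W b <-> V (b - body q)) ->
  gpair W V (shift q) (unshift q).
Proof.
move=> oW oV h; split=> //; [exact: SAc_shift|exact: SAc_unshift|exact: shift_sc|exact: unshift_sc|..].
  by move=> a /h; rewrite body_shift shiftK.
by move=> a Va; rewrite body_unshift unshiftK; split=> //; apply/h; rewrite addrK.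
Qed.

Lemma SC_local_coordinate D f P : is_chart D f -> D P -> f P = 0 ->
  local_coordinate (X := SC R) P D f.
Proof.
move=> c DP fP; have E : D = [set P : pt (SC R) | pts P /\ D P].
  by apply/seteqP; split=> [Q DQ|Q []//]; split=> //; exact: (chart_pts c DQ).
split=> //.
- by split=> //; rewrite E; exact: (modelled_sopen (@modelled_SC R) c).
- exact: (chart_inj c).
- exact: (chart_image c).
by rewrite E; apply: (modelled_flat_map (@modelled_SC R) c).
Qed.
End GoodPairs.

Section Sewn.
Variable R : realType.
Local Notation C := (cplx R).
Local Notation Lam := (grassmann C).
Local Notation shift := (@Defs.shift R).
Local Notation S := (SC R).
Variables (e th z : Lam).
Hypotheses (oe : is_odd e) (oth : is_odd th) (ez : is_even z) (bz : body z != 0).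
(** Both radii are below |body z|, so the disc removed around (z, theta) does not reach the puncture
    0. *)
Let r1 : R := cabs (body z) / 2.
Let r2 : R := cabs (body z) / 4.

(** The coordinate of index 0 is I after Delta, which over infinity is [gconj] after Upsilon, as I
    is involutive up to [gconj]. *)
Definition SC_pair : tubed R := @Tubed R S
  (fun k => if k is j.+1 then inl (nth 0 [:: z + th] j) else inr 0)
  (fun k => cdom S (k != 0%N))
  (fun k => match k with
     | 0%N => fun P => gconj (cmap S false P) | 1%N => fun P => shift (z + th) (cmap S true P)
     | _ => cmap S true end).
Definition SC_cap : tubed R := @Tubed R S
  (fun _ => inr 0) (fun _ => cdom S false) (fun _ P => cap_coord e (gconj (cmap S false P))).

Lemma SC_inversionE P : SC_inversion P = gconj (cmap S false P) :> Lam.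
Proof. by case: P => a //=; rewrite gconjK. Qed.

Lemma bzth : body (z + th) = body z.
Proof. by rewrite bodyD (body_odd oth) addr0. Qed.

Lemma gconj0 : gconj (0 : Lam) = 0. Proof. by rewrite gconj_even //; exact: ev0. Qed.
Lemma shift_self q : shift q q = 0.
Proof. by rewrite /Defs.shift subrr sub0r odd_sq ?oppr0 //; exact: odp_odd. Qed.
Lemma cap_coord0 e' : cap_coord e' 0 = 0 :> Lam.
Proof.
rewrite /cap_coord /flow (even_evp (@ev0 R)) (even_odp (@ev0 R)).
by rewrite !(mulr0, mul0r, addr0, subr0) mul0rn addr0.
Qed.

Lemma chart_pair0 : is_chart (cdom S false) (fun P => gconj (cmap S false P)).
Proof.
apply: is_chart_ext (is_chart_intro false (gpair_gconj openT)) => // P.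
by split=> [|[]].
Qed.
Lemma chart_pair1 : is_chart (cdom S true) (fun P => shift (z + th) (cmap S true P)).
Proof.
apply: is_chart_ext (is_chart_intro true (gpair_shift (q := z + th) openT openT _)) => // P.
by split=> [|[]].
Qed.
Lemma chart_cap : is_chart (cdom S false) (fun P => cap_coord e (gconj (cmap S false P))).
Proof.
apply: is_chart_ext (is_chart_intro false (gpair_comp (gpair_gconj openT) (gpair_cap oe openT))) => // P.
by split=> [|[]].
Qed.

Lemma pair_with_tubes : with_tubes 2 SC_pair.
Proof.
split; first exact: (modelled_super_riemann (@modelled_SC R)).
  case=> [|[|[|k]]] // _.
  - by apply: (SC_local_coordinate chart_pair0); [exact: body0|exact: gconj0].
  - by apply: (SC_local_coordinate chart_pair1); last exact: shift_self.
  - by apply: (SC_local_coordinate (is_chart_SC (true : cidx S))).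
have n1 : ~ same_body (X := S) (inr 0) (inl (z + th)).
  move=> [[] [] //= _ h]; rewrite body0 body_gconj inversionI_body // => /esym/eqP.
  by rewrite invr_eq0 bzth (negPf bz).
have n2 : ~ same_body (X := S) (inr 0) (inl 0).
  by move=> [[] [] //= _]; rewrite body0 eqxx.
have n3 : ~ same_body (X := S) (inl (z + th)) (inl 0).
  move=> [[] [] //= _]; last by rewrite body0 eqxx.
  by move=> _; rewrite bzth body0 => /eqP; rewrite (negPf bz).
have sym P Q : same_body (X := S) P Q -> same_body (X := S) Q P.
  by move=> [i [h1 h2 h3]]; exists i.
move=> [|[|[|k]]] [|[|[|l]]] hk hl nkl h; rewrite ?ltnS ?ltn0 in hk hl.
- by case: nkl.
- exact: n1 h.
- exact: n2 h.
- discriminate hl.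
- exact: n1 (sym _ _ h).
- by case: nkl.
- exact: n3 h.
- discriminate hl.
- exact: n2 (sym _ _ h).
- exact: n3 (sym _ _ h).
- by case: nkl.
all: by [discriminate hl|discriminate hk].
Qed.

Lemma cap_with_tubes : with_tubes 0 SC_cap.
Proof.
split; first exact: (modelled_super_riemann (@modelled_SC R)).
  case=> [|k] // _; apply: SC_local_coordinate => //=.
  - exact: chart_cap.
  - exact: body0.
  - by rewrite gconj0 cap_coord0.
by case=> [|k] // [|l].
Qed.

Lemma pair_represents : represents (sk_pair z th) SC_pair.
Proof.
exists id; first exact: (modelled_iso (@modelled_SC R)).
have t0 : tildeE (fun=> 0, fun j => - ('i *: (fun=> 0 : Lam) j)) = tildeE (@seqpair0 R).
  by congr tildeE; congr pair; apply/funext => j; rewrite scaler0 oppr0.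
have so c : sopen (X := S) (cdom S c).
  have -> : cdom S c = [set P : pt S | pts P /\ cdom S c P].
    by apply/seteqP; split=> [Q DQ|Q []//]; split=> //; exact: SC_pts DQ.
  exact: (modelled_sopen (@modelled_SC R) (is_chart_SC (c : cidx S))).
case=> -[|[|[|k]]] // hk.
- have -> : Ordinal hk = ord0 by exact/val_inj.
  rewrite /sk_puncture /sk_coordinate unlift_none; split=> //.
  exists (cdom S false); first by split; [exact: (so false)|exact: body0].
  by move=> P hP; split=> //=; rewrite SC_inversionE t0; exact: tildeE0.
- have -> : Ordinal hk = lift ord0 (ord0 : 'I_2) by exact/val_inj.
  rewrite /sk_puncture /sk_coordinate liftK; split=> //.
  exists (cdom S true); first by split; [exact: (so true)|].
  by move=> [a|b] // _; split=> //; exists a => //; exact: hatE0.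
have -> : Ordinal hk = lift ord0 (ord_max : 'I_2) by exact/val_inj.
rewrite /sk_puncture /sk_coordinate liftK; split=> //.
exists (cdom S true); first by split; [exact: (so true)|].
move=> [a|b] // _; split=> //; exists a => //=.
rewrite /Defs.shift (even_odp (@ev0 R)).
by rewrite mulr0 !subr0; exact: hatE0.
Qed.

Lemma cap_represents : represents (sk_M32 e) SC_cap.
Proof.
exists id; first exact: (modelled_iso (@modelled_SC R)).
case=> -[|k] // hk; have -> : Ordinal hk = ord0 by exact/val_inj.
rewrite /sk_puncture /sk_coordinate unlift_none; split=> //.
exists (cdom S false); last first.
  by move=> P hP; split=> //=; rewrite SC_inversionE; exact: tildeE_cap.
split; last exact: body0.
rewrite [X in sopen X](_ : _ = [set P : pt S | pts P /\ cdom S false P]); last first.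
  by apply/seteqP; split=> [Q DQ|Q []//]; split=> //; exact: SC_pts DQ.
exact: (modelled_sopen (@modelled_SC R) (is_chart_SC (false : cidx S))).
Qed.

Lemma pair_setSK : setSK (sk_pair z th).
Proof.
split=> //.
- by move=> p; rewrite inE => /eqP ->; rewrite bzth.
- exact: setH0.
by move=> j; split; [exact: ev1|rewrite body1 oner_neq0|exact: setH0].
Qed.
Lemma cap_setSK : setSK (sk_M32 e).
Proof. by split=> //; [exact: setH_single_odd|case]. Qed.

Let r1_gt0 : 0 < r1. Proof. by rewrite divr_gt0 // cabs_gt0. Qed.
Let r2_gt0 : 0 < r2. Proof. by rewrite divr_gt0 // cabs_gt0. Qed.
Let r21 : r2 < r1. Proof. have : 0 < cabs (body z) by rewrite cabs_gt0. by rewrite /r1 /r2; lra. Qed.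
Let r1z : r1 < cabs (body z). Proof. have : 0 < cabs (body z) by rewrite cabs_gt0. by rewrite /r1; lra. Qed.

Lemma pair_cap_sewable : sewable 2 SC_pair 1 0 SC_cap r1 r2.
Proof.
split=> //.
- move=> a _; exists (inl (unshift (z + th) a)) => //=; exact: unshiftK.
- move=> a _; have g := gpair_comp (gpair_gconj openT) (gpair_cap oe openT).
  have [cP cE] := SCinvP false (gconj (cap_coord (- e) a)).
  exists (SCinv false (gconj (cap_coord (- e) a))); first exact: cP.
  by apply: etrans (congr1 (fun w => cap_coord e (gconj w)) cE) _; rewrite (gp_Ki g _).2.
- move=> [|[|[|k]]] // _ _; rewrite /in_cball /= cabs_le body_shift body0 sub0r cabsN bzth.
  by rewrite leNgt r1z.
by case.
Qed.

Local Notation kept' := (@kept R SC_pair 1 SC_cap r1 r2).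
Local Notation glued' := (@glued R SC_pair 1 SC_cap r1 r2).
Local Notation cls := (@glue_class R SC_pair 1 SC_cap r1 r2).

(** The identification of the two pieces with one sphere: [kappa] on the first, extended over
    infinity, and a translation on the second. The value on the points over infinity of the second
    sphere is arbitrary, as these are cut off. *)
Definition unglue (u : pt S + pt S) : pt S :=
  match u with
  | inl (inl a) => inl (kappa e th z a) | inl (inr b) => inr (kappa_inf e th z b)
  | inr (inl a) => inl (translation e th z (unshift (z + th) a)) | inr (inr b) => inl 0 end.

Lemma keptP u : kept' u <-> match u with
  | inl (inl a) => r2 < cabs (body a - body z) | inl (inr b) => body b = 0
  | inr (inl a) => cabs (body a) < r1 | inr (inr b) => False end.
Proof.
case: u => -[a|b] /=; rewrite /in_cball /= ?cabs_le.
- rewrite body_shift bzth; split=> [[_ h]|h]; first by rewrite ltNge; apply/negP => h'; apply: h.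
  by split=> // -[_]; rewrite leNgt h.
- by split=> [[]//|h]; split=> // -[].
- have oo := @od0 R; have eb : body (cap_coord e (gconj (gconj (inversionI a)))) = body (inversionI a).
    by rewrite gconjK /cap_coord (flow_body (V := setT) oe (@od0 R) (@cap_data R _)).
  rewrite eb; split=> [[_ h]|h].
    have [a0|a0] := eqVneq (body a) 0; first by rewrite a0 cabs0.
    rewrite ltNge; apply/negP => h'; apply: h; split=> //.
    by rewrite inversionI_body // cabsV lef_pV2 // posrE cabs_gt0.
  split=> // -[a0]; rewrite inversionI_body // cabsV lef_pV2 ?posrE ?cabs_gt0 //.
  by rewrite leNgt h.
split=> // -[b0 h]; apply: h; split=> //.
rewrite /cap_coord (flow_body (V := setT) oe (@od0 R) (@cap_data R _)) // body_gconj b0 cabs0.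
by rewrite invr_ge0 ltW.
Qed.

Let oT (V : set C) : open V -> open V. Proof. by []. Qed.
Lemma body_kappa e' a : is_odd e' -> body a != body z -> body (kappa e' th z a) = body a.
Proof. by move=> oe' h; rewrite /kappa (flow_body oe' oth (hfin_dataT ez)). Qed.
Lemma body_kappa_inf e' a : is_odd e' -> 1 - body z * body a != 0 ->
  body (kappa_inf e' th z a) = body a.
Proof. by move=> oe' h; rewrite /kappa_inf (flow_body oe' oth (minf_dataT (evN (ii_even R)) ez bz)). Qed.
Lemma body_translation e' a : is_odd e' -> body (translation e' th z a) = body a.
Proof. by move=> oe'; rewrite /translation (flow_body (V := setT) oe' oth (@translation_data R _ _ ez)). Qed.
Lemma body_glue a : body a != 0 -> body (glue_map e a) = body a.
Proof. by move=> h; rewrite /glue_map (flow_body oe (@od0 R) (@glue_data R)). Qed.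

(** Inverting [cap_coord] turns the relation between the coordinates into the graph of [glue_map].
    Points over infinity of the second sphere are excluded because an inversion has nonzero body. *)
Lemma gluedP u v : glued' u v <-> exists a, [/\ u = inl (inl a),
  v = inr (inl (glue_map e (shift (z + th) a))) & r2 < cabs (body a - body z) < r1].
Proof.
split; last first.
  move=> [a [-> -> /andP[h2 h1]]]; have bs : body (shift (z + th) a) != 0.
    by rewrite body_shift bzth -cabs_gt0 (lt_trans _ h2).
  have bE : body (shift (z + th) a) = body a - body z by rewrite body_shift bzth.
  rewrite /= /in_ball /in_cball /= cabs_lt cabs_le {1 2}bE; split=> //.
  - by apply/negP; rewrite -ltNge.
  - by rewrite body_glue.
  by rewrite gconjK cap_glue.
case: u v => [[a|b]|[a|b]] [[a'|b']|[a'|b']] //= []; rewrite /in_ball /in_cball /= ?cabs_lt ?cabs_le //.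
  move=> _; rewrite body_shift bzth => h1 /negP; rewrite -ltNge => h2 a0; rewrite gconjK => E.
  exists a; split=> //; last by rewrite h2.
  have bs : body (shift (z + th) a) != 0.
    by rewrite body_shift bzth -cabs_gt0 (lt_trans _ h2).
  have := cap_glue oe bs; rewrite -E => /(congr1 (cap_coord (- e))).
  have g := gpair_cap oe openT.
  rewrite (gp_K g _).2 // (gp_K g _).2 // => /inversionI_inj -> //.
  by rewrite body_glue.
move=> _; rewrite body_shift bzth => h1 /negP; rewrite -ltNge => h2 b0 E.
have bs : body (shift (z + th) a) != 0.
  by rewrite body_shift bzth -cabs_gt0 (lt_trans _ h2).
have := congr1 (@body R) E; rewrite inversionI_body // /cap_coord.
rewrite (flow_body (V := setT) oe (@od0 R) (@cap_data R _)) // body_gconj b0 => /esym/eqP.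
by rewrite invr_eq0 (negPf bs).
Qed.

Lemma unglue_glued u v : glued' u v -> [/\ kept' u, kept' v & unglue u = unglue v].
Proof.
move=> /gluedP[a [-> -> /andP[h2 h1]]]; have bs : body (shift (z + th) a) != 0.
  by rewrite body_shift bzth -cabs_gt0 (lt_trans _ h2).
split; first by apply/keptP.
  by apply/keptP; rewrite body_glue // body_shift bzth.
rewrite /= kappa_glue //; apply/eqP => h; rewrite h subrr cabs0 in h2.
by have := lt_trans r2_gt0 h2; rewrite ltxx.
Qed.

(** The second clause records that a class with several elements consists of kept points, where
    [unglue] separates the points of each sphere. *)
Lemma cls_unglue u v : cls u v -> unglue u = unglue v /\ (u = v \/ kept' u /\ kept' v).
Proof.
elim=> {u v} [u v /unglue_glued[ku kv E]|u|u v _ [E h]|u v w _ [E1 h1] _ [E2 h2]].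
- by split=> //; right.
- by split=> //; left.
- by split=> //; case: h => [->|[]]; [left|right].
split; first by rewrite E1.
by case: h1 => [->//|[ku kv]]; case: h2 => [<-|[_ kw]]; right.
Qed.

Lemma cls_refl u : cls u u. Proof. exact: rst_refl. Qed.
Lemma cls_eq u v : cls u v -> cls u = cls v.
Proof.
move=> h; apply/seteqP; split=> w hw; last exact: rst_trans h hw.
by apply: rst_trans hw; exact: rst_sym.
Qed.

Lemma kept_unglue_body a : r2 < cabs (body a - body z) -> body a != body z.
Proof. by move=> h; rewrite -subr_eq0 -cabs_gt0 (lt_trans _ h). Qed.

Lemma unglue_inj u v : kept' u -> kept' v -> unglue u = unglue v -> cls u v.
Proof.
move=> ku kv; have gk := gpair_kappa oe oth ez; have gi := gpair_kappa_inf oe oth ez bz.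
have gt := gpair_translation oe oth ez openT.
have b1 (b : Lam) : body b = 0 -> [set b | 1 - body z * b != 0] (body b).
  by move=> ->; rewrite /= mulr0 subr0 oner_neq0.
have mixed a b : r2 < cabs (body a - body z) -> cabs (body b) < r1 ->
    kappa e th z a = translation e th z (unshift (z + th) b) -> glued' (inl (inl a)) (inr (inl b)).
  move=> h2 h1 E; apply/gluedP; exists a; have ba := kept_unglue_body h2; split=> //.
    rewrite -kappa_glue // in E; have := congr1 (translation (- e) th z) E.
    rewrite !(gp_K gt _).2 // => /(congr1 (shift (z + th))); rewrite !unshiftK => -> //.
  have := congr1 (@body R) E; rewrite body_kappa // body_translation // body_unshift bzth => bE.
  by rewrite bE addrK in h2 *; rewrite h2 h1.
case: u v ku kv => [[a|b]|[a|b]] [[a'|b']|[a'|b']] /keptP ku /keptP kv //= [].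
- move=> /(congr1 (kappa (- e) th z)).
  rewrite (gp_K gk (kept_unglue_body ku)).2 (gp_K gk (kept_unglue_body kv)).2 => ->.
  exact: cls_refl.
- by move=> E; apply: rst_step; exact: mixed.
- move=> /(congr1 (kappa_inf (- e) th z)).
  by rewrite (gp_K gi (b1 _ ku)).2 (gp_K gi (b1 _ kv)).2 => ->; exact: cls_refl.
- by move=> E; apply/rst_sym/rst_step; exact: mixed.
move=> /(congr1 (translation (- e) th z)); rewrite !(gp_K gt _).2 //.
by move=> /(congr1 (shift (z + th))); rewrite !unshiftK => ->; exact: cls_refl.
Qed.

Local Notation sewn := (@sewn_surface R SC_pair 1 SC_cap r1 r2).
Definition Kmap (T : set (pt S + pt S)) : pt S := xget (inl 0) [set unglue u | u in T].

Lemma KmapE u : Kmap (cls u) = unglue u.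
Proof.
have [v hv E] := @xgetI _ (inl 0) [set unglue u | u in cls u] (unglue u)
  (ex_intro2 _ _ u (cls_refl u) erefl).
by rewrite /Kmap -E; have [-> _] := cls_unglue hv.
Qed.

(** The representative selected by [xget] is the only possible one, because [unglue] is injective on
    the kept part of the first sphere. *)
Lemma descend1E (g : pt S -> Lam) P : kept' (inl P) -> @descend1 R SC_pair SC_cap g (cls (inl P)) = g P.
Proof.
move=> kP; rewrite /descend1 /descend2; have [Q hQ <-] := @xgetI _ 0 [set g p | p in [set p | cls (inl P) (inl p)]] (g P)
  (ex_intro2 _ _ P (cls_refl _) erefl).
have [E [[<-//]|[_ kQ]]] := cls_unglue hQ; congr g.
have gk := gpair_kappa oe oth ez; have gi := gpair_kappa_inf oe oth ez bz.
have b1 (b : Lam) : body b = 0 -> [set b | 1 - body z * b != 0] (body b).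
  by move=> ->; rewrite /= mulr0 subr0 oner_neq0.
case: P Q {hQ} kP kQ E => [a|b] [a'|b'] /keptP ku /keptP kv //= [].
  move=> /(congr1 (kappa (- e) th z)).
  by rewrite (gp_K gk (kept_unglue_body ku)).2 (gp_K gk (kept_unglue_body kv)).2 => ->.
move=> /(congr1 (kappa_inf (- e) th z)).
by rewrite (gp_K gi (b1 _ ku)).2 (gp_K gi (b1 _ kv)).2 => ->.
Qed.

Lemma descend2E (g : pt S -> Lam) P : kept' (inr P) -> @descend2 R SC_pair SC_cap g (cls (inr P)) = g P.
Proof.
move=> kP; rewrite /descend1 /descend2; have [Q hQ <-] := @xgetI _ 0 [set g p | p in [set p | cls (inr P) (inr p)]] (g P)
  (ex_intro2 _ _ P (cls_refl _) erefl).
have [E [[<-//]|[_ kQ]]] := cls_unglue hQ; congr g.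
have gt := gpair_translation oe oth ez openT.
case: P Q {hQ} kP kQ E => [a|b] [a'|b'] /keptP ku /keptP kv //= [].
move=> /(congr1 (translation (- e) th z)); rewrite !(gp_K gt _).2 //.
by move=> /(congr1 (shift (z + th))); rewrite !unshiftK => ->.
Qed.

(** The charts and tubes of the sewn surface have this shape: U and g live on one of the two
    spheres, D and f are their transports by [unglue]. *)
Lemma push1_chart (U D : set (pt S)) (f g : pt S -> Lam) :
  (forall P, kept' (inl P) -> U P -> D (unglue (inl P)) /\ f (unglue (inl P)) = g P) ->
  (forall P', D P' -> exists P, [/\ kept' (inl P), U P & unglue (inl P) = P']) ->
  forall T, (@push1 R SC_pair 1 SC_cap r1 r2 U T <-> pts (s := sewn) T /\ D (Kmap T)) /\
    (@push1 R SC_pair 1 SC_cap r1 r2 U T -> @descend1 R SC_pair SC_cap g T = f (Kmap T)).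
Proof.
move=> h1 h2 T; split=> [|[P [UP kP] <-]]; last first.
  by rewrite KmapE (descend1E _ kP) (h1 P kP UP).2.
split=> [[P [UP kP] <-]|[[u ku <-] /h2[P [kP UP E]]]].
  by split; [exists (inl P)|rewrite KmapE; exact: (h1 P kP UP).1].
exists P; first by split.
by apply/cls_eq/unglue_inj => //; rewrite E KmapE.
Qed.

Lemma push2_chart (U D : set (pt S)) (f g : pt S -> Lam) :
  (forall P, kept' (inr P) -> U P -> D (unglue (inr P)) /\ f (unglue (inr P)) = g P) ->
  (forall P', D P' -> exists P, [/\ kept' (inr P), U P & unglue (inr P) = P']) ->
  forall T, (@push2 R SC_pair 1 SC_cap r1 r2 U T <-> pts (s := sewn) T /\ D (Kmap T)) /\
    (@push2 R SC_pair 1 SC_cap r1 r2 U T -> @descend2 R SC_pair SC_cap g T = f (Kmap T)).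
Proof.
move=> h1 h2 T; split=> [|[P [UP kP] <-]]; last first.
  by rewrite KmapE (descend2E _ kP) (h1 P kP UP).2.
split=> [[P [UP kP] <-]|[[u ku <-] /h2[P [kP UP E]]]].
  by split; [exists (inr P)|rewrite KmapE; exact: (h1 P kP UP).1].
exists P; first by split.
by apply/cls_eq/unglue_inj => //; rewrite E KmapE.
Qed.

Definition Wfin : set C := [set b : C | r2 < cabs (b - body z)].
(** The condition r2 < |1 / b - body z| multiplied by |b|, so that it makes sense and holds at b =
    0. *)
Definition Winf : set C := [set b : C | r2 * cabs b < cabs (1 - body z * b)].
Definition Wcap : set C := [set b : C | cabs (b - body z) < r1].

Lemma Winf0 : Winf 0.
Proof.
change (r2 * cabs (0 : C) < cabs (1 - body z * 0)).
by rewrite cabs0 !mulr0 subr0 cabs1.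
Qed.
Lemma Winf_ne b : Winf b -> 1 - body z * b != 0.
Proof. by rewrite /Winf /= -cabs_gt0; apply: le_lt_trans; rewrite mulr_ge0 ?cabs_ge0 // ltW. Qed.
Lemma open_Winf : open Winf.
Proof.
apply/openP => b; rewrite /Winf /= -subr_gt0 => hb.
have K0 : 0 <= r2 + cabs (body z) by rewrite addr_ge0 ?cabs_ge0 // ltW.
have [d d0 hd] := ex_small K0 hb; exists d => // t td.
have h1 := cabsD b t; have h2 := cabsDl (1 - body z * b) (- (body z * t)).
have -> : 1 - body z * (b + t) = (1 - body z * b) - body z * t by ring.
apply: lt_le_trans h2; rewrite cabsN cabsM ltrBrDr.
apply: le_lt_trans (_ : r2 * cabs b + d * (r2 + cabs (body z)) < _); last by rewrite -ltrBrDl.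
rewrite mulrDr addrA lerD //; last by rewrite mulrC ler_wpM2r ?cabs_ge0 // ltW.
rewrite mulrC (mulrC r2) -mulrDl ler_wpM2r ?(ltW r2_gt0) // (le_trans h1) // lerD2l ltW //.
Qed.

Lemma gpair_fin : gpair Wfin Wfin (kappa (- e) th z) (kappa e th z).
Proof.
have sub : Wfin `<=` [set b | b != body z].
  by move=> b /= h; rewrite -subr_eq0 -cabs_gt0 (lt_trans _ h).
have oW : open Wfin := @open_gt R (body z) r2.
apply: (gpair_sub (gpair_sym (gpair_kappa oe oth ez)) oW oW sub sub) => a Wa;
  by rewrite body_kappa ?(sub _ Wa) //; exact: odN.
Qed.
Lemma gpair_inf : gpair Winf Winf (kappa_inf (- e) th z) (kappa_inf e th z).
Proof.
apply: (gpair_sub (gpair_sym (gpair_kappa_inf oe oth ez bz)) open_Winf open_Winf Winf_ne Winf_ne) => a Wa;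
  by rewrite body_kappa_inf ?(Winf_ne Wa) //; exact: odN.
Qed.
Lemma gpair_cap_fin : gpair Wcap [set b : C | cabs b < r1]
  (fun a => shift (z + th) (translation (- e) th z a)) (fun a => translation e th z (unshift (z + th) a)).
Proof.
have oW : open Wcap := @open_lt R (body z) r1.
have oV : open [set b : C | cabs b < r1].
  have := @open_lt R 0 r1; congr open; apply/funext => b /=; by rewrite subr0.
apply: (gpair_comp (gpair_sym (gpair_translation oe oth ez oW))).
by apply: gpair_shift => // b; rewrite bzth.
Qed.

Lemma chart_fin : is_chart [set P | cdom S true P /\ Wfin (body (cmap S true P))]
  (fun P => kappa (- e) th z (cmap S true P)).
Proof. exact: is_chart_intro gpair_fin. Qed.
Lemma chart_inf : is_chart [set P | cdom S false P /\ Winf (body (cmap S false P))]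
  (fun P => kappa_inf (- e) th z (cmap S false P)).
Proof. exact: is_chart_intro gpair_inf. Qed.
Lemma chart_cap_fin : is_chart [set P | cdom S true P /\ Wcap (body (cmap S true P))]
  (fun P => shift (z + th) (translation (- e) th z (cmap S true P))).
Proof. exact: is_chart_intro gpair_cap_fin. Qed.
(** On the second sphere the kept part omits infinity and the chart Upsilon omits the points of body
    0; the image is the disc around body z punctured at its centre. *)
Lemma chart_cap_inf : is_chart [set P | cdom S true P /\ (Wcap (body (cmap S true P)) /\ body (cmap S true P) != body z)]
  (fun P => gconj (inversionI (shift (z + th) (translation (- e) th z (cmap S true P))))).
Proof.
pose V : set C := [set b : C | cabs b < r1 /\ b != 0].
pose U : set C := [set b : C | b != 0 /\ r1^-1 < cabs b].
pose W : set C := [set b : C | Wcap b /\ b != body z].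
have oV : open V.
  apply: open_and; last exact: (@open_ne R 0).
  have := @open_lt R 0 r1; congr open; apply/funext => b /=; by rewrite subr0.
have oU : open U.
  apply: open_and; first exact: (@open_ne R 0).
  have := @open_gt R 0 r1^-1; congr open; apply/funext => b /=; by rewrite subr0.
have oW : open W by apply: open_and; [exact: (@open_lt R (body z) r1)|exact: open_ne].
have one := odN oe.
have g1 : gpair W V (fun a => shift (z + th) (translation (- e) th z a))
    (fun a => translation e th z (unshift (z + th) a)).
  apply: (gpair_sub gpair_cap_fin oW oV) => [b []//|b []//|a [Wa na]|a [Va na]].
    by rewrite /V /= body_shift bzth body_translation // subr_eq0.
  by rewrite /W /Wcap /= body_translation // body_unshift bzth addrK -subr_eq0 addrK.
have g2 : gpair V U (SCtrans true false) (SCtrans false true).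
  have inv_lt (b : C) (r s : R) : 0 < r -> b != 0 -> (cabs b < r) = (r^-1 < cabs b^-1).
    by move=> r0 b0; rewrite cabsV ltf_pV2 // posrE // cabs_gt0.
  apply: (gpair_sub (SCtrans_gpair R true false) oV oU) => [b []//|b []//|a [Va na]|a [na Ua]] /=.
    by rewrite body_gconj inversionI_body //; split; [rewrite invr_eq0|rewrite -inv_lt].
  rewrite inversionI_body //; split; last by rewrite invr_eq0.
  by rewrite (inv_lt _ r1) ?invrK // invr_eq0.
exact: (is_chart_intro true (gpair_comp g1 g2)).
Qed.

Lemma unglue_inf P : kept' (inl P) -> cdom S false P ->
  [/\ Winf (body (cmap S false P)), cdom S false (unglue (inl P))
    & cmap S false (unglue (inl P)) = kappa_inf e th z (cmap S false P)].
Proof.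
case: P => [a|b] /keptP /= kP dP; last first.
  have W0 : Winf (body b) by rewrite dP; exact: Winf0.
  by split=> //; rewrite body_kappa_inf //; exact: Winf_ne.
have na := kept_unglue_body kP.
split; [|by rewrite body_kappa|by rewrite kappa_kappa_inf].
rewrite body_gconj inversionI_body // /Winf /= cabsV.
have a0 : 0 < cabs (body a) by rewrite cabs_gt0.
have -> : 1 - body z / body a = (body a - body z) / body a by field.
by rewrite cabsM cabsV ltr_pM2r ?invr_gt0.
Qed.
Lemma unglue_inf_onto P' : cdom S false P' -> Winf (body (cmap S false P')) ->
  exists P, [/\ kept' (inl P), cdom S false P & unglue (inl P) = P'].
Proof.
move=> dP' W; have [W' E] := gp_K gpair_inf W; set w := kappa_inf (- e) th z _ in W' E.
have [dP wE] := SCinvP false w; exists (SCinv false w).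
have kP : kept' (inl (SCinv false w)).
  apply/keptP; move: W'; rewrite /SCinv /Winf /=; case: eqP => [//|/eqP b0].
  rewrite inversionI_body // => W'; have a0 : 0 < cabs (body w) by rewrite cabs_gt0.
  have -> : (body w)^-1 - body z = (1 - body z * body w) / body w by field.
  by rewrite cabsM cabsV ltr_pdivlMr.
split=> //; have [_ d1 E1] := unglue_inf kP dP.
by rewrite -(SCinvK d1) E1 wE E SCinvK.
Qed.

Lemma sewn_fin T : (@push1 R SC_pair 1 SC_cap r1 r2 (cdom S true) T <->
    pts (s := sewn) T /\ [set P | cdom S true P /\ Wfin (body (cmap S true P))] (Kmap T)) /\
  (@push1 R SC_pair 1 SC_cap r1 r2 (cdom S true) T ->
    @descend1 R SC_pair SC_cap (cmap S true) T = kappa (- e) th z (cmap S true (Kmap T))).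
Proof.
apply: (push1_chart (f := fun P => kappa (- e) th z (cmap S true P))) => [[a|b] /keptP //= kP _|[a|b] [dP Wa]]; last by [].
  have na := kept_unglue_body kP; rewrite /Wfin /= body_kappa //.
  by rewrite (gp_K (gpair_kappa oe oth ez) na).2.
have [W E] := gp_K gpair_fin (Wa : Wfin (body a)).
by exists (inl (kappa (- e) th z a)); split=> //; [exact/keptP|rewrite /= E].
Qed.
Lemma sewn_inf (k : Lam -> Lam) T : (@push1 R SC_pair 1 SC_cap r1 r2 (cdom S false) T <->
    pts (s := sewn) T /\ [set P | cdom S false P /\ Winf (body (cmap S false P))] (Kmap T)) /\
  (@push1 R SC_pair 1 SC_cap r1 r2 (cdom S false) T ->
    @descend1 R SC_pair SC_cap (fun P => k (cmap S false P)) T =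
    k (kappa_inf (- e) th z (cmap S false (Kmap T)))).
Proof.
apply: (push1_chart (f := fun P => k (kappa_inf (- e) th z (cmap S false P)))) => [P kP dP|P' [d W]].
  have [W d E] := unglue_inf kP dP; have ne := Winf_ne W; split; last first.
    by rewrite E (gp_K (gpair_kappa_inf oe oth ez bz) ne).2.
  by split=> //; rewrite E body_kappa_inf.
exact: unglue_inf_onto.
Qed.

Lemma sewn_cap_fin T : (@push2 R SC_pair 1 SC_cap r1 r2 (cdom S true) T <->
    pts (s := sewn) T /\ [set P | cdom S true P /\ Wcap (body (cmap S true P))] (Kmap T)) /\
  (@push2 R SC_pair 1 SC_cap r1 r2 (cdom S true) T -> @descend2 R SC_pair SC_cap (cmap S true) T =
    shift (z + th) (translation (- e) th z (cmap S true (Kmap T)))).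
Proof.
apply: (push2_chart (f := fun P => shift (z + th) (translation (- e) th z (cmap S true P)))) => [[a|b] /keptP //= ka _|[a|b] [dP Wa]]; last by [].
  by have [W E] := gp_Ki gpair_cap_fin ka.
have [W E] := gp_K gpair_cap_fin (Wa : Wcap (body a)).
by exists (inl (shift (z + th) (translation (- e) th z a))); split=> //; [exact/keptP|rewrite /= E].
Qed.
Lemma sewn_cap_inf T : (@push2 R SC_pair 1 SC_cap r1 r2 (cdom S false) T <->
    pts (s := sewn) T /\ [set P | cdom S true P /\ (Wcap (body (cmap S true P)) /\ body (cmap S true P) != body z)] (Kmap T)) /\
  (@push2 R SC_pair 1 SC_cap r1 r2 (cdom S false) T -> @descend2 R SC_pair SC_cap (cmap S false) T =
    gconj (inversionI (shift (z + th) (translation (- e) th z (cmap S true (Kmap T)))))).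
Proof.
apply: (push2_chart (f := fun P => gconj (inversionI (shift (z + th) (translation (- e) th z (cmap S true P))))))
  => [[a|b] /keptP //= ka a0|[a|b] [dP [Wa na]]]; last by [].
  have [W E] := gp_Ki gpair_cap_fin ka; split; last by rewrite E.
  by split=> //; split=> //; rewrite body_translation // body_unshift bzth -subr_eq0 addrK.
have [W E] := gp_K gpair_cap_fin (Wa : Wcap (body a)).
exists (inl (shift (z + th) (translation (- e) th z a))); split=> //; [exact/keptP| |by rewrite /= E].
change (body (shift (z + th) (translation (- e) th z a)) != 0).
by rewrite body_shift bzth body_translation ?subr_eq0 //; exact: odN.
Qed.

Lemma sewn_modelled : modelled (X := sewn) Kmap.
Proof.
split.
- move=> _ [u ku <-]; rewrite KmapE; case: u ku => [[a|b]|[a|b]] /keptP //= b0.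
  by rewrite body_kappa_inf // b0 mulr0 subr0 oner_neq0.
- move=> [a|b] hP.
    (* Points far from body z come from the first sphere and the remaining ones from the second, as
       r2 < r1. *)
    have [h|h] := boolP (r2 < cabs (body a - body z)).
      have [W E] := gp_K gpair_fin (h : Wfin (body a)).
      exists (cls (inl (inl (kappa (- e) th z a)))); last by rewrite KmapE /= E.
      by exists (inl (inl (kappa (- e) th z a))) => //; apply/keptP.
    have Wa : Wcap (body a) by rewrite /Wcap /=; apply: le_lt_trans r21; rewrite leNgt.
    have [W E] := gp_K gpair_cap_fin Wa.
    exists (cls (inr (inl (shift (z + th) (translation (- e) th z a))))); last by rewrite KmapE /= E.
    by exists (inr (inl (shift (z + th) (translation (- e) th z a)))) => //; apply/keptP.
  have [P [kP dP E]] := unglue_inf_onto (P' := inr b) hP ltac:(by rewrite [body _](hP : body b = 0); exact: Winf0).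
  by exists (cls (inl P)); [exists (inl P)|rewrite KmapE].
- move=> _ _ [u ku <-] [v kv <-]; rewrite !KmapE => E; exact/cls_eq/unglue_inj.
- apply/seteqP; split=> [_ [u ku <-]|T [[c|c] _ [P [UP kP] <-]]]; last 2 first.
  + by exists (inl P).
  + by exists (inr P).
  case: u ku => [[a|b]|[a|b]] ku.
  + by exists (inl true) => //; exists (inl a).
  + by exists (inl false) => //; exists (inr b) => //; split=> //; case/keptP: (ku).
  + by exists (inr true) => //; exists (inl a).
  + by case/keptP: ku.
case=> [[]|[]].
- exists [set P | cdom S true P /\ Wfin (body (cmap S true P))], (fun P => kappa (- e) th z (cmap S true P)).
  by split=> [|T|T]; [exact: chart_fin|exact: (sewn_fin T).1|exact: (sewn_fin T).2].
- exists [set P | cdom S false P /\ Winf (body (cmap S false P))], (fun P => kappa_inf (- e) th z (cmap S false P)).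
  by split=> [|T|T]; [exact: chart_inf|exact: (sewn_inf id T).1|exact: (sewn_inf id T).2].
- exists [set P | cdom S true P /\ Wcap (body (cmap S true P))],
    (fun P => shift (z + th) (translation (- e) th z (cmap S true P))).
  by split=> [|T|T]; [exact: chart_cap_fin|exact: (sewn_cap_fin T).1|exact: (sewn_cap_fin T).2].
exists [set P | cdom S true P /\ (Wcap (body (cmap S true P)) /\ body (cmap S true P) != body z)],
  (fun P => gconj (inversionI (shift (z + th) (translation (- e) th z (cmap S true P))))).
by split=> [|T|T]; [exact: chart_cap_inf|exact: (sewn_cap_inf T).1|exact: (sewn_cap_inf T).2].
Qed.

Definition sewn_inf_tube : seqpair R :=
  geoAM ((e * th * z^-1 * z^-1) *+ 2) (e * z^-1 * z^-1) z.
Definition sewn_fin_tube : seqpair R :=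
  geoAM ((e * th * z^-1 * z^-1) *+ 2) (e * z^-1) z^-1.
Definition sewn_sk : skdata R 1 := sk1 (1 + e * th * z^-1 * z^-1)
  (fun k => if k == ord0 then sewn_inf_tube else sewn_fin_tube).

Let ezi : is_even z^-1. Proof. exact: ev_inv. Qed.
Let eal : is_even ((e * th * z^-1 * z^-1) *+ 2).
Proof. by apply: evMn; do 2 apply: evM => //; exact: odM. Qed.
Let al_e : exists y, (e * th * z^-1 * z^-1) *+ 2 = e * y.
Proof. by exists ((th * z^-1 * z^-1) *+ 2); rewrite mulrnAr !mulrA. Qed.

Lemma sewn_setSK : setSK sewn_sk.
Proof.
split=> //.
  apply: (setH_geo oe ez eal _ al_e); first by do 2 apply: od_evM => //.
  by exists (z^-1 * z^-1); rewrite mulrA.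
move=> j; split.
- by apply: evD; [exact: ev1|do 2 apply: evM => //; exact: odM].
- by rewrite /= bodyD body1 !bodyM (body_odd oe) !mul0r addr0 oner_neq0.
apply: (setH_geo oe ezi eal _ al_e); first exact: od_evM.
by exists z^-1.
Qed.

(** The series is evaluated at I after Delta, which is [gconj] after Upsilon; conjugating the flow
    by [gconj] exchanges the parameters i and -i of [kinf]. *)
Lemma sewn_inf_value p : cabs (body z * body p) < 1 ->
  sser_at (tildeE (sewn_inf_tube.1, fun j => - ('i *: sewn_inf_tube.2 j))) p
    (gconj (kappa_inf (- e) th z (gconj p))).
Proof.
move=> pz; have tE : (sewn_inf_tube.1, fun j => - ('i *: sewn_inf_tube.2 j)) =
    geoAM ((e * th * z^-1 * z^-1) *+ 2) (- ii R * e * z^-1 * z^-1) z.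
  by congr pair; apply/funext => j; rewrite /= ii_scale !mulNr -!mulrA.
rewrite tE; apply: sser_at_eq (tildeE_value oe oth ez bz pz).
have ie := ii_even R; have ne : 1 - body z * body (gconj p) != 0.
  by rewrite body_gconj subr_eq0; apply/eqP => E; rewrite -E cabs1 ltxx in pz.
have [ke ko] := flow_parts (odN oe) oth (minf_dataT (evN ie) ez bz) ne.
rewrite -[RHS]evp_odp; have [-> ->] := gconj_parts (kappa_inf (- e) th z (gconj p)).
rewrite /kappa_inf ke ko; have [-> ->] := gconj_parts p.
rewrite /flow; have ex := @evp_even R p; have of' := @odp_odd R p.
have [_ el em _] := minf_dataT ie ez bz ex ex (ltac:(by rewrite /= body_evp; rewrite body_gconj in ne) : [set b | 1 - body z * b != 0] (body (evp p))) erefl.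
move: (linf z (evp p)) (minf z (evp p)) el em => l m el em.
rewrite /kinf.
have eu : is_even (uinf z (evp p)) by apply/ev_inv/evB; [exact: ev1|exact: evM].
move: (uinf z (evp p)) eu => u eu; move: (evp p) (odp p) ex of' => x f ex of'.
by super [:: e; th; f] [:: ii R; z^-1; u; l; m; x].
Qed.

Lemma kappa_0 : kappa e th z 0 = 0.
Proof.
rewrite /kappa /flow /hfin (even_evp (@ev0 R)) (odd_odp (@od0 R)).
by rewrite (sub0r z) invrN subrr !mulr0 !mul0r mul0rn subr0 !addr0.
Qed.
Lemma kappa_inf_0 : kappa_inf e th z 0 = 0.
Proof.
rewrite /kappa_inf /flow /kinf /linf /uinf (even_evp (@ev0 R)) (odd_odp (@od0 R)).
by rewrite !mulr0 subr0 invr1 subrr !mulr0 !mul0r subr0 mulr0 mul0rn !addr0.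
Qed.

Lemma sewn_represents : represents sewn_sk (sewn_tubed SC_pair 1 0 SC_cap r1 r2).
Proof.
exists Kmap; first exact: (modelled_iso sewn_modelled).
have z0 : 0 < cabs (body z) by rewrite cabs_gt0.
case=> -[|[|k]] // hk.
- have -> : Ordinal hk = ord0 by exact/val_inj.
  rewrite /sk_puncture unlift_none; split.
    by apply: etrans (KmapE _) _; rewrite /= kappa_inf_0.
  (* On this disc |z y| < 1 / 2, which gives both the convergence of the geometric series and
     membership in [Winf]. *)
  pose D : set (pt S) := [set P | cdom S false P /\ cabs (body (cmap S false P)) < (cabs (body z))^-1 / 2].
  have cD : is_chart D (cmap S false).
    have oW : open [set b : C | cabs b < (cabs (body z))^-1 / 2].
      have := @open_lt R 0 ((cabs (body z))^-1 / 2); congr open; apply/funext => b /=; by rewrite subr0.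
    exact: (is_chart_intro false (gpair_id oW)).
  have DW P : D P -> [/\ cdom S false P, Winf (body (cmap S false P)) & cabs (body z * body (cmap S false P)) < 1].
    move=> [d h]; have small : cabs (body z * body (cmap S false P)) < 1 / 2.
      by rewrite cabsM mulrC -ltr_pdivlMr // div1r mulrC.
    split=> //; last by apply: lt_trans small _; lra.
    have h1 := cabsDl 1 (- (body z * body (cmap S false P))); rewrite cabs1 cabsN in h1.
    apply: lt_le_trans h1; apply: (@lt_trans _ _ (1/2)); last by move: small; lra.
    rewrite /r2 mulrAC -cabsM; move: small; lra.
  exists [set T | pts (s := sewn) T /\ D (Kmap T)].
    split; first exact: (modelled_sopen sewn_modelled cD).
    split; first by exists (inl (inr 0)) => //; apply/keptP; exact: body0.
    change (D (Kmap (cls (inl (inr 0))))); rewrite KmapE /= kappa_inf_0; split=> /=; first exact: body0.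
    by rewrite body0 cabs0 divr_gt0 // invr_gt0.
  move=> T [pT /DW[d W small]]; have hT := (sewn_inf (@gconj R) T).1.2 (conj pT (conj d W)).
  split; first exact: hT.
  rewrite /sk_coordinate unlift_none; change (sser_at (tildeE (sewn_inf_tube.1, fun j => - ('i *: sewn_inf_tube.2 j)))
    (SC_inversion (Kmap T)) (@descend1 R SC_pair SC_cap (fun P => gconj (cmap S false P)) T)).
  rewrite (sewn_inf (@gconj R) T).2 // SC_inversionE.
  apply: sser_at_eq (sewn_inf_value _); rewrite ?gconjK //.
  by rewrite body_gconj.
have -> : Ordinal hk = lift ord0 (ord0 : 'I_1) by exact/val_inj.
rewrite /sk_puncture liftK; split.
  by apply: etrans (KmapE _) _; rewrite /= kappa_0.
(* For |a| < |z| / 4 the distance from a to body z exceeds r2, and a is within the disc of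
   convergence of radius |z|. *)
pose D : set (pt S) := [set P | cdom S true P /\ cabs (body (cmap S true P)) < r2].
have cD : is_chart D (cmap S true).
  have oW : open [set b : C | cabs b < r2].
    have := @open_lt R 0 r2; congr open; apply/funext => b /=; by rewrite subr0.
  exact: (is_chart_intro true (gpair_id oW)).
have DW P : D P -> cdom S true P /\ Wfin (body (cmap S true P)).
  move=> [d h]; split=> //; rewrite /Wfin /= cabsC.
  have h1 := cabsDl (body z) (- body (cmap S true P)); rewrite cabsN in h1.
  apply: lt_le_trans h1; move: h z0; rewrite /r2; lra.
exists [set T | pts (s := sewn) T /\ D (Kmap T)].
  split; first exact: (modelled_sopen sewn_modelled cD).
  have k0 : kept' (inl (inl 0)).
    by apply/keptP; rewrite body0 sub0r cabsN (lt_trans r21).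
  split; first by exists (inl (inl 0)).
  by change (D (Kmap (cls (inl (inl 0))))); rewrite KmapE /= kappa_0; split=> //=; rewrite body0 cabs0.
move=> T [pT DT]; have [d W] := DW _ DT; have hT := (sewn_fin T).1.2 (conj pT (conj d W)).
split; first exact: hT.
rewrite /sk_coordinate liftK; case E : (Kmap T) d W DT => [a|b] //= _ W [_ DT].
exists a => //; change (sser_at (hatE (1 + e * th * z^-1 * z^-1) sewn_fin_tube)
  (shift 0 a) (@descend1 R SC_pair SC_cap (cmap S true) T)).
rewrite (sewn_fin T).2 // E /Defs.shift (even_odp (@ev0 R)) mulr0 !subr0.
apply: hatE_value => //; apply: lt_trans DT _; exact: lt_trans r21 r1z.
Qed.

Lemma sewn_is_sewing : is_sewing (sk_pair z th) 1 (sk_M32 e) sewn_sk.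
Proof.
split=> //; [exact: pair_setSK|exact: cap_setSK|exact: sewn_setSK|].
exists SC_pair, SC_cap, r1, r2; split; last exact: sewn_represents.
- by split; [exact: pair_with_tubes|exact: pair_represents].
- by split; [exact: cap_with_tubes|exact: cap_represents].
exact: pair_cap_sewable.
Qed.

End Sewn.

(** * Continuation of local coordinates *)

Section OpenMapping.
Variable R : realType.
Local Notation C := (cplx R).
Implicit Types (x y z t s c : C) (a : nat -> C) (r e d : R) (h : C -> C).

Lemma pow_diff_bound t s (sg : R) n : cabs t <= sg -> cabs s <= sg ->
  cabs (t ^+ n.+1 - s ^+ n.+1) <= cabs (t - s) * (n.+1%:R * sg ^+ n).
Proof.
move=> ht hs; have sg0 : 0 <= sg := le_trans (cabs_ge0 t) ht.
rewrite subrXX cabsM ler_wpM2l ?cabs_ge0 //; apply: (le_trans (cabs_sum _ _ _)).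
rewrite mulr_natl -[X in _ *+ X]card_ord -sumr_const; apply: ler_sum => i _.
have E : sg ^+ n = sg ^+ (n.+1 - i.+1) * sg ^+ i by rewrite subSS -exprD subnK // -ltnS.
rewrite cabsM !cabsX E ler_pM ?exprn_ge0 ?cabs_ge0 //.
  by rewrite lerXn2r ?nnegrE ?cabs_ge0.
by rewrite lerXn2r ?nnegrE ?cabs_ge0.
Qed.

(* Picard iteration for [t = (c - h z - (h (z + t) - h z - a 1 t)) / a 1]. *)
Lemma an_open h z a r : pseries a r h z -> a 1%N != 0 -> forall e, 0 < e ->
  exists2 d, 0 < d & forall c, cabs (c - h z) < d -> exists2 t, cabs t < e & h (z + t) = c.
Proof.
move=> ha a1 e e0; have r0 := proj1 ha; pose p0 : R := r / 2.
have p00 : 0 < p0 by rewrite divr_gt0.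
have p0r : p0 < r by rewrite /p0; lra.
have [M M0 hM] := pseries_bound ha (ltW p00) p0r.
have A1 : 0 < cabs (a 1%N) by rewrite cabs_gt0.
(* On the disc of radius [sg] the nonlinear part [k] has Lipschitz constant L * sg; sg <= d makes
   this at most |a 1| / 2, a contraction after division by a 1. The constant 16 and the bound sg <=
   p0 / 4 absorb the factors i + 2 from differences of powers. *)
pose L : R := 16 * M / p0 ^+ 2 .
have L0 : 0 <= L by rewrite divr_ge0 ?mulr_ge0 ?exprn_ge0 // ltW.
have [d d0 hd] := ex_small L0 (ltac:(by rewrite divr_gt0) : 0 < cabs (a 1%N) / 2).
pose sg := Num.min d (Num.min (e / 2) (p0 / 4)).
have sg0 : 0 < sg by rewrite !lt_min d0 !divr_gt0.
have sgd : sg <= d by rewrite ge_min lexx.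
have sge : sg < e.
  by apply: (@le_lt_trans _ _ (e / 2)); [rewrite !ge_min lexx orbT|lra].
have sgp : sg <= p0 / 4 by rewrite !ge_min lexx !orbT.
pose k t := h (z + t) - h z - a 1%N * t.
have hz : h z = a 0%N := pseries0 ha.
have lip t s : cabs t <= sg -> cabs s <= sg -> cabs (k t - k s) <= cabs (a 1%N) / 2 * cabs (t - s).
  move=> ht hs; have tr : cabs t < r by rewrite (le_lt_trans ht) // (le_lt_trans sgp) // /p0; lra.
  have sr : cabs s < r by rewrite (le_lt_trans hs) // (le_lt_trans sgp) // /p0; lra.
  have S1 := csumD ((proj2 ha) t tr) (csumZ (-1) ((proj2 ha) s sr)).
  have S2 := csum_split 2 S1.
  have -> : k t - k s = h (z + t) + -1 * h (z + s) - \sum_(i < 2) (a i * t ^+ i + -1 * (a i * s ^+ i)).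
    by rewrite !big_ord_recr big_ord0 /k /= !expr0 !expr1; ring.
  apply: (@le_trans _ _ (L * sg * cabs (t - s))); last first.
    rewrite ler_wpM2r ?cabs_ge0 //; apply: le_trans (ltW hd).
    by rewrite mulrC ler_wpM2r.
  apply: (csum_le S2) => n.
  have term i : cabs (a (i + 2)%N * t ^+ (i + 2) + -1 * (a (i + 2)%N * s ^+ (i + 2))) <=
      (cabs (a (i + 2)%N) * p0 ^+ (i + 2)) * (16 / p0 ^+ 2 * sg * cabs (t - s)).
    rewrite mulN1r -mulrBr cabsM -mulrA ler_wpM2l ?cabs_ge0 // addn2.
    apply: (le_trans (pow_diff_bound i.+1 ht hs)).
    rewrite [leLHS]mulrC mulrA ler_wpM2r ?cabs_ge0 //.
    have -> : p0 ^+ i.+2 * (16 / p0 ^+ 2 * sg) = p0 ^+ i * 16 * sg.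
      by rewrite -addn2 exprD; field; rewrite ?lt0r_neq0.
    rewrite exprS mulrCA mulrA [leRHS]mulrC -[leLHS]mulrA ler_wpM2l ?(ltW sg0) //.
    have s1 : sg ^+ i <= (p0 / 4) ^+ i.
      have p4 : 0 <= p0 / 4 := le_trans (ltW sg0) sgp.
      by apply: lerXn2r sgp; rewrite nnegrE // ltW.
    apply: (le_trans (ler_wpM2l (ler0n _ _) s1)).
    rewrite expr_div_n mulrCA ler_wpM2l ?exprn_ge0 ?(ltW p00) //.
    rewrite ler_pdivrMr ?exprn_gt0 // -!natrX -natrM ler_nat.
    have := ltn_expl i (isT : 1 < 4)%N; move: (4 ^ i)%N; clear; lia.
  apply: (@le_trans _ _ (\sum_(i < n) (cabs (a (i + 2)%N) * p0 ^+ (i + 2)) * (16 / p0 ^+ 2 * sg * cabs (t - s)))).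
    by apply: ler_sum => i _; exact: term.
  rewrite -mulr_suml.
  have h1 := hM (n + 2)%N; rewrite -(big_mkord xpredT (fun i => cabs (a i) * p0 ^+ i)) in h1.
  have h2 : \sum_(i < n) cabs (a (i + 2)%N) * p0 ^+ (i + 2) <= M.
    apply: le_trans h1; rewrite addnC big_mkord big_split_ord /= addrC.
    rewrite (eq_bigr (fun i : 'I_n => cabs (a (2 + i)%N) * p0 ^+ (2 + i))) ?lerDl ?sumr_ge0 // => i _.
      by rewrite mulr_ge0 ?cabs_ge0 ?exprn_ge0 ?ltW.
    by rewrite addnC.
  apply: (le_trans (ler_wpM2r _ h2)).
    apply: mulr_ge0 (cabs_ge0 _); apply: mulr_ge0 (ltW sg0).
    by rewrite divr_ge0 // exprn_ge0 // ltW.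
  by rewrite /L le_eqVlt; apply/orP; left; apply/eqP; ring.
have k0 : k 0 = 0 by rewrite /k addr0 subrr mulr0 subr0.
exists (cabs (a 1%N) * sg / 2); first by rewrite divr_gt0 // mulr_gt0.
move=> c hc; pose t_ := fix t_ n := if n is n'.+1 then (c - h z - k (t_ n')) / a 1%N else 0 : C.
have tS n : t_ n.+1 = (c - h z - k (t_ n)) / a 1%N by [].
have bnd n : cabs (t_ n) <= sg.
  elim: n => [|n IH]; first by rewrite cabs0 ltW.
  rewrite tS cabsM cabsV ler_pdivrMr //; apply: (le_trans (cabsB _ _)).
  have := lip _ 0 IH; rewrite cabs0 => /(_ (ltW sg0)); rewrite k0 !subr0 => h1.
  have h2 : cabs (a 1%N) / 2 * cabs (t_ n) <= cabs (a 1%N) / 2 * sg.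
    by rewrite ler_wpM2l // divr_ge0 // ltW.
  by move: hc h1 h2; lra.
have dt n : cabs (t_ n.+1 - t_ n) <= sg / 2 ^+ n.
  elim: n => [|n IH]; first by rewrite subr0 expr0 divr1; exact: bnd 1%N.
  have -> : t_ n.+2 - t_ n.+1 = - (k (t_ n.+1) - k (t_ n)) / a 1%N.
    by rewrite (tS n.+1) [X in _ - X](tS n) -mulrBl; congr (_ / _); ring.
  rewrite cabsM cabsN cabsV ler_pdivrMr //; apply: (le_trans (lip _ _ (bnd _) (bnd _))).
  apply: le_trans (ler_wpM2l _ IH) _; first by rewrite divr_ge0 // ltW.
  by rewrite exprS le_eqVlt; apply/orP; left; apply/eqP; field; rewrite expf_neq0.
have [s hs] : exists s, csum (fun n => t_ n.+1 - t_ n) s.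
  apply: (@csum_dom R _ (fun n => sg / 2 ^+ n) (sg * 2)) => // n.
  rewrite -mulr_sumr ler_wpM2l ?(ltW sg0) //.
  under eq_bigr do rewrite -exprVn.
  have h12 : (1 - 2^-1)^-1 = 2 :> R by field.
  rewrite -[leRHS]h12.
  by apply: geom_sum; rewrite ?invf_lt1 ?ltr1n // invr_ge0.
have ts : ccvg t_ s.
  move=> e' e'0; have [N hN] := (proj2 hs) e' e'0; exists N => n Nn; have := hN n Nn.
  have -> : \sum_(i < n) (t_ i.+1 - t_ i) = t_ n.
    by rewrite -(big_mkord xpredT (fun i => t_ i.+1 - t_ i)) telescope_sumr // subr0.
  by [].
have ssg : cabs s <= sg.
  by rewrite -[s]subr0; apply: (ccvg_le (N := 0%N) ts) => n _; rewrite subr0.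
exists s; first exact: le_lt_trans ssg sge.
apply/eqP; rewrite -subr_eq0; apply/eqP/small0 => e' e'0.
have e1 : 0 < e' / (3 * cabs (a 1%N)) by rewrite divr_gt0 // mulr_gt0.
have [N hN] := ts _ e1.
have n1 := hN N (leqnn N); have n2 := hN N.+1 (leqnSn N).
have -> : h (z + s) - c = (k s - k (t_ N)) + a 1%N * (s - t_ N.+1).
  by rewrite mulrBr tS [a 1%N * (_ / _)]mulrC divfK // /k; ring.
apply: (le_trans (cabsD _ _)); have l1 := lip _ _ ssg (bnd N).
rewrite cabsC in n1; rewrite cabsC in n2; rewrite (cabsM (a 1%N)).
rewrite ltr_pdivlMr ?mulr_gt0 // in n1; rewrite ltr_pdivlMr ?mulr_gt0 // in n2.
by move: l1 n1 n2; move: (cabs (a 1%N)) A1 (cabs (s - t_ N)) (cabs (s - t_ N.+1)) (cabs (k s - k (t_ N))) => A A0 u v w; lra.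
Qed.

End OpenMapping.

(** Connectedness of [0, 1]: the supremum of the times up to which T holds satisfies T by the last
    hypothesis, and openness lets it be exceeded unless it is 1. *)
Lemma segment_ind (R : realType) (T : R -> Prop) : T 0 ->
  (forall t, 0 <= t <= 1 -> T t -> exists2 d, 0 < d & forall s, 0 <= s <= 1 -> `|s - t| < d -> T s) ->
  (forall t, 0 < t <= 1 -> (forall s, 0 <= s < t -> T s) -> T t) ->
  forall t, 0 <= t <= 1 -> T t.
Proof.
move=> T0 Top Tcl.
pose A := [set t : R | 0 <= t <= 1 /\ forall s, 0 <= s <= t -> T s].
have A0 : A 0.
  split=> [|s]; first by rewrite lexx ler01.
  by move=> s0; have -> : s = 0 by apply/eqP; rewrite eq_le andbC.
have sA : has_sup A by split; [exists 0 | exists 1 => t [/andP[_]]].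
pose b := sup A; have b0 : 0 <= b by apply: ub_le_sup => //; exact: (proj2 sA).
have b1 : b <= 1 by apply: ge_sup => [|t [/andP[_]]] //; exists 0.
have Ab s : 0 <= s < b -> T s.
  move=> /andP[s0 sb]; have d0 : 0 < b - s by rewrite subr_gt0.
  have [t [t01 hA] tb] := sup_adherent d0 sA.
  by apply: hA; rewrite s0 /=; move: tb; rewrite -/b; lra.
have Tb : T b.
  have [/eqP b00|bn] := boolP (b == 0); first by rewrite b00.
  by apply: Tcl => //; rewrite b1 andbT lt_neqAle eq_sym bn.
have [d d0 hd] := Top b (ltac:(by rewrite b0 b1)) Tb.
have b1' : b = 1.
  apply/eqP; rewrite eq_le b1 /= leNgt; apply/negP => blt.
  have m0 : 0 < Num.min (d / 2) (1 - b) by rewrite lt_min divr_gt0 //= subr_gt0.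
  have mr : Num.min (d / 2) (1 - b) <= d / 2 by rewrite ge_min lexx.
  have m1 : Num.min (d / 2) (1 - b) <= 1 - b by rewrite ge_min lexx orbT.
  have : b + Num.min (d / 2) (1 - b) <= b; last by lra.
  apply: ub_le_sup; first exact: (proj2 sA).
  split=> [|s /andP[s0 sb]]; first by apply/andP; split; lra.
  have [sb'|bs] := ltP s b; first by apply: Ab; rewrite s0.
  by apply: hd; [apply/andP; split; lra|rewrite ger0_norm ?subr_ge0 //; lra].
move=> t /andP[t0 t1]; have [tb|bt] := ltP t b; first by apply: Ab; rewrite t0.
by have -> : t = b by apply/eqP; rewrite eq_le bt b1' t1.
Qed.

(** * Injective superanalytic maps and their effect on bodies *)

Section NiceMaps.
Local Open Scope fset_scope.
Local Open Scope classical_set_scope.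
Local Open Scope ring_scope.
Variable R : realType.
Local Notation C := (cplx R).
Local Notation Lam := (grassmann C).
Implicit Types (x y a : Lam) (V W : set C) (H Phi : Lam -> Lam) (b t c : C).

(** A product of all the generators of x kills the soul of x. *)
Lemma mono_top (I : {fset nat}) x : (gens x `<=` I)%fset -> x * mono R I = body x *: mono R I.
Proof.
move=> xI; apply/grP => J; rewrite grME grZE monoE.
have zero L : L != fset0 -> (L `<=` J)%fset -> x L * mono R I (J `\` L)%fset = 0.
  move=> L0 LJ; have [->|xL] := eqVneq (x L) 0; first by rewrite mul0r.
  rewrite monoE; case: eqP => [E|_]; last by rewrite mulr0.
  have LI := fsubset_trans (gensP xL) xI; case/negP: L0; rewrite -fsubset0.
  by apply/fsubsetP => i iL; have := fsubsetP LI i iL; rewrite -E in_fsetD iL.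
rewrite (big_fsetD1 fset0) ?fpowersetE ?fsub0set //= big1_seq ?addr0.
  by rewrite fsetD0 monoE /inversions big_seq_fset0 expr0 mul1r.
move=> L /=; rewrite in_fsetD1 fpowersetE => /andP[L0 LJ].
by rewrite zero ?mulr0.
Qed.

Lemma taylor_scalar (f : jet R) b : taylor f b%:A = f b 0%N.
Proof.
have s0 : soul (b%:A : Lam) = 0 by rewrite /soul bodyA1 subrr.
rewrite /taylor bodyA1 big_ord_recl expr0 mulr1 big1 ?addr0 // => i _.
by rewrite s0 exprS mul0r mulr0.
Qed.

Lemma ex_even_top (x : Lam) : exists I : {fset nat},
  [/\ (gens x `<=` I)%fset, ~~ odd #|` I|%fset & I != fset0].
Proof.
have [i hi] := fresh [:: gens x]; have {}hi : i \notin gens x by apply: hi; rewrite mem_head.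
have [j hj] := fresh [:: (i |` gens x)%fset]; have {}hj : j \notin (i |` gens x)%fset by apply: hj; rewrite mem_head.
have ne k (L : {fset nat}) : (k |` L)%fset != fset0.
  by apply/eqP => /fsetP/(_ k); rewrite in_fset1U eqxx in_fset0.
have [od_g|ev_g] := boolP (odd #|` gens x|%fset).
  by exists (i |` gens x)%fset; rewrite fsubsetUr cardfsU1 hi /= od_g.
exists (j |` (i |` gens x))%fset; rewrite cardfsU1 hj cardfsU1 hi /= negbK ev_g; split=> //.
by apply: fsubset_trans (fsubsetUr _ _); exact: fsubsetUr.
Qed.

(* If the derivative had no body, adding to the point a product of enough
   generators would not change the value. *)
Lemma SA_deriv V H b : SA V H -> (forall p q : Lam, V (body p) -> V (body q) -> H p = H q -> p = q) ->
  V b -> exists (u : nat -> C) (r : R), pseries u r (fun t => body (H t%:A)) b /\ u 1%N != 0.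
Proof.
move=> [f [g [fa ga hH]]] inj Vb.
have Hev w : is_even w -> V (body w) -> H w = taylor f w.
  by move=> ew Vw; rewrite hH // even_evp // even_odp // mul0r addr0.
have eA t : is_even (t%:A : Lam) by exact: evA.
have [r r0 hr] := (analyticP V f).1 fa b Vb.
exists (fun n => body (f b n)), r; split.
  split=> // t tr; have [Vt] := hr t tr => /abs_sumP/(_ fset0).
  rewrite Hev ?bodyA1 // body_taylor // bodyA1; apply: eq_csum => n.
  by rewrite grZE mulrC.
apply/negP => /eqP a0; have [I [gI eI I0]] := ex_even_top (f b 1%N).
have eX : is_even (mono R I) := mono_even R eI.
have bX : body (mono R I) = 0 by rewrite /body monoE eq_sym (negPf I0).
have XX : mono R I * mono R I = 0 := mono_sq R I0.
have ebX : is_even (b%:A + mono R I) by exact: evD.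
have E : H (b%:A + mono R I) = H b%:A.
  rewrite !Hev ?bodyD ?bX ?bodyA1 ?addr0 // taylor_shift // !taylor_scalar /djet mulr1n.
  by rewrite mono_top // a0 scale0r addr0.
have /inj : V (body (b%:A + mono R I)) by rewrite bodyD bX bodyA1 addr0.
move=> /(_ _ _ E); rewrite bodyA1 => /(_ Vb) /eqP; rewrite -subr_eq0 addrC addKr => /eqP h.
by have := congr1 (fun x : Lam => x I) h; rewrite /= monoE eqxx gr0E => /eqP; rewrite oner_eq0.
Qed.

(** The properties of an injective superanalytic map that the continuation arguments use, selected
    so that they pass to compositions: action on analytic paths, dependence of bodies on bodies,
    local openness and a linear lower bound for the map on bodies. *)
Record nice V Phi : Prop := Nice {
  nice_open : open V;
  nice_path : forall ga : C -> Lam, anpath ga -> V (body (ga 0)) -> anpath (fun t => Phi (ga t));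
  nice_body : forall p q : Lam, V (body p) -> body q = body p -> body (Phi q) = body (Phi p);
  nice_onto : forall b, V b -> forall e : R, 0 < e -> exists2 d : R, 0 < d &
    forall c, cabs (c - body (Phi b%:A)) < d ->
      exists t, [/\ cabs t < e, V (b + t) & body (Phi (b + t)%:A) = c];
  nice_low : forall b, V b -> exists (K : R) (r : R), [/\ 0 < K, 0 < r & forall t, cabs t < r ->
      V (b + t) /\ K * cabs t <= cabs (body (Phi (b + t)%:A) - body (Phi b%:A))] }.

Lemma nice_SA V H : SA V H -> (forall p q : Lam, V (body p) -> V (body q) -> H p = H q -> p = q) ->
  nice V H.
Proof.
move=> hH inj; have oV := SA_open hH; split=> //.
- by move=> ga hga V0; exact: SA_anpath hH hga V0.
- by move=> p q Vp E; exact: SA_body hH Vp E.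
- move=> b Vb e e0; have [a [r [ha a1]]] := SA_deriv hH inj Vb.
  have [r' r'0 hr'] := (openP V).1 oV b Vb.
  have m0 : 0 < Num.min e r' by rewrite lt_min e0.
  have [d d0 hd] := an_open ha a1 m0; exists d => // c /hd[t]; rewrite lt_min => /andP[te tr] E.
  by exists t; split=> //; exact: hr'.
move=> b Vb; have [a [r [ha a1]]] := SA_deriv hH inj Vb.
have [r' r'0 hr'] := (openP V).1 oV b Vb.
have [M M0 hM] := pseries_rem 2 ha; have A1 : 0 < cabs (a 1%N) by rewrite cabs_gt0.
have [d d0 hd] := ex_small M0 (ltac:(by rewrite divr_gt0) : 0 < cabs (a 1%N) / 2).
exists (cabs (a 1%N) / 2), (Num.min d (Num.min r' (r / 2))); split; first by rewrite divr_gt0.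
  by rewrite !lt_min d0 r'0 divr_gt0 // (proj1 ha).
move=> t; rewrite !lt_min => /and3P[td tr' tr]; split; first exact: hr'.
have := hM t (ltW tr); rewrite !big_ord_recr big_ord0 /= expr0 expr1 add0r mulr1.
rewrite -(pseries0 ha) opprD addrA => h.
set D := body (H (b + t)%:A) - body (H b%:A) in h *.
have h1 := cabsDl (a 1%N * t) (D - a 1%N * t); rewrite subrKC cabsM in h1.
have h2 : M * cabs t ^+ 2 <= cabs (a 1%N) / 2 * cabs t.
  rewrite expr2 mulrA ler_wpM2r ?cabs_ge0 // mulrC; apply: le_trans (ltW hd).
  by rewrite ler_wpM2r // ltW.
by move: h h1 h2; lra.
Qed.

Lemma nice_open_pre V W Phi : nice V Phi -> open W -> open [set b | V b /\ W (body (Phi b%:A))].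
Proof.
move=> h oW; apply/openP => b [Vb Wb].
have pid : anpath (fun t => (b + t)%:A : Lam).
  by apply: anpath_scalar; apply: anD; [exact: an_cst|exact: an_id].
have b0 : body ((b + 0)%:A : Lam) = b by rewrite addr0 bodyA1.
have V0 : V (body ((b + 0)%:A : Lam)) by rewrite b0.
have [r r0 hr] := anpath_in (nice_open h) pid V0.
have W0 : W (body (Phi (b + 0)%:A)) by rewrite addr0.
have [r' r'0 hr'] := anpath_in oW (nice_path h pid V0) W0.
exists (Num.min r r'); first by rewrite lt_min r0.
move=> t; rewrite lt_min => /andP[tr tr']; split; last exact: hr'.
by have := hr t tr; rewrite bodyA1.
Qed.

Lemma nice_comp V W Phi Psi : nice V Phi -> nice W Psi ->
  nice [set b | V b /\ W (body (Phi b%:A))] (fun a => Psi (Phi a)).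
Proof.
move=> h h'; have bE a : V (body a) -> body (Phi a) = body (Phi (body a)%:A).
  by move=> Va; rewrite -(nice_body h Va (q := (body a)%:A)) ?bodyA1.
split; first exact: nice_open_pre h (nice_open h').
- move=> ga hga [V0 W0]; apply: (nice_path h'); last by rewrite bE.
  exact: (nice_path h).
- by move=> p q [Vp Wp] E; apply: (nice_body h'); [rewrite bE|exact: (nice_body h)].
all: move=> b [Vb Wb].
- move=> e e0; have [d d0 hd] := nice_onto h Vb e0.
  have [d' d'0 hd'] := nice_onto h' Wb d0; exists d' => // c.
  have -> : body (Psi (Phi b%:A)) = body (Psi (body (Phi b%:A))%:A).
    by apply: (nice_body h'); rewrite ?bodyA1.
  move=> /hd'[t [td Wt E]]; have [|u [ue Vu Eu]] := hd (body (Phi b%:A) + t).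
    by rewrite addrAC subrr add0r.
  exists u; split; [exact: ue|by split; [exact: Vu|rewrite Eu]|].
  by rewrite -E; apply: (nice_body h'); rewrite bodyA1.
have PhiE t : W (body (Phi t%:A)) -> body (Psi (Phi t%:A)) = body (Psi (body (Phi t%:A))%:A).
  by move=> Wt; apply: (nice_body h'); rewrite ?bodyA1.
have [K [r [K0 r0 hr]]] := nice_low h Vb; have [K' [r' [K'0 r'0 hr']]] := nice_low h' Wb.
have [r2 r20 hr2] := (openP _).1 (nice_open_pre h (nice_open h')) b (conj Vb Wb).
have pid : anpath (fun t => (b + t)%:A : Lam).
  by apply: anpath_scalar; apply: anD; [exact: an_cst|exact: an_id].
have V0 : V (body ((b + 0)%:A : Lam)) by rewrite addr0 bodyA1.
have [r3 r30 hr3] := an_cont (anpath_body (nice_path h pid V0)) r'0.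
exists (K' * K), (Num.min r (Num.min r2 r3)); split; [exact: mulr_gt0|by rewrite !lt_min r0 r20 r30|].
move=> t; rewrite !lt_min => /and3P[tr tr2 tr3]; have [Vt Wt] := hr2 t tr2; split=> //.
have := hr3 t tr3; rewrite add0r addr0 => small.
rewrite (PhiE _ Wt) (PhiE _ Wb); move: (proj2 (hr t tr)) small hr'.
move: (body (Phi (b + t)%:A)) (body (Phi b%:A)) => X B hX small hr'.
have [_] := hr' (X - B) small; rewrite subrKC; apply: le_trans.
by rewrite -mulrA ler_wpM2l // ltW.
Qed.
End NiceMaps.

Section LocalForms.
Variable R : realType.
Local Notation C := (cplx R).
Local Notation Lam := (grassmann C).

Lemma local_form (X Y : surface R) (U : set (pt X)) (F : pt X -> pt Y) i j p :
  set_inj (cdom X i) (cmap X i) -> superconformal_map U F ->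
  U p -> cdom X i p -> cdom Y j (F p) ->
  exists V H, [/\ V (body (cmap X i p)), superconformal V H,
    forall a, V (body a) -> exists2 q, cdom X i q & cmap X i q = a
    & forall q, cdom X i q -> V (body (cmap X i q)) ->
        [/\ U q, cdom Y j (F q) & cmap Y j (F q) = H (cmap X i q)]].
Proof.
move=> inj sF Up dp dFp; have [V [oV E hH]] := sF i j.
have Vp : V (body (cmap X i p)).
  have : dewitt V (cmap X i p) by rewrite -E; exists p.
  by [].
have [H sH EH] := hH (ex_intro _ _ Vp); exists V, H; split=> //.
  move=> a Va; have : dewitt V a by [].
  by rewrite -E => -[q [[_ dq] _] qa]; exists q.
move=> q dq Vq; have : dewitt V (cmap X i q) by [].
rewrite -E => -[q' [[Uq' dq'] dFq'] /inj qq].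
have {}qq := qq (mem_set dq') (mem_set dq); rewrite qq in Uq' dFq' dq'.
by split=> //; apply: EH.
Qed.

(** A coordinate of an abstract surface, read on the sphere, is a composition of two superconformal
    maps through a chart of that surface. *)
Lemma local_nice (X : surface R) (G : pt (SC R) -> pt X) (U : set (pt X)) (om : pt X -> Lam) c P :
  super_riemann X -> superconformal_map (X := SC R) (pts (s := SC R)) G ->
  (forall P Q, pts P -> pts Q -> G P = G Q -> P = Q) ->
  (forall P, pts P -> pts (G P)) ->
  superconformal_map (Y := flat R) U om -> set_inj U om ->
  cdom (SC R) c P -> U (G P) ->
  exists V Phi, [/\ nice V Phi, V (body (cmap (SC R) c P)) &
    forall Q, cdom (SC R) c Q -> V (body (cmap (SC R) c Q)) ->
      U (G Q) /\ om (G Q) = Phi (cmap (SC R) c Q)].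
Proof.
move=> [hpts hinj _] sG injG ptG som injU dP UP.
have : pts (G P) by apply/ptG/SC_pts/dP.
rewrite hpts => -[i _ di].
have Sinj : set_inj (cdom (SC R) c) (cmap (SC R) c) := chart_inj (is_chart_SC c).
have [V1 [H1 [Vp1 sH1 on1 E1]]] := local_form Sinj sG (SC_pts dP) dP di.
have [V2 [H2 [Vp2 sH2 on2 E2]]] := @local_form X (flat R) U om i tt (G P) (hinj i) som UP di I.
have n1 : nice V1 H1.
  apply: (nice_SA (superconformal_SA sH1)) => p q Vp Vq E.
  have [P1 d1 e1] := on1 p Vp; have [Q1 d2 e2] := on1 q Vq.
  have [PP1 g1 f1] := E1 P1 d1 ltac:(by rewrite e1); have [QQ1 g2 f2] := E1 Q1 d2 ltac:(by rewrite e2).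
  rewrite -e1 -e2; congr (cmap _ _ _); apply: injG => //; apply: (hinj i); try exact: mem_set.
  by rewrite f1 f2 e1 e2.
have n2 : nice V2 H2.
  apply: (nice_SA (superconformal_SA sH2)) => p q Vp Vq E.
  have [P1 d1 e1] := on2 p Vp; have [Q1 d2 e2] := on2 q Vq.
  have [PP1 g1 f1] := E2 P1 d1 ltac:(by rewrite e1); have [QQ1 g2 f2] := E2 Q1 d2 ltac:(by rewrite e2).
  rewrite -e1 -e2; congr (cmap _ _ _); apply: injU; try exact: mem_set.
  by move: f1 f2; rewrite e1 e2 /= => -> ->.
have bE a : V1 (body a) -> body (H1 a) = body (H1 (body a)%:A).
  by move=> Va; rewrite -(nice_body n1 Va (q := (body a)%:A)) ?bodyA1.
have [PP1 g1 f1] := E1 P dP Vp1.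
exists [set b | V1 b /\ V2 (body (H1 b%:A))], (fun a => H2 (H1 a)); split.
- exact: nice_comp.
- by split=> //; rewrite -bE // -f1.
move=> Q dQ [V1Q V2Q]; have [PQ gQ fQ] := E1 Q dQ V1Q.
have [UQ _ omQ] := E2 (G Q) gQ ltac:(by rewrite fQ bE).
by split=> //; rewrite -fQ; exact: omQ.
Qed.

Section CoordinateContinuation.
Variables (A : set (pt (SC R))) (Psi : pt (SC R) -> Lam) (c : bool) (n : Lam -> Lam) (be : C) (rho : R).
Hypotheses (hA : forall P, A P -> pts P)
  (hloc : forall c' P, A P -> cdom (SC R) c' P -> exists V Phi, [/\ nice V Phi,
     V (body (cmap (SC R) c' P)) & forall Q, cdom (SC R) c' Q -> V (body (cmap (SC R) c' Q)) ->
       A Q /\ Psi Q = Phi (cmap (SC R) c' Q)])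
  (hinj : set_inj A Psi)
  (hsurj : forall a, cabs (body a) < rho -> exists2 P, A P & Psi P = a)
  (hn : SA setT n) (bn : forall a, body (n a) = body a + be)
  (base : exists2 e : R, 0 < e & forall a, cabs (body a) < e ->
     A (SCinv c (n a)) /\ Psi (SCinv c (n a)) = a).

Local Notation sec a := (SCinv c (n a)).
Local Notation rc t := ((t%:C)%C : C).

(** From a small disc around b to the whole disc around b': the components of Phi (n a) - a are
    analytic along the segment from a point of body b to a, vanish near its start, hence at its
    end. *)
Lemma rigid_step (b b' : C) (e r : R) V Phi : nice V Phi -> 0 < e ->
  (forall a, cabs (body a - b) < e -> A (sec a) /\ Psi (sec a) = a) ->
  (forall x, cabs (x - b') < r -> V (x + be)) -> cabs (b - b') < r ->
  (forall a, V (body a + be) -> A (sec a) /\ Psi (sec a) = Phi (n a)) ->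
  forall a, cabs (body a - b') < r -> A (sec a) /\ Psi (sec a) = a.
Proof.
move=> hV e0 hb hr bb hP a ab; have [Aa Pa] := hP a (hr _ ab); split=> //.
rewrite Pa; apply/grP => J; apply/eqP; rewrite -subr_eq0; apply/eqP.
(* Only the body moves, from b at t = 0 to that of a at t = 1; the soul is that of a throughout. *)
pose ga (t : C) : Lam := a + ((1 - t) * (b - body a))%:A.
have bga t : body (ga t) = body a + (1 - t) * (b - body a) by rewrite /ga bodyD bodyA1.
pose h t : C := Phi (n (ga t)) J - ga t J.
have pga (s : C) : anpath (fun t => ga (s + t)).
  apply: anpathD; first exact: anpath_cst.
  apply: anpath_scalar; apply: anM; last exact: an_cst.
  have := anD (an_cst (1 - s) 0) (anM (an_cst (-1) 0) (an_id 0)); apply: an_near ltr01 _ => t _.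
  by rewrite add0r mulN1r opprD addrA.
have inr (t : R) : 0 <= t <= 1 -> cabs (body (ga (rc t)) - b') < r.
  move=> /andP[t0 t1]; rewrite bga.
  have -> : body a + (1 - rc t) * (b - body a) - b' = rc t * (body a - b') + rc (1 - t) * (b - b').
    by rewrite rmorphB rmorph1 /=; ring.
  apply: (le_lt_trans (cabsD _ _)); rewrite !cabsM !cabs_real !ger0_norm ?subr_ge0 //.
  have [->|tn] := eqVneq t 0; first by rewrite mul0r add0r subr0 mul1r.
  have tp : 0 < t by rewrite lt_neqAle eq_sym tn.
  rewrite [ltRHS](_ : r = t * r + (1 - t) * r); last by ring.
  by rewrite ltr_leD ?ltr_pM2l // ler_wpM2l ?subr_ge0 // ltW.
have an_h (t : R) : 0 <= t <= 1 -> an h (rc t).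
  move=> t01; have hnn := SA_anpath hn (pga (rc t)) I.
  have V0 : V (body (n (ga (rc t + 0)))) by rewrite bn addr0; exact: hr _ (inr t t01).
  have p1 := nice_path hV (ga := fun u => n (ga (rc t + u))) hnn V0.
  have p2 := anpathB p1 (pga (rc t)).
  have [co [r' [r'0 hco]]] := p2 J; exists co, r'; split=> // u ur.
  by have := hco u ur; rewrite add0r grBE.
have z0 : zero_near h 0.
  have K0 : 0 <= cabs (b - body a) := cabs_ge0 _.
  have m0 : 0 < Num.min e (r - cabs (b - b')) by rewrite lt_min e0 subr_gt0.
  have [d d0 hd] := ex_small K0 m0; exists d => // t td; rewrite add0r /h.
  have small : cabs (body (ga t) - b) < Num.min e (r - cabs (b - b')).
    rewrite bga (_ : _ - b = - (t * (b - body a))); last by ring.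
    by rewrite cabsN cabsM; apply: le_lt_trans hd; rewrite ler_wpM2r // ltW.
  move: small; rewrite lt_min => /andP[se sr]; have [_ PE] := hb (ga t) se.
  have Vt : V (body (ga t) + be).
    apply: hr; rewrite -(subrK b (body (ga t))) -addrA.
    by apply: (le_lt_trans (cabsD _ _)); rewrite -ltrBrDr.
  by have [_] := hP (ga t) Vt; rewrite PE => <-; rewrite subrr.
have [|r' r'0 hr'] := an_segment an_h z0 (t := 1); first by rewrite ler01 lexx.
have := hr' 0; rewrite cabs0 addr0 rmorph1 => /(_ r'0).
by rewrite /h /ga subrr mul0r scale0r addr0.
Qed.

(** Continuation along the ray t b. At a limit time t, surjectivity provides a point q with [Psi q]
    = t b, and local openness gives points near q over s b with s < t. By injectivity these lie on
    the section already known, so q is where the section should be, and [rigid_step] applies around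
    it. *)
Lemma rigid a0 : cabs (body a0) < rho -> A (sec a0) /\ Psi (sec a0) = a0.
Proof.
move=> ha0; pose b := body a0.
have bt (t : R) : 0 <= t <= 1 -> cabs (rc t * b) < rho.
  move=> /andP[t0 t1]; rewrite cabsM cabs_real ger0_norm //.
  by apply: le_lt_trans ha0; rewrite ler_piMl ?cabs_ge0.
pose T (t : R) := exists2 e : R, 0 < e & forall a, cabs (body a - rc t * b) < e -> A (sec a) /\ Psi (sec a) = a.
suff : T 1.
  by move=> [e e0 he]; apply: he; rewrite rmorph1 mul1r subrr cabs0.
have dist (s t : R) : cabs (rc s * b - rc t * b) = `|s - t| * cabs b.
  by rewrite -mulrBl -rmorphB cabsM cabs_real.
apply: (segment_ind (T := T)) => [|t t01 [e e0 he]|t /andP[t0 t1] hT|]; last by rewrite ler01 lexx.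
- have [e e0 he] := base; exists e => // a; rewrite rmorph0 mul0r subr0; exact: he.
- have [d d0 hd] := ex_small (cabs_ge0 b) e0; exists d => // s s01 sd.
  have st : cabs (rc s * b - rc t * b) < e.
    by rewrite dist; apply: le_lt_trans hd; rewrite ler_wpM2r ?cabs_ge0 // ltW.
  exists (e - cabs (rc s * b - rc t * b)); first by rewrite subr_gt0.
  move=> a ha; apply: he; rewrite -(subrK (rc s * b) (body a)) -addrA.
  by apply: (le_lt_trans (cabsD _ _)); rewrite -ltrBrDr.
have t01 : 0 <= t <= 1 by rewrite (ltW t0) t1.
have [q Aq Pq] := hsurj (a := (rc t * b)%:A) ltac:(by rewrite bodyA1; exact: bt).
(* points of [A] near [q] with values in the fibre over [s b], s < t *)
have near c' : cdom (SC R) c' q -> forall e : R, 0 < e ->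
    exists s u (q' : pt (SC R)), [/\ 0 <= s < t, `|s - t| < e, cabs u < e, cdom (SC R) c' q' &
      [/\ body (cmap (SC R) c' q') = body (cmap (SC R) c' q) + u, cdom (SC R) c q' &
      body (cmap (SC R) c q') = rc s * b + be]].
  move=> dq e e0; have [V [Phi [hV Vq hPhi]]] := hloc Aq dq.
  have [_ Pq'] := hPhi q dq Vq.
  have [d d0 hd] := nice_onto hV Vq e0.
  have [d' d'0 hd'] := ex_small (cabs_ge0 b) d0.
  pose m := Num.min t (Num.min e d'); have m0 : 0 < m by rewrite !lt_min t0 e0.
  pose s := t - m / 2; have mt : m <= t by rewrite ge_min lexx.
  have me : m <= e by rewrite !ge_min lexx orbT.
  have md : m <= d' by rewrite !ge_min lexx !orbT.
  have st : `|s - t| = m / 2 by rewrite /s addrAC subrr add0r normrN gtr0_norm // divr_gt0.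
  have s01 : 0 <= s < t by apply/andP; split; rewrite /s; lra.
  have [|u [ue Vu Eu]] := hd (rc s * b).
    rewrite (nice_body hV (p := cmap (SC R) c' q)) ?bodyA1 // -Pq' Pq bodyA1 dist st.
    by apply: le_lt_trans hd'; rewrite ler_wpM2r ?cabs_ge0 //; lra.
  set w := (body (cmap (SC R) c' q) + u)%:A in Eu.
  have [dq' wE] := SCinvP c' w; have [Aq' Eq'] := hPhi _ dq' ltac:(by rewrite wE bodyA1).
  have by' : body (Phi w) = rc s * b by rewrite Eu.
  have [e1 e10 he1] := hT s s01.
  have [A1 P1] := he1 (Phi w) ltac:(by rewrite by' subrr cabs0).
  have E : sec (Phi w) = SCinv c' w.
    by apply: (hinj (mem_set A1) (mem_set Aq')); rewrite P1 Eq' wE.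
  have [dc cE] := SCinvP c (n (Phi w)).
  exists s, u, (SCinv c' w); split=> //; first by rewrite st; lra.
  rewrite wE bodyA1; split=> //; first by rewrite -E.
  by rewrite -E cE bn by'.
(* Otherwise q lies over the point missing from chart c; there the bodies of nearby points in chart
   c tend to infinity, while those on the section stay bounded by K. *)
have dcq : cdom (SC R) c q.
  apply: contrapT => ndq.
  have [c' [cc' dq']] : exists c', c' <> c /\ cdom (SC R) c' q.
    have := hA Aq; clear -ndq; case: q ndq => [a|a] /=; case: c => //=.
    - by move=> /negP/negPn/eqP a0 _; exists true.
    - by move=> _ a0; exists false.
  have [K K1] : exists K : R, forall s, 0 <= s < t -> cabs (rc s * b + be) <= K.
    exists (cabs b + cabs be) => s /andP[s0 st]; apply: (le_trans (cabsD _ _)); rewrite lerD2r cabsM cabs_real ger0_norm //.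
    by rewrite ler_piMl ?cabs_ge0 // ltW // (lt_le_trans st).
  have K0 : 0 <= K by apply: le_trans (K1 0 _); rewrite ?cabs_ge0 // lexx.
  have e0 : 0 < (K + 1)^-1 by rewrite invr_gt0 ltr_wpDl.
  have [s [u [q' [st su ue dq'' [bq' dcq' bcq']]]]] := near c' dq' _ e0.
  have bq0 : body (cmap (SC R) c' q) = 0.
    clear -ndq dq' cc'; case: c c' cc' ndq dq' => -[] // _; case: q => [a|a] //=.
    by move=> /negP/negPn/eqP.
  rewrite bq0 add0r in bq'.
  have [T1 T2] := SCtransE dq'' dcq'.
  have Tn : @SCtrans_dom R c' c = [set b : C | b != 0] by rewrite /SCtrans_dom; case: eqP => // /cc'.
  have u0 : u != 0 by rewrite Tn /= bq' in T1.
  have inv : body (cmap (SC R) c q') = u^-1.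
    rewrite -T2 -bq'; clear -cc' T1 Tn; rewrite Tn /= in T1.
    by case: c' c cc' T1 {Tn} => -[] //= _ T1; rewrite ?body_gconj inversionI_body.
  have := K1 s st; rewrite -bcq' inv cabsV => h.
  have uK : (cabs u)^-1 < K + 1 by apply: le_lt_trans h _; rewrite ltrDl.
  by move: ue; rewrite -(invrK (cabs u)) ltf_pV2 ?posrE ?invr_gt0 ?cabs_gt0 // ?ltr_wpDl //; rewrite ltNge (ltW uK).
(* The approximating points have bodies s b + be and converge to q, with s tending to t. *)
have bq : body (cmap (SC R) c q) = rc t * b + be.
  apply/eqP; rewrite -subr_eq0; apply/eqP/small0 => e e0.
  have [d d0 hd] := ex_small (cabs_ge0 b) (ltac:(by rewrite divr_gt0) : 0 < e / 2).
  have m0 : 0 < Num.min d (e / 2) by rewrite lt_min d0 divr_gt0.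
  have [s [u [q' [st su ue dq' [bq' _ bcq']]]]] := near c dcq _ m0.
  rewrite bq' in bcq'; have -> : body (cmap (SC R) c q) - (rc t * b + be) = (rc s * b - rc t * b) - u.
    by rewrite -[body _](addrK u) bcq'; ring.
  apply: (le_trans (cabsB _ _)); rewrite dist.
  move: su ue; rewrite !lt_min => /andP[su _] /andP[_ ue].
  have h1 : `|s - t| * cabs b <= d * cabs b by rewrite ler_wpM2r ?cabs_ge0 // ltW.
  by move: h1 hd ue; lra.
have [V [Phi [hV Vq hPhi]]] := hloc Aq dcq; rewrite bq in Vq.
have [r r0 hr] := (openP V).1 (nice_open hV) _ Vq.
have [d d0 hd] := ex_small (cabs_ge0 b) r0.
pose m := Num.min t d; have m0 : 0 < m by rewrite lt_min t0.
have mt : m <= t by rewrite ge_min lexx.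
have md : m <= d by rewrite ge_min lexx orbT.
pose s := t - m / 2.
have s01 : 0 <= s < t by apply/andP; split; rewrite /s; lra.
have st : `|s - t| = m / 2 by rewrite /s addrAC subrr add0r normrN gtr0_norm // divr_gt0.
have [e e0 he] := hT s s01; exists r => //.
apply: (rigid_step hV e0 he) => [x xr||a Va].
- by rewrite -(subrK (rc t * b) x) -addrA addrC; exact: hr.
- by rewrite dist st; apply: le_lt_trans hd; rewrite ler_wpM2r ?cabs_ge0 //; lra.
have [da aE] := SCinvP c (n a).
have [AA PE] := hPhi _ da ltac:(by rewrite aE bn); split; first exact: AA.
by rewrite PE aE.
Qed.
End CoordinateContinuation.
End LocalForms.

(** * Uniqueness of the sewn supersphere *)

Section LocalNice.
Variable R : realType.
Local Notation C := (cplx R).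
Local Notation Lam := (grassmann C).
Local Notation S := (SC R).

Definition nice_at (X Y : surface R) (F : pt X -> pt Y) i j (p : pt X) (V : set C) (Phi : Lam -> Lam) :=
  [/\ nice V Phi, V (body (cmap X i p)) & forall q, cdom X i q -> V (body (cmap X i q)) ->
     cdom Y j (F q) /\ cmap Y j (F q) = Phi (cmap X i q)].

Lemma nice_sub (V W : set C) Phi : nice V Phi -> open W -> W `<=` V -> nice W Phi.
Proof.
move=> h oW sW; split=> //.
- by move=> ga hga /sW; exact: (nice_path h).
- by move=> p q /sW; exact: (nice_body h).
- move=> b Wb e e0; have [r r0 hr] := (openP W).1 oW b Wb.
  have m0 : 0 < Num.min e r by rewrite lt_min e0.
  have [d d0 hd] := nice_onto h (sW _ Wb) m0; exists d => // c /hd[t].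
  rewrite lt_min => -[/andP[te tr] Vt E]; exists t; split=> //; exact: hr.
move=> b Wb; have [K [r [K0 r0 hr]]] := nice_low h (sW _ Wb).
have [r' r'0 hr'] := (openP W).1 oW b Wb.
exists K, (Num.min r r'); split; [exact: K0|by rewrite lt_min r0|].
by move=> t; rewrite lt_min => /andP[tr tr']; split; [exact: hr'|exact: (hr t tr).2].
Qed.

Lemma nice_bodyE (V : set C) Phi (a : Lam) : nice V Phi -> V (body a) -> body (Phi a) = body (Phi (body a)%:A).
Proof. by move=> h Va; rewrite -(nice_body h Va (q := (body a)%:A)) ?bodyA1. Qed.

Lemma nice_at_comp X Y Z F G i j k p V Phi W Psi : @nice_at X Y F i j p V Phi ->
  @nice_at Y Z G j k (F p) W Psi -> cdom X i p ->
  nice_at (G \o F) i k p [set b | V b /\ W (body (Phi b%:A))] (fun a => Psi (Phi a)).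
Proof.
move=> [h Vp hF] [h' Wp hG] dp; split; first exact: nice_comp.
  by split=> //; have [_ E] := hF p dp Vp; rewrite -(nice_bodyE h Vp) -E.
move=> q dq [Vq Wq]; have [d E] := hF q dq Vq; rewrite -(nice_bodyE h Vq) -E in Wq.
by have [d' E'] := hG _ d Wq; split=> //; rewrite /= E' E.
Qed.

Lemma nice_at_open X Y F i j p V Phi (W : set (pt Y)) : @nice_at X Y F i j p V Phi ->
  set_inj (cdom Y j) (cmap Y j) -> sopen W -> cdom X i p -> W (F p) ->
  exists2 V' : set C, open V' & V' (body (cmap X i p)) /\ V' `<=` V /\
    forall q, cdom X i q -> V' (body (cmap X i q)) -> W (F q).
Proof.
move=> [h Vp hF] inj [sW oW] dp WF; have [VW oVW E] := oW j.
have im q : V (body (cmap X i q)) -> cdom X i q -> VW (body (Phi (body (cmap X i q))%:A)) -> W (F q).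
  move=> Vq dq; have [dF FE] := hF q dq Vq; rewrite -(nice_bodyE h Vq) -FE => VF.
  have : dewitt VW (cmap Y j (F q)) by [].
  by rewrite -E => -[w [Ww dw] /inj wE]; rewrite -(wE (mem_set dw) (mem_set dF)).
exists [set b | V b /\ VW (body (Phi b%:A))]; first exact: nice_open_pre h oVW.
split.
  split=> //; have [dF FE] := hF p dp Vp; rewrite -(nice_bodyE h Vp) -FE.
  by have : dewitt VW (cmap Y j (F p)) by rewrite -E; exists (F p).
by split=> [b []//|q dq [Vq VWq]]; exact: im.
Qed.

Lemma nice_at_superconformal (X Y : surface R) (U : set (pt X)) (F : pt X -> pt Y) i j p :
  set_inj (cdom X i) (cmap X i) -> set_inj (cdom Y j) (cmap Y j) -> superconformal_map U F ->
  set_inj U F -> U p -> cdom X i p -> cdom Y j (F p) -> exists V Phi, nice_at F i j p V Phi.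
Proof.
move=> injX injY sF injF Up dp dF; have [V [H [Vp sH on E]]] := local_form injX sF Up dp dF.
exists V, H; split=> //; last by move=> q dq /(E q dq)[].
apply: (nice_SA (superconformal_SA sH)) => a b Va Vb ab.
have [P d1 e1] := on a Va; have [Q d2 e2] := on b Vb.
have [UP g1 f1] := E P d1 ltac:(by rewrite e1); have [UQ g2 f2] := E Q d2 ltac:(by rewrite e2).
rewrite -e1 -e2; congr (cmap _ _ _); apply: injF; try exact: mem_set.
by apply: injY; try exact: mem_set; rewrite f1 f2 e1 e2.
Qed.

Lemma nice_gpair (W V : set C) (m n : Lam -> Lam) : gpair W V m n -> nice W m.
Proof.
move=> g; apply: nice_SA (SAc_SA (gp_oW g) (gp_SA g)) _ => p q Wp Wq E.
by rewrite -(gp_K g Wp).2 E (gp_K g Wq).2.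
Qed.

Lemma SC_inj c : set_inj (cdom S c) (cmap S c). Proof. exact: (chart_inj (is_chart_SC c)). Qed.

Lemma iso_inv (X : surface R) (F : pt X -> pt S) : superconformal_iso (X := X) (Y := S) F ->
  exists G : pt S -> pt X,
  [/\ forall p, pts p -> pts (F p) /\ G (F p) = p, forall P, pts P -> pts (G P) /\ F (G P) = P,
      superconformal_map (X := X) (Y := S) (pts (s := X)) F
    & superconformal_map (X := S) (Y := X) (pts (s := S)) G].
Proof. by move=> [G []]; exists G. Qed.

Section Coordinate.
Variables (X : surface R) (F : pt X -> pt S) (G : pt S -> pt X).
Hypotheses (hX : super_riemann X) (FK : forall p, pts p -> pts (F p) /\ G (F p) = p)
  (GK : forall P, pts P -> pts (G P) /\ F (G P) = P)
  (sF : superconformal_map (X := X) (Y := S) (pts (s := X)) F)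
  (sG : superconformal_map (X := S) (Y := X) (pts (s := S)) G).

Lemma G_inj P Q : pts P -> pts Q -> G P = G Q -> P = Q.
Proof. by move=> pP pQ E; rewrite -(GK pP).2 E (GK pQ).2. Qed.
Lemma F_inj p q : pts p -> pts q -> F p = F q -> p = q.
Proof. by move=> pp pq E; rewrite -(FK pp).2 E (FK pq).2. Qed.
Lemma chart_at p : pts p -> exists i, cdom X i p.
Proof. by case: hX => -> _ _ [i _ di]; exists i. Qed.

Lemma G_nice_at c i P : cdom S c P -> cdom X i (G P) -> exists V Phi, @nice_at S X G c i P V Phi.
Proof.
move=> dP dG; case: hX => _ inj _; apply: (nice_at_superconformal (@SC_inj c) (inj i) sG) => //.
  by move=> A B /set_mem pA /set_mem pB; exact: G_inj.
exact: SC_pts dP.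
Qed.
Lemma F_nice_at i c p : pts p -> cdom X i p -> cdom S c (F p) -> exists V Phi, @nice_at X S F i c p V Phi.
Proof.
move=> pp dp dF; case: hX => _ inj _; apply: (nice_at_superconformal (inj i) (@SC_inj c) sF) => //.
by move=> A B /set_mem pA /set_mem pB; exact: F_inj.
Qed.

(** The formula prescribed for the germ of a tube on W holds on the entire disc used by the
    sewing. *)
Lemma rigid_coordinate p (U W : set (pt X)) (om : pt X -> Lam) (rho : R) c (m n : Lam -> Lam) be :
  local_coordinate p U om -> in_cball rho `<=` om @` U -> 0 < rho ->
  SA setT n -> (forall a, body (n a) = body a + be) -> (forall a, m (n a) = a) ->
  F p = SCinv c (n 0) -> sopen W -> W p ->
  (forall q, W q -> U q /\ (cdom S c (F q) -> om q = m (cmap S c (F q)))) ->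
  forall a, cabs (body a) < rho -> U (G (SCinv c (n a))) /\ om (G (SCinv c (n a))) = a.
Proof.
move=> [[oU Up] injU om0 _ som] ball rho0 hn bn mn Fp oW Wp hW.
have ptX q : U q -> pts q by case: oU => h _; exact: h.
pose A : set (pt S) := [set P | pts P /\ U (G P)].
suff main : forall a, cabs (body a) < rho -> A (SCinv c (n a)) /\ om (G (SCinv c (n a))) = a.
  by move=> a /main[[_ h] h'].
apply: (@rigid R A (fun P => om (G P)) c n be rho) => //.
- by move=> P [].
- move=> c' P [pP UP] dP; have hinj : forall P Q, pts P -> pts Q -> G P = G Q -> P = Q by exact: G_inj.
  have [V [Phi [hV VP hPhi]]] := local_nice hX sG hinj (fun P pP => (GK pP).1) som injU dP UP.
  exists V, Phi; split=> // Q dQ VQ; have [UQ E] := hPhi Q dQ VQ; split=> //.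
  by split=> //; exact: SC_pts dQ.
- move=> P Q /set_mem[pP UP] /set_mem[pQ UQ] E; apply: G_inj => //.
  by apply: injU; try exact: mem_set.
- move=> a arho; have [q Uq <-] := ball a ltac:(by rewrite /in_cball /= cabs_le ltW).
  have pq := ptX q Uq; exists (F q); last by rewrite (FK pq).2.
  by split; [exact: (FK pq).1|rewrite (FK pq).2].
- have [d0 E0] := SCinvP c (n 0); have pp := ptX p Up.
  have Gp : G (SCinv c (n 0)) = p by rewrite -Fp (FK pp).2.
  have [i di] := chart_at pp.
  have [V [Phi hV]] : exists V Phi, @nice_at S X G c i (SCinv c (n 0)) V Phi by apply: G_nice_at; rewrite ?Gp.
  case: hX => _ inj _.
  have [V' oV' [V'0 [_ hV']]] := nice_at_open hV (inj i) oW d0 (ltac:(by rewrite Gp) : W (G (SCinv c (n 0)))).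
  rewrite E0 bn body0 add0r in V'0; have [r r0 hr] := (openP V').1 oV' be V'0.
  exists r => // a ar; have [da Ea] := SCinvP c (n a).
  have WG : W (G (SCinv c (n a))) by apply: hV' => //; rewrite Ea bn addrC; exact: hr.
  have [UG om_] := hW _ WG; have pa := SC_pts da.
  split; first by split.
  by rewrite om_ (GK pa).2 ?Ea ?mn.
Qed.
End Coordinate.
End LocalNice.

(** * The sewing of arbitrary representatives, compared with the sphere *)

Section Uniqueness.
Variable R : realType.
Local Notation C := (cplx R).
Local Notation Lam := (grassmann C).
Local Notation S := (SC R).
Local Notation shift := (@Defs.shift R).
Variables (e th z : Lam) (X1 X2 : tubed R) (r1 r2 : R) (Q : skdata R 1).
Hypotheses (oe : is_odd e) (oth : is_odd th) (ez : is_even z) (bz : body z != 0).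
Hypotheses (tX1 : with_tubes 2 X1) (tX2 : with_tubes 0 X2) (sew12 : sewable 2 X1 1 0 X2 r1 r2).
Variables (F1 : pt X1 -> pt S) (G1 : pt S -> pt X1) (F2 : pt X2 -> pt S) (G2 : pt S -> pt X2).
Hypotheses (F1K : forall p, pts p -> pts (F1 p) /\ G1 (F1 p) = p)
  (G1K : forall P, pts P -> pts (G1 P) /\ F1 (G1 P) = P)
  (sF1 : superconformal_map (X := X1) (Y := S) (pts (s := X1)) F1)
  (sG1 : superconformal_map (X := S) (Y := X1) (pts (s := S)) G1)
  (F2K : forall p, pts p -> pts (F2 p) /\ G2 (F2 p) = p)
  (G2K : forall P, pts P -> pts (G2 P) /\ F2 (G2 P) = P)
  (sF2 : superconformal_map (X := X2) (Y := S) (pts (s := X2)) F2)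
  (sG2 : superconformal_map (X := S) (Y := X2) (pts (s := S)) G2)
  (rep1 : forall k : 'I_3, F1 (punct X1 k) = sk_puncture (sk_pair z th) k /\
      exists2 W : set (pt X1), sopen W /\ W (punct X1 k) &
        forall p, W p -> udom X1 k p /\ sk_coordinate (sk_pair z th) k (F1 p) (ucrd X1 k p))
  (rep2 : forall k : 'I_1, F2 (punct X2 k) = sk_puncture (sk_M32 e) k /\
      exists2 W : set (pt X2), sopen W /\ W (punct X2 k) &
        forall p, W p -> udom X2 k p /\ sk_coordinate (sk_M32 e) k (F2 p) (ucrd X2 k p)).

Let r20 : 0 < r2. Proof. by case: sew12 => -[]. Qed.
Let r21 : r2 < r1. Proof. by case: sew12 => -[]. Qed.
Let r10 : 0 < r1. Proof. exact: lt_trans r21. Qed.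
Let bzth' : body (z + th) = body z. Proof. exact: bzth. Qed.
Let hX1 : super_riemann X1. Proof. by case: tX1. Qed.
Let hX2 : super_riemann X2. Proof. by case: tX2. Qed.
Let one : is_odd (- e). Proof. exact: odN. Qed.

Lemma coord1 a : cabs (body a) < r1 ->
  udom X1 1 (G1 (inl (unshift (z + th) a))) /\ ucrd X1 1 (G1 (inl (unshift (z + th) a))) = a.
Proof.
case: tX1 => _ /(_ 1%N isT) lc _; case: sew12 => _ ball _ _ _.
have [Fp [W [oW Wp] hW]] := rep1 (lift ord0 (ord0 : 'I_2)).
apply: (rigid_coordinate hX1 F1K G1K sG1 lc ball r10 (c := true) (n := unshift (z + th)) (m := shift (z + th))
  (be := body z) (W := W)) => //.
- exact: (SAc_SA openT (@SAc_unshift R _ _)).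
- by move=> a'; rewrite body_unshift bzth'.
- by move=> a'; exact: unshiftK.
- apply: etrans Fp _; rewrite /sk_puncture liftK /=; congr inl.
  by rewrite /unshift (odd_odp (@od0 R)) mul0r add0r addr0.
move=> q Wq; have [Uq] := hW q Wq; rewrite /sk_coordinate liftK => -[b Fq hs]; split; first exact: Uq.
by rewrite Fq => _; apply: abs_sum_uniq hs _; exact: hatE0.
Qed.

Lemma coord2 a : cabs (body a) < r2^-1 ->
  udom X2 0 (G2 (SCinv false (gconj (cap_coord (- e) a)))) /\
  ucrd X2 0 (G2 (SCinv false (gconj (cap_coord (- e) a)))) = a.
Proof.
case: tX2 => _ /(_ 0%N isT) lc _; case: sew12 => _ _ ball _ _.
have [Fp [W [oW Wp] hW]] := rep2 ord0.
have r20' : 0 < r2^-1 by rewrite invr_gt0.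
apply: (rigid_coordinate hX2 F2K G2K sG2 lc ball r20' (c := false) (n := fun a => gconj (cap_coord (- e) a))
  (m := fun a => cap_coord e (gconj a)) (be := 0) (W := W)) => //.
- exact: SA_gconj (SAc_SA openT (@SAc_cap R _ _)).
- move=> a'; rewrite addr0 body_gconj /cap_coord.
  by rewrite (flow_body (V := setT) one (@od0 R) (@cap_data R _)).
- by move=> a'; rewrite gconjK (gp_Ki (gpair_cap oe openT) (I : setT _)).2.
- apply: etrans Fp _; rewrite /sk_puncture unlift_none.
  by rewrite cap_coord0 gconj0 /= body0 eqxx.
move=> q Wq; have [Uq] := hW q Wq; rewrite /sk_coordinate unlift_none SC_inversionE => hs.
by split=> [|_]; [exact: Uq|apply: abs_sum_uniq hs _; exact: tildeE_cap].
Qed.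

Let injU1 : set_inj (udom X1 1) (ucrd X1 1).
Proof. by case: tX1 => _ /(_ 1%N isT)[]. Qed.
Let injU2 : set_inj (udom X2 0) (ucrd X2 0).
Proof. by case: tX2 => _ /(_ 0%N isT)[]. Qed.
Let G1i P P' : pts P -> pts P' -> G1 P = G1 P' -> P = P'. Proof. exact: (G_inj G1K). Qed.
Let G2i P P' : pts P -> pts P' -> G2 P = G2 P' -> P = P'. Proof. exact: (G_inj G2K). Qed.

Lemma in_U1 P : pts P -> udom X1 1 (G1 P) -> cabs (body (ucrd X1 1 (G1 P))) < r1 ->
  P = inl (unshift (z + th) (ucrd X1 1 (G1 P))).
Proof.
move=> pP UP small; have [U' E] := coord1 small.
have := injU1 (mem_set U') (mem_set UP) E => h; exact/esym/G1i.
Qed.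
Lemma in_U2 P : pts P -> udom X2 0 (G2 P) -> cabs (body (ucrd X2 0 (G2 P))) < r2^-1 ->
  P = SCinv false (gconj (cap_coord (- e) (ucrd X2 0 (G2 P)))).
Proof.
move=> pP UP small; have [U' E] := coord2 small.
have := injU2 (mem_set U') (mem_set UP) E => h; apply/esym/G2i => //.
exact: SC_pts (SCinvP false _).1.
Qed.

Let punct0 : F1 (punct X1 0) = inr 0.
Proof. by have [+ _] := rep1 ord0; rewrite /sk_puncture unlift_none. Qed.
Let punct2 : F1 (punct X1 2) = inl 0.
Proof. by have [+ _] := rep1 (lift ord0 (ord_max : 'I_2)); rewrite /sk_puncture liftK. Qed.
Let ppunct k : (k <= 2)%N -> pts (punct X1 k).
Proof. by move=> hk; case: tX1 => _ /(_ k hk)[[[sU _] Up] _ _ _ _] _; exact: sU. Qed.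

(** Otherwise the puncture at 0 would lie in the closed disc of radius r1 of the sewn tube, where
    sewability admits no other puncture. *)
Lemma r1_le : r1 <= cabs (body z).
Proof.
rewrite leNgt; apply/negP => lt1.
have small : cabs (body (shift (z + th) 0)) < r1 by rewrite body_shift body0 sub0r cabsN bzth'.
have [U1 E1] := coord1 small; rewrite shiftK in U1 E1.
have Gp : G1 (inl 0) = punct X1 2.
  by apply: etrans (congr1 G1 (esym punct2)) _; exact: (F1K (@ppunct 2 isT)).2.
rewrite Gp in U1 E1; case: sew12 => _ _ _ /(_ 2 isT U1) + _; rewrite E1.
by rewrite /in_cball /= cabs_le ltW // => /(_ isT).
Qed.

Local Notation kept' := (@kept R X1 1 X2 r1 r2).
Local Notation glued' := (@glued R X1 1 X2 r1 r2).
Local Notation cls := (@glue_class R X1 1 X2 r1 r2).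
Local Notation sewn := (@sewn_surface R X1 1 X2 r1 r2).

Lemma glued_fun p q q' : glued' (inl p) (inr q) -> glued' (inl p) (inr q') -> q = q'.
Proof.
move=> [_ _ _ U E] [_ _ _ U' E']; apply: injU2; try exact: mem_set.
by rewrite E E'.
Qed.
Lemma glued_inj p p' q : glued' (inl p) (inr q) -> glued' (inl p') (inr q) -> p = p'.
Proof.
have nz x : ~ in_cball r2 x -> body x != 0.
  by rewrite /in_cball /= cabs_le => h; apply/eqP => x0; apply: h; rewrite x0 cabs0 ltW.
move=> [U _ n _ E] [U' _ n' _ E']; apply: injU1; try exact: mem_set.
by apply: inversionI_inj; [exact: nz|exact: nz|rewrite -E -E'].
Qed.

(** The gluing is a partial injection from the first surface to the second, so chains of length two
    already collapse. *)
Lemma cls_rel u v : cls u v -> [\/ u = v, glued' u v | glued' v u].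
Proof.
elim=> {u v} [u v h|u|u v _ [->|h|h]|u v w _ h1 _ h2]; try by [apply: Or31|apply: Or32|apply: Or33].
case: h1 => [->//|h1|h1]; case: h2 => [<-|h2|h2]; try by [apply: Or32|apply: Or33].
- by case: u v h1 h2 => [u|u] [v|v].
- case: u v w h1 h2 => [u|u] [v|v] [w|w] //= h1 h2.
  by apply: Or31; rewrite (glued_inj h1 h2).
- case: u v w h1 h2 => [u|u] [v|v] [w|w] //= h1 h2.
  by apply: Or31; rewrite (glued_fun h1 h2).
by case: u v w h1 h2 => [u|u] [v|v] [w|w].
Qed.

Lemma cls_self u : cls u u. Proof. exact: rst_refl. Qed.
Lemma cls_glued p q : glued' (inl p) (inr q) -> cls (inl p) = cls (inr q).
Proof.
move=> g; have h : cls (inl p) (inr q) by exact: rst_step.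
apply/seteqP; split=> w hw; last exact: rst_trans h hw.
by apply: rst_trans hw; exact: rst_sym.
Qed.
Lemma cls_inl p q : cls (inl p) = cls (inl q) -> p = q.
Proof.
move=> E; have : cls (inl p) (inl q) by rewrite E; exact: cls_self.
by move=> /cls_rel[[]|[]|[]].
Qed.
Lemma cls_mixed p q : cls (inl p) = cls (inr q) -> glued' (inl p) (inr q).
Proof.
move=> E; have : cls (inl p) (inr q) by rewrite E; exact: cls_self.
by move=> /cls_rel[|//|[]].
Qed.

Lemma desc1E (f : pt X1 -> Lam) p : @descend1 R X1 X2 f (cls (inl p)) = f p.
Proof.
rewrite /descend1; have [q hq <-] := @xgetI _ 0 [set f p' | p' in [set p' | cls (inl p) (inl p')]] (f p)
  (ex_intro2 _ _ p (cls_self _) erefl).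
by case/cls_rel: hq => [[->]|[]|[]].
Qed.
Lemma desc2E (f : pt X2 -> Lam) p : @descend2 R X1 X2 f (cls (inr p)) = f p.
Proof.
rewrite /descend2; have [q hq <-] := @xgetI _ 0 [set f p' | p' in [set p' | cls (inr p) (inr p')]] (f p)
  (ex_intro2 _ _ p (cls_self _) erefl).
by case/cls_rel: hq => [[->]|[]|[]].
Qed.

Lemma sewn_chart_inj i : set_inj (cdom sewn i) (cmap sewn i).
Proof.
case: i => i T T' /set_mem[p [dp kp] <-] /set_mem[q [dq kq] <-].
  move=> E; congr (cls (inl _)); case: hX1 => _ /(_ i) inj _; apply: inj; try exact: mem_set.
  by move: E; rewrite [LHS]desc1E [RHS]desc1E.
move=> E; congr (cls (inr _)); case: hX2 => _ /(_ i) inj _; apply: inj; try exact: mem_set.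
by move: E; rewrite [LHS]desc2E [RHS]desc2E.
Qed.

(* kappa (- e) on the sphere, and the inverse of the identification of the
   second sphere. *)
Definition kap (P : pt S) : pt S :=
  match P with inl a => inl (kappa (- e) th z a) | inr b => inr (kappa_inf (- e) th z b) end.
Definition capm (a : Lam) : Lam := shift (z + th) (translation (- e) th z a).
(** The counterpart, for arbitrary representatives, of the inverse of [Kmap]. On the annulus both
    formulas define the same class by [overlap]. *)
Definition theta_ (P : pt S) : pt sewn :=
  match P with
  | inl a => if r2 < cabs (body a - body z) then cls (inl (G1 (kap P))) else cls (inr (G2 (inl (capm a))))
  | inr b => cls (inl (G1 (kap P))) end.

Definition far (P : pt S) : bool := if P is inl a then r2 < cabs (body a - body z) else true.

Lemma body_capm a : body (capm a) = body a - body z.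
Proof. by rewrite /capm body_shift bzth' (body_translation oth ez) . Qed.

Lemma far_ne a : r2 < cabs (body a - body z) -> body a != body z.
Proof. by move=> h; rewrite -subr_eq0 -cabs_gt0 (lt_trans r20). Qed.

Lemma kap_pts P : pts P -> far P -> pts (kap P).
Proof. by case: P => [a|b] //= b0 _; rewrite body_kappa_inf // b0 mulr0 subr0 oner_neq0. Qed.

Lemma kept1 P : pts P -> far P ->
  kept' (inl (G1 (kap P))).
Proof.
move=> pP hf; have pk := kap_pts pP hf; split; first exact: (G1K pk).1.
move=> [U]; rewrite /in_cball /= cabs_le => small.
have := in_U1 pk U (le_lt_trans small r21).
case: P pP hf {pk} U small => [a|b] _ hf U small //= [] /(congr1 (@body R)).
rewrite /far in hf; rewrite (body_kappa oth ez one (far_ne hf)) body_unshift bzth' => E.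
by move: hf; rewrite E addrK ltNge small.
Qed.

Lemma kept2 a : cabs (body a - body z) < r1 -> kept' (inr (G2 (inl (capm a)))).
Proof.
move=> near; split; first exact: (G2K (I : pts (inl (capm a) : pt S))).1.
move=> [U]; rewrite /in_cball /= cabs_le => small.
have small' : cabs (body (ucrd X2 0 (G2 (inl (capm a))))) < r2^-1.
  by apply: le_lt_trans small _; rewrite ltf_pV2.
have := in_U2 (I : pts (inl (capm a) : pt S)) U small'; set y := ucrd X2 0 _ in small *.
have by' : body (gconj (cap_coord (- e) y)) = body y.
  rewrite body_gconj /cap_coord.
  by rewrite (flow_body (V := setT) one (@od0 R) (@cap_data R _)).
rewrite /SCinv by'; case: eqP => [//|/eqP y0 [] /(congr1 (@body R))].
rewrite body_capm inversionI_body by' // => E.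
move: near; rewrite E cabsV ltNge; case/negP.
by rewrite -[r1]invrK lef_pV2 // posrE ?cabs_gt0 // invr_gt0.
Qed.

Lemma overlap a : r2 < cabs (body a - body z) -> cabs (body a - body z) < r1 ->
  glued' (inl (G1 (kap (inl a)))) (inr (G2 (inl (capm a)))).
Proof.
move=> far near; have na := far_ne far; rewrite /=; set a' := kappa (- e) th z a.
have ba' : body a' = body a by rewrite /a' body_kappa.
have s1 : cabs (body (shift (z + th) a')) < r1 by rewrite body_shift bzth' ba'.
have [U1 E1] := coord1 s1; rewrite shiftK in U1 E1.
have sn : body (shift (z + th) a') != 0 by rewrite body_shift bzth' ba' subr_eq0.
have small : cabs (body (inversionI (shift (z + th) a'))) < r2^-1.
  by rewrite inversionI_body // body_shift bzth' ba' cabsV ltf_pV2 // posrE (lt_trans r20).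
have [U2 E2] := coord2 small.
have Tn : body (glue_map e (shift (z + th) a')) != 0 by rewrite body_glue.
have capE : cap_coord (- e) (inversionI (shift (z + th) a')) = inversionI (glue_map e (shift (z + th) a')).
  by rewrite -(cap_glue oe sn) (gp_K (gpair_cap oe openT) (I : setT _)).2.
have bE : capm a = glue_map e (shift (z + th) a').
  have aE : a = kappa e th z a'.
    by rewrite /a' (gp_Ki (gpair_kappa oe oth ez) (na : [set b | b != body z] (body a))).2.
  rewrite /capm {1}aE -kappa_glue ?ba' //.
  by rewrite (gp_K (gpair_translation oe oth ez openT) (I : setT _)).2 unshiftK.
rewrite capE /SCinv body_gconj inversionI_body // invr_eq0 (negPf Tn) inversionI_gconj inversionI2 // gconjK -bE in U2 E2.
split; rewrite ?E1 //.
  by rewrite /in_ball /= cabs_lt.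
by rewrite /in_cball /= cabs_le body_shift bzth' ba' => h; move: far; rewrite ltNge h.
Qed.

Lemma theta_far P : pts P -> far P ->
  theta_ P = cls (inl (G1 (kap P))) /\ pts (s := sewn) (theta_ P).
Proof.
move=> pP hf; have -> : theta_ P = cls (inl (G1 (kap P))).
  by case: P pP hf => [a|b] //= _; rewrite /far => ->.
by split=> //; exists (inl (G1 (kap P))) => //; exact: kept1.
Qed.
Lemma theta_near a : cabs (body a - body z) < r1 ->
  theta_ (inl a) = cls (inr (G2 (inl (capm a)))) /\ pts (s := sewn) (theta_ (inl a)).
Proof.
move=> near; have -> : theta_ (inl a) = cls (inr (G2 (inl (capm a)))).
  by rewrite /theta_; case: ifP => // hf; apply: cls_glued; exact: overlap.
by split=> //; exists (inr (G2 (inl (capm a)))) => //; exact: kept2.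
Qed.
Lemma theta_pts P : pts P -> pts (s := sewn) (theta_ P).
Proof.
case: P => [a|b] pP; last exact: (theta_far pP isT).2.
have [hf|near] := ltP r2 (cabs (body a - body z)); first exact: (@theta_far (inl a) I hf).2.
by apply: (theta_near _).2; exact: le_lt_trans r21.
Qed.

Lemma theta_nice_inl a : exists i V Phi,
  cdom sewn i (theta_ (inl a)) /\ @nice_at R S sewn theta_ true i (inl a) V Phi.
Proof.
have [hf|near] := ltP r2 (cabs (body a - body z)).
  pose W : set C := [set b : C | r2 < cabs (b - body z)].
  have oW : open W := @open_gt R (body z) r2.
  have fP : far (inl a) := hf.
  have [i di] := chart_at hX1 (G1K (kap_pts (I : pts (inl a : pt S)) fP)).1.
  have [V [Phi [hV Va hPhi]]] : exists V Phi, @nice_at R S X1 G1 true i (kap (inl a)) V Phi.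
    by apply: (G_nice_at hX1 G1K sG1).
  have n0 : nice W (kappa (- e) th z).
    apply: nice_sub (nice_gpair (gpair_kappa one oth ez)) oW _ => b.
    by rewrite /W /= => h; rewrite -subr_eq0 -cabs_gt0 (lt_trans r20).
  have dT (a' : Lam) : W (body a') -> V (body (kappa (- e) th z a')) ->
      cdom sewn (inl i) (theta_ (inl a')) /\ cmap sewn (inl i) (theta_ (inl a')) = Phi (kappa (- e) th z a').
    move=> Wa' Va'; have fP' : far (inl a') := Wa'; have [E _] := theta_far (I : pts (inl a' : pt S)) fP'.
    have [dG EG] := hPhi (inl (kappa (- e) th z a')) I Va'; rewrite E; split.
      by exists (G1 (kap (inl a'))) => //; split=> //; exact: kept1.
    by apply: etrans (desc1E _ _) _.
  exists (inl i), [set b | W b /\ V (body (kappa (- e) th z b%:A))], (fun a => Phi (kappa (- e) th z a)).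
  have vE (a' : Lam) : W (body a') -> V (body (kappa (- e) th z (body a')%:A)) -> V (body (kappa (- e) th z a')).
    by move=> Wa'; rewrite (nice_bodyE n0 Wa').
  split; first exact: (dT a hf Va).1.
  split; [exact: nice_comp|by split=> //; rewrite -(nice_bodyE n0)|].
  by move=> [a'|//] _ [Wa' Va']; apply: dT => //; exact: vE.
have near' : cabs (body a - body z) < r1 := le_lt_trans near r21.
pose W : set C := [set b : C | cabs (b - body z) < r1].
have oW : open W := @open_lt R (body z) r1.
have [i di] := chart_at hX2 (G2K (I : pts (inl (capm a) : pt S))).1.
have [V [Phi [hV Va hPhi]]] : exists V Phi, @nice_at R S X2 G2 true i (inl (capm a)) V Phi.
  by apply: (G_nice_at hX2 G2K sG2).
have n0 : nice W capm.
  apply: (nice_gpair (V := [set b : C | cabs (b - 0) < r1]) (n := fun a => translation (- - e) th z (unshift (z + th) a))).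
  apply: (gpair_comp (gpair_translation one oth ez oW)).
  by apply: gpair_shift => //; [exact: open_lt|move=> b; rewrite bzth' /W /= subr0].
have dT (a' : Lam) : W (body a') -> V (body (capm a')) ->
    cdom sewn (inr i) (theta_ (inl a')) /\ cmap sewn (inr i) (theta_ (inl a')) = Phi (capm a').
  move=> Wa' Va'; have [E _] := theta_near Wa'.
  have [dG EG] := hPhi (inl (capm a')) I Va'; rewrite E; split.
    by exists (G2 (inl (capm a'))) => //; split=> //; exact: kept2.
  by apply: etrans (desc2E _ _) _.
exists (inr i), [set b | W b /\ V (body (capm b%:A))], (fun a => Phi (capm a)).
have vE (a' : Lam) : W (body a') -> V (body (capm (body a')%:A)) -> V (body (capm a')).
  by move=> Wa'; rewrite (nice_bodyE n0 Wa').
split; first exact: (dT a near' Va).1.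
split; [exact: nice_comp|by split=> //; rewrite -(nice_bodyE n0)|].
by move=> [a'|//] _ [Wa' Va']; apply: dT => //; exact: vE.
Qed.

Let kap0 : kap (inr 0) = inr 0. Proof. by rewrite /kap kappa_inf_0. Qed.
Let G10 : G1 (inr 0) = punct X1 0.
Proof. by apply: etrans (congr1 G1 (esym punct0)) _; exact: (F1K (@ppunct 0 isT)).2. Qed.
Let G12 : G1 (inl 0) = punct X1 2.
Proof. by apply: etrans (congr1 G1 (esym punct2)) _; exact: (F1K (@ppunct 2 isT)).2. Qed.
Let pinf : pts (inr 0 : pt S). Proof. exact: body0. Qed.

(** Below this modulus r2 |y| < |1 - z y|, so a point near infinity is far from body z. *)
Definition einf : R := (r2 + cabs (body z) + 1)^-1.
Lemma einf_gt0 : 0 < einf.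
Proof. by rewrite invr_gt0 ltr_wpDl // addr_ge0 ?cabs_ge0 // ltW. Qed.

Lemma inf_far P : cdom S false P -> cabs (body (cmap S false P)) < einf ->
  [/\ far P, 1 - body z * body (cmap S false P) != 0, cdom S false (kap P)
    & cmap S false (kap P) = kappa_inf (- e) th z (cmap S false P)].
Proof.
move=> dP; set y := cmap S false P => small.
have k1 : cabs (body y) * (r2 + cabs (body z)) < 1.
  have k0 : 0 < r2 + cabs (body z) + 1 by rewrite -invr_gt0; exact: einf_gt0.
  move: small; rewrite /einf -(mul1r (_^-1)) ltr_pdivlMr // mulrDr; apply: le_lt_trans.
  by rewrite lerDl mulr1 cabs_ge0.
have W : r2 * cabs (body y) < cabs (1 - body z * body y).
  have h1 := cabsDl 1 (- (body z * body y)); rewrite cabs1 cabsN cabsM in h1.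
  by apply: lt_le_trans h1; rewrite ltrBrDr; move: k1; rewrite mulrDr !(mulrC (cabs (body y))).
have ne : 1 - body z * body y != 0.
  by rewrite -cabs_gt0; apply: le_lt_trans W; rewrite mulr_ge0 ?cabs_ge0 // ltW.
case: P dP @y small k1 W ne => [a|b] /= dP small k1 W ne; last first.
  by split=> //; rewrite body_kappa_inf.
rewrite body_gconj inversionI_body // in W ne.
have a0 : 0 < cabs (body a) by rewrite cabs_gt0.
have E : 1 - body z / body a = (body a - body z) / body a by field.
have hf : r2 < cabs (body a - body z).
  by move: W; rewrite E cabsM !cabsV ltr_pM2r // invr_gt0.
have na := far_ne hf.
by split=> //; [rewrite body_gconj inversionI_body|rewrite body_kappa|rewrite kappa_kappa_inf].
Qed.

Lemma theta_nice_inf i : cdom X1 i (punct X1 0) -> exists V Phi,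
  [/\ @nice_at R S sewn theta_ false (inl i) (inr 0) V Phi, cdom sewn (inl i) (theta_ (inr 0)) &
   forall b, V b -> cabs b < einf].
Proof.
move=> di; pose W : set C := [set b : C | cabs (b - 0) < einf].
have oW : open W := @open_lt R 0 einf.
have WE b : W b -> cabs b < einf by rewrite /W /= subr0.
have W0 : W 0.
  by change (cabs ((0 : C) - 0) < einf); rewrite subr0 cabs0 einf_gt0.
have [V [Phi [hV Va hPhi]]] : exists V Phi, @nice_at R S X1 G1 false i (kap (inr 0)) V Phi.
  by apply: (G_nice_at hX1 G1K sG1); rewrite kap0 ?G10 //; exact: body0.
rewrite kap0 /= body0 in Va.
have n0 : nice W (kappa_inf (- e) th z).
  apply: nice_sub (nice_gpair (gpair_kappa_inf one oth ez bz)) oW _ => b /WE small.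
  have [dP PE] := SCinvP false (b%:A : Lam).
  by have [_ + _ _] := inf_far dP (ltac:(by rewrite PE bodyA1)); rewrite PE bodyA1.
have dT (P : pt S) : cdom S false P -> W (body (cmap S false P)) ->
    V (body (kappa_inf (- e) th z (cmap S false P))) ->
    cdom sewn (inl i) (theta_ P) /\ cmap sewn (inl i) (theta_ P) = Phi (kappa_inf (- e) th z (cmap S false P)).
  move=> dP /WE small VP; have [fP _ dk kE] := inf_far dP small.
  have pP := SC_pts dP; have [E _] := theta_far pP fP.
  have [dG EG] := hPhi (kap P) dk ltac:(by rewrite kE); rewrite E; split.
    by exists (G1 (kap P)) => //; split=> //; exact: kept1.
  by apply: etrans (desc1E _ _) _; rewrite EG kE.
exists [set b | W b /\ V (body (kappa_inf (- e) th z b%:A))], (fun a => Phi (kappa_inf (- e) th z a)).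
have V0 : W 0 /\ V (body (kappa_inf (- e) th z (0 : C)%:A)).
  by split; [exact: W0|rewrite scale0r kappa_inf_0 body0].
split; last by move=> b [/WE].
  split; [exact: nice_comp|by rewrite /= body0|].
  by move=> P dP [WP VP]; apply: dT => //; rewrite (nice_bodyE n0 WP).
by apply: (dT (inr 0) _ _ _).1; rewrite /= ?body0 ?kappa_inf_0 ?body0.
Qed.

Variables (H : pt sewn -> pt S) (HG : pt S -> pt sewn).
Local Notation Xs := (sewn_tubed X1 1 0 X2 r1 r2).
Hypotheses (HK : forall T, pts T -> pts (H T) /\ HG (H T) = T)
  (HGK : forall P, pts P -> pts (HG P) /\ H (HG P) = P)
  (sH : superconformal_map (X := sewn) (Y := S) (pts (s := sewn)) H)
  (sHG : superconformal_map (X := S) (Y := sewn) (pts (s := S)) HG)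
  (hQ : setSK Q)
  (repQ : forall k : 'I_2, H (punct Xs k) = sk_puncture Q k /\
      exists2 W : set (pt sewn), sopen W /\ W (punct Xs k) &
        forall T, W T -> udom Xs k T /\ sk_coordinate Q k (H T) (ucrd Xs k T)).

(** The comparison automorphism of the sphere, to be proved the identity on finite points. *)
Definition Gam (P : pt S) : pt S := H (theta_ P).

Lemma H_inj T T' : pts T -> pts T' -> H T = H T' -> T = T'.
Proof. by move=> pT pT' E; rewrite -(HK pT).2 E (HK pT').2. Qed.
Lemma Gam_pts P : pts P -> pts (Gam P).
Proof. by move=> /theta_pts/HK[]. Qed.

Lemma H_nice_at i c T : pts T -> cdom sewn i T -> cdom S c (H T) ->
  exists V Phi, @nice_at R sewn S H i c T V Phi.
Proof.
move=> pT dT dH; apply: (nice_at_superconformal (@sewn_chart_inj i) (@SC_inj R c) sH) => //.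
by move=> A B /set_mem pA /set_mem pB; exact: H_inj.
Qed.

Lemma Gam_nice_inl a c : cdom S c (Gam (inl a)) ->
  exists V Phi, @nice_at R S S Gam true c (inl a) V Phi.
Proof.
move=> dG; have [i [V [Phi [dT hV]]]] := theta_nice_inl a.
have [V' [Phi' hV']] := H_nice_at (theta_pts (I : pts (inl a : pt S))) dT dG.
by eexists; eexists; apply: (nice_at_comp hV hV').
Qed.

Let theta0 : theta_ (inr 0) = punct Xs 0.
Proof. by rewrite (theta_far pinf isT).1 kap0 G10. Qed.
Let far0 : far (inl 0).
Proof. by rewrite /far body0 sub0r cabsN (lt_le_trans r21 r1_le). Qed.
Let theta1 : theta_ (inl 0) = punct Xs 1.
Proof.
rewrite (@theta_far (inl 0) I far0).1 /=; congr (cls (inl _)).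
by rewrite kappa_0 G12.
Qed.
Lemma Gam_inf : Gam (inr 0) = inr 0.
Proof.
have [+ _] := repQ ord0; rewrite /sk_puncture unlift_none => E.
exact: etrans (congr1 H theta0) E.
Qed.
Lemma Gam_0 : Gam (inl 0) = inl 0.
Proof.
have [+ _] := repQ (lift ord0 (ord0 : 'I_1)); rewrite /sk_puncture liftK /= => E.
apply: etrans (congr1 H theta1) (etrans E _); congr inl.
by rewrite nth_default // size_tuple.
Qed.

Lemma Gam_nice_inf : exists V Phi, @nice_at R S S Gam false false (inr 0) V Phi.
Proof.
have [i di] := chart_at hX1 (@ppunct 0 isT); have [V [Phi [hV dT _]]] := theta_nice_inf di.
have [V' [Phi' hV']] := @H_nice_at _ false _ (theta_pts pinf) dT (ltac:(by rewrite -/(Gam _) Gam_inf; exact: body0)).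
by eexists; eexists; apply: (nice_at_comp hV hV'); exact: body0.
Qed.

Let AMQ : seqpair R := ((sk_inf Q).1, fun j => - ('i *: (sk_inf Q).2 j)).

(** The tube at infinity of the sewn surface is a restriction of that of the first surface, so
    [theta_] expresses it by [kappa_inf]; through H it is the series attached to Q. The bound by dl
    keeps the image close to infinity too. *)
Lemma coordinate_inf (dl : R) : 0 < dl -> exists2 ep : R, 0 < ep & forall P, cdom S false P ->
  cabs (body (cmap S false P)) < ep ->
  [/\ sser_at (tildeE AMQ) (SC_inversion (Gam P)) (gconj (kappa_inf (- e) th z (cmap S false P))),
      cdom S false (Gam P) & cabs (body (cmap S false (Gam P))) < dl].
Proof.
move=> dl0; have [i di] := chart_at hX1 (@ppunct 0 isT); have [V [Phi [hV dT Vinf]]] := theta_nice_inf di.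
have [_ [W [oW Wp] hW]] := repQ ord0; rewrite -theta0 in Wp.
have d0 : cdom S false (inr 0 : pt S) by exact: body0.
have [V1 oV1 [V10 [V1V hV1]]] := nice_at_open hV (@sewn_chart_inj _) oW d0 Wp.
have [_ [W' [oW' Wp'] hW']] := rep1 ord0.
have [V2 [Phi2 hV2]] : exists V Phi, @nice_at R S X1 G1 false i (inr 0) V Phi.
  by apply: (G_nice_at hX1 G1K sG1); rewrite ?G10.
have injX : set_inj (cdom X1 i) (cmap X1 i) by case: hX1 => _ /(_ i).
have [V3 oV3 [V30 [_ hV3]]] := nice_at_open hV2 injX oW' d0 (ltac:(by rewrite G10) : W' (G1 (inr 0))).
have [V4 [Phi4 [n4 V40 h4]]] := Gam_nice_inf.
have [dG0 EG0] := h4 _ d0 V40.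
rewrite /= body0 in V10 V30 V40.
pose B : set C := [set b : C | cabs (b - 0) < dl].
have oB : open B := @open_lt R 0 dl.
have o5 := nice_open_pre n4 oB.
have V50 : V4 0 /\ B (body (Phi4 (0 : C)%:A)).
  split; first exact: V40; move: EG0; rewrite Gam_inf /= scale0r => <-.
  by change (cabs (body (0 : Lam) - 0) < dl); rewrite body0 subr0 cabs0.
have [ep ep0 hep] := (openP _).1 (openI oV1 (openI oV3 o5)) 0 (conj V10 (conj V30 V50)).
exists ep => // P dP Pep; have := hep _ Pep; rewrite add0r => -[V1P [V3P [V4P B4P]]].
have small := Vinf _ (V1V _ V1P); have [fP ne dk kE] := inf_far dP small.
have WP := hV1 P dP V1P; have W'P : W' (G1 (kap P)).
  by apply: hV3 => //; rewrite kE body_kappa_inf.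
have [_ cQ] := hW _ WP; have [_ c1] := hW' _ W'P.
have [dG EG] := h4 P dP V4P; split=> //; last first.
  by have := B4P; rewrite -(nice_bodyE n4 V4P) -EG /B /= subr0.
move: cQ c1; rewrite /sk_coordinate !unlift_none (G1K (SC_pts dk)).2 (SC_inversionE (kap P)) kE.
have t0 : tildeE (fun=> 0, fun j => - ('i *: (fun=> 0 : Lam) j)) = tildeE (@seqpair0 R).
  by congr tildeE; congr pair; apply/funext => j; rewrite scaler0 oppr0.
move=> cQ c1; have c2 := tildeE0 (gconj (kappa_inf (- e) th z (cmap S false P))).
rewrite -t0 in c2; have uE := abs_sum_uniq c1 c2.
apply: sser_at_eq cQ; rewrite -uE; have [-> _] := theta_far (SC_pts dP) fP.
exact: desc1E.
Qed.

Lemma coordinate_fin : exists2 ep : R, 0 < ep & forall a, cabs (body a) < ep ->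
  exists2 a', Gam (inl a) = inl a' &
    sser_at (hatE (sk_a Q ord0) (sk_tube Q ord0)) a' (kappa (- e) th z a).
Proof.
have [i [V [Phi [dT hV]]]] := theta_nice_inl 0.
have [_ [W [oW Wp] hW]] := repQ (lift ord0 (ord0 : 'I_1)).
have Wp1 : W (theta_ (inl 0)) by rewrite theta1.
have [V1 oV1 [V10 [V1V hV1]]] := nice_at_open hV (@sewn_chart_inj _) oW (I : cdom S true (inl 0)) Wp1.
have [_ [W' [oW' Wp'] hW']] := rep1 (lift ord0 (ord_max : 'I_2)).
have [i2 di2] := chart_at hX1 (@ppunct 2 isT).
have [V2 [Phi2 hV2]] : exists V Phi, @nice_at R S X1 G1 true i2 (inl 0) V Phi.
  by apply: (G_nice_at hX1 G1K sG1); rewrite ?G12.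
have injX : set_inj (cdom X1 i2) (cmap X1 i2) by case: hX1 => _ /(_ i2).
have [V3 oV3 [V30 [_ hV3]]] := nice_at_open hV2 injX oW' (I : cdom S true (inl 0)) (ltac:(by rewrite G12) : W' (G1 (inl 0))).
have oF : open [set b : C | r2 < cabs (b - body z)] by exact: open_gt.
have F0 : r2 < cabs (0 - body z) by have := far0; rewrite /far body0.
rewrite /= body0 in V10 V30.
have [ep ep0 hep] := (openP _).1 (openI oV1 (openI oV3 oF)) 0 (conj V10 (conj V30 F0)).
exists ep => // a aep; have := hep _ aep; rewrite add0r => -[V1P [V3P fP]].
have WP := hV1 (inl a) I V1P; have na := far_ne fP.
have W'P : W' (G1 (inl (kappa (- e) th z a))) by apply: hV3 => //=; rewrite body_kappa.
have [_ cQ] := hW _ WP; have [_ c1] := hW' _ W'P.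
move: cQ c1; rewrite /sk_coordinate !liftK (G1K (I : pts (inl (kappa (- e) th z a) : pt S))).2.
move=> [a' Ea' hs] [b [bE] hb]; rewrite -bE in hb; exists a'; first exact: Ea'.
have s0 (q : Lam) : shift 0 q = q by rewrite /Defs.shift (even_odp (@ev0 R)) mulr0 !subr0.
have n0 : nth 0 (sk_pts Q) (ord0 : 'I_1) = 0 by rewrite nth_default // size_tuple.
rewrite n0 s0 in hs.
have hb' : sser_at (hatE 1 (@seqpair0 R)) (shift 0 (kappa (- e) th z a)) (ucrd X1 2 (G1 (inl (kappa (- e) th z a)))).
  exact: hb.
rewrite s0 in hb'; have uE := abs_sum_uniq hb' (hatE0 _).
apply: sser_at_eq hs; rewrite -uE; have [-> _] := @theta_far (inl a) I fP.
exact: desc1E.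
Qed.

(** A whole fibre lies over infinity, so injectivity at the puncture is not enough. Bodies are
    compared instead: a finite point sent into this fibre would have in the sewn surface the body of
    the puncture, hence come from the fibre over infinity of the first sphere. *)
Lemma Gam_fin a : exists a', Gam (inl a) = inl a'.
Proof.
case E : (Gam (inl a)) => [a'|b]; first by exists a'.
have pa : pts (inl a : pt S) by [].
have b0 : body b = 0 by have := Gam_pts pa; rewrite E.
have [i di] := chart_at hX1 (@ppunct 0 isT).
have pT0 : pts (s := sewn) (punct Xs 0) by rewrite -theta0; exact: theta_pts pinf.
have HG0 : HG (inr 0) = punct Xs 0.
  by rewrite -Gam_inf /Gam theta0; exact: (HK pT0).2.
have HGa : HG (inr b) = theta_ (inl a) by rewrite -E /Gam (HK (theta_pts pa)).2.
have dT0 : cdom sewn (inl i) (punct Xs 0).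
  have [V [Phi [_ dT _]]] := theta_nice_inf di; by rewrite -theta0.
have d0 : cdom S false (inr 0 : pt S) by exact: body0.
have HGinj : set_inj (pts (s := S)) HG.
  by move=> A B /set_mem pA /set_mem pB AB; rewrite -(HGK pA).2 AB (HGK pB).2.
have [V [Phi [nV V0 hV]]] := nice_at_superconformal (@SC_inj R false) (@sewn_chart_inj (inl i)) sHG HGinj
  pinf d0 (ltac:(by rewrite HG0) : cdom sewn (inl i) (HG (inr 0))).
have [_ EG0] := hV _ d0 V0; rewrite /= body0 in V0.
have db : cdom S false (inr b : pt S) by exact: b0.
have [dGb EGb] := hV _ db ltac:(by rewrite /= b0).
have bE : body (cmap sewn (inl i) (HG (inr b))) = body (cmap sewn (inl i) (HG (inr 0))).
  by rewrite EGb EG0; apply: (nice_body nV); rewrite /= ?body0 ?b0.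
have := dGb; rewrite HGa => -[p [dp kp] pE].
have bp : body (cmap X1 i p) = body (cmap X1 i (punct X1 0)).
  move: bE; rewrite HGa -pE HG0 -theta0 (theta_far pinf isT).1 kap0 G10.
  by rewrite [cmap sewn _ _]desc1E [X in _ = body X]desc1E.
have dF0 : cdom S false (F1 (punct X1 0)) by rewrite punct0; exact: body0.
have [V2 [Phi2 [n2 V20 h2]]] := F_nice_at hX1 F1K sF1 (@ppunct 0 isT) di dF0.
have [_ EF0] := h2 _ di V20; have [dFp EFp] := h2 p dp ltac:(by rewrite bp).
have pp : pts p by case: kp.
have bF : body (cmap S false (F1 p)) = 0.
  rewrite EFp (nice_body n2 (p := cmap X1 i (punct X1 0))) // -EF0 punct0 /=; exact: body0.
have [b' Fb'] : exists b', F1 p = inr b'.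
  case F1p : (F1 p) dFp bF => [c|c] /= h; last by exists c.
  by rewrite body_gconj inversionI_body // => /eqP; rewrite invr_eq0 (negPf h).
have Gp : G1 (inr b') = p by rewrite -Fb' (F1K pp).2.
have pb' : pts (inr b' : pt S) by rewrite -Fb'; exact: (F1K pp).1.
exfalso; have [hf|near] := ltP r2 (cabs (body a - body z)).
  move: pE; rewrite (@theta_far (inl a) I hf).1 => /cls_inl; rewrite -Gp => /G1i.
  by move=> /(_ pb' (kap_pts pa hf)).
move: pE; rewrite (theta_near (le_lt_trans near r21)).1 => /cls_mixed[U small _ _ _].
rewrite /in_ball /= cabs_lt -Gp in small; rewrite -Gp in U.
by have := in_U1 pb' U small.
Qed.
End Uniqueness.

(** * Entire functions of linear growth and estimates for inverses *)

Section Slopes.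
Variable R : realType.
Local Notation C := (cplx R).
Local Notation Lam := (grassmann C).

Lemma an_div (h : C -> C) : an h 0 -> h 0 = 0 ->
  exists c : C, an (fun t => if t == 0 then c else h t / t) 0.
Proof.
move=> [a [r [r0 hr]]] h0; exists (a 1%N), (fun n => a n.+1), r; split=> // t tr.
have a0 : a 0%N = 0 by rewrite -(pseries0 (conj r0 hr)).
have hs := csum_split 1 (hr t tr); rewrite big_ord1 a0 mul0r subr0 add0r in hs.
rewrite add0r; case: eqP => [->|/eqP t0].
  have := @csum_fin R (fun n => a n.+1 * 0 ^+ n) 1%N; rewrite big_ord1 expr0 mulr1; apply.
  by case=> // n _; rewrite exprS mul0r mulr0.
rewrite mulrC; apply: eq_csum (csumZ t^-1 hs) => n.
by rewrite addn1 exprS mulrCA; congr (_ * _); rewrite mulKf.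
Qed.

Lemma an_divE (h : C -> C) z0 : z0 != 0 -> an h z0 -> forall c : C, an (fun t => if t == 0 then c else h t / t) z0.
Proof.
move=> z00 hh c; have b0 : body (z0%:A : Lam) != 0 by rewrite bodyA1.
have pz : anpath (fun t => (z0 + t)%:A : Lam).
  by apply: anpath_scalar; apply: anD; [exact: an_cst|exact: an_id].
have iv : anpath (fun t => ((z0 + t)^-1)%:A : Lam).
  have hSA : SA [set b : C | b != 0] (fun p : Lam => (evp p)^-1).
    apply: SA_inv => [|p bp]; first exact: SA_evp_id (@open_ne R 0).
    by split; [exact: evp_even|rewrite body_evp].
  have := SA_anpath hSA pz; rewrite addr0 => /(_ b0).
  apply: (anpath_near (r := cabs z0)); first by rewrite cabs_gt0.
  move=> t tz; have nz : z0 + t != 0.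
    by apply/eqP => /eqP; rewrite addr_eq0 => /eqP E; rewrite E cabsN ltxx in tz.
  rewrite even_evp; last exact: evA.
  by apply: evV_unique; [exact: evA|rewrite -scalerAl mul1r scalerA divff // scale1r].
have iv0 : an (fun t : C => (z0 + t)^-1) 0.
  have := anpath_body iv; apply: an_near ltr01 _ => t _; by rewrite add0r bodyA1.
have [co [r [r0 hco]]] := iv0.
have : an (fun t : C => h t * t^-1) z0.
  apply: anM hh _; exists co, r; split=> // t tr.
  by have := hco t tr; rewrite add0r.
apply: (an_near (r := cabs z0)); first by rewrite cabs_gt0.
move=> t tz; case: eqP => // /eqP; rewrite addr_eq0 => /eqP E.
by rewrite E cabsN ltxx in tz.
Qed.

(** With the removable singularities filled in, the second quotient (h t / t - c) / t is entire and
    tends to 0 at infinity, so it is zero by [liouville]. *)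
Lemma entire_linear (h : C -> C) (K B : R) : (forall s, an h s) -> h 0 = 0 ->
  (forall t, B < cabs t -> cabs (h t) <= K * cabs t) -> forall t, h t = t * h 1.
Proof.
move=> hh h0 hK.
have K0 : 0 <= K.
  have B1 : B < cabs ((`|B| + 1)%:C%C : C).
    by rewrite cabs_real ger0_norm ?addr_ge0 // (le_lt_trans (ler_norm B)) // ltrDl.
  have := hK _ B1; have p : 0 < cabs ((`|B| + 1)%:C%C : C).
    by rewrite cabs_real ger0_norm ?addr_ge0 // ltr_wpDl.
  by rewrite -ler_pdivrMr //; apply: le_trans; rewrite divr_ge0 ?cabs_ge0.
have [c hc] := an_div (hh 0) h0; pose f (t : C) : C := if t == 0 then c else h t / t.
have fan s : an f s by have [->//|s0] := eqVneq s 0; exact: an_divE.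
have f0 : an (fun t => f t - f 0) 0.
  have := anD (fan 0) (an_cst (- f 0) 0); by [].
have [c' hc'] := an_div f0 (subrr _).
pose k (t : C) : C := if t == 0 then c' else (f t - f 0) / t.
have kan s : an k s.
  have [->//|s0] := eqVneq s 0; apply: an_divE => //.
  exact: anD (fan s) (an_cst (- f 0) s).
have k0 : forall t, k t = 0.
  apply: liouville kan _ => ep ep0; exists (Num.max (Num.max B 1) ((K + cabs (f 0)) / ep)) => t.
  rewrite !gt_max => /andP[/andP[tB t1] tep].
  have t0 : t != 0 by rewrite -cabs_gt0 (lt_trans _ t1).
  have tp : 0 < cabs t by rewrite cabs_gt0.
  rewrite /k (negPf t0) cabsM cabsV ler_pdivrMr //.
  apply: (le_trans (cabsB _ _)); rewrite ltr_pdivrMr // in tep; apply: le_trans (ltW _); last by rewrite mulrC; exact: tep.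
  by rewrite lerD2r /f (negPf t0) cabsM cabsV ler_pdivrMr //; exact: hK.
have fE t : f t = f 0.
  have [->//|t0] := eqVneq t 0; apply/eqP; rewrite -subr_eq0.
  have := k0 t; rewrite /k (negPf t0) => /eqP; rewrite mulf_eq0 invr_eq0 (negPf t0) orbF.
  by [].
move=> t; have [->|t0] := eqVneq t 0; first by rewrite h0 mul0r.
have := fE t; rewrite -(fE 1) /f (negPf t0) oner_eq0 divr1 => <-.
by rewrite mulrC divfK.
Qed.

Lemma inversionI_scalar (y : C) : y != 0 -> inversionI (y%:A : Lam) = (y^-1)%:A.
Proof.
move=> y0; rewrite /inversionI even_evp ?even_odp; try exact: evA.
rewrite mul0r scaler0 addr0; apply: evV_unique; first exact: evA.
by rewrite -scalerAl mul1r scalerA divff // scale1r.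
Qed.

Lemma tildeE_1 (AM : seqpair R) : (tildeE AM).1 1%N = 1 + AM.2 0%N.
Proof.
have E l : (iter l.+1 (genT AM) (xphi R)).1 1%N = AM.2 0%N * (iter l (genT AM) (xphi R)).2 0%N.
  rewrite iterS; apply: etrans (genT1 AM _ 1) _.
  by rewrite big_ord1 subnn mulr0n mulr0 add0r.
have z l : (iter l.+1 (genT AM) (xphi R)).2 0%N = 0.
  by rewrite iterS; apply: etrans (genT2 AM _ 0) _; rewrite big_ord0.
rewrite /tildeE expT_1 (big_ord_recl _) big_ord_recl big1 => [|l _].
  by rewrite !lift0 E /= !fact0 factS fact0 mul1n invr1 !scale1r mulr1 addr0.
by rewrite !lift0 E z mulr0 scaler0.
Qed.

(** From x^-1 = b^-1 - b^-1 s x^-1, with b the body and s the soul, the seminorm N of the inverse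
    satisfies N <= 1 / |b| + N / 2. *)
Lemma gnorm_inv (lam : R) I (x : Lam) : 0 < lam -> is_even x -> body x != 0 ->
  gnorm lam I (soul x) <= cabs (body x) / 2 -> gnorm lam I x^-1 <= 2 / cabs (body x).
Proof.
move=> l0 ex bx hs; have b0 : 0 < cabs (body x) by rewrite cabs_gt0.
have E : x^-1 = (body x)^-1%:A - (body x)^-1 *: (soul x * x^-1).
  have -> : soul x * x^-1 = 1 - body x *: x^-1 by rewrite /soul mulrBl evrV // -scalerAl mul1r.
  by rewrite scalerBr scalerA mulVf // scale1r opprB addrCA subrr addr0.
have : gnorm lam I x^-1 <= (cabs (body x))^-1 + gnorm lam I x^-1 / 2.
  rewrite {1}E (le_trans (gnormD _ l0 _ _)) // gnormN gnormA gnormZ cabsV lerD2l.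
  rewrite mulrC ler_pdivrMr // (le_trans (gnormM _ l0 _ _)) // mulrC -mulrA ler_wpM2l ?gnorm_ge0 //.
  by apply: (le_trans hs); rewrite mulrC.
set N := gnorm _ _ _; rewrite (mulrC 2); set v := (cabs _)^-1; lra.
Qed.
Lemma cabs_ii : cabs ('i : C) = 1.
Proof.
apply/eqP; rewrite -sqrp_eq1 ?cabs_ge0 // expr2 -cabsM -expr2.
by rewrite (_ : ('i : C) ^+ 2 = -1) ?cabsN ?cabs1 //; exact: sqrCi.
Qed.

Lemma small_prod (x b : R) : 0 <= x -> 0 <= b -> b < (1 + x)^-1 -> x * b < 1.
Proof.
move=> x0 b0; have c0 : 0 < 1 + x by rewrite ltr_wpDr.
by rewrite -div1r ltr_pdivlMr //; nra.
Qed.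

Lemma an_shift (h : C -> C) s : an (fun t => h (s + t)) 0 -> an h s.
Proof. by move=> [co [r [r0 H]]]; exists co, r; split=> // t /H; rewrite add0r. Qed.

Lemma gnorm_le (lam : R) I (x y : Lam) : 0 < lam -> (forall J, cabs (x J) <= cabs (y J)) ->
  gnorm lam I x <= gnorm lam I y.
Proof. by move=> l0 h; apply: ler_sum => J _; rewrite ler_wpM2r // exprn_ge0 // ltW. Qed.

Lemma gnorm_evp (lam : R) I (x : Lam) : 0 < lam -> gnorm lam I (evp x) <= gnorm lam I x.
Proof. by move=> l0; apply: gnorm_le => // J; rewrite evpE; case: ifP; rewrite ?cabs0 ?cabs_ge0. Qed.

Lemma gnorm_odp (lam : R) I (x : Lam) : 0 < lam -> gnorm lam I (odp x) <= gnorm lam I x.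
Proof. by move=> l0; apply: gnorm_le => // J; rewrite odpE; case: ifP; rewrite ?cabs0 ?cabs_ge0. Qed.

Lemma gnorm_mono (lam : R) I (x : Lam) : 0 < lam -> lam <= 1 -> gnorm lam I x <= gnorm 1 I x.
Proof.
move=> l0 l1; apply: ler_sum => J _; rewrite ler_wpM2l ?cabs_ge0 // expr1n.
by rewrite exprn_ile1 // ltW.
Qed.

Lemma gnorm_soul (lam : R) I (x : Lam) : 0 < lam -> lam <= 1 ->
  gnorm lam I (soul x) <= lam * gnorm 1 I x.
Proof.
move=> l0 l1; rewrite /gnorm mulr_sumr; apply: ler_sum => J _; rewrite soulE expr1n mulr1.
have [->|J0] := eqVneq J fset0; first by rewrite cabs0 mul0r mulr_ge0 ?cabs_ge0 // ltW.
rewrite mulrC ler_wpM2r ?cabs_ge0 //; rewrite -cardfs_gt0 in J0.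
by rewrite -(prednK J0) exprS ler_piMr ?exprn_ile1 // ltW.
Qed.
End Slopes.

(** * An automorphism of the sphere fixing 0 and infinity is trivial *)

Section SphereAutomorphism.
Variable R : realType.
Local Notation C := (cplx R).
Local Notation Lam := (grassmann C).
Local Notation S := (SC R).
Variables (e th z : Lam) (Q : skdata R 1) (Gam : pt S -> pt S).
Hypotheses (oe : is_odd e) (oth : is_odd th) (ez : is_even z) (bz : body z != 0) (hQ : setSK Q).
Hypotheses (Gam_fin : forall a, exists a', Gam (inl a) = inl a')
  (Gam_nice_inl : forall a c, cdom S c (Gam (inl a)) -> exists V Phi, @nice_at R S S Gam true c (inl a) V Phi)
  (Gam_0 : Gam (inl 0) = inl 0) (Gam_inf : Gam (inr 0) = inr 0)
  (Gam_nice_inf : exists V Phi, @nice_at R S S Gam false false (inr 0) V Phi)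
  (coordinate_inf : forall dl : R, 0 < dl -> exists2 ep : R, 0 < ep & forall P, cdom S false P ->
     cabs (body (cmap S false P)) < ep ->
     [/\ sser_at (tildeE ((sk_inf Q).1, fun j => - ('i *: (sk_inf Q).2 j))) (SC_inversion (Gam P))
          (gconj (kappa_inf (- e) th z (cmap S false P))),
         cdom S false (Gam P) & cabs (body (cmap S false (Gam P))) < dl])
  (coordinate_fin : exists2 ep : R, 0 < ep & forall a, cabs (body a) < ep ->
     exists2 a', Gam (inl a) = inl a' &
       sser_at (hatE (sk_a Q ord0) (sk_tube Q ord0)) a' (kappa (- e) th z a)).

Definition gam (a : Lam) : Lam := cmap S true (Gam (inl a)).

Lemma gamE a : Gam (inl a) = inl (gam a).
Proof. by rewrite /gam; have [a' ->] := Gam_fin a. Qed.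

Lemma gam_path ga : anpath ga -> anpath (fun t => gam (ga t)).
Proof.
move=> hga; have [V [Phi [nV V0 hV]]] := @Gam_nice_inl (ga 0) true (ltac:(by rewrite gamE)).
have [r r0 hr] := anpath_in (nice_open nV) hga V0.
apply: (anpath_near (ga := fun t => Phi (ga t)) r0); last exact: nice_path nV _ hga V0.
by move=> t /hr Vt; have [_ <-] := hV (inl (ga t)) I Vt.
Qed.

Lemma gam_an a I (s : C) : an (fun t => gam (a + t%:A) I) s.
Proof.
apply: (@an_shift R (fun t => gam (a + t%:A) I)).
apply: (gam_path (ga := fun t => a + (s + t)%:A)).
apply: anpathD (anpath_cst _) _; apply: anpath_scalar.
by apply: anD; [exact: an_cst|exact: an_id].
Qed.

(** In the coordinate y = 1 / t at infinity the map is of order y, with body bounded below by a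
    multiple of |y|. Inverting it gives growth of order t for the even part, but a bounded odd part,
    which will force the slope to be even. *)
Lemma slope_bound I : exists K B : R, forall t, B < cabs t ->
  [/\ cabs (gam t%:A I) <= K * cabs t, odd #|` I|%fset -> cabs (gam t%:A I) <= K
    & body (gam t%:A) != 0].
Proof.
have [V [U [nV V0 hV]]] := Gam_nice_inf; have d0 : cdom S false (inr 0 : pt S) by exact: body0.
have [_] := hV _ d0 V0; rewrite Gam_inf /= => U0; rewrite /= body0 in V0.
have [K K0 [r r0 hr]] : exists2 K : R, 0 <= K & exists2 r : R, 0 < r & forall t, cabs t < r ->
    gnorm 1 I (U t%:A) <= K * cabs t.
  apply: (anpath_small (ga := fun t => U t%:A)); last by rewrite scale0r -U0.
  by apply: (nice_path nV (@anpath_id R)); rewrite bodyA1.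
have [K' [r' [K'0 r'0 low]]] := nice_low nV V0.
(* This weight makes lam K <= K' / 2, so that the soul has at most half the size of the body, as
   [gnorm_inv] requires. *)
pose lam := K' / (2 * (K + K')).
have KK : 0 < K + K' by rewrite ltr_wpDl.
have l0 : 0 < lam by rewrite divr_gt0 // mulr_gt0.
have l1 : lam <= 1 by rewrite ler_pdivrMr ?mulr_gt0 // mul1r; lra.
have lK : lam * K <= K' / 2.
  rewrite mulrAC ler_pdivrMr ?mulr_gt0 // (_ : K' / 2 * (2 * (K + K')) = K' * (K + K')); last by field.
  by rewrite ler_wpM2l ?(ltW K'0) //; lra.
have main (y : C) : y != 0 -> cabs y < r -> cabs y < r' ->
    [/\ gnorm lam I (evp (gam (y^-1)%:A)) <= 2 / K' / cabs y,
        gnorm lam I (odp (gam (y^-1)%:A)) <= 2 * K / K' & body (gam (y^-1)%:A) != 0].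
  move=> y0 yr yr'; have [dP PE] := SCinvP false (y%:A : Lam).
  have y00 : 0 < cabs y by rewrite cabs_gt0.
  have PI : SCinv false (y%:A : Lam) = inl (y^-1)%:A.
    by rewrite /= bodyA1 (negPf y0) inversionI_scalar.
  have [Vy lowy] := low y yr'; rewrite add0r in Vy lowy.
  have [dG EG] := hV _ dP (ltac:(by rewrite PE bodyA1)); rewrite PE PI in dG EG.
  have gd : cdom S true (Gam (inl (y^-1)%:A)) by rewrite gamE.
  have [bu ug] := SCtransE dG gd; rewrite EG in bu ug.
  have gu : inversionI (U y%:A) = gam (y^-1)%:A := ug.
  rewrite scale0r -U0 body0 subr0 in lowy.
  set u := U y%:A in bu gu lowy; have bu0 : body u != 0 by exact: bu.
  have N1 : gnorm 1 I u <= K * cabs y by exact: hr.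
  have iN : gnorm lam I (evp u)^-1 <= 2 / (K' * cabs y).
    apply: (le_trans (gnorm_inv l0 (evp_even u) _ _)); rewrite body_evp //.
      apply: (le_trans (gnorm_soul _ _ l0 l1)); apply: (le_trans (ler_wpM2l (ltW l0) (le_trans (gnorm_evp _ _ ltr01) N1))).
      by rewrite mulrA (le_trans (ler_wpM2r (cabs_ge0 _) lK)) // mulrAC ler_wpM2r.
    by rewrite ler_wpM2l // lef_pV2 // posrE ?mulr_gt0 ?cabs_gt0.
  have ev1 : is_even (evp u)^-1 by exact: ev_inv (evp_even u).
  have od1 : is_odd ('i *: (odp u * (evp u)^-1)) by apply: odZ; apply: od_evM => //; exact: odp_odd.
  rewrite -gu /inversionI; split.
  - rewrite evp_add // (le_trans iN) // invfM mulrA mulrAC; exact: lexx.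
  - rewrite odp_add // gnormZ (_ : cabs 'i = 1) ?mul1r; last exact: cabs_ii.
    apply: (le_trans (gnormM _ l0 _ _)).
    apply: (@le_trans _ _ (K * cabs y * (2 / (K' * cabs y)))).
      apply: ler_pM; rewrite ?gnorm_ge0 //.
      by apply: (le_trans (gnorm_odp _ _ l0)); apply: le_trans N1; exact: gnorm_mono.
    by rewrite (_ : K * _ * _ = 2 * K / K') //; field; rewrite !gt_eqF.
  - have := inversionI_body bu0; rewrite /inversionI => ->; by rewrite invr_eq0.
exists ((2 / K' + 2 * K / K') / lam ^+ #|` I|), (Num.max 1 (Num.max r^-1 r'^-1)) => t.
rewrite !gt_max => /and3P[t1 tr tr'].
have t0 : t != 0 by rewrite -cabs_gt0 (lt_trans _ t1).
have tp : 0 < cabs t by rewrite cabs_gt0.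
have [M1 M2 M3] : [/\ gnorm lam I (evp (gam (t^-1^-1)%:A)) <= 2 / K' / cabs t^-1,
    gnorm lam I (odp (gam (t^-1^-1)%:A)) <= 2 * K / K' & body (gam (t^-1^-1)%:A) != 0].
  apply: main; rewrite ?cabsV; first by rewrite invr_eq0.
    by rewrite -(invrK r) ltf_pV2 // posrE invr_gt0.
  by rewrite -(invrK r') ltf_pV2 // posrE invr_gt0.
rewrite invrK cabsV invrK in M1 M2 M3; have lI : 0 < lam ^+ #|` I| by rewrite exprn_gt0.
have c1 := le_trans (gnorm_comp l0 (evp (gam t%:A)) (fsubset_refl I)) M1.
have c2 := le_trans (gnorm_comp l0 (odp (gam t%:A)) (fsubset_refl I)) M2.
have k1 : 0 < 2 / K' by rewrite divr_gt0.
have k2 : 0 <= 2 * K / K' by rewrite divr_ge0 ?mulr_ge0 // ltW.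
move: c1 c2 lI k1 k2; set L := lam ^+ _; set a := 2 / K'; set b := 2 * K / K' => c1 c2 lI k1 k2.
have big (v x : R) : 1 < x -> v * L <= a * x \/ v * L <= b -> v <= (a + b) / L * x.
  by move=> x1 h; rewrite mulrAC ler_pdivlMr //; case: h => h; apply: (le_trans h); nra.
have const (v : R) : v * L <= b -> v <= (a + b) / L.
  by move=> h; rewrite ler_pdivlMr //; apply: (le_trans h); lra.
have Eg : gam t%:A I = if odd #|` I|%fset then odp (gam t%:A) I else evp (gam t%:A) I.
  by rewrite odpE evpE; case: (odd _).
split; [apply: (big _ _ t1)| |exact: M3]; rewrite Eg; first by case: ifP; [right|left].
by move=> oI; rewrite oI; exact: const.
Qed.

Lemma gam_linear : exists kp, [/\ is_even kp, body kp != 0 & forall t : C, gam t%:A = t *: kp].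
Proof.
have g0 : gam (0 : C)%:A = 0 by rewrite scale0r /gam Gam_0.
have lin I t : gam t%:A I = t * gam (1 : C)%:A I.
  have [K [B hK]] := slope_bound I.
  apply: (@entire_linear R (fun t => gam t%:A I) K B) => [s||t' /hK[]//]; last by rewrite g0 gr0E.
  rewrite (_ : (fun t => _) = fun t : C => gam (0 + t%:A) I); first exact: gam_an.
  by apply/funext => t'; rewrite add0r.
have glin t : gam t%:A = t *: gam (1 : C)%:A by apply/grP => I; rewrite lin grZE.
exists (gam (1 : C)%:A); split=> //.
  move=> I oI; have [K [B hK]] := slope_bound I; set k := gam _ I.
  apply/eqP; rewrite -cabs_eq0; apply/negP => /negP k0.
  have kp : 0 < cabs k by rewrite lt_def k0 cabs_ge0.
  (* An odd component is both linear in t and bounded; beyond K / |k| this is a contradiction unless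
     k = 0. *)
  pose T : R := Num.max (`|B|) (`|K| / cabs k) + 1.
  have T0 : 0 <= T by rewrite addr_ge0 // le_max normr_ge0.
  have TB : B < T by rewrite (le_lt_trans (ler_norm B)) // /T ltr_pwDr // le_max lexx.
  have [|_ /(_ oI) h _] := hK (T%:C)%C; first by rewrite cabs_real ger0_norm.
  move: h; rewrite lin cabsM cabs_real ger0_norm // -/k -ler_pdivlMr // leNgt => /negP; apply.
  rewrite (@le_lt_trans _ _ (`|K| / cabs k)) ?ler_wpM2r ?invr_ge0 ?ler_norm ?cabs_ge0 //.
  by rewrite /T ltr_pwDr // le_max lexx orbT.
have [K [B hK]] := slope_bound fset0; pose T : R := `|B| + 1.
have [|_ _] := hK (T%:C)%C.
  by rewrite cabs_real ger0_norm ?addr_ge0 // (le_lt_trans (ler_norm B)) // ltrDl.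
by rewrite glin /body grZE mulf_eq0 negb_or => /andP[].
Qed.

Lemma inf_tube : sk_inf Q = sewn_inf_tube e th z /\ forall t : C, gam t%:A = t%:A.
Proof.
have [kp [ek bk glin]] := gam_linear.
have eki : is_even kp^-1 by exact: ev_inv.
pose AM : seqpair R := ((sk_inf Q).1, fun j => - ('i *: (sk_inf Q).2 j)).
have tE : sk_inf Q = sewn_inf_tube e th z <->
  AM = ((sewn_inf_tube e th z).1, fun j => - ('i *: (sewn_inf_tube e th z).2 j)).
  rewrite /AM; case: (sk_inf Q) (sewn_inf_tube e th z) => [A M] [A' M'] /=; split=> [[-> ->]//|[-> h]].
  congr pair; apply/funext => j; have /oppr_inj := congr1 (fun f => f j) h.
  by apply: scalerI; rewrite -cabs_gt0 cabs_ii.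
set AM' : seqpair R := (_, _) in tE *.
(* Inversion turns the slope kp into kp^-1, and scalar points near infinity allow a comparison of
   coefficients. *)
have co n : kp^-1 ^+ n * (tildeE AM).1 n = (tildeE AM').1 n.
  have [ep ep0 hep] := coordinate_inf ltr01.
  have m0 : 0 < Num.min ep (1 + cabs (body z))^-1.
    by rewrite lt_min ep0 invr_gt0 ltr_wpDr ?cabs_ge0.
  apply: (sser_scalar_coef (u := (fun n => kp^-1 ^+ n * (tildeE AM).1 n, fun=> 0)) m0) => t.
  rewrite lt_min => /andP[tep tz]; have [dP PE] := SCinvP false (t%:A : Lam).
  have [+ _ _] := hep _ dP (ltac:(by rewrite PE bodyA1)); rewrite PE => sA.
  have et : is_even (t%:A : Lam) by exact: evA.
  exists (gconj (kappa_inf (- e) th z t%:A)); last first.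
    rewrite -[in X in sser_at _ _ X](gconj_even et); apply: (sewn_inf_value oe oth ez bz).
    rewrite bodyA1 cabsM.
    by apply: small_prod; rewrite ?cabs_ge0.
  have SE : SC_inversion (Gam (SCinv false t%:A)) = t *: kp^-1.
    have [->|t0] := eqVneq t 0.
      by rewrite !scale0r /= body0 eqxx Gam_inf /= gconj0.
    rewrite /= bodyA1 (negPf t0) inversionI_scalar // gamE glin /= /inversionI.
    have ev : is_even (t^-1 *: kp) by exact: evZ.
    rewrite even_evp // even_odp // mul0r scaler0 addr0; apply: evV_unique => //.
    by rewrite -scalerAl -scalerAr scalerA mulVf // scale1r evrV.
  rewrite SE in sA; apply: eq_abs_sum sA => n' /=.
  have ev : is_even (t *: kp^-1) by exact: evZ.
  rewrite !even_evp // !even_odp // !mul0r !addr0 mulrA; congr (_ * _).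
  by rewrite -exprMn_comm; [congr (_ ^+ _); rewrite -scalerAl mul1r|exact: evenC].
have [_ _ [eA oM _] hQ2 _] := hQ.
have [eA' oM' _] : setH (sewn_inf_tube e th z) by have [_ _] := sewn_setSK oe oth ez.
have oMi (M : nat -> Lam) j : (forall j, is_odd (M j)) -> is_odd (- ('i *: M j)).
  by move=> oM_; apply: odN; apply: odZ.
(* The coefficient of x in [tildeE] is 1 plus an odd parameter, so its even part is 1 on both
   sides. *)
have k1 : kp^-1 = 1.
  have := co 1%N; rewrite expr1 !tildeE_1 mulrDr mulr1 => /(congr1 (@evp R)).
  have o1 : is_odd (kp^-1 * AM.2 0%N) by apply: ev_odM => //; exact: oMi.
  have o2 : is_odd (AM'.2 0%N) by exact: oMi.
  by rewrite (evp_add eki o1) (evp_add (@ev1 R) o2).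
have kE : kp = 1 by rewrite -(evrV ek bk) k1 mulr1.
split; last by move=> t; rewrite glin kE.
have b1 : body (1 : Lam) != 0 by rewrite body1 oner_eq0.
apply/tE; apply: (@expT_inj R AM AM' 1 1 eA eA' _ _ (@ev1 R) (@ev1 R) b1 b1).
- by move=> j; exact: oMi.
- by move=> j; exact: oMi.
by move=> n; have := co n; rewrite k1 expr1n mul1r /tildeE xphiE.
Qed.

(** With the tube at infinity identified, both a and its image have the same value of one injective
    coordinate; this covers all points near infinity, with arbitrary soul. *)
Lemma gam_id_inf : exists B : R, forall a, B < cabs (body a) -> gam a = a.
Proof.
pose dl := (1 + cabs (body z))^-1.
have c0 : 0 < 1 + cabs (body z) by rewrite ltr_wpDr ?cabs_ge0.
have dl0 : 0 < dl by rewrite invr_gt0.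
have small (b : C) : cabs b < dl -> cabs (body z * b) < 1.
  by move=> bd; rewrite cabsM; apply: small_prod; rewrite ?cabs_ge0.
have [ep ep0 hep] := coordinate_inf dl0.
have m0 : 0 < Num.min ep dl by rewrite lt_min ep0.
exists (Num.min ep dl)^-1 => a Ba.
have ba : 0 < cabs (body a) by rewrite (lt_trans _ Ba) // invr_gt0.
have bn : body a != 0 by rewrite -cabs_gt0.
pose c : Lam := gconj (inversionI a).
have cE : cabs (body c) < Num.min ep dl.
  rewrite body_gconj inversionI_body // cabsV -(invrK (Num.min _ _)) ltf_pV2 // posrE //.
  by rewrite invr_gt0.
move: cE; rewrite lt_min => /andP[cep cdl].
have [sA dG cd'] := hep (inl a) bn cep; set P' := Gam (inl a) in sA dG cd'.
rewrite inf_tube.1 SC_inversionE in sA.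
have := sewn_inf_value oe oth ez bz (p := gconj (cmap S false P')).
rewrite body_gconj gconjK => /(_ (small _ cd')) sB.
have /(congr1 (@gconj R)) := abs_sum_uniq sA sB; rewrite !gconjK => kE.
have gp := gp_K (gpair_kappa_inf (odN oe) oth ez bz).
have ne (b : C) : cabs b < dl -> [set b | 1 - body z * b != 0] b.
  by move=> /small h /=; apply/eqP => /subr0_eq E; rewrite -E cabs1 ltxx in h.
have ck : cmap S false P' = c by rewrite -(gp _ (ne _ cd')).2 -kE (gp _ (ne _ cdl)).2.
have := SCinvK dG; rewrite ck -[c]/(cmap S false (inl a)) SCinvK // /P' gamE.
by case.
Qed.

(** Along the line a + t the difference of components is entire, and zero for large t. *)
Lemma gam_id a : gam a = a.
Proof.
have [B hB] := gam_id_inf; apply/grP => I; apply/eqP; rewrite -subr_eq0; apply/eqP.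
have := @liouville R (fun t => gam (a + t%:A) I - (a + t%:A) I) _ _ 0; rewrite scale0r addr0; apply.
  move=> s; have h2 : an (fun t : C => (a + t%:A) I) s.
    apply: (@an_shift R (fun t => (a + t%:A : Lam) I)).
    apply: (anpathD (anpath_cst a) _ I); apply: anpath_scalar.
    by apply: anD; [exact: an_cst|exact: an_id].
  apply: (an_near ltr01 _ (anD (gam_an a I s) (anM (an_cst (-1) s) h2))) => t _.
  by rewrite mulN1r.
move=> ep ep0; exists (B + cabs (body a)) => t Bt.
rewrite hB ?subrr ?cabs0 ?(ltW ep0) // bodyD bodyA1.
have := cabsB (body a + t) (body a); rewrite addrAC subrr add0r; lra.
Qed.

Lemma sk_unique : Q = sewn_sk e th z.
Proof.
have bzi : body z^-1 != 0 by rewrite bodyV // invr_eq0.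
have [ep ep0 hep] := coordinate_fin.
have [_ _ _ hT _] := hQ; have [ea ba [eA oM _]] := hT ord0.
have [_ _ _ /(_ ord0) [/= ea' ba' [eA' oM' _]] _] := sewn_setSK oe oth ez.
rewrite /= in eA' oM'; set al' := 1 + _ in ea' ba'.
have m0 : 0 < Num.min ep (cabs (body z)) by rewrite lt_min ep0 cabs_gt0.
have val p : cabs (body p) < Num.min ep (cabs (body z)) ->
    sser_at (hatE (sk_a Q ord0) (sk_tube Q ord0)) p (kappa (- e) th z p) /\
    sser_at (hatE al' (sewn_fin_tube e th z)) p (kappa (- e) th z p).
  rewrite lt_min => /andP[pe pz]; split; last exact: hatE_value.
  by have [a' + h] := hep p pe; rewrite gamE gam_id => -[E]; rewrite -E in h.
have c1 : (hatE (sk_a Q ord0) (sk_tube Q ord0)).1 =1 (hatE al' (sewn_fin_tube e th z)).1.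
  apply: (sser_scalar_coef m0) => t tm; have [h h'] := val t%:A (ltac:(by rewrite bodyA1)).
  by eexists; [exact: h|exact: h'].
(* The coefficient of phi at x^0 is a itself, and a fresh odd generator extracts it; with a known,
   [expT_inj] recovers the tube from the scalar values. *)
have [i /(_ _ (mem_head _ _)) fi] := gens_fresh [:: (hatE (sk_a Q ord0) (sk_tube Q ord0)).2 0%N -
  (hatE al' (sewn_fin_tube e th z)).2 0%N].
have [h h'] := val (zeta R i) (ltac:(by rewrite (body_odd (zeta_odd R i)) cabs0)).
have := sser_zeta_coef fi (c1 0%N) h h'.
rewrite /hatE !pow_xphiE !(expT_linear _ _ _).1 => al.
have tE : sk_tube Q ord0 = sewn_fin_tube e th z.
  have b2 : body (al' * al') != 0 by rewrite bodyM mulf_neq0.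
  apply: (@expT_inj R (sk_tube Q ord0) (sewn_fin_tube e th z) (al' * al') al' eA eA' oM oM' _ ea' b2 ba').
    exact: evM.
  by move=> n; have := c1 n; rewrite /hatE !pow_xphiE al.
move: inf_tube.1 al tE; rewrite /al'; case: (Q) => pts inf a tube /= -> al tE.
rewrite /sewn_sk /sk1 /= tuple0; congr SkData; apply/funext => j; rewrite (ord1 j) //.
Qed.
End SphereAutomorphism.

Lemma sewing_unique (R : realType) (e th z : grassmann (cplx R)) (Q : skdata R 1) :
  is_odd e -> is_odd th -> is_even z -> body z != 0 ->
  is_sewing (sk_pair z th) 1 (sk_M32 e) Q -> Q = sewn_sk e th z.
Proof.
move=> oe oth ez bz [hQ1 hQ2 hQ _ [X1 [X2 [r1 [r2]]]]].
move=> [[tX1 [F1 iF1 rep1]] [tX2 [F2 iF2 rep2]] sw [H iH repQ]].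
have [G1 [F1K G1K sF1 sG1]] := iso_inv iF1.
have [G2 [F2K G2K sF2 sG2]] := iso_inv iF2.
have [HG [HK HGK sH sHG]] := iso_inv iH.
apply: (sk_unique oe oth ez bz hQ
  (Gam_fin oe oth ez bz tX1 tX2 sw F1K G1K sF1 sG1 F2K G2K sG2 rep1 rep2 HK HGK sHG repQ)).
- by move=> a c; apply: (Gam_nice_inl oe oth ez bz tX1 tX2 sw F1K G1K sG1 F2K G2K sG2 rep1 rep2 HK sH).
- exact: (Gam_0 oe oth ez bz tX1 sw G2 F1K G1K sG1 rep1 repQ).
- exact: (Gam_inf oe oth ez bz tX1 sw G2 F1K G1K sG1 rep1 repQ).
- exact: (Gam_nice_inf oe oth ez bz tX1 tX2 sw F1K G1K sG1 F2K G2K sG2 rep1 rep2 HK sH repQ).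
- by move=> dl; apply: (coordinate_inf oe oth ez bz tX1 tX2 sw F1K G1K sG1 F2K G2K sG2 rep1 rep2 HK sH repQ).
exact: (coordinate_fin oe oth ez bz tX1 tX2 sw F1K G1K sG1 F2K G2K sG2 rep1 rep2 repQ).
Qed.

(** * The tangent vector *)

Section Derivatives.
Variable R : realType.
Local Notation C := (cplx R).
Local Notation Lam := (grassmann C).

Lemma has_even_deriv_unique (h : Lam -> Lam) d d' : has_even_deriv h d -> has_even_deriv h d' -> d = d'.
Proof. by move=> hd hd'; apply/grP => I; case: (hd I) (hd' I) => _ <- [_ <-]. Qed.

Lemma even_derivE (h : Lam -> Lam) d : has_even_deriv h d -> even_deriv h = d.
Proof.
move=> hd; apply: (has_even_deriv_unique _ hd); rewrite /even_deriv.
by case: xgetP => [x _ //|/(_ d)].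
Qed.

(** The derivative is tested only after multiplication by odd elements; a generator absent from the
    difference makes this test faithful. *)
Lemma has_odd_deriv_unique (h : Lam -> Lam) d d' : has_odd_deriv h d -> has_odd_deriv h d' -> d = d'.
Proof.
move=> hd hd'; have [i /(_ _ (mem_head _ _)) fi] := gens_fresh [:: d - d'].
apply/eqP; rewrite -subr_eq0; apply/eqP; apply: zeta_inj fi _.
have oz := zeta_odd R i; rewrite mulrBr; apply/eqP; rewrite subr_eq0.
by rewrite -(inj_eq (addrI (h 0))) -hd // -hd'.
Qed.

Lemma odd_derivE (h : Lam -> Lam) d : has_odd_deriv h d -> odd_deriv h = d.
Proof.
move=> hd; apply: (has_odd_deriv_unique _ hd); rewrite /odd_deriv.
by case: xgetP => [x _ //|/(_ d)].
Qed.

Lemma is_deriveMC (f g : C -> C) (df dg : C) : is_derive (0 : C) 1 f df -> is_derive (0 : C) 1 g dg ->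
  is_derive (0 : C) 1 (fun t => f t * g t : C) (df * g 0 + f 0 * dg).
Proof.
move=> hf hg; have h := @is_deriveM (complex R) C f g (0 : C) 1 df dg hf hg.
by apply: is_derive_eq h _; rewrite addrC; congr (_ + _); rewrite mulrC.
Qed.

Lemma is_derive_inv1D : is_derive (0 : C) 1 (fun t : C => (1 + t)^-1 : C) (-1).
Proof.
have h : is_derive (0 : C) 1 (fun t : C => 1 + t : C) 1.
  have := @is_deriveD (complex R) C C (fun=> 1) id (0:C) 1 0 1 (is_derive_cst _ _ _) (is_derive_id _ _).
  by rewrite add0r.
have h1 : (fun t : C => 1 + t : C) 0 != 0 by rewrite addr0 oner_neq0.
have [hd hE] := h; apply: DeriveDef; first exact: (derivableV h1 hd).
apply: etrans (deriveV h1 hd) _; rewrite hE.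
by rewrite addr0 expr1n invr1 scaleN1r.
Qed.

Lemma has_even_derivD (h1 h2 : Lam -> Lam) d1 d2 : has_even_deriv h1 d1 -> has_even_deriv h2 d2 ->
  has_even_deriv (fun t => h1 t + h2 t) (d1 + d2).
Proof.
move=> H1 H2 I; have := is_deriveD (H1 I) (H2 I); rewrite grDE.
by apply: near_eq_is_derive; near=> t; rewrite grDE.
Unshelve. all: by end_near.
Qed.

Lemma is_derive_bigsum (T : eqType) (s : seq T) (f : T -> C -> C) (df : T -> C) :
  (forall i, i \in s -> is_derive (0 : C) 1 (f i) (df i)) ->
  is_derive (0 : C) 1 (fun t : C => \sum_(i <- s) f i t : C) (\sum_(i <- s) df i).
Proof.
elim: s => [|a s IH] h.
  rewrite big_nil (_ : (fun t => _) = cst 0); first exact: is_derive_cst.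
  by apply/funext => t; rewrite big_nil.
rewrite big_cons (_ : (fun t => _) = f a \+ (fun t => \sum_(i <- s) f i t)).
  by apply: is_deriveD; [exact: h (mem_head _ _)|apply: IH => i si; apply: h; rewrite inE si orbT].
by apply/funext => t; rewrite big_cons.
Qed.

Lemma has_even_derivM (h1 h2 : Lam -> Lam) d1 d2 : has_even_deriv h1 d1 -> has_even_deriv h2 d2 ->
  has_even_deriv (fun t => h1 t * h2 t) (d1 * h2 0 + h1 0 * d2).
Proof.
move=> H1 H2 I; rewrite grDE !grME -big_split /=.
rewrite (_ : (fun t : C => _) = fun t : C => \sum_(J <- fpowerset I)
  (-1) ^+ inversions J (I `\` J)%fset * (h1 t%:A J * h2 t%:A (I `\` J)%fset)); last first.
  by apply/funext => t; rewrite grME.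
apply: is_derive_bigsum => J _; rewrite -mulrDr.
have := is_deriveMC (is_derive_cst ((-1) ^+ inversions J (I `\` J)%fset : C) (0 : C) 1)
  (is_deriveMC (H1 J) (H2 (I `\` J)%fset)).
by rewrite mul0r add0r scale0r.
Qed.

Lemma has_odd_derivD (h1 h2 : Lam -> Lam) d1 d2 : has_odd_deriv h1 d1 -> has_odd_deriv h2 d2 ->
  has_odd_deriv (fun t => h1 t + h2 t) (d1 + d2).
Proof. by move=> H1 H2 e oe; rewrite (H1 e oe) (H2 e oe) mulrDr addrACA. Qed.

(** The parameter has to move to the left of [h1 0], whence the conjugation; the quadratic term
    contains the odd parameter twice. *)
Lemma has_odd_derivM (h1 h2 : Lam -> Lam) d1 d2 : has_odd_deriv h1 d1 -> has_odd_deriv h2 d2 ->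
  has_odd_deriv (fun t => h1 t * h2 t) (d1 * h2 0 + gconj (h1 0) * d2).
Proof.
move=> H1 H2 e oe; rewrite (H1 e oe) (H2 e oe) mulrDl !mulrDr -addrA; congr (_ + _).
have -> : e * d1 * (e * d2) = 0.
  by rewrite mulrA -(mulrA e) (odd_swap d1 oe) mulrA odd_sq // mul0r mul0r.
by rewrite addr0 !mulrA (odd_swap _ oe) addrC.
Qed.

End Derivatives.

(** * Coordinate paths through e *)

Section ValueAt.
Variable R : realType.
Local Notation C := (cplx R).
Local Notation Lam := (grassmann C).
Local Notation value := (@value_at R).
Implicit Types (F : superfun R) (q : skdata R 1).

Lemma value_in F q (h : setSK q) : value F q = F (exist _ q h).
Proof. by rewrite /value_at; case: pselect => // h'; rewrite (Prop_irrelevance h h'). Qed.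

Lemma valueD F1 F2 q : value (fun Q => F1 Q + F2 Q) q = value F1 q + value F2 q.
Proof. by rewrite /value_at; case: pselect => // _; rewrite addr0. Qed.
Lemma valueM F1 F2 q : value (fun Q => F1 Q * F2 Q) q = value F1 q * value F2 q.
Proof. by rewrite /value_at; case: pselect => // _; rewrite mul0r. Qed.

Lemma setSK_sk1 (a : Lam) (AM : 'I_2 -> seqpair R) : is_even a -> body a != 0 ->
  (forall k, setH (AM k)) -> setSK (sk1 a AM).
Proof. by move=> ea ba hAM; split=> //= j; split. Qed.

Lemma setSK_e : setSK (sk_e R).
Proof.
apply: setSK_sk1; [exact: ev1|by rewrite body1 oner_eq0|by move=> k; exact: setH0].
Qed.

Definition path_a (t : Lam) : skdata R 1 := sk1 (1 + t) (fun=> seqpair0).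
Definition path_A (k : 'I_2) j (t : Lam) : skdata R 1 :=
  sk1 1 (fun l => if l == k then (single j t, fun=> 0) else seqpair0).
Definition path_M (k : 'I_2) j (t : Lam) : skdata R 1 :=
  sk1 1 (fun l => if l == k then (fun=> 0, single j t) else seqpair0).

Lemma single0 j : single j (0 : Lam) = fun=> 0.
Proof. by apply/funext => l; rewrite /single; case: eqP. Qed.
Lemma path_a0 : path_a 0 = sk_e R. Proof. by rewrite /path_a addr0. Qed.
Lemma path_A0 k j : path_A k j 0 = sk_e R.
Proof. by rewrite /path_A single0; congr sk1; apply/funext => l; case: eqP. Qed.
Lemma path_M0 k j : path_M k j 0 = sk_e R.
Proof. by rewrite /path_M single0; congr sk1; apply/funext => l; case: eqP. Qed.

Lemma setSK_path_a (t : C) : 1 + t != 0 -> setSK (path_a t%:A).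
Proof.
move=> t0; apply: setSK_sk1 => [||k]; last exact: setH0.
  exact: evD (@ev1 R) (evA _).
by rewrite bodyD body1 bodyA1.
Qed.
Lemma setSK_path_A k j (t : C) : setSK (path_A k j t%:A).
Proof.
apply: setSK_sk1 => [||l]; [exact: ev1|by rewrite body1 oner_eq0|].
by case: eqP => _; [exact: setH_single_scalar|exact: setH0].
Qed.
Lemma setSK_path_M k j e : is_odd e -> setSK (path_M k j e).
Proof.
move=> oe; apply: setSK_sk1 => [||l]; [exact: ev1|by rewrite body1 oner_eq0|].
by case: eqP => _; [exact: setH_single_odd|exact: setH0].
Qed.

Lemma sk_seq_sk1 (a : Lam) (AM : 'I_2 -> seqpair R) k : sk_seq (sk1 a AM) k = AM k.
Proof.
rewrite /sk_seq; case: eqP => [->//|/eqP k0] /=; congr AM.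
by apply/val_inj => /=; case: k k0 => [[|[|]]].
Qed.
End ValueAt.

(** * The chain rule along the sewing *)

Section Tangent.
Variable R : realType.
Local Notation C := (cplx R).
Local Notation Lam := (grassmann C).
Local Notation value := (@value_at R).
Variables (z th : Lam).
Hypotheses (ez : is_even z) (oth : is_odd th) (bz : body z != 0).
Implicit Types (F : superfun R).

Definition coefA (k : 'I_2) (j : nat) : Lam := z ^ (- (2 * k%:Z - 1) * j%:Z - 2).
Definition coefM (k : 'I_2) (j : nat) : Lam := z ^ (- (2 * k%:Z - 1) * j%:Z - 2 + k%:Z).
(** The expected combination of partial derivatives, truncated at N, as a function of the candidates
    [pa], [pA], [pM]. *)
Definition direction N (pa : Lam) (pA pM : 'I_2 -> nat -> Lam) : Lam :=
  \sum_(k < 2) \sum_(1 <= j < N) coefM k j * pM k j.-1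
  + (th *+ 2) * ((2^-1 : C) *: (z ^ (- 2) * pa) + \sum_(k < 2) \sum_(1 <= j < N) coefA k j * pA k j.-1).

(** The invariant of the induction over superfunctions. A polynomial involves finitely many
    coordinates, and N0 is a bound beyond which the truncation changes nothing. *)
Definition differential F pa pA pM N0 : Prop :=
  [/\ has_even_deriv (fun t => value F (path_a t)) pa,
      forall k j, has_even_deriv (fun t => value F (path_A k j t)) (pA k j),
      forall k j, has_odd_deriv (fun t => value F (path_M k j t)) (pM k j)
    & forall N, (N0 <= N)%N ->
        has_odd_deriv (fun e => value F (sewn_sk e th z)) (direction N pa pA pM)].

Lemma ev_expz (n : int) : is_even (z ^ n).
Proof. by case: n => n; [exact: evX|apply: ev_inv; exact: evX]. Qed.

Lemma directionD N pa pa' pA pA' pM pM' :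
  direction N (pa + pa') (fun k j => pA k j + pA' k j) (fun k j => pM k j + pM' k j) =
  direction N pa pA pM + direction N pa' pA' pM'.
Proof.
have sD (G P P' : 'I_2 -> nat -> Lam) :
    \sum_(k < 2) \sum_(1 <= j < N) G k j * (P k j.-1 + P' k j.-1) =
    \sum_(k < 2) \sum_(1 <= j < N) G k j * P k j.-1 + \sum_(k < 2) \sum_(1 <= j < N) G k j * P' k j.-1.
  rewrite -big_split; apply: eq_bigr => k _; rewrite -big_split.
  by apply: eq_bigr => j _; rewrite mulrDr.
rewrite /direction !sD (mulrDr (z ^ (- 2))) scalerDr [RHS]addrACA -mulrDr.
by congr (_ + _ * _); exact: addrACA.
Qed.

Lemma direction_mulr N pa pA pM v :
  direction N (pa * v) (fun k j => pA k j * v) (fun k j => pM k j * v) = direction N pa pA pM * v.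
Proof.
have sM (G P : 'I_2 -> nat -> Lam) : \sum_(k < 2) \sum_(1 <= j < N) G k j * (P k j.-1 * v) =
    (\sum_(k < 2) \sum_(1 <= j < N) G k j * P k j.-1) * v.
  rewrite mulr_suml; apply: eq_bigr => k _; rewrite mulr_suml.
  by apply: eq_bigr => j _; rewrite mulrA.
rewrite /direction !sM [RHS]mulrDl; congr (_ + _); rewrite -[RHS]mulrA; congr (_ * _).
by rewrite [RHS]mulrDl -scalerAl mulrA.
Qed.

(** The direction is odd: v passes the odd coefficient 2 theta at the price of a conjugation, while
    the odd partial derivatives carry theirs already. *)
Lemma direction_mull N pa pA pM v :
  direction N (v * pa) (fun k j => v * pA k j) (fun k j => gconj v * pM k j) =
  gconj v * direction N pa pA pM.
Proof.
have sM w (G P : 'I_2 -> nat -> Lam) : (forall k j, is_even (G k j)) ->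
    \sum_(k < 2) \sum_(1 <= j < N) G k j * (w * P k j.-1) =
    w * (\sum_(k < 2) \sum_(1 <= j < N) G k j * P k j.-1).
  move=> eG; rewrite mulr_sumr; apply: eq_bigr => k _; rewrite mulr_sumr.
  by apply: eq_bigr => j _; rewrite !mulrA (evenC _ (eG k j)).
rewrite /direction !sM; try by move=> k j; exact: ev_expz.
rewrite [RHS]mulrDr; congr (_ + _).
rewrite [RHS]mulrA (odd_swap (gconj v) (odMn 2 oth)) gconjK -[RHS]mulrA; congr (_ * _).
rewrite [RHS]mulrDr; congr (_ + _); rewrite -scalerAr; congr (_ *: _).
by rewrite !mulrA (evenC _ (ev_expz _)).
Qed.

Lemma sewn_sk0 : sewn_sk 0 th z = sk_e R.
Proof.
have g0 c : geoAM (0 : Lam) 0 c = seqpair0 by congr pair; apply/funext => j; rewrite mul0r.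
rewrite /sewn_sk /sewn_inf_tube /sewn_fin_tube !mul0r mul0rn addr0 !g0.
by congr sk1; apply/funext => k; case: eqP.
Qed.

Lemma differentialD F1 F2 pa1 pa2 pA1 pA2 pM1 pM2 N1 N2 :
  differential F1 pa1 pA1 pM1 N1 -> differential F2 pa2 pA2 pM2 N2 ->
  differential (fun Q => F1 Q + F2 Q) (pa1 + pa2) (fun k j => pA1 k j + pA2 k j)
    (fun k j => pM1 k j + pM2 k j) (maxn N1 N2).
Proof.
move=> [a1 A1 M1 D1] [a2 A2 M2 D2].
have vD (q : Lam -> skdata R 1) : (fun t => value (fun Q => F1 Q + F2 Q) (q t)) =
    (fun t => value F1 (q t) + value F2 (q t)) by apply/funext => t; exact: valueD.
split=> [|k j|k j|N]; rewrite ?geq_max ?vD; [exact: has_even_derivD|exact: has_even_derivD|exact: has_odd_derivD|].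
by move=> /andP[h1 h2]; rewrite directionD; apply: has_odd_derivD; [exact: D1|exact: D2].
Qed.

Lemma differentialM F1 F2 pa1 pa2 pA1 pA2 pM1 pM2 N1 N2 :
  differential F1 pa1 pA1 pM1 N1 -> differential F2 pa2 pA2 pM2 N2 ->
  let v1 := value F1 (sk_e R) in let v2 := value F2 (sk_e R) in
  differential (fun Q => F1 Q * F2 Q) (pa1 * v2 + v1 * pa2)
    (fun k j => pA1 k j * v2 + v1 * pA2 k j)
    (fun k j => pM1 k j * v2 + gconj v1 * pM2 k j) (maxn N1 N2).
Proof.
move=> [a1 A1 M1 D1] [a2 A2 M2 D2] v1 v2.
have vM (q : Lam -> skdata R 1) : (fun t => value (fun Q => F1 Q * F2 Q) (q t)) =
    (fun t => value F1 (q t) * value F2 (q t)) by apply/funext => t; exact: valueM.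
split=> [|k j|k j|N]; rewrite ?geq_max ?vM.
- by have := has_even_derivM a1 a2; rewrite path_a0.
- by have := has_even_derivM (A1 k j) (A2 k j); rewrite path_A0.
- by have := has_odd_derivM (M1 k j) (M2 k j); rewrite path_M0.
move=> /andP[h1 h2]; have := has_odd_derivM (D1 N h1) (D2 N h2).
rewrite sewn_sk0 -/v1 -/v2 -direction_mulr -direction_mull -directionD.
by [].
Qed.

(** The restriction on t keeps a = 1 + t invertible, outside of which [value_at] takes its default
    value; it holds near t = 0. *)
Lemma has_even_deriv_affine (h : Lam -> Lam) c d :
  (forall t : C, 1 + t != 0 -> h t%:A = c + t *: d) -> has_even_deriv h d.
Proof.
move=> hE I; have H : is_derive (0 : C) 1 (fun t : C => c I + t * d I : C) (d I).
  have := is_deriveD (is_derive_cst (c I : C) (0 : C) 1)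
    (is_deriveMC (is_derive_id (0 : C) 1) (is_derive_cst (d I : C) (0 : C) 1)).
  by rewrite mul1r mulr0 add0r addr0.
apply: near_eq_is_derive H.
have o1 : open [set b : C | b != -1] by exact: open_ne.
have n1 : (0 : C) != -1 by rewrite eq_sym oppr_eq0 oner_neq0.
near=> t; rewrite hE ?grDE ?grZE // addrC addr_eq0.
by near: t; exact: open_nbhs_nbhs (conj o1 n1).
Unshelve. all: by end_near. Qed.

Lemma has_odd_deriv0 (h : Lam -> Lam) c : (forall e, is_odd e -> h e = c) -> has_odd_deriv h 0.
Proof. by move=> hE e oe; rewrite mulr0 addr0 !hE //; exact: od0. Qed.

Lemma sum_delta N (G : 'I_2 -> nat -> Lam) (k0 : 'I_2) j0 : (j0.+1 < N)%N ->
  \sum_(k < 2) \sum_(1 <= j < N) G k j * ((k == k0) && (j.-1 == j0))%:R = G k0 j0.+1.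
Proof.
move=> jN; rewrite (bigD1 k0) //= [X in _ + X]big1 ?addr0; last first.
  by move=> k /negPf->; rewrite big1 // => j _; rewrite mulr0.
rewrite (bigD1_seq j0.+1) ?iota_uniq ?mem_index_iota //= !eqxx mulr1 big1_seq ?addr0 //.
move=> j /= /andP[nj]; rewrite mem_index_iota => /andP[j1 _].
by rewrite -(inj_eq succn_inj) (prednK j1) (negPf nj) mulr0.
Qed.

Lemma sum_delta0 N (G : 'I_2 -> nat -> Lam) :
  \sum_(k < 2) \sum_(1 <= j < N) G k j * 0 = 0.
Proof. by rewrite big1 // => k _; rewrite big1 // => j _; rewrite mulr0. Qed.

Let uz : z \is a GRing.unit. Proof. exact: ev_unit. Qed.

Lemma expzN2 : z ^ (- 2) = z^-1 * z^-1.
Proof. by rewrite -expr2 exprVn. Qed.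

Lemma coefAE (k : 'I_2) j : coefA k j.+1 = z^-1 * z^-1 * (if k == ord0 then z else z^-1) ^+ j.+1.
Proof.
rewrite /coefA exprzDr // expzN2 (evenC _ (ev_expz _)); congr (_ * _).
case: k => [[|[|//]] lk] /=.
  by rewrite (_ : - _ * _ = j.+1%:Z) //; lia.
by rewrite (_ : - _ * _ = - j.+1%:Z) ?exprVn //; lia.
Qed.

Lemma coefME (k : 'I_2) j : coefM k j.+1 =
  if k == ord0 then z^-1 * z^-1 * z ^+ j.+1 else z^-1 * z^-1 ^+ j.+1.
Proof.
rewrite /coefM exprzDr // -/(coefA k j.+1) coefAE.
case: k => [[|[|//]] lk] /=; first by rewrite expr0z mulr1.
have -> : z ^ 1%Z = z by exact: expr1z.
by rewrite -!mulrA -(evenC _ ez) mulKr.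
Qed.

Lemma sewn_value F e (oe : is_odd e) : value F (sewn_sk e th z) = F (exist _ _ (sewn_setSK oe oth ez)).
Proof. exact: value_in. Qed.

Lemma has_differential F : SD1 F -> exists pa pA pM N0, differential F pa pA pM N0.
Proof.
pose z0 : 'I_2 -> nat -> Lam := fun _ _ => 0.
have sewn_a e : sk_a (sewn_sk e th z) ord0 = 1 + e * (th * (z ^ (-2))).
  by rewrite expzN2 /= !mulrA.
have half (x : Lam) : th *+ 2 * ((2^-1 : C) *: x) = th * x.
  by rewrite -scalerAr mulrnAl -[th * x *+ 2](@scaler_nat C) scalerA mulVf ?scale1r.
elim=> {F} [c| | |k0 j0|k0 j0|F1 F2 _ [pa1 [pA1 [pM1 [N1 h1]]]] _ [pa2 [pA2 [pM2 [N2 h2]]]]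
  |F1 F2 _ [pa1 [pA1 [pM1 [N1 h1]]]] _ [pa2 [pA2 [pM2 [N2 h2]]]]].
- exists 0, z0, z0, 0%N; split=> [|k j|k j|N _].
  + apply: (@has_even_deriv_affine _ c) => t t0; rewrite scaler0 addr0.
    by rewrite (value_in _ (setSK_path_a t0)).
  + apply: (@has_even_deriv_affine _ c) => t _; rewrite scaler0 addr0.
    by rewrite (value_in _ (setSK_path_A k j t)).
  + apply: (@has_odd_deriv0 _ c) => e oe; by rewrite (value_in _ (setSK_path_M k j oe)).
  rewrite /direction !sum_delta0 mulr0 scaler0 addr0 mulr0 addr0.
  by apply: (@has_odd_deriv0 _ c) => e oe; rewrite (sewn_value _ oe).
- exists 1, z0, z0, 0%N; split=> [|k j|k j|N _].
  + apply: (@has_even_deriv_affine _ 1) => t t0.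
    by rewrite (value_in _ (setSK_path_a t0)).
  + apply: (@has_even_deriv_affine _ 1) => t _; rewrite scaler0 addr0.
    by rewrite (value_in _ (setSK_path_A k j t)).
  + apply: (@has_odd_deriv0 _ 1) => e oe; by rewrite (value_in _ (setSK_path_M k j oe)).
  rewrite /direction !sum_delta0 mulr1 addr0 add0r half => e oe.
  by rewrite !sewn_value; [exact: od0|move=> o0]; rewrite !sewn_a mul0r addr0.
- exists (-1), z0, z0, 0%N; split=> [I|k j|k j|N _].
  + have H : is_derive (0 : C) 1 (fun t : C => (1 + t)^-1 * (1 : Lam) I : C) ((-1 : Lam) I).
      have := is_deriveMC (@is_derive_inv1D R) (is_derive_cst ((1 : Lam) I : C) (0 : C) 1).
      by rewrite mulr0 addr0 grNE mulN1r.
    apply: near_eq_is_derive H; near=> t.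
    have t0 : 1 + t != 0.
      rewrite addrC addr_eq0; near: t; apply: open_nbhs_nbhs; split; first exact: (@open_ne R (-1)).
      by rewrite /= eq_sym oppr_eq0 oner_neq0.
    rewrite (value_in _ (setSK_path_a t0)) /= -grZE; congr (fun_of_fsfun _ I).
    apply/esym/evV_unique; first exact: evD (@ev1 R) (evA _).
    by rewrite -[X in X + _]scale1r -scalerDl -scalerAl mul1r scalerA divff // scale1r.
  + apply: (@has_even_deriv_affine _ 1) => t _; rewrite scaler0 addr0.
    by rewrite (value_in _ (setSK_path_A k j t)) /= invr1.
  + apply: (@has_odd_deriv0 _ 1) => e oe; by rewrite (value_in _ (setSK_path_M k j oe)) /= invr1.
  rewrite /direction !sum_delta0 mulrN1 addr0 add0r half => e oe.
  rewrite (sewn_value _ oe) (sewn_value _ (@od0 R)) !sewn_a mul0r addr0 invr1 !mulrN.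
  set y := th * _; have ey : is_even (e * y) by apply: odM => //; apply: od_evM => //; exact: ev_expz.
  apply: evV_unique; first exact: evD (@ev1 R) ey.
  have sq : e * y * (e * y) = 0 by rewrite mulrA -(mulrA e) (odd_swap y oe) mulrA odd_sq // !mul0r.
  by rewrite mulrBr mulr1 mulrDl mul1r sq addr0 addrK.
(* The stored index j0 is the summation index j0 + 1, which the range 1 <= j < N contains as soon as
   j0 + 2 <= N. *)
- exists 0, (fun k j => ((k == k0) && (j == j0))%:R), z0, j0.+2; split=> [|k j|k j|N jN].
  + apply: (@has_even_deriv_affine _ 0) => t t0; rewrite scaler0 addr0.
    by rewrite (value_in _ (setSK_path_a t0)) /= /sk_seq; case: eqP.
  + apply: (@has_even_deriv_affine _ 0) => t _; rewrite add0r.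
    rewrite (value_in _ (setSK_path_A k j t)) /= sk_seq_sk1 eq_sym.
    case: eqP => _ /=; last by rewrite scaler0.
    by rewrite /single eq_sym; case: eqP => _; rewrite ?scaler0.
  + apply: (@has_odd_deriv0 _ 0) => e oe; rewrite (value_in _ (setSK_path_M k j oe)) /= sk_seq_sk1.
    by case: eqP.
  rewrite /direction sum_delta0 sum_delta // mulr0 scaler0 !add0r coefAE => e oe.
  rewrite (sewn_value _ oe) (sewn_value _ (@od0 R)) /= !sk_seq_sk1.
  case: eqP => _ /=; rewrite !mul0r mul0rn mul0r add0r mulrnAl mulrnAl mulrnAr; congr (_ *+ 2);
    by rewrite !mulrA.
- exists 0, z0, (fun k j => ((k == k0) && (j == j0))%:R), j0.+2; split=> [|k j|k j|N jN].
  + apply: (@has_even_deriv_affine _ 0) => t t0; rewrite scaler0 addr0.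
    by rewrite (value_in _ (setSK_path_a t0)) /= /sk_seq; case: eqP.
  + apply: (@has_even_deriv_affine _ 0) => t _; rewrite scaler0 addr0.
    by rewrite (value_in _ (setSK_path_A k j t)) /= sk_seq_sk1; case: eqP.
  + move=> e oe; rewrite (value_in _ (setSK_path_M k j oe)) (value_in _ (setSK_path_M k j (@od0 R))).
    rewrite /= !sk_seq_sk1 eq_sym; case: eqP => _ /=; last by rewrite mulr0 addr0.
    by rewrite /single eq_sym; case: eqP => _; rewrite ?mulr1 ?mulr0 add0r.
  rewrite /direction sum_delta0 sum_delta // mulr0 scaler0 !addr0 mulr0 addr0 coefME => e oe.
  rewrite (sewn_value _ oe) (sewn_value _ (@od0 R)) /= !sk_seq_sk1.
  by case: eqP => _ /=; rewrite !mul0r add0r !mulrA.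
- by do 4 eexists; exact: differentialD h1 h2.
by do 4 eexists; exact: differentialM h1 h2.
Unshelve. all: by end_near.
Qed.

(** The witness chosen by [sew] is unknown, but uniqueness equates its data with the explicit ones,
    and superfunctions do not see the membership proof. *)
Lemma sewn_M32E e : is_odd e ->
  exists2 Q, sewn_M32 z th e = Some Q & forall F, F Q = value F (sewn_sk e th z).
Proof.
move=> oe; have hs := sewn_is_sewing oe oth ez bz.
have hK := sewn_setSK oe oth ez.
rewrite /sewn_M32 /sew; case: pselect => [h|[]]; last by exists (exist _ _ hK).
exists (projT1 (cid h)) => // F; case: (cid h) => /= -[Q hQ] /= sQ.
have E := sewing_unique oe oth ez bz sQ.
move: hQ sQ; rewrite E => hQ _; exact/esym/value_in.
Qed.

Lemma sewn_deriv F d : has_odd_deriv (fun e => value F (sewn_sk e th z)) d ->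
  has_odd_deriv (fun eps => oapp F 0 (sewn_M32 z th eps)) d.
Proof.
move=> hd e oe; have [Q EQ hQ] := sewn_M32E oe; have [Q' EQ' hQ'] := sewn_M32E (@od0 R).
by rewrite EQ EQ' /= hQ hQ'; exact: hd.
Qed.

Lemma GeE F pa pA pM N0 : differential F pa pA pM N0 ->
  forall N, (N0 <= N)%N -> Ge z th F = direction N pa pA pM.
Proof. by move=> [_ _ _ h] N /h hN; apply: odd_derivE; exact: sewn_deriv. Qed.

Lemma Ge_add F1 F2 : SD1 F1 -> SD1 F2 -> Ge z th (fun Q => F1 Q + F2 Q) = Ge z th F1 + Ge z th F2.
Proof.
move=> /has_differential[pa1 [pA1 [pM1 [N1 h1]]]] /has_differential[pa2 [pA2 [pM2 [N2 h2]]]].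
rewrite (GeE (differentialD h1 h2) (leqnn _)) directionD.
by rewrite (GeE h1 (leq_maxl N1 N2)) (GeE h2 (leq_maxr N1 N2)).
Qed.

Lemma Ge_mul F1 F2 : SD1 F1 -> SD1 F2 -> Ge z th (fun Q => F1 Q * F2 Q) =
  Ge z th F1 * value F2 (sk_e R) + gconj (value F1 (sk_e R)) * Ge z th F2.
Proof.
move=> /has_differential[pa1 [pA1 [pM1 [N1 h1]]]] /has_differential[pa2 [pA2 [pM2 [N2 h2]]]].
rewrite (GeE (differentialM h1 h2) (leqnn _)) directionD direction_mulr direction_mull.
by rewrite (GeE h1 (leq_maxl N1 N2)) (GeE h2 (leq_maxr N1 N2)).
Qed.

Lemma Ge_cst c : Ge z th (fun=> c) = 0.
Proof.
apply: odd_derivE => e oe; have [Q -> _] := sewn_M32E oe; have [Q' -> _] := sewn_M32E (@od0 R).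
by rewrite mulr0 addr0.
Qed.
End Tangent.

Theorem proposition4p11 (R : realType) (z theta : grassmann (cplx R))
    (hz : is_even z) (htheta : is_odd theta) (hz0 : body z != 0) :
  [/\ (forall eps, is_odd eps -> exists Q, sewn_M32 z theta eps = Some Q),
      (forall F, SD1 F -> exists d,
         has_odd_deriv (fun eps => oapp F 0 (sewn_M32 z theta eps)) d),
      tangent_e (Ge z theta)
    & forall F : superfun R, SD1 F -> exists N0 : nat, forall N : nat, (N0 <= N)%N ->
        Ge z theta F =
          \sum_(k < 2) \sum_(1 <= j < N)
             z ^ (- (2 * k%:Z - 1) * j%:Z - 2 + k%:Z) * partial_M k j.-1 F
          + (theta *+ 2) *
            ((2^-1 : cplx R) *: (z ^ (- 2) * partial_a F)
             + \sum_(k < 2) \sum_(1 <= j < N)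
                  z ^ (- (2 * k%:Z - 1) * j%:Z - 2) * partial_A k j.-1 F)].
Proof.
split.
- by move=> e oe; have [Q h _] := sewn_M32E hz htheta hz0 oe; exists Q.
- move=> F /(has_differential hz htheta hz0)[pa [pA [pM [N0 [_ _ _ h]]]]].
  by exists (direction z theta N0 pa pA pM); apply: sewn_deriv => //; exact: h.
(* The functional satisfies the odd Leibniz rule as a whole, so its even part is taken to be 0. *)
- exists (fun=> 0), (Ge z theta); split=> [||F _]; last by rewrite add0r.
    by split=> [|F1 F2 _ _]; [split=> *; rewrite ?addr0 ?mul0r|rewrite mul0r mulr0 addr0].
  split; first split; [exact: Ge_add| |].
    move=> F c hF; rewrite Ge_mul //; last exact: SD1_cst.
    by rewrite Ge_cst // mulr0 addr0 (value_in _ (@setSK_e R)).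
  move=> b F1 F2 h1 h2 par; rewrite Ge_mul // (value_in F1 (@setSK_e R)); congr (_ + _).
  have := par (exist _ _ (@setSK_e R)); case: b {par} => h.
    by rewrite (gconj_odd h) expr1 mulN1r mulNr.
  by rewrite (gconj_even h) expr0 mul1r.
move=> F /(has_differential hz htheta hz0)[pa [pA [pM [N0 h]]]]; exists N0 => N hN.
rewrite (GeE hz htheta hz0 h hN) /direction /coefA /coefM; have [ha hA hM _] := h.
have -> : partial_a F = pa by exact: even_derivE ha.
congr (_ + _ * (_ + _)); apply: eq_bigr => k _; apply: eq_bigr => j _; congr (_ * _).
  exact/esym/(odd_derivE (hM k j.-1)).
exact/esym/(even_derivE (hA k j.-1)).
Qed.
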